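(* Let $T:X\to X$ be a mixing probability preserving Gibbs-Markov map, with probability measure $m$ and partition $\alpha$, and let $\eta\in(0,1]$. There exists a function $\epsilon:(1,\infty)\to(0,\infty)$, bounded away from zero on compact subsets of $(1,\infty)$, with the following property. Let $f:X\to\mathbb{R}$ be a measurable function satisfying $\sum_{a\in\alpha}m(a)Df(a)^\eta<\infty$ and $f\in L^p$ for some $p>1$. Let $\lambda(t)$, for $t$ close to $0$, be the leading eigenvalue of the perturbed transfer operator $\hat T_t=\hat T(e^{\mathbf{i}tf}\,\cdot\,)$. Then there exist complex numbers $c_i$ (for integers $1\le i<p+\epsilon(p)$) such that, as $t\to0$, $$\lambda(t)=E(e^{\mathbf{i}tf})+\sum_{2\le i<p+\epsilon(p)}c_it^i+O(|t|^{p+\epsilon(p)}).$$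
   Context: Gibbs-Markov maps. Let $(X,d)$ be a bounded metric space endowed with a probability measure $m$. A map $T:X\to X$ preserving $m$ is Gibbs-Markov if there exists a partition $\alpha$ of $X$ (modulo $0$) by sets of positive measure such that: (1) Markov: for all $a\in\alpha$, $T(a)$ is a union (modulo $0$) of elements of $\alpha$ and $T:a\to T(a)$ is invertible. (2) Big image and preimage property: there is a finite subset $\{a_1,\dots,a_n\}$ of $\alpha$ such that for any $a\in\alpha$ there exist $i,j\in\{1,\dots,n\}$ with $a\subset T(a_i)$ and $a_j\subset T(a)$ (modulo $0$). (3) Expansion: there exists $\gamma<1$ such that for all $a\in\alpha$, for almost all $x,y\in a$, $d(Tx,Ty)\ge\gamma^{-1}d(x,y)$. (4) Distortion: for $a\in\alpha$ let $g(x)=\frac{dm_{|a}}{d(m\circ T_{|a})}(x)$, $x\in a$, be the inverse of the jacobian of $T$ on $a$. There exists $C$ such that for all $a\in\alpha$, for almost all $x,y\in a$, $\left|1-\frac{g(x)}{g(y)}\right|\le C\,d(Tx,Ty)$. The Gibbs-Markov map $T$ is mixing if for all $a,b\in\alpha$ there exists $N$ such that $b\subset T^n(a)$ modulo $0$ for any $n>N$. For $f:X\to\mathbb{R}$ and $A\subset X$, $Df(A)$ denotes the best Lipschitz constant of $f$ on $A$. $E$ denotes integration with respect to $m$; $\mathbf{i}$ is the imaginary unit. Transfer operator and leading eigenvalue. The transfer operator $\hat T$ is defined by $\int u\cdot v\circ T\,dm=\int\hat Tu\cdot v\,dm$; explicitly $\hat Tu(x)=\sum_{Ty=x}g(y)u(y)$.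 Let $\mathcal{L}$ be the Banach space of bounded functions $u:X\to\mathbb{C}$ (modulo null sets) with $\sup_{a\in\alpha}\sup_{x,y\in a}|u(x)-u(y)|/d(x,y)^\eta<\infty$, normed by the sum of the sup norm and this seminorm. The operator $\hat T$ acts continuously on $\mathcal{L}$, has a simple eigenvalue at $1$, and the rest of its spectrum is contained in a disk of radius $<1$. If $\sum_{a\in\alpha} m(a)Df(a)^\eta<\infty$, the operator $\hat T_t(u)=\hat T(e^{\mathbf{i}tf}u)$ acts continuously on $\mathcal{L}$ and $\|\hat T_t-\hat T\|_{\mathcal{L}\to\mathcal{L}}\to0$ as $t\to0$. Hence, for small enough $t$, $\hat T_t$ acting on $\mathcal{L}$ has a unique eigenvalue close to $1$; it is simple, and the rest of the spectrum of $\hat T_t$ is contained in a disk of radius $<1$ independent of $t$. This eigenvalue is denoted by $\lambda(t)$; it satisfies $\lambda(0)=1$ and $\lambda(t)\to1$ as $t\to0$. *)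

(* Defs.v *)
(* MathComp-Analysis, with the complex numbers R[i] of mathcomp-real-closed *)
From HB Require Import structures.
From mathcomp Require Export all_boot all_order all_algebra.
From mathcomp Require Export all_classical all_reals all_analysis.
From mathcomp Require Export complex.

Set Implicit Arguments.
Unset Strict Implicit.
Unset Printing Implicit Defensive.

Export Order.TTheory GRing.Theory Num.Theory.
Export numFieldNormedType.Exports.

Global Open Scope classical_set_scope.
Global Open Scope ring_scope.
Global Open Scope complex_scope.

(* A metric space carrying a sigma-algebra; that the latter is the Borel one is
   the separate assumption [borel_space]. *)
#[short(type="metricMeasurableType")]
HB.structure Definition MetricMeasurable (R : numDomainType)
    (d : measure_display) :=
  { X of Metric R X & Measurable d X }.

Definition borel_space (R : realType) (d : measure_display)
    (X : metricMeasurableType R d) : Prop :=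
  (measurable : set (set X)) = <<s [set U : set X | open U] >>.

Definition bounded_metric (R : realType) (X : metricType R) : Prop :=
  exists M : R, forall x y : X, mdist x y <= M.

Section modulo_null_sets.
Context {d : measure_display} {X : measurableType d} {R : realType}.
Variable m : {measure set X -> \bar R}.

(* Images of measurable sets need not be measurable, hence negligible sets
   rather than sets of measure zero. *)
Definition subset_mod0 (A B : set X) : Prop := m.-negligible (A `\` B).
Definition eq_mod0 (A B : set X) : Prop := m.-negligible (A `+` B).

Definition partition_mod0 (alpha : set (set X)) : Prop :=
  [/\ forall a, alpha a -> measurable a /\ (0 < m a)%E,
      forall a b, alpha a -> alpha b -> a <> b -> m.-negligible (a `&` b) &
      m.-negligible (~` \bigcup_(a in alpha) a)].

Definition measure_preserving (T : X -> X) : Prop :=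
  measurable_fun setT T /\
  forall A, measurable A -> m (T @^-1` A) = m A.

(* T : a -> T(a) is invertible as a map of measure spaces: it is injective, and
   its inverse is measurable and nonsingular (the latter is needed for the
   jacobian of T on a to exist). *)
Definition invertible_on (T : X -> X) (a : set X) : Prop :=
  [/\ set_inj a T,
      forall A, measurable A -> A `<=` a ->
        exists2 B, measurable B & eq_mod0 (T @` A) B &
      forall A, A `<=` a -> m.-negligible A -> m.-negligible (T @` A)].

(* nu is the measure A |-> m (T (A `&` a)), written m o T_{|a}. *)
Definition is_pullback (T : X -> X) (a : set X)
    (nu : {measure set X -> \bar R}) : Prop :=
  forall A B, measurable A -> measurable B ->
    eq_mod0 (T @` (A `&` a)) B -> nu A = m B.

(* g is a version of the Radon-Nikodym derivative dm_{|a} / d(m o T_{|a}). *)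
Definition inverse_jacobian (T : X -> X) (a : set X) (g : X -> R) : Prop :=
  exists2 nu : {measure set X -> \bar R}, is_pullback T a nu &
    [/\ measurable_fun setT g,
        forall x, 0 <= g x &
        forall A, measurable A ->
          m (A `&` a) = (\int[nu]_(x in A) (g x)%:E)%E].

Definition mixing (T : X -> X) (alpha : set (set X)) : Prop :=
  forall a b, alpha a -> alpha b ->
    exists N : nat, forall n : nat, (N < n)%N ->
      subset_mod0 b (iter n T @` a).

End modulo_null_sets.

Section gibbs_markov.
Context {R : realType} {d : measure_display} {X : metricMeasurableType R d}.
Variable m : probability X R.

Record gibbs_markov (T : X -> X) (alpha : set (set X)) : Prop := GibbsMarkov {
  gm_preserving : measure_preserving m T ;
  gm_partition : partition_mod0 m alpha ;
  gm_markov : forall a, alpha a ->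
    (exists2 beta : set (set X), beta `<=` alpha &
       eq_mod0 m (T @` a) (\bigcup_(b in beta) b)) /\
    invertible_on m T a ;
  gm_big_image_preimage :
    exists F : set (set X), [/\ finite_set F, F `<=` alpha &
      forall a, alpha a -> exists b c,
        [/\ F b, F c, subset_mod0 m a (T @` b) & subset_mod0 m c (T @` a)]] ;
  gm_expansion : exists2 gamma : R, 0 < gamma < 1 &
    forall a, alpha a ->
      {ae (m \x m)%E, forall xy : X * X, a xy.1 -> a xy.2 ->
         gamma^-1 * mdist xy.1 xy.2 <= mdist (T xy.1) (T xy.2)} ;
  gm_distortion : exists C : R, forall a, alpha a ->
    exists2 g : X -> R, inverse_jacobian m T a g &
      {ae (m \x m)%E, forall xy : X * X, a xy.1 -> a xy.2 ->
         `|1 - g xy.1 / g xy.2| <= C * mdist (T xy.1) (T xy.2)}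
}.

(* Df(A), in [0, +oo] for nonempty A; the terms with x = y are 0 / 0 = 0. *)
Definition best_lipschitz (f : X -> R) (A : set X) : \bar R :=
  ereal_sup [set (`|f xy.1 - f xy.2| / mdist xy.1 xy.2)%:E | xy in A `*` A].

End gibbs_markov.

Section complex_valued.
Context {R : realType}.

Definition cmod (z : R[i]) : R := Normc.normc z.

Definition cexpi (x : R) : R[i] := cos x +i* sin x.

Context {d : measure_display} {X : measurableType d}.

Definition cmeasurable (u : X -> R[i]) : Prop :=
  measurable_fun setT (fun x => complex.Re (u x)) /\
  measurable_fun setT (fun x => complex.Im (u x)).

Variable m : {measure set X -> \bar R}.

Definition cintegrable (u : X -> R[i]) : Prop :=
  m.-integrable setT (fun x => (complex.Re (u x))%:E) /\
  m.-integrable setT (fun x => (complex.Im (u x))%:E).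

Definition cintegral (u : X -> R[i]) : R[i] :=
  (\int[m]_x complex.Re (u x)) +i* (\int[m]_x complex.Im (u x)).

(* w is (a version of) the image of u under the transfer operator of T. *)
Definition is_transfer (T : X -> X) (u w : X -> R[i]) : Prop :=
  [/\ cintegrable u, cintegrable w &
      forall v : X -> R[i], cmeasurable v ->
        (exists M : R, forall x, cmod (v x) <= M) ->
        cintegral (fun x => u x * v (T x)) = cintegral (fun x => w x * v x)].

End complex_valued.

Section leading_eigenvalue.
Context {R : realType} {d : measure_display} {X : metricMeasurableType R d}.
Variables (m : probability X R) (T : X -> X) (alpha : set (set X)) (eta : R).

(* Representatives of the elements of the Banach space of bounded functions
   that are eta-Hoelder on each a in alpha, uniformly in a; the elements being
   classes modulo null sets, the conditions are imposed almost everywhere. *)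
Definition holder_space (u : X -> R[i]) : Prop :=
  [/\ cmeasurable u,
      exists M : R, {ae m, forall x, cmod (u x) <= M} &
      exists C : R, forall a, alpha a ->
        {ae (m \x m)%E, forall xy : X * X, a xy.1 -> a xy.2 ->
           cmod (u xy.1 - u xy.2) <= C * mdist xy.1 xy.2 `^ eta}].

(* z is an eigenvalue, on [holder_space], of the operator
   u |-> That (e^{itf} u), where That is the transfer operator of T. *)
Definition perturbed_eigenvalue (f : X -> R) (t : R) (z : R[i]) : Prop :=
  exists u : X -> R[i],
    [/\ holder_space u,
        ~ {ae m, forall x, u x = 0} &
        is_transfer m T (fun x => cexpi (t * f x) * u x) (fun x => z * u x)].

(* For t close to 0, lambda t is the unique eigenvalue close to 1.  Simplicity
   and the spectral gap, being consequences, are not part of the definition. *)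
Definition leading_eigenvalue (f : X -> R) (lambda : R -> R[i]) : Prop :=
  (exists2 r : R, 0 < r & \forall t \near (0 : R),
     cmod (lambda t - 1) < r /\
     forall z, cmod (z - 1) < r ->
       (perturbed_eigenvalue f t z <-> z = lambda t)) /\
  (forall e : R, 0 < e -> \forall t \near (0 : R), cmod (lambda t - 1) < e).

End leading_eigenvalue.

(* Main.v *)
(** Let [S_n] be the Birkhoff sums of [f] and [b_n(t) = E(e^{itS_n})].  The lazy
    operator [(1 + That_t) / 2] contracts, by a Doeblin minorization on each
    ergodic component (laziness removes periodicity).  Its [n]-th iterate at
    [1] integrates to the binomial average [a_n(t)] of [b_0(t), ..., b_n(t)],
    and perturbing the spectral gap yields
    [a_{n+1}(t) = (1 + lambda(t))/2 a_n(t) + O(rho^n)] uniformly for [t] near 0.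

    Since [b_{n+1} - b_n = E(e^{itf} - 1) + xi_n] with the correlation
    [xi_n = E((e^{itS_n} - 1)(e^{itf o T^n} - 1))], this recurrence expresses
    [lambda(t) - E(e^{itf})] through the [xi_k] and [E(e^{itf} - 1)], up to
    [O(rho^n)].  The order exceeds the integrability of [f] because [f] is
    almost constant on the partition elements: bounded distortion gives
    [E(|f|^eta |f o T^k|^p) < oo] for [k >= 1], so that [xi_n] has a Taylor
    expansion of order [q = p + eta/(2p)] with constants polynomial in [n].

    Hence [lambda(t) - E(e^{itf})] is within [n^K (|t|^q + rho^n)] of a
    polynomial [Q_n(t)]; comparing [Q_n] with [Q_{n+1}] for [|t| <= rho^{n/q}]
    shows that the coefficients of [Q_n] converge, and the limits give the
    expansion up to every order [q' < q]. *)

Require Import Defs.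
From mathcomp Require Import measurable_realfun.
From mathcomp Require Import ring lra zify.
Set Implicit Arguments.
Unset Strict Implicit.
Unset Printing Implicit Defensive.

(** * Integration and transfer of integrals *)

Section integrals.
Context {d : measure_display} {X : measurableType d} {R : realType}.
Variable m : probability X R.
Implicit Types (u v : X -> R) (A B C : set X).

Definition integ u := m.-integrable setT (EFin \o u).

Definition dens u A : R := \int[m]_(x in A) u x.

Definition mr A : R := fine (m A).

Lemma mr_fin A : measurable A -> (mr A)%:E = m A.
Proof. by move=> mA; rewrite /mr fineK// fin_num_measure. Qed.

Lemma mr_ge0 A : 0 <= mr A.
Proof. by rewrite /mr fine_ge0. Qed.

Lemma mrT : mr setT = 1.
Proof. by rewrite /mr probability_setT. Qed.

Lemma mr_set0 : mr set0 = 0.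
Proof. by rewrite /mr measure0. Qed.

Lemma mr_le A B : measurable A -> measurable B -> A `<=` B -> mr A <= mr B.
Proof.
by move=> mA mB AB; rewrite /mr fine_le ?fin_num_measure ?le_measure ?inE.
Qed.

Lemma mr_le1 A : measurable A -> mr A <= 1.
Proof. by move=> mA; rewrite -mrT mr_le. Qed.

Lemma mr0P A : measurable A -> (mr A = 0) <-> (m A = 0%E).
Proof. by move=> mA; rewrite -mr_fin//; split => [->//|[]]. Qed.

Lemma mr0_le A B : measurable A -> measurable B -> A `<=` B -> mr B = 0 -> mr A = 0.
Proof.
by move=> mA mB AB B0; apply/eqP; rewrite eq_le mr_ge0 -B0 mr_le.
Qed.

Lemma mr_gt0 A : measurable A -> (0 < m A)%E -> 0 < mr A.
Proof. by move=> mA; rewrite -mr_fin. Qed.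

Lemma integ_cst (c : R) : integ (fun=> c).
Proof. exact: finite_measure_integrable_cst. Qed.

Lemma integ_meas u : integ u -> measurable_fun setT u.
Proof. by move=> /measurable_int/measurable_EFinP. Qed.

Lemma integS u A : measurable A -> integ u -> m.-integrable A (EFin \o u).
Proof. by move=> mA; apply: integrableS. Qed.

Lemma integD u v : integ u -> integ v -> integ (fun x => u x + v x).
Proof. by move=> iu iv; apply: (integrableD measurableT iu iv). Qed.

Lemma integB u v : integ u -> integ v -> integ (fun x => u x - v x).
Proof. by move=> iu iv; apply: (integrableB measurableT iu iv). Qed.

Lemma integZ (c : R) u : integ u -> integ (fun x => c * u x).
Proof. by move=> iu; apply: (integrableZl measurableT c iu). Qed.

Lemma integN u : integ u -> integ (fun x => - u x).
Proof. by move=> iu; apply: (integrableN iu). Qed.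

Lemma integ_norm u : integ u -> integ (fun x => `|u x|).
Proof. exact: integrable_norm. Qed.

Lemma integ_le u v : measurable_fun setT u -> (forall x, `|u x| <= v x) ->
  integ v -> integ u.
Proof.
move=> mu uv; apply: (le_integrable measurableT); first exact/measurable_EFinP.
move=> x _ /=; rewrite lee_fin; apply: (le_trans (uv x)).
by rewrite ler_norm.
Qed.

Lemma integM_bounded u v (M : R) : measurable_fun setT v ->
  (forall x, `|v x| <= M) -> integ u -> integ (fun x => v x * u x).
Proof.
move=> mv vM iu; apply: (@integ_le _ (fun x => M * `|u x|)).
- by apply: measurable_funM => //; exact: integ_meas.
- by move=> x; rewrite normrM ler_wpM2r.
- exact/integZ/integ_norm.
Qed.

Lemma integ_bounded v (M : R) : measurable_fun setT v ->
  (forall x, `|v x| <= M) -> integ v.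
Proof. by move=> mv vM; apply: (integ_le mv vM); exact: integ_cst. Qed.

Lemma integ_indic u B : measurable B -> integ u -> integ (fun x => u x * \1_B x).
Proof.
move=> mB iu; rewrite (_ : (fun x => _) = (fun x => \1_B x * u x)); last first.
  by apply/funext => x; rewrite mulrC.
apply: (@integM_bounded _ _ 1) => // x.
by rewrite indicE; case: (_ \in _); rewrite ?normr1 ?normr0.
Qed.

Lemma integ_sum (I : Type) (s : seq I) (F : I -> X -> R) :
  (forall i, integ (F i)) -> integ (fun x => \sum_(i <- s) F i x).
Proof.
move=> iF; elim: s => [|i s ih].
  by under eq_fun do rewrite big_nil; exact: integ_cst.
by under eq_fun do rewrite big_cons; exact: integD.
Qed.

Lemma densD u v A : measurable A -> integ u -> integ v ->
  dens (fun x => u x + v x) A = dens u A + dens v A.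
Proof. by move=> mA iu iv; rewrite /dens RintegralD//; exact: integS. Qed.

Lemma densB u v A : measurable A -> integ u -> integ v ->
  dens (fun x => u x - v x) A = dens u A - dens v A.
Proof. by move=> mA iu iv; rewrite /dens RintegralB//; exact: integS. Qed.

Lemma densZ (c : R) u A : measurable A -> integ u ->
  dens (fun x => c * u x) A = c * dens u A.
Proof. by move=> mA iu; rewrite /dens RintegralZl//; exact: integS. Qed.

Lemma densN u A : measurable A -> integ u -> dens (fun x => - u x) A = - dens u A.
Proof.
move=> mA iu; rewrite -mulN1r -densZ//; apply: eq_Rintegral => x _.
by rewrite mulN1r.
Qed.

Lemma dens_cst (c : R) A : measurable A -> dens (fun=> c) A = c * mr A.
Proof. by move=> mA; rewrite /dens Rintegral_cst. Qed.

Lemma dens_sum (I : Type) (s : seq I) (F : I -> X -> R) A : measurable A ->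
  (forall i, integ (F i)) ->
  dens (fun x => \sum_(i <- s) F i x) A = \sum_(i <- s) dens (F i) A.
Proof.
move=> mA iF; elim: s => [|i s ih].
  by under [X in dens X]eq_fun do rewrite big_nil; rewrite dens_cst// mul0r big_nil.
under [X in dens X]eq_fun do rewrite big_cons.
by rewrite densD ?ih ?big_cons//; exact: integ_sum.
Qed.

Lemma dens_indic u B A : dens (fun x => u x * \1_B x) A = dens u (A `&` B).
Proof.
rewrite /dens Rintegral_mkcondr; apply: eq_Rintegral => x _.
by rewrite /patch indicE; case: (_ \in _); rewrite ?mulr1 ?mulr0.
Qed.

Lemma dens_eq u v A : (forall x, A x -> u x = v x) -> dens u A = dens v A.
Proof. by move=> uv; apply: eq_Rintegral => x; rewrite inE => /uv. Qed.

Lemma dens_ae_ge0 u A : measurable A -> integ u ->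
  {ae m, forall x, A x -> 0 <= u x} -> 0 <= dens u A.
Proof.
move=> mA iu u0; rewrite /dens /Rintegral fine_ge0//.
rewrite (@ae_eq_integral _ _ _ _ _ (EFin \o (fun x => `|u x|)))//.
- by apply: integral_ge0 => x _; rewrite lee_fin.
- exact: (measurable_int m (integS mA iu)).
- exact: (measurable_int m (integS mA (integ_norm iu))).
- by apply: filterS u0 => x xA Ax /=; rewrite ger0_norm// xA.
Qed.

Lemma dens_ae_le u v A : measurable A -> integ u -> integ v ->
  {ae m, forall x, A x -> u x <= v x} -> dens u A <= dens v A.
Proof.
move=> mA iu iv uv; rewrite -subr_ge0 -densB//; apply: dens_ae_ge0 => //.
  exact: integB.
by apply: filterS uv => x xA Ax /=; rewrite subr_ge0 xA.
Qed.

Lemma dens_le u v A : measurable A -> integ u -> integ v ->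
  (forall x, A x -> u x <= v x) -> dens u A <= dens v A.
Proof. by move=> mA iu iv uv; apply: dens_ae_le => //; exact: aeW. Qed.

Lemma dens_ge0 u A : (forall x, A x -> 0 <= u x) -> 0 <= dens u A.
Proof. exact: Rintegral_ge0. Qed.

Lemma dens_norm u A : measurable A -> integ u ->
  `|dens u A| <= dens (fun x => `|u x|) A.
Proof. by move=> mA iu; apply: le_normr_Rintegral => //; exact: integS. Qed.

Lemma dens_ae_bound u (s : R) A : measurable A -> integ u ->
  {ae m, forall x, A x -> `|u x| <= s} -> `|dens u A| <= s * mr A.
Proof.
move=> mA iu us; apply: (le_trans (dens_norm mA iu)).
rewrite -dens_cst//; apply: dens_ae_le => //; first exact: integ_norm.
exact: integ_cst.
Qed.

Lemma densU u A B : measurable A -> measurable B -> integ u -> A `&` B = set0 ->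
  dens u (A `|` B) = dens u A + dens u B.
Proof.
move=> mA mB iu AB; apply: Rintegral_setU => //.
  by apply: integS => //; exact: measurableU.
by apply/disj_set2P.
Qed.

Lemma dens_null u A : measurable A -> integ u -> mr A = 0 -> dens u A = 0.
Proof.
move=> mA iu /mr0P -/(_ mA) A0; rewrite /dens /Rintegral null_set_integral//.
exact: (measurable_int m (integS mA iu)).
Qed.

Lemma densID u A B : measurable A -> measurable B -> integ u ->
  dens u A = dens u (A `&` B) + dens u (A `\` B).
Proof.
move=> mA mB iu; rewrite -densU//; first by rewrite setUIDK.
- exact: measurableI.
- exact: measurableD.
- by rewrite setDE setIACA setICr setI0.
Qed.

Lemma mrID A B : measurable A -> measurable B -> mr A = mr (A `&` B) + mr (A `\` B).
Proof.
move=> mA mB; have := densID mA mB (integ_cst 1).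
rewrite !dens_cst ?mul1r//; [exact: measurableD|exact: measurableI].
Qed.

Lemma dens_mod0 u A B : measurable A -> measurable B -> integ u ->
  mr (A `\` B) = 0 -> dens u (A `&` B) = dens u A.
Proof.
move=> mA mB iu AB; rewrite (densID mA mB iu) (dens_null _ iu AB) ?addr0//.
exact: measurableD.
Qed.

Lemma mr_mod0 A B : measurable A -> measurable B ->
  mr (A `\` B) = 0 -> mr (A `&` B) = mr A.
Proof. by move=> mA mB AB; rewrite (mrID mA mB) AB addr0. Qed.

Lemma dens_nneg_subset u A B : measurable A -> measurable B -> integ u ->
  (forall x, 0 <= u x) -> A `<=` B -> dens u A <= dens u B.
Proof.
move=> mA mB iu u0 AB; rewrite (densID mB mA iu) (setIidr AB) lerDl.
exact: dens_ge0.
Qed.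

Lemma dens_pieces_ge0 u (F : nat -> set X) A : integ u -> measurable A ->
  (forall i, measurable (F i)) -> trivIset setT F ->
  mr (~` \bigcup_i F i) = 0 ->
  (forall i, 0 <= dens u (A `&` F i)) -> 0 <= dens u A.
Proof.
move=> iu mA mF tF F0 uF.
have mU : measurable (\bigcup_i F i) by exact: bigcupT_measurable.
rewrite -(dens_mod0 mA mU iu); last first.
  apply: mr0_le F0 => //; [exact: measurableD|exact: measurableC].
rewrite setI_bigcupr /dens /Rintegral fine_ge0// integral_bigcup//.
- apply: nneseries_ge0 => i _ _.
  rewrite -[leRHS]fineK; first by rewrite lee_fin; exact: uF.
  apply: integrable_fin_num; first exact: measurableI.
  by apply: integS => //; exact: measurableI.
- by move/trivIsetP : tF => tF; apply/trivIsetP => i j _ _ ij;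
    rewrite setIACA setIid tF// setI0.
- by move=> i; exact: measurableI.
- by apply: integS => //; apply: bigcupT_measurable => i; exact: measurableI.
Qed.

Lemma ae_le_of_dens u (k : R) C : measurable C -> integ u ->
  (forall A, measurable A -> A `<=` C -> dens u A <= k * mr A) ->
  {ae m, forall x, C x -> u x <= k}.
Proof.
move=> mC iu uk.
have mu := integ_meas iu.
pose A := C `&` [set x | k < u x].
have mA : measurable A.
  apply: measurableI => //; rewrite -[X in measurable X]setTI.
  exact: (measurable_fun_ltr (measurable_cst k) mu).
have iv : integ (fun x => u x - k) by apply: integB => //; exact: integ_cst.
have v0 : dens (fun x => u x - k) A = 0.
  apply/eqP; rewrite eq_le densB//; last exact: integ_cst.
  rewrite dens_cst// subr_le0 uk//=; last by move=> x [].
  rewrite -dens_cst// -densB//; last exact: integ_cst.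
  by apply: dens_ge0 => x [_ /ltW]; rewrite subr_ge0.
have : ae_eq m A (EFin \o (fun x => u x - k)) (cst 0%E).
  apply/ae_eq_integral_abs => //; first exact: (measurable_int m (integS mA iv)).
  rewrite -[LHS]fineK; last first.
    apply: integrable_fin_num => //.
    apply: (eq_integrable _ (EFin \o (fun x => `|u x - k|))) => //.
    exact/integS/integ_norm.
  congr EFin; rewrite -[RHS]v0; congr fine; apply: eq_integral => x.
  by rewrite inE => -[_ /ltW] kx; rewrite /= ger0_norm// subr_ge0.
apply: filterS => x /= xA Cx; rewrite leNgt; apply/negP => kx.
have /xA [] : A x by [].
by move/eqP; rewrite subr_eq0 => /eqP ukx; rewrite ukx ltxx in kx.
Qed.

Lemma ae_norm_le_of_dens u (c k : R) C : measurable C -> integ u ->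
  (forall A, measurable A -> A `<=` C -> `|dens u A - c * mr A| <= k * mr A) ->
  {ae m, forall x, C x -> `|u x - c| <= k}.
Proof.
move=> mC iu uk.
have h1 : {ae m, forall x, C x -> u x <= c + k}.
  apply: ae_le_of_dens => // A mA AC; have := uk A mA AC.
  by rewrite ler_norml mulrDl => /andP[_]; lra.
have h2 : {ae m, forall x, C x -> - u x <= - c + k}.
  apply: ae_le_of_dens => //; first exact: integN.
  move=> A mA AC; rewrite densN//; have := uk A mA AC.
  by rewrite ler_norml mulrDl => /andP[]; lra.
apply: filterS2 h1 h2 => x a1 a2 Cx; rewrite ler_norml.
by have := a1 Cx; have := a2 Cx; lra.
Qed.

Lemma ae_exists (P : X -> Prop) A : measurable A -> 0 < mr A ->
  {ae m, forall x, P x} -> exists2 x, A x & P x.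
Proof.
move=> mA A0 [N [mN N0 PN]]; apply: contrapT => h.
suff : mr A <= mr N by rewrite (_ : mr N = 0) ?leNgt ?A0//; exact/mr0P.
apply: mr_le => // x Ax; apply: PN => /= Px; apply: h; by exists x.
Qed.

Lemma ae_in_null (P : X -> Prop) A : measurable A -> mr A = 0 ->
  {ae m, forall x, A x -> P x}.
Proof.
move=> mA /mr0P -/(_ mA) A0; exists A; split => // x /=.
by apply: contra_notP => nA /nA.
Qed.

End integrals.

Section transfer.
Context {d : measure_display} {X : measurableType d} {R : realType}.
Variables (m : probability X R) (T : X -> X).
Hypothesis hT : measure_preserving m T.
Implicit Types (u v w : X -> R) (A B C : set X).

Lemma preserving_fun : measurable_fun setT T.
Proof. by case: hT. Qed.

Lemma preimage_meas A : measurable A -> measurable (T @^-1` A).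
Proof. by move=> mA; rewrite -[X in measurable X]setTI; apply: preserving_fun. Qed.

Lemma mr_preimage A : measurable A -> mr m (T @^-1` A) = mr m A.
Proof. by move=> mA; rewrite /mr; case: hT => _ ->. Qed.

Lemma ae_preimage (P : X -> Prop) : {ae m, forall x, P x} -> {ae m, forall x, P (T x)}.
Proof.
move=> [N [mN N0 PN]]; exists (T @^-1` N); split.
- exact: preimage_meas.
- by case: hT => _ ->.
- by move=> x /= Px; apply: PN.
Qed.

Lemma integral_comp_preserving (f : X -> \bar R) A : measurable A ->
  measurable_fun setT f -> (forall x, (0 <= f x)%E) ->
  (\int[m]_(x in T @^-1` A) f (T x) = \int[m]_(x in A) f x)%E.
Proof.
move=> mA mf f0.
rewrite -(@ge0_integral_pushforward _ _ _ _ _ _ preserving_fun m _ f mA)//.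
- apply: (eq_measure_integral m); first exact: preserving_fun.
  by move=> ? B mB _; rewrite /= /pushforward; case: hT => _ ->.
- exact: measurable_funTS.
Qed.

Lemma integ_comp u : integ m u -> integ m (u \o T).
Proof.
move=> iu; have mu := integ_meas iu; apply/integrableP; split.
  by apply/measurable_EFinP; apply: measurableT_comp => //; exact: preserving_fun.
have /integrableP[_] := iu.
rewrite -(preimage_setT T) -(@integral_comp_preserving (fun x => `|(u x)%:E|%E))//.
  by rewrite !preimage_setT.
by apply: measurableT_comp => //; exact/measurable_EFinP.
Qed.

Lemma dens_comp u A : measurable A -> integ m u ->
  dens m (u \o T) (T @^-1` A) = dens m u A.
Proof.
move=> mA iu; have mu := integ_meas iu.
rewrite /dens /Rintegral; congr fine.
rewrite integralE [RHS]integralE; congr (_ - _)%E.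
- rewrite -[RHS](@integral_comp_preserving (EFin \o u)^\+%E)//.
    by apply: eq_integral => x _; rewrite -[RHS]/(((EFin \o u)^\+%E \o T) x) -funepos_comp.
  by apply: measurable_funepos; apply/measurable_EFinP.
- rewrite -[RHS](@integral_comp_preserving (EFin \o u)^\-%E)//.
    by apply: eq_integral => x _; rewrite -[RHS]/(((EFin \o u)^\-%E \o T) x) -funeneg_comp.
  by apply: measurable_funeneg; apply/measurable_EFinP.
Qed.

Lemma transfer_exists u : integ m u ->
  exists2 w, integ m w & forall A, measurable A -> dens m w A = dens m u (T @^-1` A).
Proof.
move=> iu.
have [nu nuE] : exists nu : {charge set X -> \bar R},
    forall A, nu A = (\int[m]_(t in T @^-1` A) (u t)%:E)%E.
  by unshelve (exists (pushforward (induced_charge iu) T)); first exact: preserving_fun.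
have num : nu `<< m.
  apply/null_content_dominatesP => A mA A0; rewrite nuE null_set_integral//.
  - exact: preimage_meas.
  - exact: (measurable_int m (integS (preimage_meas mA) iu)).
  - by case: hT => _ ->.
have iw : m.-integrable setT (Radon_Nikodym nu m) by exact: Radon_Nikodym_integrable.
exists (fine \o (Radon_Nikodym nu m)).
  apply: (eq_integrable _ (Radon_Nikodym nu m)) => // x _.
  by rewrite /= fineK// Radon_Nikodym_fin_num.
move=> A mA; rewrite /dens /Rintegral -nuE (Radon_Nikodym_integral num mA).
congr fine; apply: eq_integral => x _.
by rewrite /= fineK// Radon_Nikodym_fin_num.
Qed.

Lemma floor_sum (N : nat) (y : R) : 0 <= y <= N%:R ->
  0 <= y - \sum_(i < N) ((i.+1%:R <= y)%R)%:R <= 1.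
Proof.
elim: N => [|N IH] /andP[y0 yN].
  by rewrite big_ord0 subr0 y0 (le_trans yN)// ler01.
rewrite big_ord_recr/=; have [yN'|yN'] := leP y N%:R.
  have -> : (N.+1%:R <= y) = false.
    by apply/negbTE; rewrite -ltNge (le_lt_trans yN')// ltr_nat.
  by rewrite addr0 IH// y0.
rewrite (eq_bigr (fun=> 1)); last first.
  move=> i _; suff -> : (i.+1%:R <= y) by [].
  by rewrite (le_trans _ (ltW yN'))// ler_nat.
rewrite sumr_const card_ord; case: (leP _ y) => yS /=; move: yN yN' yS;
  rewrite -natr1; lra.
Qed.

(* [v] is approximated, within [e], by a combination of the indicators of the
   sets [{v + M >= i e}] *)
Lemma transfer_test u w v (M : R) : integ m u -> integ m w ->
  (forall A, measurable A -> dens m w A = dens m u (T @^-1` A)) ->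
  measurable_fun setT v -> (forall x, `|v x| <= M) ->
  dens m (fun x => v x * w x) setT = dens m (fun x => v (T x) * u x) setT.
Proof.
move=> iu iw wu mv vM.
have ivw : integ m (fun x => v x * w x) by exact: integM_bounded vM iw.
have mvT : measurable_fun setT (v \o T).
  by apply: measurableT_comp => //; exact: preserving_fun.
have ivu : integ m (fun x => v (T x) * u x).
  by apply: (@integM_bounded _ _ _ _ _ (v \o T) M) => // x; exact: vM.
pose S := dens m (fun x => `|w x|) setT + dens m (fun x => `|u x|) setT.
have S0 : 0 <= S by rewrite addr_ge0// dens_ge0.
suff h (e : R) : 0 < e -> `|dens m (fun x => v x * w x) setT -
    dens m (fun x => v (T x) * u x) setT| <= e * S.
  apply/eqP; rewrite -subr_eq0 -normr_le0; apply/ler_addgt0Pr => e e0.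
  rewrite add0r; apply: (le_trans (h (e / (S + 1)) _)).
    by rewrite divr_gt0// ltr_wpDl.
  rewrite mulrAC ler_pdivrMr ?ltr_wpDl// ler_wpM2l ?ltW//; lra.
move=> e0.
pose N := Num.bound (2 * `|M| / e).
have NM : 2 * `|M| <= N%:R * e.
  rewrite -ler_pdivrMr// ltW// /N.
  by have := archi_boundP (divr_ge0 (mulr_ge0 (ler0n _ 2) (normr_ge0 M)) (ltW e0)).
pose y x := (v x + `|M|) / e.
pose A (i : nat) : set X := [set x | i.+1%:R <= y x].
have my : measurable_fun setT y.
  by apply: measurable_funM => //; apply: measurable_funD.
have mA i : measurable (A i).
  rewrite -[X in measurable X]setTI.
  exact: (measurable_fun_ler (measurable_cst _) my).
have AT i : T @^-1` (A i) = [set x | i.+1%:R <= y (T x)] by [].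
pose vn x := e * \sum_(i < N) \1_(A i) x - `|M|.
have vvn x : `|v x - vn x| <= e.
  have yN : 0 <= y x <= N%:R.
    have := vM x; have := ler_norm M; rewrite ler_norml => MM /andP[v1 v2].
    rewrite /y divr_ge0//=; [|lra|exact: ltW].
    by rewrite ler_pdivrMr//; lra.
  have := floor_sum yN; rewrite (eq_bigr (fun i : 'I_N => \1_(A i) x)); last first.
    by move=> i _; rewrite indicE; congr (_%:R); congr nat_of_bool;
       apply/idP/idP; rewrite inE.
  have ye : v x = e * y x - `|M| by rewrite /y mulrCA divff ?gt_eqF// mulr1 addrK.
  rewrite /vn ye; set s := \sum_(_ < _) _ => /andP[s0 s1].
  rewrite ler_norml; nra.
have key (w' : X -> R) (B : nat -> set X) (v' : X -> R) : integ m w' ->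
    (forall i, measurable (B i)) -> measurable_fun setT v' ->
    (forall x, `|v' x| <= M) ->
    (forall x, `|v' x - (e * (\sum_(i < N) \1_(B i) x) - `|M|)| <= e) ->
    `|dens m (fun x => v' x * w' x) setT -
      (e * (\sum_(i < N) dens m w' (B i)) - `|M| * dens m w' setT)|
     <= e * dens m (fun x => `|w' x|) setT.
  move=> iw' mB mv' v'M v'e.
  have iwB (i : nat) : integ m (fun x => w' x * \1_(B i) x) by exact: integ_indic.
  have iv' : integ m (fun x => v' x * w' x) by exact: integM_bounded v'M iw'.
  have iS : integ m (fun x => \sum_(i < N) w' x * \1_(B i) x).
    by apply: integ_sum.
  have -> : e * (\sum_(i < N) dens m w' (B i)) - `|M| * dens m w' setT =
      dens m (fun x => e * (\sum_(i < N) w' x * \1_(B i) x) - `|M| * w' x) setT.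
    rewrite densB//; [|exact: integZ|exact: integZ].
    rewrite !densZ// dens_sum//.
    by congr (e * _ - _); apply: eq_bigr => i _; rewrite dens_indic setTI.
  rewrite -densB//; last first.
    by apply: integB; exact: integZ.
  rewrite -densZ//; last exact: integ_norm.
  apply: (le_trans (dens_norm _ _)) => //.
    by apply: integB => //; apply: integB; exact: integZ.
  apply: dens_le => //.
  - by apply: integ_norm; apply: integB => //; apply: integB; exact: integZ.
  - by apply: integZ; exact: integ_norm.
  - move=> x _; rewrite -big_distrr/=.
    rewrite (_ : _ - _ = (v' x - (e * (\sum_(i < N) \1_(B i) x) - `|M|)) * w' x).
      by rewrite normrM ler_wpM2r.
    by ring.
have k1 := key w A v iw mA mv vM vvn.
have k2 := key u (fun i => T @^-1` A i) (v \o T) iu (fun i => preimage_meas (mA i))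
  mvT (fun x => vM (T x)) (fun x => vvn (T x)).
have e1 : \sum_(i < N) dens m w (A i) = \sum_(i < N) dens m u (T @^-1` A i).
  by apply: eq_bigr => i _; exact: wu.
have e2 : dens m w setT = dens m u setT by rewrite wu.
move: k1 k2; rewrite e1 e2 /S mulrDr /=.
set q := e * _ - _; set a := dens m _ _; set b := dens m (fun x => v (T x) * _) _ => k1 k2.
rewrite (_ : a - b = (a - q) - (b - q)); last by ring.
by apply: (le_trans (ler_normB _ _)); rewrite lerD.
Qed.

End transfer.

Lemma preserving_iter {d : measure_display} {X : measurableType d} {R : realType}
  (m : probability X R) (T : X -> X) : measure_preserving m T ->
  forall n, measure_preserving m (iter n T).
Proof.
move=> hT; elim=> [|n [mn pn]]; first by split; [exact: measurable_id|].
split.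
  by apply: measurableT_comp => //; exact: preserving_fun hT.
move=> A mA; rewrite (_ : iter n.+1 T @^-1` A = iter n T @^-1` (T @^-1` A))//.
by rewrite pn; [case: hT => _ ->|exact: (preimage_meas hT)].
Qed.

(** * Coding of Gibbs-Markov maps by a countable partition *)

Section countable_partition.
Context {d : measure_display} {X : measurableType d} {R : realType}.
Variable m : probability X R.
Implicit Types (A B : set X) (s : seq (set X)).

Lemma mr_negligible A : measurable A -> m.-negligible A -> mr m A = 0.
Proof. by move=> mA /negligibleP-/(_ mA) A0; apply/mr0P. Qed.

Lemma negligible_mr A B : measurable B -> mr m B = 0 -> A `<=` B -> m.-negligible A.
Proof. by move=> mB /mr0P-/(_ mB) B0 AB; exists B. Qed.

Lemma mr_gt0_nonempty A : 0 < mr m A -> exists x, A x.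
Proof.
move=> A0; apply/set0P/eqP => A0'; by rewrite A0' mr_set0 ltxx in A0.
Qed.

Lemma negligible_bigsetU_seq (I : eqType) (s : seq I) (F : I -> set X) :
  (forall i, i \in s -> m.-negligible (F i)) ->
  m.-negligible (\big[setU/set0]_(i <- s) F i).
Proof.
move=> nF; rewrite big_seq; elim/big_ind : _ => //; first exact: negligible_set0.
exact: negligibleU.
Qed.

Lemma sum_mr_almost_disjoint s : uniq s ->
  (forall a, a \in s -> measurable a) ->
  (forall a b, a \in s -> b \in s -> a <> b -> m.-negligible (a `&` b)) ->
  \sum_(a <- s) mr m a = mr m (\big[setU/set0]_(a <- s) a).
Proof.
elim: s => [|a s ih] /=; first by rewrite !big_nil mr_set0.
move=> /andP[as_ us] ms ns.
have ma : measurable a by apply: ms; rewrite mem_head.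
have mU : measurable (\big[setU/set0]_(b <- s) b).
  rewrite big_seq; apply: bigsetU_measurable => b bs.
  by apply: ms; rewrite in_cons bs orbT.
rewrite !big_cons ih//; last 2 first.
- by move=> b bs; apply: ms; rewrite in_cons bs orbT.
- by move=> b c bs cs; apply: ns; rewrite in_cons ?bs ?cs orbT.
set U := \big[setU/set0]_(j <- s) j in mU *.
have Ua : mr m (U `&` a) = 0.
  apply: mr_negligible; first exact: measurableI.
  rewrite /U big_distrl/=; apply: negligible_bigsetU_seq => b bs.
  apply: ns; rewrite ?in_cons ?bs ?eqxx ?orbT//.
  by move=> ba; move: as_; rewrite -ba bs.
rewrite (mrID m (measurableU _ _ ma mU) ma) setUK; congr (_ + _).
rewrite setDUl setDv set0U (mrID m mU ma) Ua add0r//.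
Qed.

Lemma partition_mod0_countable (alpha : set (set X)) :
  partition_mod0 m alpha -> countable alpha.
Proof.
move=> [pa na _].
pose al n := alpha `&` [set a | n.+1%:R^-1 <= mr m a].
have -> : alpha = \bigcup_n al n.
  apply/seteqP; split => [a aa|a [n _ []//]].
  have [ma a0] := pa _ aa; have {}a0 := mr_gt0 ma a0.
  exists (Num.bound (mr m a)^-1) => //; split => //=.
  rewrite -[leRHS]invrK lef_pV2 ?posrE ?invr_gt0//.
  have := archi_boundP (ltW (_ : 0 < (mr m a)^-1)); rewrite invr_gt0 => /(_ a0) h.
  by rewrite (le_trans (ltW h))// ler_nat.
apply: bigcup_countable => // n _; apply: finite_set_countable.
apply: contrapT => /(infinite_set_fset n.+2)[B Bal nB].
have mB (a : set X) : a \in finmap.enum_fset B -> measurable a by move=> /Bal[/pa[]].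
have : \sum_(a <- finmap.enum_fset B) mr m a <= 1.
  rewrite sum_mr_almost_disjoint ?finmap.fset_uniq//.
  - by apply: mr_le1; rewrite big_seq; apply: bigsetU_measurable => a /mB.
  - by move=> a b /Bal[aa _] /Bal[bb _]; exact: na.
apply/negP; rewrite -ltNge.
rewrite (@lt_le_trans _ _ (\sum_(a <- finmap.enum_fset B) n.+1%:R^-1))//.
  rewrite big_const_seq count_predT iter_addr_0 -mulr_natr mulrC.
  by rewrite mulr1 -[ltRHS]mulr_natl ltr_pdivlMr// mul1r ltr_nat.
rewrite big_seq [leRHS]big_seq; apply: ler_sum => a /Bal[]//.
Qed.

Lemma partition_seq (alpha : set (set X)) : partition_mod0 m alpha ->
  exists e A : nat -> set X, [/\ forall i, e i = set0 \/ alpha (e i),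
    forall a, alpha a -> exists i, e i = a,
    forall i, [/\ measurable (A i), A i `<=` e i & mr m (e i `\` A i) = 0],
    trivIset setT A &
    mr m (~` \bigcup_i A i) = 0].
Proof.
move=> pal; have /countable_injP[f finj] := partition_mod0_countable pal.
have [pa na ca] := pal.
pose e n : set X := xget set0 [set a | alpha a /\ f a = n].
have eP n : e n = set0 \/ (alpha (e n) /\ f (e n) = n).
  by rewrite /e; case: xgetP => [a _ []|]; [right|left].
have ef a : alpha a -> e (f a) = a.
  move=> aa; rewrite /e; case: xgetP => [b _ [bb fba]|/(_ a)/=].
    by apply: finj => //; rewrite inE.
  by move=> h; exfalso; apply: h.
have me n : measurable (e n) by case: (eP n) => [->//|[/pa[]]].
have ne i j : i <> j -> m.-negligible (e i `&` e j).
  move=> ij; case: (eP i) => [->|[ai fi]]; first by rewrite set0I; exact: negligible_set0.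
  case: (eP j) => [->|[aj fj]]; first by rewrite setI0; exact: negligible_set0.
  by apply: na => // eij; apply: ij; rewrite -fi -fj eij.
have mS n : measurable (seqDU e n).
  by apply: measurableD => //; apply: bigsetU_measurable => i _.
have eS n : mr m (e n `\` seqDU e n) = 0.
  apply: mr_negligible; first exact: measurableD.
  rewrite /seqDU setDD big_distrr/=; apply: negligible_bigsetU_seq => k _.
  by apply: ne => nk; have := ltn_ord k; rewrite -nk ltnn.
exists e, (seqDU e); split => //.
- by move=> i; case: (eP i) => [|[]]; [left|right].
- by move=> a aa; exists (f a); exact: ef.
- by move=> i; split => //; exact: subset_seqDU.
- rewrite -seqDU_bigcup_eq; apply: mr_negligible.
    by apply: measurableC; exact: bigcupT_measurable.
  apply: negligibleS ca; apply: subsetC => x [a aa ax].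
  by exists (f a) => //; rewrite ef.
Qed.

End countable_partition.

Section product_almost_everywhere.
Context {d : measure_display} {X : measurableType d} {R : realType}.
Variable m : probability X R.
Local Notation m2 := (m \x m)%E.

Lemma ae_prod_iter (P : X * X -> Prop) : {ae m2, forall xy, P xy} ->
  {ae m, forall x, {ae m, forall y, P (x, y)}}.
Proof.
move=> [N [mN N0 PN]].
have ms : measurable_fun setT (m \o xsection N) by exact: measurable_fun_xsection.
have : ae_eq m setT (m \o xsection N) (cst 0%E).
  apply/ae_eq_integral_abs => //; rewrite -[RHS]N0 /product_measure1.
  by apply: eq_integral => x _; rewrite gee0_abs.
apply: filterS => x /(_ I) /= Nx; exists (xsection N x); split => //.
  exact: measurable_xsection.
by move=> y /= Pxy; rewrite /xsection/= inE; exact: PN.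
Qed.

Lemma prod_null_iter (N : set (X * X)) : measurable N ->
  {ae m, forall x, {ae m, forall y, ~ N (x, y)}} -> m2 N = 0%E.
Proof.
move=> mN hN; rewrite /product_measure1.
have ms : measurable_fun setT (m \o xsection N) by exact: measurable_fun_xsection.
have : ae_eq m setT (m \o xsection N) (cst 0%E).
  apply: filterS hN => x Nx _ /=; apply: measure_negligible.
    exact: measurable_xsection.
  apply: negligibleS Nx => y; rewrite /xsection/= inE => Nxy; exact.
move=> /ae_eq_integral_abs => /(_ measurableT ms) <-.
by apply: eq_integral => x _; rewrite gee0_abs.
Qed.

Lemma ae_prod_left (P : X -> Prop) : {ae m, forall x, P x} ->
  {ae m2, forall xy, P xy.1}.
Proof.
move=> [N [mN N0 PN]]; exists (N `*` setT); split.
- exact: measurableX.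
- by apply/eqP; rewrite product_measure1E// mule_eq0; apply/orP; left; exact/eqP.
- by move=> [x y] /= Px; split => //; exact: PN.
Qed.

Lemma ae_prod_right (P : X -> Prop) : {ae m, forall x, P x} ->
  {ae m2, forall xy, P xy.2}.
Proof.
move=> [N [mN N0 PN]]; exists (setT `*` N); split.
- exact: measurableX.
- by apply/eqP; rewrite product_measure1E// mule_eq0; apply/orP; right; exact/eqP.
- by move=> [x y] /= Px; split => //; exact: PN.
Qed.

Variables (T : X -> X) (A I : set X).
Hypothesis T_meas : measurable_fun setT T.
Hypothesis (mA : measurable A) (mI : measurable I).
Hypothesis image_ae : forall Q : X -> Prop,
  {ae m, forall x, A x -> Q (T x)} -> {ae m, forall z, I z -> Q z}.
Hypothesis A_separated : forall E, measurable E -> E `<=` A ->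
  exists2 B, measurable B & {ae m, forall x, A x -> (E x <-> B (T x))}.

(* The measurable subsets of [A `*` A] are, off a null set, preimages under
   [T * T]: the sets with this property form a sigma-algebra containing the
   rectangles. *)
Lemma prod_separated (N : set (X * X)) : measurable N ->
  exists2 M : set (X * X), measurable M & exists2 Z, m.-negligible Z &
    forall x y, A x -> A y -> ~ Z x -> ~ Z y -> (N (x, y) <-> M (T x, T y)).
Proof.
pose G := [set N : set (X * X) | exists2 M : set (X * X), measurable M &
  exists2 Z, m.-negligible Z & forall x y, A x -> A y -> ~ Z x -> ~ Z y ->
    (N (x, y) <-> M (T x, T y))].
suff : measurable `<=` G by exact.
rewrite measurable_prod_measurableType; apply: smallest_sub.
  split.
  - by exists set0 => //; exists set0 => //; exact: negligible_set0.
  - move=> N' [M mM [Z nZ h]]; exists (~` M); first exact: measurableC.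
    by exists Z => // x y Ax Ay Zx Zy /=; have := h x y Ax Ay Zx Zy; tauto.
  - move=> F GF; have /choice[M hM] : forall i, exists M : set (X * X),
      measurable M /\ exists2 Z, m.-negligible Z & forall x y, A x -> A y ->
        ~ Z x -> ~ Z y -> (F i (x, y) <-> M (T x, T y)).
      by move=> i; case: (GF i) => M mM hM; exists M.
    have /choice[Z hZ] : forall i, exists Z, m.-negligible Z /\
       forall x y, A x -> A y -> ~ Z x -> ~ Z y -> (F i (x, y) <-> M i (T x, T y)).
      by move=> i; case: (hM i) => _ [Z nZ hZ]; exists Z.
    exists (\bigcup_i M i); first by apply: bigcupT_measurable => i; case: (hM i).
    exists (\bigcup_i Z i); first by apply: negligible_bigcup => i; case: (hZ i).
    move=> x y Ax Ay Zx Zy; split => -[i _ hi]; exists i => //.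
      by apply/(hZ i).2 => // ?; [apply: Zx|apply: Zy]; exists i.
    by apply/(hZ i).2 => // ?; [apply: Zx|apply: Zy]; exists i.
move=> _ [E1 mE1 [E2 mE2 <-]].
have sep E : measurable E -> exists2 B, measurable B &
    {ae m, forall x, A x -> (E x <-> B (T x))}.
  move=> mE; have [B mB h] := A_separated (measurableI _ _ mE mA) (@subIsetr _ _ _).
  exists B => //; apply: filterS h => x h Ax; have := h Ax.
  by rewrite /setI/=; tauto.
have [B1 mB1 [Z1 [mZ1 Z10 h1]]] := sep _ mE1.
have [B2 mB2 [Z2 [mZ2 Z20 h2]]] := sep _ mE2.
exists (B1 `*` B2); first exact: measurableX.
exists (Z1 `|` Z2).
  by apply: negligibleU; apply/negligibleP.
move=> x y Ax Ay Zx Zy.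
have {}h1 : E1 x <-> B1 (T x).
  have := contra_not (@h1 x) (fun h => Zx (or_introl h)).
  by move/contrapT => /(_ Ax).
have {}h2 : E2 y <-> B2 (T y).
  have := contra_not (@h2 y) (fun h => Zy (or_intror h)).
  by move/contrapT => /(_ Ay).
by rewrite /=; tauto.
Qed.

Lemma image_ae2 (Q : X -> X -> Prop) :
  {ae m2, forall xy, A xy.1 -> A xy.2 -> Q (T xy.1) (T xy.2)} ->
  {ae m2, forall zz, I zz.1 -> I zz.2 -> Q zz.1 zz.2}.
Proof.
move=> [N [mN N0 QN]].
have [M mM [Z nZ NM]] := prod_separated mN.
have aeZ : {ae m, forall x, ~ Z x}.
  by apply: negligibleS nZ => x /= /contrapT.
have M0 : {ae m, forall z, I z -> {ae m, forall z', I z' -> ~ M (z, z')}}.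
  apply: image_ae.
  have N0' : {ae m, forall x, {ae m, forall y, ~ N (x, y)}}.
    by apply: (@ae_prod_iter (fun xy => ~ N xy)); exists N; split => // xy /= /contrapT.
  apply: filterS2 (aeZ) (N0') => x Zx Nx Ax; apply: image_ae.
  by apply: filterS2 (aeZ) (Nx) => y Zy Nxy Ay; apply: contra_not Nxy => Mxy; apply/NM.
have nM : m2 (M `&` (I `*` I)) = 0%E.
  apply: prod_null_iter.
    by apply: measurableI => //; exact: measurableX.
  apply: filterS M0 => z Mz.
  have [Iz|nIz] := pselect (I z); last by apply: aeW => y [_ []].
  by apply: filterS (Mz Iz) => z' Mz' [Mzz' [_ Iz']]; exact: (Mz' Iz').
have aeW' : {ae m, forall z, I z -> exists x, [/\ A x, ~ Z x & T x = z]}.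
  by apply: image_ae; apply: filterS aeZ => x Zx Ax; exists x.
have aeM : {ae m2, forall zz, ~ (M `&` (I `*` I)) zz}.
  exists (M `&` (I `*` I)); split => //; last by move=> zz /= /contrapT.
  by apply: measurableI => //; exact: measurableX.
apply: filterS3 aeM (ae_prod_left aeW') (ae_prod_right aeW').
move=> [z z'] /= nMz h1 h2 Iz Iz'.
have [x [Ax Zx xz]] := h1 Iz; have [y [Ay Zy yz']] := h2 Iz'.
apply: contrapT => nQ; apply: nMz; split => //; rewrite -xz -yz'.
apply/NM => //; apply: QN => /= /(_ Ax Ay); by rewrite xz yz'.
Qed.

End product_almost_everywhere.

Lemma ae_prod_preimage {d : measure_display} {X : measurableType d} {R : realType}
    (m : probability X R) (T : X -> X) (P : X -> X -> Prop) :
  measure_preserving m T ->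
  {ae m, forall x, {ae m, forall y, P x y}} ->
  {ae m, forall x, {ae m, forall y, P (T x) (T y)}}.
Proof.
move=> hT hP.
apply: (ae_preimage hT (P := fun z => {ae m, forall y, P z (T y)})).
apply: filterS hP => z hz; exact: (ae_preimage hT (P := P z)).
Qed.

Section countable_union.
Context {d : measure_display} {X : measurableType d} {R : realType}.
Variable m : probability X R.

Lemma countable_union_seq (I : Type) (D : set I) (F : I -> set X) : countable D ->
  exists F' : nat -> set X, \bigcup_(i in D) F i = \bigcup_n F' n /\
    forall n, F' n = set0 \/ exists2 i, D i & F' n = F i.
Proof.
move=> /countable_injP[f finj].
exists (fun n => \bigcup_(i in D `&` [set i | f i = n]) F i); split.
  apply/seteqP; split => [x [i Di Fx]|x [n _ [i [Di _] Fx]]]; last by exists i.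
  by exists (f i) => //; exists i.
move=> n; have [[i [Di fi]]|h] := pselect (exists i, D i /\ f i = n).
  right; exists i => //; apply/seteqP; split => [x [j [Dj fj] Fx]|x Fx]; last by exists i.
  by rewrite -(finj j i) ?inE//= fj.
left; apply/seteqP; split => // x [j [Dj fj] _]; by apply: h; exists j.
Qed.

Lemma countable_union_measurable (I : Type) (D : set I) (F : I -> set X) :
  countable D -> (forall i, D i -> measurable (F i)) ->
  measurable (\bigcup_(i in D) F i).
Proof.
move=> /(countable_union_seq F)[F' [-> hF']] mF; apply: bigcupT_measurable => n.
by case: (hF' n) => [->//|[i Di ->]]; exact: mF.
Qed.

Lemma countable_union_negligible (I : Type) (D : set I) (F : I -> set X) :
  countable D -> (forall i, D i -> m.-negligible (F i)) ->
  m.-negligible (\bigcup_(i in D) F i).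
Proof.
move=> /(countable_union_seq F)[F' [-> hF']] nF; apply: negligible_bigcup => n.
case: (hF' n) => [->|[i Di ->]]; [exact: negligible_set0|exact: nF].
Qed.

End countable_union.

Record markov_coding {R : realType} {d : measure_display}
    {X : metricMeasurableType R d} (m : probability X R) (T : X -> X)
    (A I : nat -> set X) (G : nat -> X -> R) (gam D C : R) : Prop := MarkovCoding {
  mc_preserving : measure_preserving m T ;
  mc_gam : 0 < gam < 1 ;
  mc_D : 1 <= D ;
  mc_diam : forall x y : X, mdist x y <= D ;
  mc_C : 0 <= C ;
  mc_A : forall i, measurable (A i) ;
  mc_I : forall i, measurable (I i) ;
  mc_triv : trivIset setT A ;
  mc_cover : mr m (~` \bigcup_i A i) = 0 ;
  mc_markov : forall i j, mr m (A j `\` I i) = 0 \/ mr m (A j `&` I i) = 0 ;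
  mc_image2 : forall i (Q : X -> X -> Prop),
    {ae (m \x m)%E, forall xy : X * X, A i xy.1 -> A i xy.2 -> Q (T xy.1) (T xy.2)} ->
    {ae (m \x m)%E, forall zz : X * X, I i zz.1 -> I i zz.2 -> Q zz.1 zz.2} ;
  mc_into : forall i, {ae m, forall x, A i x -> I i (T x)} ;
  mc_separated : forall i E, measurable E -> E `<=` A i ->
    exists2 B, measurable B & {ae m, forall x, A i x -> (E x <-> B (T x))} ;
  mc_G_integ : forall i, integ m (G i) ;
  mc_G_ge0 : forall i x, 0 <= G i x ;
  mc_G_dens : forall i E, measurable E -> dens m (G i) E = mr m (A i `&` T @^-1` E) ;
  mc_G_off : forall i x, ~ I i x -> G i x = 0 ;
  mc_distortion : forall i, {ae (m \x m)%E, forall zz : X * X, I i zz.1 -> I i zz.2 ->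
    `|G i zz.1 - G i zz.2| <= C * mdist zz.1 zz.2 * G i zz.2} ;
  mc_expansion : forall i, {ae (m \x m)%E, forall xy : X * X, A i xy.1 -> A i xy.2 ->
    mdist xy.1 xy.2 <= gam * mdist (T xy.1) (T xy.2)} ;
  mc_bip : exists F : seq nat, forall i, 0 < mr m (A i) -> exists b c,
    [/\ b \in F, c \in F, 0 < mr m (A b), 0 < mr m (A c) &
        mr m (A i `\` I b) = 0 /\ mr m (A c `\` I i) = 0]
}.

Section branch.
Context {R : realType} {d : measure_display} {X : metricMeasurableType R d}.
Variables (m : probability X R) (T : X -> X) (alpha : set (set X)).
Hypothesis hT : measure_preserving m T.
Hypothesis alpha_part : partition_mod0 m alpha.
Variables (a A : set X) (beta : set (set X)).
Hypotheses (aa : alpha a) (mA : measurable A) (Aa : A `<=` a).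
Hypothesis aA : mr m (a `\` A) = 0.
Hypothesis beta_alpha : beta `<=` alpha.
Let I := \bigcup_(b in beta) b.
Hypothesis image_a : eq_mod0 m (T @` a) I.
Hypothesis Tinv : invertible_on m T a.

Let ma : measurable a.
Proof. by case: alpha_part => h _ _; case: (h _ aa). Qed.

Lemma branch_I_meas : measurable I.
Proof.
apply: countable_union_measurable.
  exact: sub_countable (subset_card_le beta_alpha) (partition_mod0_countable alpha_part).
by move=> b /beta_alpha bb; case: alpha_part => h _ _; case: (h _ bb).
Qed.

Lemma branch_negl_aA : m.-negligible (a `\` A).
Proof. by apply: (negligible_mr (B := a `\` A)) => //; exact: measurableD. Qed.

Lemma branch_markov b : alpha b -> b `<=` I \/ m.-negligible (b `&` I).
Proof.
move=> bb; have [bbeta|nb] := pselect (beta b).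
  by left => x bx; exists b.
right; rewrite /I setI_bigcupr; apply: countable_union_negligible.
  exact: sub_countable (subset_card_le beta_alpha) (partition_mod0_countable alpha_part).
move=> c cb; case: alpha_part => _ h _; apply: h => //; first exact: beta_alpha.
by move=> bc; apply: nb; rewrite bc.
Qed.

Lemma branch_into : {ae m, forall x, a x -> I (T x)}.
Proof.
have : {ae m, forall z, (T @` a) z -> I z}.
  apply: negligibleS image_a => z /= /not_implyP[az nz]; by left.
move=> /(ae_preimage hT); apply: filterS => x h ax; by apply: h; exists x.
Qed.

Lemma branch_image (Q : X -> Prop) : {ae m, forall x, A x -> Q (T x)} ->
  {ae m, forall z, I z -> Q z}.
Proof.
move=> hQ; case: Tinv => _ _ Tnull.
have n1 : m.-negligible (T @` (a `&` ~` [set x | A x -> Q (T x)])).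
  by apply: Tnull => [x []//|]; apply: negligibleS hQ => x [].
have n2 : m.-negligible (T @` (a `\` A)).
  by apply: Tnull => [x []//|]; exact: branch_negl_aA.
apply: negligibleS (negligibleU (negligibleU n1 n2) image_a).
move=> z /= /not_implyP[Iz nQ].
have [[x ax xz]|nz] := pselect ((T @` a) z); last by right; right.
left; have [Ax|nAx] := pselect (A x); [left|right]; exists x => //.
by split => //= h; apply: nQ; rewrite -xz; exact: h.
Qed.

Lemma branch_separated E : measurable E -> E `<=` A ->
  exists2 B, measurable B & {ae m, forall x, A x -> (E x <-> B (T x))}.
Proof.
move=> mE EA; case: Tinv => inj sep _.
have [B mB EB] := sep E mE (subset_trans EA Aa).
exists B => //.
have : {ae m, forall z, (T @` E) z <-> B z}.
  apply: negligibleS EB => z /= h.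
  have [h1|h1] := pselect ((T @` E) z); have [h2|h2] := pselect (B z).
  - by exfalso; apply: h; split.
  - by left.
  - by right.
  - by exfalso; apply: h; split.
move=> /(ae_preimage hT); apply: filterS => x [h1 h2] Ax; split.
  by move=> Ex; apply: h1; exists x.
move=> /h2[x' Ex' xx']; have <- // : x' = x.
by apply: inj => //; rewrite inE; [exact/Aa/EA|exact: Aa].
Qed.

Lemma branch_density : exists G : X -> R, [/\ integ m G, forall x, 0 <= G x,
  forall E, measurable E -> dens m G E = mr m (A `&` T @^-1` E) &
  forall x, ~ I x -> G x = 0].
Proof.
have mI := branch_I_meas.
have i1 : integ m (\1_A : X -> R).
  exact: integrable_indic.
have [w iw wE] := transfer_exists hT i1.
have {}wE E : measurable E -> dens m w E = mr m (A `&` T @^-1` E).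
  move=> mE; have mTE := preimage_meas hT mE; rewrite wE//.
  have -> : dens m \1_A (T @^-1` E) = dens m (fun x => 1 * \1_A x) (T @^-1` E).
    by apply: dens_eq => x _; rewrite mul1r.
  by rewrite (dens_indic m (fun=> 1)) dens_cst ?mul1r 1?setIC//; exact: measurableI.
have w0 : {ae m, forall x, 0 <= w x}.
  have := @ae_le_of_dens _ _ _ m (fun x => - w x) 0 setT measurableT (integN iw).
  have h E : measurable E -> E `<=` setT -> dens m (fun x => - w x) E <= 0 * mr m E.
    by move=> mE _; rewrite densN// wE// mul0r oppr_le0 mr_ge0.
  by move=> /(_ h); apply: filterS => x /(_ Logic.I); rewrite oppr_le0.
have woff : {ae m, forall x, ~ I x -> w x = 0}.
  have := @ae_norm_le_of_dens _ _ _ m w 0 0 (~` I) (measurableC mI) iw.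
  have h E : measurable E -> E `<=` ~` I -> `|dens m w E - 0 * mr m E| <= 0 * mr m E.
    move=> mE EI; rewrite !mul0r subr0 wE// mr_negligible ?normr0//.
      by apply: measurableI => //; exact: (preimage_meas hT).
    apply: negligibleS branch_into => x [Ax] /= ETx.
    by move=> h; exact: (EI _ ETx (h (Aa Ax))).
  move=> /(_ h); apply: filterS => x /[apply]; rewrite subr0 normr_le0 => /eqP//.
pose G x := Num.max (w x) 0 * \1_I x.
have mG : measurable_fun setT G.
  apply: measurable_funM => //.
  by apply: measurable_maxr => //; exact: integ_meas iw.
have iG : integ m G.
  apply: (integ_le mG (v := fun x => `|w x|)); last exact: integ_norm.
  move=> x; rewrite /G indicE; case: (_ \in _); last by rewrite mulr0 normr0.
  by rewrite mulr1; case: (leP (w x) 0) => _; rewrite ?normr0.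
exists G; split => //.
- by move=> x; rewrite mulr_ge0// ?le_max ?lexx ?orbT// indicE.
- move=> E mE; rewrite -wE//; apply/eqP; rewrite eq_le.
  have wG : {ae m, forall x, w x = G x}.
    apply: filterS2 w0 woff => x x0 xI; rewrite /G indicE.
    have [Ix|nIx] := pselect (I x); first by rewrite mem_set// mulr1 max_l.
    by rewrite memNset// mulr0 xI.
  by apply/andP; split; apply: dens_ae_le => //; apply: filterS wG => x ->.
- move=> x nIx; rewrite /G indicE (_ : (x \in I) = false) ?mulr0//.
  by apply/negbTE/negP; rewrite inE.
Qed.

Section distortion.
Variables (G g : X -> R) (C0 : R).
Hypotheses (iG : integ m G) (G0 : forall x, 0 <= G x).
Hypothesis G_dens : forall E, measurable E -> dens m G E = mr m (A `&` T @^-1` E).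
Hypothesis gjac : inverse_jacobian m T a g.

Lemma ge0_integral_mod0 (nu : {measure set X -> \bar R}) (U V : set X)
    (f : X -> \bar R) : measurable U -> measurable V ->
  measurable_fun setT f -> (forall x, (0 <= f x)%E) ->
  nu (U `\` V) = 0%E -> nu (V `\` U) = 0%E ->
  (\int[nu]_(x in U) f x = \int[nu]_(x in V) f x)%E.
Proof.
move=> mU mV mf f0 UV VU.
rewrite (ge0_negligible_integral _ mU _ _ UV)//; [|exact: measurableD|exact: measurable_funTS].
rewrite [RHS](ge0_negligible_integral _ mV _ _ VU)//; [|exact: measurableD|exact: measurable_funTS].
by rewrite !setDD setIC.
Qed.

Lemma branch_jacobian : {ae m, forall x, A x -> g x = G (T x) /\ 0 < g x}.
Proof.
have mI := branch_I_meas; have mT := preserving_fun hT.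
case: gjac => nu nuP [mg g0 mE].
have nuE E : measurable E -> E `<=` I -> nu (T @^-1` E) = m E.
  move=> mE' EI; apply: (nuP _ E (preimage_meas hT mE') mE').
  apply: negligibleS image_a => z [[[x [ETx ax] <-] nE]|[Ez nz]]; first by [].
  right; split; first exact: EI.
  by move=> [x ax xz]; apply: nz; exists x => //; split => //=; rewrite /preimage/= xz.
have nu0 N : measurable N -> m.-negligible (N `&` a) -> nu N = 0%E.
  move=> mN Na; rewrite (nuP N set0)// ?measure0//.
  rewrite /eq_mod0 setY0; case: Tinv => _ _; apply => //.
have m0 N : measurable N -> (\int[nu]_(x in N) (g x)%:E = 0)%E -> m (N `&` A) = 0%E.
  move=> mN gN; apply: measure_negligible; first exact: measurableI.
  exists (N `&` a); split; first exact: measurableI.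
    exact: (eq_trans (mE _ mN) gN).
  by move=> x [Nx Ax]; split => //; exact: Aa.
have eqA : ae_eq nu A (EFin \o g) (EFin \o (G \o T)).
  apply: integral_ae_eq => //.
  - apply/integrableP; split; first exact/measurable_EFinP/measurable_funTS.
    under eq_integral do rewrite /= ger0_norm//.
    by rewrite -mE// ltey_eq fin_num_measure//; exact: measurableI.
  - apply/measurable_EFinP/measurable_funTS.
    by apply: measurableT_comp => //; exact: integ_meas iG.
  move=> E EA mE'.
  have [B' mB' hB'] := branch_separated mE' EA.
  pose B := B' `&` I; have mB : measurable B by exact: measurableI.
  have hB : {ae m, forall x, A x -> (E x <-> B (T x))}.
    apply: filterS2 hB' branch_into => x h1 h2 Ax; have := h1 Ax; have := h2 (Aa Ax).
    by rewrite /B/setI/=; tauto.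
  have mTB : measurable (T @^-1` B) by exact: (preimage_meas hT).
  have hEB : m.-negligible ((E `+` (T @^-1` B)) `&` a).
    apply: negligibleS (negligibleU hB branch_negl_aA) => x [h ax].
    have [Ax|nAx] := pselect (A x); [left|by right].
    by move=> /= /(_ Ax); case: h => -[/= h1 h2]; tauto.
  transitivity (m E).
    rewrite -mE//; congr (m _); apply/setIidl; exact: subset_trans EA Aa.
  transitivity (\int[nu]_(x in T @^-1` B) (G (T x))%:E)%E; last first.
    apply: ge0_integral_mod0 => //.
    - by apply/measurable_EFinP; apply: measurableT_comp => //; exact: integ_meas iG.
    - by move=> x; rewrite lee_fin.
    - apply: nu0; first exact: measurableD.
      by apply: negligibleS hEB; apply: setSI => x; right.
    - apply: nu0; first exact: measurableD.
      by apply: negligibleS hEB; apply: setSI => x; left.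
  rewrite -(ge0_integral_pushforward mT nu (f := EFin \o G) mB); last 2 first.
  - by apply/measurable_EFinP/measurable_funTS; exact: integ_meas iG.
  - by move=> x _; rewrite lee_fin.
  rewrite (eq_measure_integral m); last first.
    by move=> F mF FB; apply: nuE => //; apply: subset_trans FB _ => x [].
  have -> : (\int[m]_(y in B) (EFin \o G) y = (dens m G B)%:E)%E.
    by rewrite /dens /Rintegral fineK// integrable_fin_num//; exact: integS.
  rewrite G_dens// mr_fin; last exact: measurableI.
  have EAB : m.-negligible (E `+` (A `&` T @^-1` B)).
    apply: negligibleS hB => x [[/= Ex nAB]|[[/= Ax Bx] nE]] h.
      by apply: nAB; split; [exact: EA|apply/(h (EA _ Ex))].
    by apply: nE; apply/(h Ax).
  have mAB : measurable (A `&` T @^-1` B) by exact: measurableI.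
  rewrite -[LHS](mr_fin m mE') -[RHS](mr_fin m mAB); congr EFin.
  rewrite (mrID m mE' mAB) [RHS](mrID m mAB mE') setIC; congr (_ + _).
  rewrite !mr_negligible//; try exact: measurableD.
  - by apply: negligibleS EAB => x; right.
  - by apply: negligibleS EAB => x; left.
have ae1 : {ae m, forall x, A x -> g x = G (T x)}.
  case: eqA => N [mN N0 hN]; exists (N `&` A); split; first exact: measurableI.
    apply: m0 => //; apply: null_set_integral => //.
    exact/measurable_EFinP/measurable_funTS.
  move=> x /= /not_implyP[Ax h]; split => //; apply: hN => /= /(_ Ax).
  by move=> -[].
have ae2 : {ae m, forall x, A x -> 0 < g x}.
  have mN : measurable (g @^-1` [set 0]).
    by rewrite -[X in measurable X]setTI; exact: mg.
  exists ((g @^-1` [set 0]) `&` A); split; first exact: measurableI.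
    by apply: m0 => //; rewrite integral0_eq// => x ->.
  move=> x /= /not_implyP[Ax h]; split => //; apply/eqP; move/negP: h.
  by rewrite lt0r g0 andbT negbK.
by apply: filterS2 ae1 ae2 => x h1 h2 Ax; split; [exact: h1|exact: h2].
Qed.

Lemma branch_distortion :
  {ae (m \x m)%E, forall xy : X * X, a xy.1 -> a xy.2 ->
     `|1 - g xy.1 / g xy.2| <= C0 * mdist (T xy.1) (T xy.2)} ->
  {ae (m \x m)%E, forall zz : X * X, I zz.1 -> I zz.2 ->
     `|G zz.1 - G zz.2| <= `|C0| * mdist zz.1 zz.2 * G zz.2}.
Proof.
move=> hg.
apply: (@image_ae2 _ _ _ m T A I mA branch_I_meas (@branch_image) branch_separated
  (fun z z' => `|G z - G z'| <= `|C0| * mdist z z' * G z')).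
have j := branch_jacobian.
apply: filterS3 hg (ae_prod_left j) (ae_prod_right j) => -[x y] /= h h1 h2 Ax Ay.
have [<- _] := h1 Ax; have [<- gy] := h2 Ay.
have -> : g x - g y = - ((1 - g x / g y) * g y).
  by rewrite mulrBl mul1r divfK ?gt_eqF// opprB.
rewrite normrN normrM (ger0_norm (ltW gy)) ler_wpM2r ?(ltW gy)//.
apply: (le_trans (h (Aa Ax) (Aa Ay))).
by rewrite ler_wpM2r ?mdist_ge0// ler_norm.
Qed.

End distortion.

End branch.

Section coding_of_gibbs_markov.
Context {R : realType} {d : measure_display} {X : metricMeasurableType R d}.
Variables (m : probability X R) (T : X -> X) (alpha : set (set X)).
Hypothesis X_bounded : bounded_metric X.
Hypothesis gm : gibbs_markov m T alpha.

Definition branch_data (a A : set X) (C0 : R) (I : set X) (G : X -> R) : Prop :=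
  [/\ measurable I /\ (alpha a -> eq_mod0 m (T @` a) I),
    (forall b, alpha b -> b `<=` I \/ m.-negligible (b `&` I)) /\
    (forall Q : X -> X -> Prop,
      {ae (m \x m)%E, forall xy : X * X, A xy.1 -> A xy.2 -> Q (T xy.1) (T xy.2)} ->
      {ae (m \x m)%E, forall zz : X * X, I zz.1 -> I zz.2 -> Q zz.1 zz.2}),
    {ae m, forall x, A x -> I (T x)} /\
    (forall E, measurable E -> E `<=` A ->
      exists2 B, measurable B & {ae m, forall x, A x -> (E x <-> B (T x))}),
    [/\ integ m G, forall x, 0 <= G x,
      forall E, measurable E -> dens m G E = mr m (A `&` T @^-1` E) &
      forall x, ~ I x -> G x = 0] &
    {ae (m \x m)%E, forall zz : X * X, I zz.1 -> I zz.2 ->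
     `|G zz.1 - G zz.2| <= `|C0| * mdist zz.1 zz.2 * G zz.2}].

Lemma gibbs_markov_branch (a A : set X) (C0 : R) : alpha a -> measurable A ->
  A `<=` a -> mr m (a `\` A) = 0 ->
  (exists2 g : X -> R, inverse_jacobian m T a g &
      {ae (m \x m)%E, forall xy : X * X, a xy.1 -> a xy.2 ->
         `|1 - g xy.1 / g xy.2| <= C0 * mdist (T xy.1) (T xy.2)}) ->
  exists I G, branch_data a A C0 I G.
Proof.
move=> aa mA Aa aA [g gjac gdist].
have [[beta ba image_a] Tinv] := gm_markov gm aa.
have hT := gm_preserving gm; have pal := gm_partition gm.
have [G [iG G0 GE Goff]] := branch_density hT pal mA Aa ba image_a.
exists (\bigcup_(b in beta) b), G; split => //.
- by split => //; exact: (branch_I_meas pal ba).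
- split; first exact: (branch_markov pal ba).
  move=> Q; apply: (@image_ae2 _ _ _ m T A _ mA (branch_I_meas pal ba)).
    exact: (branch_image pal aa mA aA image_a Tinv).
  exact: (branch_separated hT Aa Tinv).
- split; last exact: (branch_separated hT Aa Tinv).
  by apply: filterS (branch_into hT image_a) => x h /Aa.
- exact: (branch_distortion hT pal aa mA Aa aA ba image_a Tinv iG G0 GE gjac gdist).
Qed.

Lemma gibbs_markov_coding : exists (e A I : nat -> set X) (G : nat -> X -> R) (gam D C : R),
  markov_coding m T A I G gam D C /\
  [/\ forall i, e i = set0 \/ alpha (e i), forall i, A i `<=` e i,
      forall i, mr m (e i `\` A i) = 0 & forall a, alpha a -> exists i, e i = a].
Proof.
have hT := gm_preserving gm; have pal := gm_partition gm.
have [e [A [ealpha enum_e hA tA cA]]] := partition_seq pal.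
have [gam gam01 hexp] := gm_expansion gm.
have [C0 hdist] := gm_distortion gm.
have [M hM] := X_bounded.
have /choice[IG hIG] i : exists p, branch_data (e i) (A i) C0 p.1 p.2.
  have [mAi Aei eAi] := hA i.
  have [ei|aei] := pselect (alpha (e i)).
    have [I [G h]] := gibbs_markov_branch ei mAi Aei eAi (hdist _ ei).
    by exists (I, G).
  have Ai0 : A i = set0.
    by case: (ealpha i) => // ei; apply/seteqP; split => // x /Aei; rewrite ei.
  exists (set0, fun=> 0); split => //=.
  - split; first by move=> b bb; right; rewrite setI0; exact: negligible_set0.
    by move=> Q _; exact: aeW.
  - split; first by rewrite Ai0; exact: aeW.
    by move=> E mE EA; exists set0 => //; rewrite Ai0; exact: aeW.
  - split => //; first exact: integ_cst.
    by move=> E mE; rewrite dens_cst// mul0r Ai0 set0I mr_set0.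
  - exact: aeW.
exists e, A, (fun i => (IG i).1), (fun i => (IG i).2), gam, (Num.max M 1), `|C0|.
split; last by split => // i; case: (hA i).
split => //.
- by rewrite le_max lexx orbT.
- by move=> x y; rewrite le_max hM.
- by move=> i; case: (hA i).
- by move=> i; case: (hIG i) => -[].
- move=> i j; have [mAj Aej eAj] := hA j; have [[mI _] [h _] _ _ _] := hIG i.
  case: (ealpha j) => [ej|/h[jI|jI]].
  - left; rewrite (_ : A j = set0) ?set0D ?mr_set0//.
    by apply/seteqP; split => // x /Aej; rewrite ej.
  - left; rewrite (_ : _ `\` _ = set0) ?mr_set0//.
    by apply/seteqP; split => // x [/Aej/jI].
  - right; apply: mr_negligible; first exact: measurableI.
    by apply: negligibleS jI; exact: setSI.
- by move=> i; case: (hIG i) => _ [].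
- by move=> i; case: (hIG i) => _ _ [].
- by move=> i; case: (hIG i) => _ _ [].
- by move=> i; case: (hIG i) => _ _ _ [].
- by move=> i; case: (hIG i) => _ _ _ [].
- by move=> i; case: (hIG i) => _ _ _ [].
- by move=> i; case: (hIG i) => _ _ _ [].
- by move=> i; case: (hIG i).
- move=> i; have [_ Aei _] := hA i; case: (ealpha i) => [ei|aei].
    by apply: aeW => xy /Aei; rewrite ei.
  apply: filterS (hexp _ aei) => xy h /Aei Ax /Aei Ay.
  have /andP[g0 _] := gam01.
  by rewrite -ler_pdivrMl// h.
- have [F [finF Falpha hF]] := gm_big_image_preimage gm.
  have [s sF] : exists s : seq (set X), F = [set` s] by apply/finite_seqP.
  have /choice[idx hidx] a : exists i, alpha a -> e i = a.
    have [/enum_e[i ei]|na] := pselect (alpha a); [by exists i|by exists 0].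
  exists (map idx s) => i Ai0.
  have [mAi Aei eAi] := hA i.
  have aei : alpha (e i).
    case: (ealpha i) => // ei; move: Ai0; rewrite (_ : A i = set0) ?mr_set0 ?ltxx//.
    by apply/seteqP; split => // x /Aei; rewrite ei.
  have [b [c [Fb Fc ib ci]]] := hF _ aei.
  have [ab ac] := (Falpha _ Fb, Falpha _ Fc).
  have pos a : alpha a -> 0 < mr m (A (idx a)).
    move=> aa; have [mAa Aea eAa] := hA (idx a).
    have [ma a0] : measurable a /\ (0 < m a)%E by case: pal => h _ _; exact: h.
    rewrite hidx// in Aea eAa.
    by rewrite -(setIidr Aea) mr_mod0// mr_gt0.
  exists (idx b), (idx c); split => //.
  - by apply: map_f; move: Fb; rewrite sF.
  - by apply: map_f; move: Fc; rewrite sF.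
  - exact: pos.
  - exact: pos.
  - have [mAc Aec eAc] := hA (idx c).
    have [[mIb hIb] _ _ _ _] := hIG (idx b); have [[mIi hIi] _ _ _ _] := hIG i.
    rewrite (hidx b)// in hIb; rewrite (hidx c)// in Aec; have {}hIb := hIb ab; have {}hIi := hIi aei.
    split; apply: mr_negligible; try exact: measurableD.
    + apply: negligibleS (negligibleU ib hIb) => x [/Aei ex nI].
      have [h|h] := pselect ((T @` b) x); last by left.
      by right; left.
    + apply: negligibleS (negligibleU ci hIi) => x [/Aec cx nI].
      have [h|h] := pselect ((T @` e i) x); last by left.
      by right; left.
Qed.

End coding_of_gibbs_markov.

(** * The transfer operator and bounded distortion *)

Section transfer_operator.
Context {d : measure_display} {X : measurableType d} {R : realType}.
Variables (m : probability X R).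
Implicit Types (u v w : X -> R) (A B E : set X).

Lemma integ_ae_eq u v : measurable_fun setT u -> integ m v ->
  {ae m, forall x, u x = v x} -> integ m u.
Proof.
move=> mu iv uv; apply/integrableP; split; first exact/measurable_EFinP.
have /integrableP[_] := iv; congr (_ < _)%E; apply: ae_eq_integral => //.
- by apply: measurableT_comp => //; apply/measurable_EFinP; exact: integ_meas iv.
- by apply: measurableT_comp => //; exact/measurable_EFinP.
- by apply: filterS uv => x /= -> _.
Qed.

Definition truncate (M : R) v x := Num.max (- M) (Num.min (v x) M).

Lemma truncate_meas M v : measurable_fun setT v -> measurable_fun setT (truncate M v).
Proof. by move=> mv; apply: measurable_maxr => //; exact: measurable_minr. Qed.

Lemma truncate_le M v x : 0 <= M -> `|truncate M v x| <= M.
Proof.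
move=> M0; rewrite /truncate ler_norml le_max lexx /= ge_max ge_min lexx orbT andbT.
by rewrite (le_trans _ M0)// oppr_le0.
Qed.

Lemma truncate_id M v x : `|v x| <= M -> truncate M v x = v x.
Proof.
by rewrite ler_norml /truncate => /andP[h1 h2]; rewrite min_l// max_r.
Qed.

Lemma ae_bound_ge0 v (M : R) : {ae m, forall x, `|v x| <= M} -> 0 <= M.
Proof.
move=> vM; have [|x _ vx] := ae_exists (A := setT) measurableT _ vM.
  by rewrite mrT ltr01.
exact: le_trans (normr_ge0 _) vx.
Qed.

Lemma integM_ae_bounded u v (M : R) : measurable_fun setT v ->
  {ae m, forall x, `|v x| <= M} -> integ m u -> integ m (fun x => v x * u x).
Proof.
move=> mv vM iu; have M0 := ae_bound_ge0 vM.
apply: (@integ_ae_eq _ (fun x => truncate M v x * u x)).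
- by apply: measurable_funM => //; exact: integ_meas iu.
- apply: (@integM_bounded _ _ _ _ _ _ M) => //; first exact: truncate_meas.
  by move=> x; exact: truncate_le.
- by apply: filterS vM => x vx; rewrite truncate_id.
Qed.

Lemma integ_ae_bounded v (M : R) : measurable_fun setT v ->
  {ae m, forall x, `|v x| <= M} -> integ m v.
Proof.
move=> mv vM; apply: (@integ_ae_eq _ (fun x => v x * 1)) => //.
  exact: (integM_ae_bounded mv vM (integ_cst m 1)).
by apply: aeW => x; rewrite mulr1.
Qed.

Lemma dens_ae_eq u v A : measurable A -> integ m u -> integ m v ->
  {ae m, forall x, A x -> u x = v x} -> dens m u A = dens m v A.
Proof.
move=> mA iu iv uv; apply/eqP; rewrite eq_le.
by apply/andP; split; apply: dens_ae_le => //; apply: filterS uv => x h /h ->.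
Qed.

Lemma ae_eq_of_dens u v A : measurable A -> integ m u -> integ m v ->
  (forall E, measurable E -> E `<=` A -> dens m u E = dens m v E) ->
  {ae m, forall x, A x -> u x = v x}.
Proof.
move=> mA iu iv uv.
have := @ae_norm_le_of_dens _ _ _ m (fun x => u x - v x) 0 0 A mA (integB iu iv).
have h E : measurable E -> E `<=` A ->
    `|dens m (fun x => u x - v x) E - 0 * mr m E| <= 0 * mr m E.
  by move=> mE EA; rewrite densB// uv// subrr !mul0r subr0 normr0.
move=> /(_ h); apply: filterS => x /[apply].
by rewrite subr0 normr_le0 subr_eq0 => /eqP.
Qed.

Lemma dens_ae_set u E E' : measurable E -> measurable E' -> integ m u ->
  {ae m, forall x, E x <-> E' x} -> dens m u E = dens m u E'.
Proof.
move=> mE mE' iu EE'; rewrite -(setTI E) -(setTI E') -!dens_indic.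
apply: dens_ae_eq => //; [exact: integ_indic|exact: integ_indic|].
apply: filterS EE' => x hx _; congr (_ * _); rewrite !indicE.
by have -> : (x \in E) = (x \in E') by apply/idP/idP; rewrite !inE => /hx.
Qed.

Lemma dens_cover_le w (F : nat -> set X) B (c : R) : integ m w -> (forall x, 0 <= w x) ->
  measurable B -> (forall i, measurable (F i)) -> trivIset setT F ->
  mr m (~` \bigcup_i F i) = 0 ->
  (forall n, \sum_(i < n) dens m w (B `&` F i) <= c) -> dens m w B <= c.
Proof.
move=> iw w0 mB mF tF F0 hc.
have mU : measurable (\bigcup_i F i) by exact: bigcupT_measurable.
have mBF i : measurable (B `&` F i) by exact: measurableI.
rewrite -(dens_mod0 mB mU iw); last first.
  apply: mr0_le F0 => //; [exact: measurableD|exact: measurableC].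
rewrite setI_bigcupr -lee_fin /dens /Rintegral fineK; last first.
  by apply: integrable_fin_num; [|apply: integS => //]; exact: bigcupT_measurable.
rewrite integral_bigcup//.
- apply: lime_le.
    by apply: is_cvg_nneseries => i _ _; apply: integral_ge0 => x _; rewrite lee_fin.
  apply: nearW => n; rewrite big_mkord.
  rewrite (eq_bigr (fun i : 'I_n => (dens m w (B `&` F i))%:E)) ?sumEFin ?lee_fin; [exact: hc|].
  move=> i _; rewrite /dens /Rintegral fineK//.
  by apply: integrable_fin_num; [|apply: integS].
- by move/trivIsetP : tF => tF; apply/trivIsetP => i j _ _ ij;
    rewrite setIACA setIid tF// setI0.
- by apply: integS => //; exact: bigcupT_measurable.
Qed.

Lemma mr_bigcup_ord n (F : nat -> set X) : (forall i, measurable (F i)) ->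
  trivIset setT F -> mr m (\bigcup_(i in `I_n) F i) = \sum_(i < n) mr m (F i).
Proof.
move=> mF tF; rewrite bigcup_mkord /mr measure_bigsetU//.
by rewrite sum_fine// => i _; exact: fin_num_measure.
Qed.

Variable T : X -> X.
Hypothesis hT : measure_preserving m T.

Lemma transfer_test_ae u w v (M : R) : integ m u -> integ m w ->
  (forall A, measurable A -> dens m w A = dens m u (T @^-1` A)) ->
  measurable_fun setT v -> {ae m, forall x, `|v x| <= M} ->
  dens m (fun x => v x * w x) setT = dens m (fun x => v (T x) * u x) setT.
Proof.
move=> iu iw wu mv vM; have M0 := ae_bound_ge0 vM.
have mt := truncate_meas M mv.
have h := transfer_test hT iu iw wu mt (fun x => truncate_le v x M0).
have vMT := ae_preimage hT vM.
have mvT : measurable_fun setT (v \o T).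
  by apply: measurableT_comp => //; exact: preserving_fun hT.
have mtT : measurable_fun setT (truncate M v \o T).
  by apply: measurableT_comp => //; exact: preserving_fun hT.
rewrite (@dens_ae_eq _ (fun x => truncate M v x * w x)) ?h//.
- apply: dens_ae_eq => //.
  + apply: (@integM_bounded _ _ _ _ _ (truncate M v \o T) M) => // x.
    exact: truncate_le.
  + exact: (integM_ae_bounded mvT vMT).
  + by apply: filterS vMT => x vx _; rewrite truncate_id.
- exact: (integM_ae_bounded mv vM).
- by apply: (@integM_bounded _ _ _ _ _ _ M) => // x; exact: truncate_le.
- by apply: filterS vM => x vx _; rewrite truncate_id.
Qed.

Definition tr u : X -> R := xget (fun=> 0) [set w | integ m w /\
  forall A, measurable A -> dens m w A = dens m u (T @^-1` A)].

Lemma trP u : integ m u -> integ m (tr u) /\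
  forall A, measurable A -> dens m (tr u) A = dens m u (T @^-1` A).
Proof.
move=> iu; rewrite /tr; case: xgetP => [w _ //|].
by have [w iw wu] := transfer_exists hT iu => /(_ w)/= []; split.
Qed.

Lemma tr_integ u : integ m u -> integ m (tr u).
Proof. by move=> /trP[]. Qed.

Lemma tr_dens u A : integ m u -> measurable A ->
  dens m (tr u) A = dens m u (T @^-1` A).
Proof. by move=> /trP[_]; exact. Qed.

Lemma tr_test u v (M : R) : integ m u ->
  measurable_fun setT v -> {ae m, forall x, `|v x| <= M} ->
  dens m (fun x => v x * tr u x) setT = dens m (fun x => v (T x) * u x) setT.
Proof.
move=> iu mv vM; have [it ht] := trP iu; exact: transfer_test_ae ht mv vM.
Qed.

Lemma tr_ae_eq u w : integ m u -> integ m w ->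
  (forall A, measurable A -> dens m w A = dens m u (T @^-1` A)) ->
  {ae m, forall x, tr u x = w x}.
Proof.
move=> iu iw wu; have := @ae_eq_of_dens (tr u) w setT measurableT (tr_integ iu) iw.
have h E : measurable E -> E `<=` setT -> dens m (tr u) E = dens m w E.
  by move=> mE _; rewrite tr_dens// wu.
by move=> /(_ h); apply: filterS => x; exact.
Qed.

Lemma trD u v : integ m u -> integ m v ->
  {ae m, forall x, tr (fun y => u y + v y) x = tr u x + tr v x}.
Proof.
move=> iu iv; have iu' := tr_integ iu; have iv' := tr_integ iv.
apply: tr_ae_eq; [exact: integD|exact: integD|].
move=> A mA; have mTA := preimage_meas hT mA.
by rewrite !densD// !tr_dens.
Qed.

Lemma trZ (c : R) u : integ m u ->
  {ae m, forall x, tr (fun y => c * u y) x = c * tr u x}.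
Proof.
move=> iu; have iu' := tr_integ iu.
apply: tr_ae_eq; [exact: integZ|exact: integZ|].
move=> A mA; have mTA := preimage_meas hT mA.
by rewrite !densZ// tr_dens.
Qed.

Lemma tr_congr u v : integ m u -> integ m v -> {ae m, forall x, u x = v x} ->
  {ae m, forall x, tr u x = tr v x}.
Proof.
move=> iu iv uv; apply: tr_ae_eq => //; first exact: tr_integ.
move=> A mA; rewrite tr_dens//; apply: dens_ae_eq => //; first exact: (preimage_meas hT mA).
by apply: filterS uv => x ->.
Qed.

Lemma tr_bound u (s : R) : integ m u -> {ae m, forall x, `|u x| <= s} ->
  {ae m, forall x, `|tr u x| <= s}.
Proof.
move=> iu us.
have := @ae_norm_le_of_dens _ _ _ m (tr u) 0 s setT measurableT (tr_integ iu).
have h E : measurable E -> E `<=` setT -> `|dens m (tr u) E - 0 * mr m E| <= s * mr m E.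
  move=> mE _; have mTE := preimage_meas hT mE.
  rewrite mul0r subr0 tr_dens// -(mr_preimage hT mE).
  by apply: dens_ae_bound => //; apply: filterS us.
by move=> /(_ h); apply: filterS => x /(_ Logic.I); rewrite subr0.
Qed.

End transfer_operator.

Section cylinders.
Context {R : realType} {d : measure_display} {X : metricMeasurableType R d}.
Variables (m : probability X R) (T : X -> X) (A I : nat -> set X)
  (G : nat -> X -> R) (gam D C : R).
Hypothesis mc : markov_coding m T A I G gam D C.
Implicit Types (E B : set X) (w v : seq nat).

Let hT := mc_preserving mc.
Let mA := mc_A mc.
Let mI := mc_I mc.
Let gam0 : 0 < gam. Proof. by case/andP: (mc_gam mc). Qed.
Let gam1 : gam < 1. Proof. by case/andP: (mc_gam mc). Qed.
Let D0 : 0 <= D. Proof. exact: le_trans ler01 (mc_D mc). Qed.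

Fixpoint cylinder w : set X :=
  if w is i :: w' then A i `&` T @^-1` (cylinder w') else setT.

Lemma cylinder_meas w : measurable (cylinder w).
Proof.
elim: w => [|i w ih] //=; apply: measurableI => //; exact: (preimage_meas hT ih).
Qed.

Lemma iter_preimage_meas n E : measurable E -> measurable (iter n T @^-1` E).
Proof. by move=> mE; apply: (preimage_meas (preserving_iter hT n) mE). Qed.

Lemma iter_preimage_mr n E : measurable E -> mr m (iter n T @^-1` E) = mr m E.
Proof. exact: (mr_preimage (preserving_iter hT n)). Qed.

Lemma preimage_iterS n E : iter n.+1 T @^-1` E = T @^-1` (iter n T @^-1` E).
Proof. by apply/seteqP; split => x; rewrite /preimage /= -iterS iterSr. Qed.

Lemma cylinder_cat w v :
  cylinder (w ++ v) = cylinder w `&` iter (size w) T @^-1` (cylinder v).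
Proof.
elim: w => [|i w ih]; first by rewrite /= setTI.
by rewrite cat_cons [LHS]/= ih preimage_iterS preimage_setI setIA.
Qed.

Lemma cylinder_ae_diam w : {ae m, forall x, {ae m, forall y, cylinder w x ->
  cylinder w y -> mdist x y <= D * gam ^+ size w}}.
Proof.
elim: w => [|i w ih].
  by apply: aeW => x; apply: aeW => y _ _; rewrite expr0 mulr1 (mc_diam mc).
have h1 := ae_prod_iter (mc_expansion mc i).
have h2 := ae_prod_preimage hT ih.
apply: filterS2 h1 h2 => x h1 h2; apply: filterS2 h1 h2 => y h1 h2 /= [Ax wx] [Ay wy].
by rewrite (le_trans (h1 Ax Ay))// exprS mulrCA ler_wpM2l ?(ltW gam0)//; apply: h2.
Qed.

Lemma dens_G_I i E : measurable E -> dens m (G i) (E `&` I i) = dens m (G i) E.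
Proof.
move=> mE; rewrite [RHS](densID mE (mI i) (mc_G_integ mc i)).
rewrite [X in _ = _ + X](@dens_eq _ _ _ m _ (fun=> 0)); last first.
  by move=> x [_ nI]; exact: (mc_G_off mc).
by rewrite dens_cst ?mul0r ?addr0//; exact: measurableD.
Qed.

Lemma branch_null i E : measurable E -> mr m (E `&` I i) = 0 ->
  mr m (A i `&` T @^-1` E) = 0.
Proof.
move=> mE E0; rewrite -(mc_G_dens mc)// -dens_G_I// dens_null//.
  exact: measurableI.
exact: (mc_G_integ mc).
Qed.

Lemma branch_ratio i w E E' : measurable E -> measurable E' ->
  E `<=` cylinder w -> E' `<=` cylinder w ->
  mr m (A i `&` T @^-1` E) * mr m (E' `&` I i) <=
  (1 + C * D * gam ^+ size w) * mr m (A i `&` T @^-1` E') * mr m (E `&` I i).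
Proof.
move=> mE mE' Ew E'w; have iG := mc_G_integ mc i.
have mEI : measurable (E `&` I i) by exact: measurableI.
have mEI' : measurable (E' `&` I i) by exact: measurableI.
rewrite -!(mc_G_dens mc)// -(dens_G_I i mE) -(dens_G_I i mE').
set kap := 1 + _; set e' := mr m (E' `&` I i).
have hd := ae_prod_iter (mc_distortion mc i).
have hw := cylinder_ae_diam w.
have h1 : {ae m, forall x, (E `&` I i) x ->
    G i x * e' <= kap * dens m (G i) (E' `&` I i)}.
  apply: filterS2 hd hw => x hd hw [Ex Ix].
  rewrite -dens_cst// -densZ//; apply: dens_ae_le => //.
  - exact: integ_cst.
  - exact: integZ.
  apply: filterS2 hd hw => y hd hw [E'y Iy].
  have := hd Ix Iy; have := hw (Ew _ Ex) (E'w _ E'y) => /= dxy.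
  rewrite ler_norml => /andP[_]; rewrite lerBlDr => /le_trans; apply.
  rewrite /kap mulrDl mul1r addrC lerD2l ler_wpM2r ?(mc_G_ge0 mc)//.
  by rewrite -mulrA ler_wpM2l ?(mc_C mc).
have h2 : dens m (fun x => e' * G i x) (E `&` I i) <=
          dens m (fun=> kap * dens m (G i) (E' `&` I i)) (E `&` I i).
  apply: dens_ae_le => //; [exact: integZ|exact: integ_cst|].
  by apply: filterS h1 => x; rewrite mulrC.
by move: h2; rewrite densZ// dens_cst// mulrC.
Qed.

Lemma image_lower : exists2 rho : R, 0 < rho &
  forall i, 0 < mr m (A i) -> rho <= mr m (I i).
Proof.
have [F hF] := mc_bip mc.
have [rho rho0 h] : exists2 rho : R, 0 < rho &
    forall c, c \in F -> 0 < mr m (A c) -> rho <= mr m (A c).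
  elim: F {hF} => [|c F [rho rho0 ih]]; first by exists 1.
  have [c0|c0] := ltP 0 (mr m (A c)).
    exists (Num.min rho (mr m (A c))); first by rewrite lt_min rho0.
    move=> b; rewrite in_cons => /orP[/eqP->|bF] b0.
      by rewrite ge_min lexx orbT.
    by rewrite ge_min ih.
  exists rho => // b; rewrite in_cons => /orP[/eqP->|]; last exact: ih.
  by rewrite ltNge c0.
exists rho => // i /hF[b [c [_ cF _ c0 [_ cI]]]].
apply: (le_trans (h c cF c0)); rewrite -(mr_mod0 (mA c) (mI i) cI).
by apply: mr_le => //; exact: measurableI.
Qed.

Lemma branch_upper : exists2 K1 : R, 0 < K1 & forall i E, measurable E ->
  mr m (A i `&` T @^-1` E) <= K1 * mr m (A i) * mr m E.
Proof.
have [rho rho0 hrho] := image_lower.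
have CD : 0 < 1 + C * D by rewrite ltr_wpDr// mulr_ge0// (mc_C mc).
exists ((1 + C * D) / rho); first by rewrite divr_gt0.
move=> i E mE.
have mTE : measurable (A i `&` T @^-1` E).
  by apply: measurableI => //; exact: (preimage_meas hT mE).
have [Ai0|Ai0] := ltP 0 (mr m (A i)); last first.
  rewrite (_ : mr m (_ `&` _) = 0); last first.
    apply: (mr0_le mTE (mA i)) => //.
    by apply/eqP; rewrite eq_le Ai0 mr_ge0.
  by rewrite !mulr_ge0// ?mr_ge0// ?invr_ge0 ?ltW.
have := branch_ratio (w := [::]) i mE measurableT (fun x _ => Logic.I) (fun x _ => Logic.I).
rewrite setTI preimage_setT setIT expr0 mulr1 => h.
rewrite -(ler_pM2r rho0).
have -> : (1 + C * D) / rho * mr m (A i) * mr m E * rho = (1 + C * D) * mr m (A i) * mr m E.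
  by field; rewrite gt_eqF.
apply: (@le_trans _ _ (mr m (A i `&` T @^-1` E) * mr m (I i))).
  by rewrite ler_wpM2l ?mr_ge0// hrho.
apply: (le_trans h); rewrite ler_wpM2l ?mulr_ge0 ?mr_ge0 ?(ltW CD)//.
by apply: mr_le => //; exact: measurableI.
Qed.

Let distortion_prod n : R := \prod_(j < n) (1 + C * D * gam ^+ j).

Let distortion_prodS n :
  distortion_prod n.+1 = distortion_prod n * (1 + C * D * gam ^+ n).
Proof. by rewrite /distortion_prod big_ord_recr. Qed.

Let distortion_factor_ge0 n : 0 <= 1 + C * D * gam ^+ n.
Proof. by rewrite addr_ge0// mulr_ge0// ?exprn_ge0 ?(ltW gam0)// mulr_ge0// (mc_C mc). Qed.

Let distortion_prod_ge0 n : 0 <= distortion_prod n.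
Proof. exact: prodr_ge0. Qed.

Lemma cylinder_ratio i w E E' : measurable E -> measurable E' ->
  mr m (cylinder (i :: w) `&` iter (size w).+1 T @^-1` E) * mr m (E' `&` I (last i w)) <=
  distortion_prod (size w).+1 *
  mr m (cylinder (i :: w) `&` iter (size w).+1 T @^-1` E') * mr m (E `&` I (last i w)).
Proof.
move=> mE mE'; elim: w i => [|j w ih] i.
  rewrite /distortion_prod big_ord_recl big_ord0 mulr1 [cylinder _]/= preimage_setT setIT.
  exact: (@branch_ratio i [::]).
rewrite [last i _]/=; have {}ih := ih j.
set s := mr m (E `&` _) in ih *; set s' := mr m (E' `&` _) in ih *.
rewrite [size (j :: w)]/= distortion_prodS.
have P0 := distortion_prod_ge0 (size w).+1.
set P := distortion_prod _ in ih P0 *.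
pose F B := cylinder (j :: w) `&` iter (size w).+1 T @^-1` B.
have cF B : cylinder [:: i, j & w] `&` iter (size w).+2 T @^-1` B =
    A i `&` T @^-1` F B.
  by rewrite preimage_iterS -setIA -preimage_setI.
rewrite !cF; rewrite -/(F E) -/(F E') in ih.
have mF B : measurable B -> measurable (F B).
  by move=> mB; apply: measurableI; [exact: cylinder_meas|exact: iter_preimage_meas].
have Fj B : F B `<=` A j by move=> x [[]].
have Fw B : F B `<=` cylinder (j :: w) by move=> x [].
have h1 := @branch_ratio i (j :: w) _ _ (mF _ mE) (mF _ mE') (Fw _) (Fw _).
have kap0 := distortion_factor_ge0 (size w).+1.
rewrite [size (j :: w)]/= in h1.
set kap := 1 + _ in h1 kap0 *.
set a := mr m (A i `&` T @^-1` F E) in h1 *.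
set a' := mr m (A i `&` T @^-1` F E') in h1 *.
have a0 : 0 <= a by exact: mr_ge0.
have a0' : 0 <= a' by exact: mr_ge0.
have s0 : 0 <= s by exact: mr_ge0.
have s0' : 0 <= s' by exact: mr_ge0.
case: (mc_markov mc i j) => [ji|ji]; last first.
  have -> : a = 0.
    apply: branch_null; first exact: mF.
    apply: (mr0_le _ _ _ ji); [|exact: measurableI|exact: setSI].
    by apply: measurableI => //; exact: mF.
  by rewrite mul0r !mulr_ge0.
have FI B : measurable B -> mr m (F B `&` I i) = mr m (F B).
  move=> mB; apply: mr_mod0 => //; first exact: mF.
  apply: (mr0_le _ _ _ ji); [|exact: measurableD|exact: setSD].
  by apply: measurableD => //; exact: mF.
rewrite !FI// in h1.
set e := mr m (F E) in h1 ih *; set e' := mr m (F E') in h1 ih *.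
have e0 : 0 <= e by exact: mr_ge0.
have [e'0|e'0] := ltP 0 e'.
  rewrite -(ler_pM2r e'0).
  apply: (@le_trans _ _ (kap * a' * (e * s'))).
    by rewrite mulrAC mulrA ler_wpM2r.
  apply: (@le_trans _ _ (kap * a' * (P * e' * s))).
    by rewrite ler_wpM2l// mulr_ge0.
  by rewrite le_eqVlt; apply/orP; left; apply/eqP; ring.
have {}e'0 : e' = 0 by apply/eqP; rewrite eq_le e'0 mr_ge0.
rewrite e'0 mulr0 mul0r in ih.
have : e * s' = 0 by apply/eqP; rewrite eq_le ih mulr_ge0.
move/eqP; rewrite mulf_eq0 => /orP[/eqP e00|/eqP ->]; last first.
  by rewrite mulr0 !mulr_ge0.
have -> : a = 0.
  apply: branch_null; first exact: mF.
  by rewrite FI.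
by rewrite mul0r !mulr_ge0.
Qed.

Lemma cylinder_lower : exists2 c : R, 0 < c & forall i w E, measurable E ->
  c * mr m (cylinder (i :: w)) * mr m (E `&` I (last i w)) <=
  mr m (cylinder (i :: w) `&` iter (size w).+1 T @^-1` E).
Proof.
have CD : 0 <= C * D by rewrite mulr_ge0// (mc_C mc).
have g1 : 0 < 1 - gam by rewrite subr_gt0.
pose K := expR (C * D / (1 - gam)).
exists K^-1; first by rewrite invr_gt0 expR_gt0.
move=> i w E mE.
have := cylinder_ratio i w measurableT mE.
rewrite preimage_setT setIT setTI.
have mI1 := mr_le1 m (mI (last i w)).
have a'0 := mr_ge0 m (cylinder (i :: w) `&` iter (size w).+1 T @^-1` E).
set P := distortion_prod _; set a := mr m (cylinder _).
set s := mr m (E `&` I _); set a' := mr m (_ `&` _) in a'0 *.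
have PK : P <= K.
  have h n : distortion_prod n <= expR (C * D * \sum_(j < n) gam ^+ j).
    rewrite /distortion_prod; elim: n => [|n ih].
      by rewrite !big_ord0 mulr0 expR0.
    rewrite !big_ord_recr/= [X in expR X]mulrDr expRD ler_pM//; first exact: distortion_prod_ge0.
    exact: expR_ge1Dx.
  apply: (le_trans (h _)); rewrite ler_expR ler_wpM2l// -[leRHS]mul1r ler_pdivlMr//.
  by rewrite mulrC -opprB mulNr -subrX1 opprB lerBlDr lerDl exprn_ge0// ltW.
move=> h; rewrite -mulrA ler_pdivrMl ?expR_gt0//; apply: (le_trans h).
apply: (@le_trans _ _ (P * a')).
  by rewrite -[leRHS]mulr1 ler_wpM2l// mulr_ge0// distortion_prod_ge0.
by rewrite ler_wpM2r.
Qed.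

End cylinders.

Lemma seq_pos_lower (R : realType) (I : eqType) (s : seq I) (f : I -> R) :
  exists2 kap : R, 0 < kap & forall x, x \in s -> 0 < f x -> kap <= f x.
Proof.
elim: s => [|c s [kap kap0 ih]]; first by exists 1.
have [c0|c0] := ltP 0 (f c).
  exists (Num.min kap (f c)); first by rewrite lt_min kap0.
  move=> b; rewrite in_cons => /orP[/eqP->|bF] b0; first by rewrite ge_min lexx orbT.
  by rewrite ge_min ih.
exists kap => // b; rewrite in_cons => /orP[/eqP->|]; last exact: ih.
by rewrite ltNge c0.
Qed.

(** * Doeblin minorization for the lazy operator *)

Section lazy_operator.
Context {d : measure_display} {X : measurableType d} {R : realType}.
Variables (m : probability X R) (T : X -> X).
Hypothesis hT : measure_preserving m T.

Definition lazy (u : X -> R) : X -> R := fun x => 2^-1 * (u x + tr m T u x).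

Fixpoint lazy_set N (mu : set X -> R) (E : set X) : R :=
  if N is N'.+1 then 2^-1 * (lazy_set N' mu E + lazy_set N' mu (T @^-1` E)) else mu E.

Lemma lazy_integ u : integ m u -> integ m (lazy u).
Proof. by move=> iu; apply: integZ; apply: integD => //; exact: (tr_integ hT). Qed.

Lemma lazy_dens u A : integ m u -> measurable A ->
  dens m (lazy u) A = 2^-1 * (dens m u A + dens m u (T @^-1` A)).
Proof.
move=> iu mA; have it := tr_integ hT iu.
by rewrite densZ ?densD ?(tr_dens hT)//; exact: integD.
Qed.

Lemma iter_lazy_integ N u : integ m u -> integ m (iter N lazy u).
Proof. by move=> iu; elim: N => [//|N ih] /=; exact: lazy_integ. Qed.

Lemma iter_lazy_dens N u A : integ m u -> measurable A ->
  dens m (iter N lazy u) A = lazy_set N (dens m u) A.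
Proof.
move=> iu; elim: N A => [//|N ih] A mA /=.
rewrite lazy_dens ?ih//; first exact: (preimage_meas hT mA).
exact: iter_lazy_integ.
Qed.

Lemma lazy_set_ge0 N mu E : (forall B, 0 <= mu B) -> 0 <= lazy_set N mu E.
Proof.
by move=> h; elim: N E => [//|N ih] E /=; rewrite mulr_ge0// addr_ge0.
Qed.

Lemma lazy_set_lower N q mu E : (forall B, 0 <= mu B) -> (q <= N)%N ->
  (2^-1) ^+ N * mu (iter q T @^-1` E) <= lazy_set N mu E.
Proof.
move=> h; elim: N q E => [|N ih] q E.
  by rewrite leqn0 => /eqP -> /=; rewrite expr0 mul1r.
case: q => [_|q qN]; rewrite [lazy_set _ _ _]/= exprS -mulrA ler_wpM2l//.
  by rewrite (le_trans (ih 0 E _))// lerDl lazy_set_ge0.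
by rewrite (le_trans (ih q (T @^-1` E) _))// lerDr lazy_set_ge0.
Qed.

Lemma lazy_set_comb N (a b : R) (mu nu : set X -> R) E :
  lazy_set N (fun B => a * mu B + b * nu B) E = a * lazy_set N mu E + b * lazy_set N nu E.
Proof. by elim: N E => [//|N ih] E /=; rewrite !ih; ring. Qed.

Lemma lazy_set_le N mu nu E : measurable E ->
  (forall B, measurable B -> mu B <= nu B) -> lazy_set N mu E <= lazy_set N nu E.
Proof.
move=> mE h; elim: N E mE => [E|N ih E mE] /=; first exact: h.
by rewrite ler_wpM2l// lerD ?ih//; exact: (preimage_meas hT).
Qed.

End lazy_operator.

Section components.
Context {R : realType} {d : measure_display} {X : metricMeasurableType R d}.
Variables (m : probability X R) (T : X -> X) (A I : nat -> set X)
  (G : nat -> X -> R) (gam D C : R).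
Hypothesis mc : markov_coding m T A I G gam D C.
Implicit Types (E B : set X) (w v : seq nat).

Let hT := mc_preserving mc.
Let mA := mc_A mc.
Let mI := mc_I mc.
Local Notation cylinder := (cylinder T A).

Definition reach i j := exists2 w, 0 < mr m (cylinder (i :: w)) & last i w = j.

Lemma cylinder_head i w : cylinder (i :: w) `<=` A i.
Proof. by move=> x []. Qed.

Lemma cylinder_last i w : cylinder (i :: w) `<=` iter (size w) T @^-1` A (last i w).
Proof.
rewrite lastI -cats1 cylinder_cat size_belast => x [_ [Ax _]]; exact: Ax.
Qed.

Lemma cylinder1 i : cylinder [:: i] = A i.
Proof. by rewrite /= preimage_setT setIT. Qed.

Lemma reach_pos i j : reach i j -> 0 < mr m (A i) /\ 0 < mr m (A j).
Proof.
move=> [w w0 <-]; have mw := cylinder_meas mc (i :: w); split.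
  by apply: (lt_le_trans w0); apply: mr_le => //; exact: cylinder_head.
apply: (lt_le_trans w0); rewrite -(iter_preimage_mr mc (size w) (mA _)).
by apply: mr_le => //; [exact: (iter_preimage_meas mc)|exact: cylinder_last].
Qed.

Lemma reach_refl i : 0 < mr m (A i) -> reach i i.
Proof. by move=> i0; exists [::] => //; rewrite cylinder1. Qed.

Lemma cylinder_pos_cat i w v : 0 < mr m (cylinder (i :: w)) ->
  0 < mr m (cylinder v `&` I (last i w)) -> 0 < mr m (cylinder (i :: w ++ v)).
Proof.
move=> w0 v0; have [c c0 h] := cylinder_lower mc.
rewrite -cat_cons cylinder_cat.
apply: lt_le_trans (h i w _ (cylinder_meas mc v)).
by rewrite !mulr_gt0.
Qed.

Lemma reach_step i j : 0 < mr m (A i) -> 0 < mr m (A j `&` I i) -> reach i j.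
Proof.
move=> i0 j0; exists [:: j] => //.
by apply: (@cylinder_pos_cat i [::] [:: j]); rewrite cylinder1.
Qed.

Lemma reach_trans j i l : reach i j -> reach j l -> reach i l.
Proof.
move=> [w w0 wj] [v v0 vl]; exists (w ++ v); last by rewrite last_cat wj.
apply: cylinder_pos_cat => //; rewrite wj lt0r mr_ge0 andbT; apply/eqP => h.
have := branch_null mc (cylinder_meas mc v) h => h'.
by rewrite /= h' ltxx in v0.
Qed.

Definition component i := \bigcup_(j in [set j | reach i j]) A j.

Lemma component_meas i : measurable (component i).
Proof. by exact: countable_union_measurable. Qed.

Lemma component_forward i : mr m (component i `\` T @^-1` component i) = 0.
Proof.
have mY := component_meas i; have mTY := preimage_meas hT mY.
apply: mr_negligible; first exact: measurableD.
have nc : m.-negligible (T @^-1` ~` \bigcup_i A i).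
  apply: (negligible_mr (B := T @^-1` ~` \bigcup_i A i)) => //.
    by apply: (preimage_meas hT); apply: measurableC; exact: bigcupT_measurable.
  rewrite mr_preimage//; first exact: (mc_cover mc).
  by apply: measurableC; exact: bigcupT_measurable.
have n1 : m.-negligible (\bigcup_j \bigcup_(l in [set l | reach i j /\ ~ reach i l])
    (A j `&` T @^-1` A l)).
  apply: negligible_bigcup => j; apply: countable_union_negligible => //.
    move=> l [rij nril].
  have ml : measurable (A j `&` T @^-1` A l).
    by apply: measurableI => //; exact: (preimage_meas hT).
  apply: (negligible_mr ml) => //.
  apply/eqP; rewrite eq_le mr_ge0 andbT leNgt; apply/negP => h0.
  apply: nril; apply: (reach_trans rij).
  by exists [:: l] => //=; rewrite preimage_setT setIT.
apply: negligibleS (negligibleU nc n1) => x [[j rij Ajx] nY].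
have [[l _ Alx]|h] := pselect ((\bigcup_i A i) (T x)); last by left.
right; exists j => //; exists l => //; split => // ril; apply: nY; by exists l.
Qed.

Lemma component_backward i : mr m (T @^-1` component i `\` component i) = 0.
Proof.
have mY := component_meas i; have mTY := preimage_meas hT mY.
have h1 := mrID m mY mTY; have h2 := mrID m mTY mY.
rewrite component_forward addr0 in h1; rewrite (mr_preimage hT mY) setIC -h1 in h2.
by move: h2; lra.
Qed.

Lemma component_ae i : {ae m, forall x, component i x <-> component i (T x)}.
Proof.
have mY := component_meas i; have mTY := preimage_meas hT mY.
have n1 := negligible_mr (measurableD mY mTY) (component_forward i) (@subset_refl _ _).
have n2 := negligible_mr (measurableD mTY mY) (component_backward i) (@subset_refl _ _).
apply: negligibleS (negligibleU n1 n2) => x /= h.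
have [h1|h1] := pselect (component i x); have [h2|h2] := pselect (component i (T x)).
- by exfalso; apply: h.
- by left.
- by right.
- by exfalso; apply: h.
Qed.

Lemma component_ae_iter i n : {ae m, forall x, component i x <-> component i (iter n T x)}.
Proof.
elim: n => [|n ih]; first exact: aeW.
have := ae_preimage (preserving_iter hT n) (component_ae i).
by apply: filterS2 ih => x h1 h2 /=; rewrite h1.
Qed.

Lemma branch_uniq i j x : A i x -> A j x -> i = j.
Proof.
move=> Ai Aj; apply: contrapT => ij.
have /trivIsetP/(_ i j Logic.I Logic.I) := mc_triv mc.
by move/eqP: ij => /[swap] /[apply] h; have : (A i `&` A j) x by []; rewrite h.
Qed.

Lemma reach_sym i j : reach i j -> reach j i.
Proof.
move=> rij; have [i0 j0] := reach_pos rij; case: rij => w w0 wj.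
have [x wx hx] := ae_exists (cylinder_meas mc (i :: w)) w0
  (component_ae_iter j (size w)).
have : component j x.
  apply/hx; exists j; first exact: reach_refl.
  by have := cylinder_last wx; rewrite wj.
move=> [l rjl Alx]; suff -> : i = l by [].
exact: branch_uniq (cylinder_head wx) Alx.
Qed.

Lemma component_eq i j : reach i j -> component i = component j.
Proof.
move=> rij; have rji := reach_sym rij.
by apply/seteqP; split => x [l hl Alx]; exists l => //; apply: reach_trans hl.
Qed.

Lemma component_disjoint i j x : component i x -> component j x ->
  component i = component j.
Proof.
move=> [l ril Al] [l' rjl Al']; rewrite (component_eq ril) (component_eq rjl).
by rewrite (branch_uniq Al Al').
Qed.

Lemma doeblin_branches i : exists (M : nat) (c : R), 0 < c /\
  forall j w a E, reach i j -> reach i a -> measurable E -> E `<=` A a ->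
  exists2 p, (p <= M)%N & c * mr m (cylinder (j :: w)) * mr m E <=
    mr m (cylinder (j :: w) `&` iter ((size w).+1 + p) T @^-1` E).
Proof.
have [c0 c0_gt0 hc0] := cylinder_lower mc.
have [F hF] := mc_bip mc.
have /choice[pth hpth] cb : exists u, reach cb.1 cb.2 ->
    0 < mr m (cylinder (cb.1 :: u)) /\ last cb.1 u = cb.2.
  have [[u u0 ul]|n] := pselect (reach cb.1 cb.2); first by exists u.
  by exists [::] => /n.
pose FF := [seq (c, b) | c <- F, b <- F].
have [kap kap0 hkap] := seq_pos_lower FF (fun cb => mr m (cylinder (cb.1 :: pth cb))).
exists (\max_(cb <- FF) (size (pth cb)).+1), (c0 * c0 * kap).
split; first by rewrite !mulr_gt0.
move=> j w a E rij ria mE Ea.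
have [D0|D0] := ltP 0 (mr m (cylinder (j :: w))); last first.
  exists 0 => //; rewrite (_ : mr m (cylinder (j :: w)) = 0) ?mulr0 ?mul0r ?mr_ge0//.
  by apply/eqP; rewrite eq_le D0 mr_ge0.
set l := last j w.
have ril : reach i l by apply: (reach_trans rij); exists w.
have [_ l0] := reach_pos ril; have [_ a0] := reach_pos ria.
have [_ [c [_ cF _ pc0 [_ cl]]]] := hF _ l0.
have [b [_ [bF _ b0 _ [ab _]]]] := hF _ a0.
have rlc : reach l c by apply: reach_step => //; rewrite mr_mod0.
have rba : reach b a by apply: reach_step => //; rewrite mr_mod0.
have rcb : reach c b.
  apply: (reach_trans (reach_sym (reach_trans ril rlc))).
  exact: reach_trans ria (reach_sym rba).
have cbF : (c, b) \in FF by apply: allpairs_f.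
have [u0 ul] := hpth (c, b) rcb.
have ku := hkap _ cbF u0.
rewrite -[(c, b).1]/c -[(c, b).2]/b in ul; rewrite -[(c, b).1]/c in u0 ku.
exists (size (pth (c, b))).+1.
  exact: (@leq_bigmax_seq _ FF xpredT (fun cb => (size (pth cb)).+1) (c, b)).
set u := pth (c, b) in u0 ul ku *.
pose E2 := cylinder (c :: u) `&` iter (size u).+1 T @^-1` E.
have mE2 : measurable E2.
  by apply: measurableI; [exact: (cylinder_meas mc)|exact: (iter_preimage_meas mc)].
have mD := cylinder_meas mc (j :: w).
have s1 : c0 * kap * mr m E <= mr m E2.
  apply: le_trans (hc0 c u E mE).
  rewrite ul [mr m (E `&` I b)]mr_mod0//; last first.
    apply: (mr0_le _ _ _ ab); [exact: measurableD|exact: measurableD|exact: setSD].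
  by rewrite ler_wpM2r ?mr_ge0// ler_wpM2l// ltW.
have s2 : c0 * mr m (cylinder (j :: w)) * mr m E2 <=
    mr m (cylinder (j :: w) `&` iter (size w).+1 T @^-1` E2).
  apply: le_trans (hc0 j w E2 mE2).
  rewrite [X in _ <= _ * X]mr_mod0//.
  apply: (mr0_le _ _ _ cl); [exact: measurableD|exact: measurableD|].
  by apply: setSD => x [[]].
apply: (@le_trans _ _ (c0 * mr m (cylinder (j :: w)) * mr m E2)).
  rewrite (_ : _ * _ * _ = c0 * mr m (cylinder (j :: w)) * (c0 * kap * mr m E)).
    by rewrite ler_wpM2l// mulr_ge0 ?mr_ge0// ltW.
  by ring.
apply: (le_trans s2); apply: mr_le.
- by apply: measurableI => //; exact: (iter_preimage_meas mc).
- by apply: measurableI => //; exact: (iter_preimage_meas mc).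
- move=> x [Dx [_ Ex]]; split => //; rewrite addnC.
  by change (E (iter ((size u).+1 + (size w).+1) T x)); rewrite iterD.
Qed.

Lemma doeblin i : exists (M : nat) (c : R), 0 < c /\
  forall N j w E, reach i j -> ((size w).+1 + M <= N)%N -> measurable E ->
  c * (2^-1) ^+ N * mr m (cylinder (j :: w)) * mr m (E `&` component i) <=
  lazy_set T N (fun B => mr m (cylinder (j :: w) `&` B)) E.
Proof.
have [M [c [c0 h]]] := doeblin_branches i; exists M, c; split => //.
move=> N j w E rij wMN mE.
set D0 := cylinder (j :: w); have mD0 : measurable D0 by exact: (cylinder_meas mc).
have iD : integ m (\1_D0 : X -> R) by exact: integrable_indic.
have dD B : measurable B -> dens m (\1_D0 : X -> R) B = mr m (D0 `&` B).
  move=> mB; have -> : dens m (\1_D0 : X -> R) B = dens m (fun x => 1 * \1_D0 x) B.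
    by apply: dens_eq => x _; rewrite mul1r.
  by rewrite (dens_indic m (fun=> 1)) dens_cst ?mul1r 1?setIC//; exact: measurableI.
have lE B : measurable B -> dens m (iter N (lazy m T) (\1_D0 : X -> R)) B =
    lazy_set T N (fun B => mr m (D0 `&` B)) B.
  move=> mB; rewrite (iter_lazy_dens hT)//.
  elim: N {wMN} B mB => [|N ih] B mB /=; first exact: dD.
  by rewrite !ih//; exact: (preimage_meas hT).
have iL := iter_lazy_integ hT N iD.
have mY := component_meas i.
pose cc := c * (2^-1) ^+ N * mr m D0.
have cc0 : 0 <= cc by rewrite !mulr_ge0 ?mr_ge0 ?exprn_ge0 ?(ltW c0)// invr_ge0.
suff : 0 <= dens m (fun x => iter N (lazy m T) (\1_D0 : X -> R) x - cc * \1_(component i) x) E.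
  rewrite densB//; last by apply: integZ; exact: integrable_indic.
  rewrite (dens_indic m (fun=> cc)) dens_cst; last exact: measurableI.
  by rewrite lE// subr_ge0.
apply: (dens_pieces_ge0 (F := A)) => //.
- apply: integB => //; apply: integZ; exact: integrable_indic.
- exact: (mc_triv mc).
- exact: (mc_cover mc).
move=> a; have mEa : measurable (E `&` A a) by exact: measurableI.
rewrite densB//; last by apply: integZ; exact: integrable_indic.
rewrite (dens_indic m (fun=> cc)) dens_cst; last exact: measurableI.
rewrite lE// subr_ge0.
have [ria|nria] := pselect (reach i a); last first.
  rewrite (_ : _ `&` component i = set0) ?mr_set0 ?mulr0.
    by apply: lazy_set_ge0 => B; exact: mr_ge0.
  apply/seteqP; split => // x [[_ Ax] [l ril Alx]]; apply: nria.
  by rewrite (branch_uniq Ax Alx).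
have [p pM hp] := h j w a _ rij ria mEa (@subIsetr _ _ _).
have pN : ((size w).+1 + p <= N)%N by rewrite (leq_trans _ wMN)// leq_add2l.
have hm B : 0 <= mr m (D0 `&` B) by exact: mr_ge0.
apply: le_trans (lazy_set_lower T (E `&` A a) hm pN).
rewrite /cc -!mulrA mulrCA ler_wpM2l ?exprn_ge0 ?invr_ge0//.
apply: le_trans hp; rewrite -mulrA ler_wpM2l ?(ltW c0)// ler_wpM2l ?mr_ge0//.
by apply: mr_le => //; exact: measurableI.
Qed.

End components.

(** * Spectral gap on Hoelder functions *)

Section operators.
Context {R : realType} {d : measure_display} {X : metricMeasurableType R d}.
Variables (m : probability X R) (T : X -> X) (A I : nat -> set X)
  (G : nat -> X -> R) (gam D C : R).
Hypothesis mc : markov_coding m T A I G gam D C.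
Variable eta : R.
Hypothesis eta01 : 0 < eta <= 1.
Implicit Types (E B : set X) (w : seq nat) (u v : X -> R).

Let hT := mc_preserving mc.
Let mA := mc_A mc.
Let mI := mc_I mc.
Let gam0 : 0 < gam. Proof. by case/andP: (mc_gam mc). Qed.
Let gam1 : gam < 1. Proof. by case/andP: (mc_gam mc). Qed.
Let D0 : 0 <= D. Proof. exact: le_trans ler01 (mc_D mc). Qed.
Let C0 := mc_C mc.
Let eta0 : 0 < eta. Proof. by case/andP: eta01. Qed.
Local Notation th := (gam `^ eta).

Lemma th_gt0 : 0 < th. Proof. exact: powR_gt0. Qed.

Lemma th_lt1 : th < 1.
Proof.
have <- : 1 `^ eta = 1 :> R by rewrite powR1.
by rewrite gt0_ltr_powR// nnegrE ltW.
Qed.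

Lemma dist_le_powR (x y : X) : mdist x y <= D * mdist x y `^ eta.
Proof.
have /andP[_ eta1] := eta01.
set r := mdist x y; have r0 : 0 <= r by exact: mdist_ge0.
have [r1|r1] := leP r 1; last first.
  rewrite (le_trans (mc_diam mc x y))// ler_peMr// -(powRr0 r) ler_powR// ltW//.
have [->|rn0] := eqVneq r 0; first by rewrite mulr_ge0// powR_ge0.
rewrite (le_trans (ger1_powR _ eta1))//; first by rewrite lt0r rn0 r0.
by rewrite ler_peMl ?powR_ge0// (mc_D mc).
Qed.

Definition branch_tr i v := tr m T (fun x => v x * \1_(A i) x).

Lemma branch_tr_integ i v : integ m v -> integ m (branch_tr i v).
Proof. by move=> iv; apply: (tr_integ hT); exact: integ_indic. Qed.

Lemma branch_tr_dens i v E : integ m v -> measurable E ->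
  dens m (branch_tr i v) E = dens m v (T @^-1` E `&` A i).
Proof. by move=> iv mE; rewrite (tr_dens hT) ?dens_indic//; exact: integ_indic. Qed.

Lemma branch_tr_off i v : integ m v -> {ae m, forall x, ~ I i x -> branch_tr i v x = 0}.
Proof.
move=> iv; have := @ae_eq_of_dens _ _ _ m (branch_tr i v) (fun=> 0) (~` I i)
  (measurableC (mI i)) (branch_tr_integ i iv) (integ_cst m 0).
apply => E mE EI; rewrite branch_tr_dens// dens_cst// mul0r dens_null//.
  by apply: measurableI => //; exact: (preimage_meas hT).
rewrite setIC (branch_null mc)// (_ : E `&` I i = set0) ?mr_set0//.
by apply/seteqP; split => // x [/EI].
Qed.

Lemma G_upper (K1 : R) : (forall i E, measurable E ->
    mr m (A i `&` T @^-1` E) <= K1 * mr m (A i) * mr m E) ->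
  forall i, {ae m, forall x, G i x <= K1 * mr m (A i)}.
Proof.
move=> hK i; have := @ae_le_of_dens _ _ _ m (G i) (K1 * mr m (A i)) setT measurableT
  (mc_G_integ mc i).
have h E : measurable E -> E `<=` setT -> dens m (G i) E <= K1 * mr m (A i) * mr m E.
  by move=> mE _; rewrite (mc_G_dens mc)// hK.
by move=> /(_ h); apply: filterS => x; exact.
Qed.

Lemma G_ae_bounded i : exists M : R, {ae m, forall x, `|G i x| <= M}.
Proof.
have [K1 _ hK] := branch_upper mc; exists (K1 * mr m (A i)).
by apply: filterS (G_upper hK i) => x; rewrite ger0_norm// (mc_G_ge0 mc).
Qed.

(* For [E `<=` A i], [E] is [A i `&` T @^-1` B] modulo null sets, and both
   functions integrate over [E] to [\int_B branch_tr i v * G i]. *)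
Lemma branch_tr_comp i v s : integ m v -> {ae m, forall x, `|v x| <= s} ->
  {ae m, forall x, A i x -> branch_tr i v (T x) = G i (T x) * v x}.
Proof.
move=> iv vs; have ib := branch_tr_integ i iv.
have vsA : {ae m, forall x, `|v x * \1_(A i) x| <= s}.
  have s0 := ae_bound_ge0 vs.
  apply: filterS vs => x vx; rewrite indicE; case: (_ \in _).
    by rewrite mulr1.
  by rewrite mulr0 normr0.
have bs : {ae m, forall x, `|branch_tr i v x| <= s}.
  by apply: (tr_bound hT) => //; exact: integ_indic.
have [M GM] := G_ae_bounded i.
have iG := mc_G_integ mc i.
have i1A : integ m (\1_(A i) : X -> R) by exact: integrable_indic.
have GE B : measurable B -> dens m (G i) B = dens m (\1_(A i) : X -> R) (T @^-1` B).
  move=> mB; have mTB := preimage_meas hT mB.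
  have -> : dens m (\1_(A i) : X -> R) (T @^-1` B) =
      dens m (fun x => 1 * \1_(A i) x) (T @^-1` B).
    by apply: dens_eq => x _; rewrite mul1r.
  rewrite (dens_indic m (fun=> 1)) dens_cst ?mul1r; last exact: measurableI.
  by rewrite (mc_G_dens mc)// setIC.
have ibT := integ_comp hT ib; have iGT := integ_comp hT iG.
have iGv : integ m (fun x => (G i \o T) x * v x).
  apply: (@integM_ae_bounded _ _ _ _ _ _ M) => //; first exact: integ_meas iGT.
  exact: (ae_preimage hT GM).
apply: ae_eq_of_dens => // E mE EA.
have [B mB hB] := mc_separated mc mE EA.
have EB (u : X -> R) : integ m u -> dens m u E =
    dens m (fun x => \1_B (T x) * (u x * \1_(A i) x)) setT.
  move=> iu; have mTB := preimage_meas hT mB.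
  have -> : dens m (fun x => \1_B (T x) * (u x * \1_(A i) x)) setT =
      dens m (fun x => (u x * \1_(A i) x) * \1_(T @^-1` B) x) setT.
    by apply: dens_eq => x _; rewrite mulrC !indicE.
  rewrite dens_indic dens_indic setTI.
  apply: dens_ae_set => //; first exact: measurableI.
  apply: filterS (hB) => x hx; split=> [Ex|[/= BTx Ax]].
    by split; [exact/(hx (EA _ Ex)) | exact: EA].
  exact/hx.
rewrite (EB _ ibT) (EB _ iGv).
have mB1 : measurable_fun setT (fun x => \1_B x * branch_tr i v x).
  by apply: measurable_funM; [exact: measurable_indic|exact: integ_meas ib].
have mB2 : measurable_fun setT (fun x => \1_B x * G i x).
  by apply: measurable_funM; [exact: measurable_indic|exact: integ_meas iG].
have := @tr_test _ _ _ _ _ hT _ (fun x => \1_B x * G i x) M (integ_indic (mA i) iv) mB2.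
have hM : {ae m, forall x, `|\1_B x * G i x| <= M}.
  have M0 := ae_bound_ge0 GM.
  by apply: filterS GM => x Gx; rewrite indicE; case: (_ \in _); rewrite ?mul1r// mul0r normr0.
have hs : {ae m, forall x, `|\1_B x * branch_tr i v x| <= s}.
  have s0 := ae_bound_ge0 vs.
  by apply: filterS bs => x Gx; rewrite indicE; case: (_ \in _); rewrite ?mul1r// mul0r normr0.
move=> /(_ hM) e1.
have e2 := transfer_test_ae hT i1A iG GE mB1 hs.
transitivity (dens m (fun x => \1_B (T x) * branch_tr i v (T x) * \1_(A i) x) setT).
  by apply: dens_eq => x _; rewrite mulrA.
rewrite -e2; transitivity (dens m (fun x => \1_B x * G i x * tr m T (fun x => v x * \1_(A i) x) x) setT).
  by apply: dens_eq => x _; rewrite -!mulrA; congr (_ * _); rewrite mulrC.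
by rewrite e1; apply: dens_eq => x _; rewrite -!mulrA.
Qed.

End operators.

Section holder.
Context {R : realType} {d : measure_display} {X : metricMeasurableType R d}.
Variables (m : probability X R) (T : X -> X) (A I : nat -> set X)
  (G : nat -> X -> R) (gam D C : R).
Hypothesis mc : markov_coding m T A I G gam D C.
Variable eta : R.
Hypothesis eta01 : 0 < eta <= 1.
Variable K1 : R.
Hypothesis K1gt0 : 0 < K1.
Hypothesis K1up : forall i E, measurable E ->
  mr m (A i `&` T @^-1` E) <= K1 * mr m (A i) * mr m E.
Implicit Types (E B : set X) (w : seq nat) (u v h : X -> R).

Let hT := mc_preserving mc.
Let mA := mc_A mc.
Let mI := mc_I mc.
Let gam0 : 0 < gam. Proof. by case/andP: (mc_gam mc). Qed.
Let gam1 : gam < 1. Proof. by case/andP: (mc_gam mc). Qed.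
Let D0 : 0 <= D. Proof. exact: le_trans ler01 (mc_D mc). Qed.
Let C0 := mc_C mc.
Let eta0 : 0 < eta. Proof. by case/andP: eta01. Qed.
Let K10 := ltW K1gt0.
Local Notation m2 := (m \x m)%E.
Local Notation th := (gam `^ eta).
Local Notation branch_tr := (branch_tr m T A).

Lemma tr_sup v (V : nat -> R) (S : R) : integ m v -> (forall i, 0 <= V i) ->
  (forall i, {ae m, forall x, A i x -> `|v x| <= V i}) ->
  (forall n, \sum_(i < n) V i * mr m (A i) <= S) ->
  {ae m, forall x, `|tr m T v x| <= K1 * S}.
Proof.
move=> iv V0 vV hS.
have := @ae_norm_le_of_dens _ _ _ m (tr m T v) 0 (K1 * S) setT measurableT (tr_integ hT iv).
have h E : measurable E -> E `<=` setT -> `|dens m (tr m T v) E - 0 * mr m E| <= K1 * S * mr m E.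
  move=> mE _; have mTE := preimage_meas hT mE.
  have inv := integ_norm iv.
  rewrite mul0r subr0 (tr_dens hT)// (le_trans (dens_norm mTE iv))//.
  apply: (dens_cover_le inv _ mTE mA (mc_triv mc) (mc_cover mc)) => // n.
  apply: (@le_trans _ _ (\sum_(i < n) V i * (K1 * mr m (A i) * mr m E))).
    apply: ler_sum => i _; have mEA : measurable (T @^-1` E `&` A i) by exact: measurableI.
    apply: (@le_trans _ _ (V i * mr m (T @^-1` E `&` A i))); last first.
      by rewrite ler_wpM2l// setIC K1up.
    rewrite -(dens_cst m (V i) mEA); apply: dens_ae_le => //; first exact: integ_cst.
    by apply: filterS (vV i) => x hx [_ /hx].
  rewrite (eq_bigr (fun i : 'I_n => K1 * mr m E * (V i * mr m (A i)))); last by move=> i _; ring.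
  by rewrite -mulr_sumr (mulrAC K1 S) ler_wpM2l ?mulr_ge0 ?mr_ge0; try exact: hS.
move=> /(_ h); apply: filterS => x /(_ Logic.I); by rewrite subr0.
Qed.

Let tail n := ~` \bigcup_(i in `I_n) A i.

Let tail_meas n : measurable (tail n).
Proof. by apply: measurableC; apply: bigcup_measurable => i _. Qed.

Lemma tail_mr_cvg (e : R) : 0 < e -> exists n, mr m (tail n) < e.
Proof.
move=> e0; have c0 : m (\bigcap_n tail n) = 0%E.
  have mc0 : measurable (~` \bigcup_i A i) by exact/measurableC/bigcupT_measurable.
  have -> : \bigcap_n tail n = ~` \bigcup_i A i.
    rewrite setC_bigcup; apply/seteqP; split=> x /= hx.
      by move=> i _ Ax; apply: (hx i.+1 Logic.I); exists i => //=.
    by move=> n _ [i _ Ax]; exact: (hx i Logic.I Ax).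
  by apply/mr0P => //; exact: mc_cover mc.
have h1 : (m (tail 0%N) < +oo)%E by exact: (le_lt_trans (probability_le1 m (tail_meas 0)) (ltry _)).
have h2 : {homo tail : i j / (i <= j)%N >-> (j <= i)%O}.
  move=> i j ij; apply/subsetPset; apply: subsetC => x [k /= ki Ax].
  by exists k => //=; exact: leq_trans ki ij.
have hc := nonincreasing_cvg_mu h1 tail_meas (bigcapT_measurable tail_meas) h2.
have := eq_ind _ (fun l => (m \o tail) n @[n --> \oo] --> l) hc _ c0.
move=> /fine_cvgP[_ /cvgrPdist_lt /(_ _ e0) [N _ /(_ N (leqnn N))]] /=.
by rewrite sub0r normrN ger0_norm ?mr_ge0// => h; exists N.
Qed.

Lemma branch_tail v s n : integ m v -> {ae m, forall x, `|v x| <= s} ->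
  {ae m, forall x, `|tr m T v x - \sum_(i < n) branch_tr i v x| <= K1 * (s * mr m (tail n))}.
Proof.
move=> iv vs; have s0 := ae_bound_ge0 vs.
have iS k : integ m (fun x => \sum_(i < k) v x * \1_(A i) x).
  by apply: integ_sum => i; exact: integ_indic.
have eS k : {ae m, forall x, tr m T (fun y => \sum_(i < k) v y * \1_(A i) y) x =
    \sum_(i < k) branch_tr i v x}.
  apply: (tr_ae_eq hT) => //.
    by apply: integ_sum => i; exact: (branch_tr_integ mc).
  move=> B mB; rewrite !dens_sum//; last 3 first.
  - exact: (preimage_meas hT mB).
  - by move=> i; exact: integ_indic.
  - by move=> i; exact: (branch_tr_integ mc).
  by apply: eq_bigr => i _; rewrite /branch_tr (tr_dens hT)//; exact: integ_indic.
pose v' x := v x - \sum_(i < n) v x * \1_(A i) x.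
have iv' : integ m v' by exact: integB.
have trv' : {ae m, forall x, tr m T v' x = tr m T v x - tr m T (fun y => \sum_(i < n) v y * \1_(A i) y) x}.
  have h := trD hT iv (integZ (-1) (iS n)); have h2 := trZ hT (-1) (iS n).
  have h3 : {ae m, forall x, tr m T v' x = tr m T (fun y => v y + -1 * \sum_(i < n) v y * \1_(A i) y) x}.
    apply: (tr_congr hT) => //; first exact: integD iv (integZ _ (iS n)).
    by apply: nearW => x; rewrite mulN1r.
  by apply: filterS3 h h2 h3 => x -> -> ->; rewrite mulN1r.
pose V i := if (i < n)%N then 0 else s.
have v'E x i : A i x -> v' x = if (i < n)%N then 0 else v x.
  move=> Ax; rewrite /v'; case: ifP => [ltin|/negbT ni].
    rewrite (bigD1 (Ordinal ltin))//= big1 ?addr0.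
      by rewrite indicE mem_set// mulr1 subrr.
    move=> j /eqP ji; rewrite indicE memNset ?mulr0// => Aj; apply: ji.
    by apply/val_inj => /=; exact: (branch_uniq mc Aj Ax).
  rewrite big1 ?subr0// => j _; rewrite indicE memNset ?mulr0// => Aj.
  by move: ni; rewrite -(branch_uniq mc Aj Ax) ltn_ord.
have := @tr_sup v' V (s * mr m (tail n)) iv'.
have V0 i : 0 <= V i by rewrite /V; case: ifP.
have hv' i : {ae m, forall x, A i x -> `|v' x| <= V i}.
  apply: filterS vs => x vx Ax; rewrite (v'E _ _ Ax) /V; case: ifP => //.
  by rewrite normr0.
have hs k : \sum_(i < k) V i * mr m (A i) <= s * mr m (tail n).
  apply: (@le_trans _ _ (\sum_(i < k) s * mr m (A i `&` tail n))).
    apply: ler_sum => i _; rewrite /V; case: ifP => [_|/negbT]; rewrite ?mul0r.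
      by rewrite mulr_ge0// mr_ge0.
    rewrite -leqNgt => ni; rewrite setIidl// => x Ax [j /= jn Aj].
    by move: jn; rewrite (branch_uniq mc Aj Ax) ltnNge ni.
  rewrite -mulr_sumr ler_wpM2l//.
  have -> : \sum_(i < k) mr m (A i `&` tail n) = mr m (\bigcup_(i in `I_k) (A i `&` tail n)).
    rewrite mr_bigcup_ord// => [i|]; first exact: measurableI.
    apply/trivIsetP => i j _ _ ij; rewrite setIACA.
    by move/trivIsetP : (mc_triv mc) => ->//; rewrite set0I.
  apply: mr_le => //; last by move=> x [i _ []].
  by apply: bigcup_measurable => i _; exact: measurableI.
move=> /(_ V0 hv' hs); apply: filterS3 (eS n) trv' => x e1 e2.
by rewrite e2 e1.
Qed.

Lemma branch_G_sum n : {ae m, forall x, \sum_(i < n) G i x <= 1}.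
Proof.
have iS : integ m (fun x => \sum_(i < n) G i x) by apply: integ_sum => i; exact: mc_G_integ mc i.
have := @ae_le_of_dens _ _ _ m _ 1 setT measurableT iS.
have h E : measurable E -> E `<=` setT -> dens m (fun x => \sum_(i < n) G i x) E <= 1 * mr m E.
  move=> mE _; have mTE := preimage_meas hT mE.
  rewrite mul1r dens_sum//; last by move=> i; exact: mc_G_integ mc i.
  rewrite -(mr_preimage hT mE).
  rewrite (eq_bigr (fun i : 'I_n => mr m (A i `&` T @^-1` E))); last by move=> i _; rewrite (mc_G_dens mc).
  have -> : \sum_(i < n) mr m (A i `&` T @^-1` E) = mr m (\bigcup_(i in `I_n) (A i `&` T @^-1` E)).
    rewrite mr_bigcup_ord// => [i|]; first exact: measurableI.
    apply/trivIsetP => i j _ _ ij; rewrite setIACA.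
    by move/trivIsetP : (mc_triv mc) => ->//; rewrite set0I.
  apply: mr_le => //; last by move=> x [i _ []].
  by apply: bigcup_measurable => i _; exact: measurableI.
by move=> /(_ h); apply: filterS => x; exact.
Qed.

Definition hol u (K : R) := forall j, {ae m2, forall xy : X * X, A j xy.1 -> A j xy.2 ->
  `|u xy.1 - u xy.2| <= K * mdist xy.1 xy.2 `^ eta}.

Lemma hol_ae_eq u v K : {ae m, forall x, u x = v x} -> hol u K -> hol v K.
Proof.
move=> uv hu j; apply: filterS3 (ae_prod_left uv) (ae_prod_right uv) (hu j).
by move=> xy -> ->.
Qed.

Lemma hol_le u K K' : K <= K' -> hol u K -> hol u K'.
Proof.
move=> KK' hu j; apply: filterS (hu j) => xy h x y.
by rewrite (le_trans (h x y))// ler_wpM2r// powR_ge0.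
Qed.

Lemma holD u v K K' : hol u K -> hol v K' -> hol (fun x => u x + v x) (K + K').
Proof.
move=> hu hv j; apply: filterS2 (hu j) (hv j) => xy h1 h2 x y.
rewrite opprD addrACA mulrDl (le_trans (ler_normD _ _))// lerD ?h1 ?h2//.
Qed.

Lemma holZ (c : R) u K : hol u K -> hol (fun x => c * u x) (`|c| * K).
Proof.
move=> hu j; apply: filterS (hu j) => xy h x y.
by rewrite -mulrBr normrM -mulrA ler_wpM2l ?h.
Qed.

Lemma branch_pairs i v (k1 k2 : R) s : integ m v -> {ae m, forall x, `|v x| <= s} ->
  0 <= k1 -> 0 <= k2 -> {ae m, forall x, A i x -> `|v x| <= k2} ->
  {ae m2, forall xy : X * X, A i xy.1 -> A i xy.2 ->
    `|v xy.1 - v xy.2| <= k1 * mdist (T xy.1) (T xy.2) `^ eta} ->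
  forall j, {ae m2, forall z : X * X, A j z.1 -> A j z.2 ->
    `|branch_tr i v z.1 - branch_tr i v z.2| <=
      (G i z.1 * k1 + C * D * k2 * G i z.2) * mdist z.1 z.2 `^ eta}.
Proof.
move=> iv vs k10 k20 vk2 vk1 j.
pose Q z z' := `|branch_tr i v z - branch_tr i v z'| <=
  G i z * k1 * mdist z z' `^ eta + `|G i z - G i z'| * k2.
have hQ : {ae m2, forall zz : X * X, I i zz.1 -> I i zz.2 -> Q zz.1 zz.2}.
  apply: (mc_image2 mc (Q := Q)).
  have hb := branch_tr_comp mc i iv vs.
  have h2 := ae_prod_right vk2.
  apply: filterS3 (ae_prod_left hb) (ae_prod_right hb) (filterI h2 vk1).
  move=> [x y] /= e1 e2 [hk hd] Ax Ay; rewrite /Q e1// e2//.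
  have -> : G i (T x) * v x - G i (T y) * v y =
      G i (T x) * (v x - v y) + (G i (T x) - G i (T y)) * v y by ring.
  rewrite (le_trans (ler_normD _ _))// lerD// normrM.
    by rewrite (ger0_norm (mc_G_ge0 mc i _)) -mulrA ler_wpM2l ?(mc_G_ge0 mc)// hd.
  by rewrite ler_wpM2l// hk.
have hoff := branch_tr_off mc i iv.
have [AI|AI] := mc_markov mc i j.
  have aI : {ae m, forall x, A j x -> I i x}.
    have := ae_in_null (fun x => False) (measurableD (mA j) (mI i)) AI.
    by apply: filterS => x h Ax; apply: contrapT => nI; exact: (h (conj Ax nI)).
  apply: filterS3 (ae_prod_left aI) (ae_prod_right aI) (filterI hQ (mc_distortion mc i)).
  move=> [x y] /= ax ay [q dd] Ax Ay; rewrite (le_trans (q (ax Ax) (ay Ay)))//.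
  rewrite mulrDl lerD2l (le_trans (ler_wpM2r k20 (dd (ax Ax) (ay Ay))))//.
  have := dist_le_powR mc eta01 x y; have g0 := mc_G_ge0 mc i y.
  move=> /(ler_wpM2l (mulr_ge0 C0 (mulr_ge0 g0 k20))).
  by congr (_ <= _); ring.
have aI : {ae m, forall x, A j x -> ~ I i x}.
  have := ae_in_null (fun x => False) (measurableI _ _ (mA j) (mI i)) AI.
  by apply: filterS => x h Ax Ix; exact: h.
have ab : {ae m, forall x, A j x -> branch_tr i v x = 0}.
  by apply: filterS2 aI hoff => x h1 h2 Ax; exact/h2/h1.
apply: filterS2 (ae_prod_left ab) (ae_prod_right ab) => -[x y] /= ex ey Ax Ay.
by rewrite ex// ey// subrr normr0 mulr_ge0 ?powR_ge0// addr_ge0// !mulr_ge0// (mc_G_ge0 mc).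
Qed.

Lemma tr_pairs v s (a b : nat -> R) (P Q : R) : integ m v ->
  {ae m, forall x, `|v x| <= s} ->
  (forall i, 0 <= a i) -> (forall i, 0 <= b i) ->
  (forall i j, {ae m2, forall z : X * X, A j z.1 -> A j z.2 ->
    `|branch_tr i v z.1 - branch_tr i v z.2| <=
      (G i z.1 * a i + b i * G i z.2) * mdist z.1 z.2 `^ eta}) ->
  (forall n, {ae m, forall x, \sum_(i < n) G i x * a i <= P}) ->
  (forall n, {ae m, forall x, \sum_(i < n) b i * G i x <= Q}) ->
  hol (tr m T v) (P + Q).
Proof.
move=> iv vs a0 b0 hp hP hQ j; have s0 := ae_bound_ge0 vs.
have h1 : {ae m, forall x, forall n, `|tr m T v x - \sum_(i < n) branch_tr i v x| <=
    K1 * (s * mr m (tail n))} by apply: ae_foralln => n; exact: branch_tail.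
have h2 : {ae m2, forall z : X * X, forall i, A j z.1 -> A j z.2 ->
    `|branch_tr i v z.1 - branch_tr i v z.2| <=
      (G i z.1 * a i + b i * G i z.2) * mdist z.1 z.2 `^ eta} by apply: ae_foralln.
have h3 : {ae m, forall x, forall n, \sum_(i < n) G i x * a i <= P} by exact: ae_foralln.
have h4 : {ae m, forall x, forall n, \sum_(i < n) b i * G i x <= Q} by exact: ae_foralln.
apply: filterS3 (filterI (ae_prod_left h1) (ae_prod_right h1)) h2
  (filterI (ae_prod_left h3) (ae_prod_right h4)).
move=> [x y] /= [tx ty] hb [hx hy] Ax Ay; set r := _ `^ eta.
have r0 : 0 <= r by exact: powR_ge0.
apply/ler_addgt0Pr => e e0.
have q1 : 0 < K1 * s * 2 + 1 by rewrite ltr_wpDl// !mulr_ge0.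
have [n hn] := tail_mr_cvg (divr_gt0 e0 q1).
have -> : tr m T v x - tr m T v y = (tr m T v x - \sum_(i < n) branch_tr i v x)
   - (tr m T v y - \sum_(i < n) branch_tr i v y)
   + \sum_(i < n) (branch_tr i v x - branch_tr i v y) by rewrite sumrB; ring.
rewrite addrC (le_trans (ler_normD _ _))// lerD//.
  rewrite (le_trans (ler_norm_sum _ _ _))//.
  apply: (@le_trans _ _ (\sum_(i < n) (G i x * a i + b i * G i y) * r)).
    by apply: ler_sum => i _; exact: hb.
  by rewrite -mulr_suml big_split/= ler_wpM2r// lerD.
rewrite (le_trans (ler_normB _ _))// (le_trans (lerD (tx n) (ty n)))//.
have := ltW hn; rewrite ler_pdivlMr; last by rewrite ltr_wpDl// !mulr_ge0.
apply: le_trans.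
have := mr_ge0 m (tail n); rewrite !mulrA; move: (K1 * s) (mulr_ge0 K10 s0) => q q0 t0; nra.
Qed.

Lemma tr_hol u s K : integ m u -> 0 <= K -> {ae m, forall x, `|u x| <= s} -> hol u K ->
  hol (tr m T u) (th * K + C * D * s).
Proof.
move=> iu K0 us hu; have s0 := ae_bound_ge0 us.
have th0 : 0 <= th := powR_ge0 _ _.
have cd0 : 0 <= C * D * s by rewrite !mulr_ge0.
apply: (@tr_pairs u s (fun=> th * K) (fun=> C * D * s)) => //.
- by move=> _; rewrite mulr_ge0.
- move=> i; apply: (@branch_pairs _ _ _ _ s) => //; first by rewrite mulr_ge0.
    by apply: filterS us => x ux _.
  apply: filterS2 (mc_expansion mc i) (hu i) => -[x y] /= h1 h2 Ax Ay.
  rewrite (le_trans (h2 Ax Ay))// (mulrC th) -mulrA ler_wpM2l//.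
  rewrite -powRM; [|exact: ltW|exact: mdist_ge0].
  by rewrite ge0_ler_powR ?nnegrE ?h1 ?mulr_ge0 ?mdist_ge0// ltW.
- move=> n; apply: filterS (branch_G_sum n) => x h.
  by rewrite -mulr_suml ler_piMl// mulr_ge0.
- move=> n; apply: filterS (branch_G_sum n) => x h.
  by rewrite -mulr_sumr ler_piMr.
Qed.

Lemma tr_mul_hol u h (H : nat -> R) (S K s : R) : measurable_fun setT h ->
  (forall x, `|h x| <= 2) -> (forall i, 0 <= H i) ->
  (forall i x, A i x -> `|h x| <= H i) ->
  (forall i x y, A i x -> A i y -> `|h x - h y| <= H i * mdist x y `^ eta) ->
  (forall n, \sum_(i < n) H i * mr m (A i) <= S) ->
  integ m u -> 0 <= K -> {ae m, forall x, `|u x| <= s} -> hol u K ->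
  {ae m, forall x, `|tr m T (fun y => h y * u y) x| <= K1 * (S * s)} /\
  hol (tr m T (fun y => h y * u y)) (K1 * S * (K + s + C * D * s)).
Proof.
move=> mh h2 H0 hH hd hS iu K0 us hu; have s0 := ae_bound_ge0 us.
have ihu : integ m (fun y => h y * u y).
  have := @integM_bounded _ _ _ m u h 2 mh h2 iu; exact.
have hus : {ae m, forall x, `|h x * u x| <= 2 * s}.
  by apply: filterS us => x ux; rewrite normrM ler_pM.
have hub i : {ae m, forall x, A i x -> `|h x * u x| <= H i * s}.
  by apply: filterS us => x ux Ax; rewrite normrM ler_pM ?hH.
have th1 : th <= 1 by exact: ltW (th_lt1 mc eta01).
split.
  apply: (@tr_sup _ (fun i => H i * s)) => // [i|n]; first by rewrite mulr_ge0.
  rewrite (eq_bigr (fun i : 'I_n => H i * mr m (A i) * s)); last by move=> i _; ring.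
  by rewrite -mulr_suml ler_wpM2r; try exact: hS.
rewrite mulrDr.
have GK i : {ae m, forall x, G i x <= K1 * mr m (A i)} by exact: (G_upper mc K1up).
have Gn : {ae m, forall x, forall i, G i x <= K1 * mr m (A i)} by exact: ae_foralln.
apply: (@tr_pairs _ (2 * s) (fun i => H i * (K + s)) (fun i => C * D * (H i * s))) => //.
- by move=> i; rewrite mulr_ge0// addr_ge0.
- by move=> i; rewrite !mulr_ge0.
- move=> i; apply: (@branch_pairs _ _ _ _ (2 * s)) => //.
  + by rewrite mulr_ge0// addr_ge0.
  + by rewrite mulr_ge0.
  apply: filterS3 (mc_expansion mc i) (hu i) (ae_prod_right us).
  move=> -[x y] /= e1 e2 uy Ax Ay.
  have -> : h x * u x - h y * u y = h x * (u x - u y) + (h x - h y) * u y by ring.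
  have r1 : mdist x y `^ eta <= mdist (T x) (T y) `^ eta.
    rewrite ge0_ler_powR ?nnegrE ?mdist_ge0 ?(ltW eta0)//.
    by rewrite (le_trans (e1 Ax Ay))// ler_piMl ?mdist_ge0// ltW.
  rewrite (le_trans (ler_normD _ _))// !normrM mulrDr mulrDl.
  rewrite -!mulrA lerD//.
    rewrite ler_pM ?hH// (le_trans (e2 Ax Ay))// ler_wpM2l//.
  rewrite (le_trans (ler_pM _ _ (hd _ _ _ Ax Ay) uy))//.
  by rewrite -mulrA ler_wpM2l// mulrC ler_wpM2l.
- move=> n; apply: filterS Gn => x hG.
  apply: (@le_trans _ _ (\sum_(i < n) K1 * (K + s) * (H i * mr m (A i)))).
    apply: ler_sum => i _; rewrite (_ : K1 * _ * _ = K1 * mr m (A i) * (H i * (K + s))); last by ring.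
    by rewrite ler_wpM2r// mulr_ge0// addr_ge0.
  rewrite -mulr_sumr (_ : K1 * S * _ = K1 * (K + s) * S); last by ring.
  by apply: ler_wpM2l; [rewrite mulr_ge0 ?addr_ge0|exact: hS].
- move=> n; apply: filterS Gn => x hG.
  apply: (@le_trans _ _ (\sum_(i < n) K1 * (C * D * s) * (H i * mr m (A i)))).
    apply: ler_sum => i _; rewrite (_ : K1 * _ * _ = C * D * (H i * s) * (K1 * mr m (A i))); last by ring.
    by rewrite ler_wpM2l// !mulr_ge0.
  rewrite -mulr_sumr (_ : K1 * S * _ = K1 * (C * D * s) * S); last by ring.
  by apply: ler_wpM2l; [rewrite !mulr_ge0|exact: hS].
Qed.

End holder.

Section spectral_gap.
Context {R : realType} {d : measure_display} {X : metricMeasurableType R d}.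
Variables (m : probability X R) (T : X -> X) (A I : nat -> set X)
  (G : nat -> X -> R) (gam D C : R).
Hypothesis mc : markov_coding m T A I G gam D C.
Variable eta : R.
Hypothesis eta01 : 0 < eta <= 1.
Implicit Types (E B : set X) (w : seq nat) (u v h : X -> R).

Let hT := mc_preserving mc.
Let mA := mc_A mc.
Let mI := mc_I mc.
Let gam0 : 0 < gam. Proof. by case/andP: (mc_gam mc). Qed.
Let gam1 : gam < 1. Proof. by case/andP: (mc_gam mc). Qed.
Let D0 : 0 <= D. Proof. exact: le_trans ler01 (mc_D mc). Qed.
Let C0 := mc_C mc.
Let eta0 : 0 < eta. Proof. by case/andP: eta01. Qed.
Local Notation m2 := (m \x m)%E.
Local Notation th := (gam `^ eta).
Local Notation hol := (hol m A eta).
Local Notation cylinder := (cylinder T A).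
Local Notation component := (component m T A).
Local Notation reach := (reach m T A).
Local Notation lazy := (lazy m T).
Let th0 : 0 < th := th_gt0 mc eta.
Let th1 : th < 1 := th_lt1 mc eta01.

Lemma lazy_set_eq N (mu nu : set X -> R) E : measurable E ->
  (forall B, measurable B -> mu B = nu B) -> lazy_set T N mu E = lazy_set T N nu E.
Proof.
move=> mE h; apply/eqP; rewrite eq_le !(lazy_set_le hT)// => B /h -> //.
Qed.

Definition lazy_fun N E x : R := lazy_set T N (fun B => \1_B x) E.

Lemma lazy_fun_ge0 N E x : 0 <= lazy_fun N E x.
Proof. by apply: lazy_set_ge0 => B; rewrite indicE. Qed.

Lemma lazy_fun_integ N E v : measurable E -> integ m v ->
  integ m (fun x => lazy_fun N E x * v x).
Proof.
move=> mE iv; elim: N E mE => [|N ih] E mE.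
  have := integ_indic mE iv; congr integ.
  by apply/funext => x; rewrite mulrC.
have := integZ 2^-1 (integD (ih E mE) (ih _ (preimage_meas hT mE))).
by congr integ; apply/funext => x; rewrite -mulrDl mulrA.
Qed.

Lemma lazy_fun_dens N E v B : measurable E -> measurable B -> integ m v ->
  dens m (fun x => lazy_fun N E x * v x) B =
  lazy_set T N (fun B' => dens m v (B `&` B')) E.
Proof.
move=> mE mB iv; elim: N E mE => [|N ih] E mE.
  have -> : lazy_set T 0 (fun B' => dens m v (B `&` B')) E = dens m v (B `&` E) by [].
  by rewrite -dens_indic; apply: dens_eq => x _; rewrite mulrC.
have mTE := preimage_meas hT mE.
have i1 := lazy_fun_integ N mE iv; have i2 := lazy_fun_integ N mTE iv.
have i12 := integD i1 i2.
rewrite [RHS]/= -!ih// -densD// -densZ//.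
by apply: dens_eq => x _; rewrite -mulrDl mulrA.
Qed.

Lemma hol_cylinder u K j w : integ m u -> 0 <= K -> hol u K ->
  {ae m, forall y, cylinder (j :: w) y ->
     dens m u (cylinder (j :: w)) <=
     (u y + K * (D * gam ^+ (size w).+1) `^ eta) * mr m (cylinder (j :: w))}.
Proof.
move=> iu K0 hu; have mD := cylinder_meas mc (j :: w).
have h1 := ae_prod_iter (hu j); have h2 := cylinder_ae_diam mc (j :: w).
apply: filterS2 h1 h2 => y h1 h2 Dy.
rewrite -(dens_cst m _ mD); apply: dens_ae_le => //; first exact: integ_cst.
apply: filterS2 h1 h2 => x h1 h2 Dx.
have e1 : K * mdist y x `^ eta <= K * (D * gam ^+ (size w).+1) `^ eta.
  rewrite ler_wpM2l// ge0_ler_powR ?nnegrE ?mdist_ge0 ?(ltW eta0)//.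
    by rewrite mulr_ge0// exprn_ge0// ltW.
  exact: h2.
have := le_trans (h1 (cylinder_head Dy) (cylinder_head Dx)) e1.
by rewrite ler_norml => /andP[/=]; lra.
Qed.

Lemma lazy_lower i : exists (M : nat) (c : R), 0 < c /\ forall N n v K E,
  integ m v -> {ae m, forall x, 0 <= v x} -> 0 <= K -> hol v K -> measurable E ->
  (n.+1 + M <= N)%N ->
  c * 2^-1 ^+ N * mr m (E `&` component i) *
    (dens m v (component i) - K * (D * gam ^+ n.+1) `^ eta * mr m (component i)) <=
  dens m (iter N lazy v) E.
Proof.
have [M [c [c0 hdb]]] := doeblin mc i; exists M, c; split => //.
move=> N n v K E iv v0 K0 hv mE nMN.
set Y := component i; have mY : measurable Y by exact: (component_meas mc).
set ka := c * _ * _; set dl := K * _.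
have ka0 : 0 <= ka by rewrite !mulr_ge0 ?mr_ge0 ?ltW// exprn_ge0.
pose F x := lazy_fun N E x * v x - ka * (v x - dl).
have iq : integ m (fun x => lazy_fun N E x * v x) by exact: lazy_fun_integ.
have iv' : integ m (fun x => v x - dl) by apply: integB => //; exact: integ_cst.
have ikv : integ m (fun x => ka * (v x - dl)) by exact: integZ.
have iF : integ m F by exact: integB.
have dF B : measurable B -> dens m F B =
    dens m (fun x => lazy_fun N E x * v x) B - ka * (dens m v B - dl * mr m B).
  move=> mB; rewrite densB// densZ// densB// ?dens_cst//; exact: integ_cst.
have hP k w : (size w + k = n.+1)%N -> 0 <= dens m F (Y `&` cylinder w).
  elim: k w => [|k ih] w.
    rewrite addn0; case: w => [//|j w] [sw].
    have mD := cylinder_meas mc (j :: w).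
    have [rij|nr] := pselect (reach i j); last first.
      rewrite (_ : _ `&` _ = set0) ?(dens_null _ iF) ?mr_set0//.
      apply/seteqP; split => // x [[l ril Al] /cylinder_head Aj]; apply: nr.
      by rewrite (branch_uniq mc Aj Al).
    rewrite setIidr; last by move=> x /cylinder_head Aj; exists j.
    have [D00|D0n] := eqVneq (mr m (cylinder (j :: w))) 0; first by rewrite dens_null.
    have Dgt : 0 < mr m (cylinder (j :: w)) by rewrite lt_neqAle eq_sym D0n mr_ge0.
    set B := cylinder (j :: w) in mD D0n Dgt *.
    have hosc := @hol_cylinder v K j w iv K0 hv.
    pose a := Num.max 0 (dens m v B / mr m B - dl).
    have a0 : 0 <= a by rewrite /a le_max lexx.
    have va : {ae m, forall y, B y -> a <= v y}.
      apply: filterS2 v0 hosc => y vy h By; rewrite /a ge_max vy/= lerBlDr.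
      by rewrite ler_pdivrMr//; have := h By; rewrite sw.
    rewrite dF// subr_ge0.
    have e1 : a * dens m (fun x => lazy_fun N E x * 1) B <= dens m (fun x => lazy_fun N E x * v x) B.
      have i1 := lazy_fun_integ N mE (integ_cst m 1).
      rewrite -densZ//; apply: dens_ae_le => //; first exact: integZ.
      apply: filterS va => y h By; rewrite mulr1 mulrC ler_wpM2l ?h//.
      exact: lazy_fun_ge0.
    apply: le_trans e1; rewrite lazy_fun_dens//; last exact: integ_cst.
    rewrite (@lazy_set_eq _ _ (fun B' => mr m (B `&` B')))//; last first.
      by move=> B' mB'; rewrite dens_cst ?mul1r//; exact: measurableI.
    have e2 := hdb N j w E rij _ mE; rewrite sw in e2.
    have {}e2 := ler_wpM2l a0 (e2 nMN).
    apply: le_trans e2.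
    rewrite (_ : c * _ * _ * _ = ka * mr m B); last by rewrite /ka; ring.
    rewrite [leRHS]mulrCA ler_wpM2l//.
    rewrite -ler_pdivrMr// mulrBl mulfK// /a le_max lexx orbT//.
  move=> sw.
  have mYw : measurable (Y `&` cylinder w) by exact/measurableI/(cylinder_meas mc).
  apply: (@dens_pieces_ge0 _ _ _ _ _ (fun j => iter (size w) T @^-1` A j)) => //.
  - by move=> j; exact: (iter_preimage_meas mc).
  - have /trivIsetP tA := mc_triv mc; apply/trivIsetP => a b _ _ ab.
    by rewrite -preimage_setI tA// preimage_set0.
  - have mU : measurable (~` \bigcup_i A i) by exact/measurableC/bigcupT_measurable.
    exact: (eq_trans (iter_preimage_mr mc (size w) mU) (mc_cover mc)).
  - move=> j; rewrite -setIA.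
    have := ih (w ++ [:: j]); rewrite cylinder_cat cylinder1; apply.
    by rewrite size_cat addn1 addSn -addnS.
have := hP n.+1 [::] erefl; rewrite /= setIT dF// subr_ge0 => /le_trans; apply.
rewrite (iter_lazy_dens hT)//.
have -> : lazy_set T N (dens m v) E = dens m (fun x => lazy_fun N E x * v x) setT.
  by rewrite lazy_fun_dens//; apply: lazy_set_eq => // B mB; rewrite setTI.
rewrite (densID measurableT mY iq) setTI lerDl; apply: dens_ae_ge0 => //.
  exact: measurableD.
by apply: filterS v0 => x vx _; rewrite mulr_ge0// lazy_fun_ge0.
Qed.

Lemma tr_support i u : integ m u -> {ae m, forall x, ~ component i x -> u x = 0} ->
  {ae m, forall x, ~ component i x -> tr m T u x = 0}.
Proof.
move=> iu u0; have mY := component_meas mc i.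
apply: ae_eq_of_dens (measurableC mY) (tr_integ hT iu) (integ_cst m 0) _ => E mE EY.
have mTE := preimage_meas hT mE.
rewrite (tr_dens hT)// dens_cst// mul0r.
rewrite -[RHS](mul0r (mr m (T @^-1` E))) -(dens_cst m 0 mTE).
apply: dens_ae_eq => //; first exact: integ_cst.
apply: filterS2 u0 (component_ae mc i) => x h1 h2 Ex; apply: h1 => Yx.
by apply: (EY _ Ex); apply/h2.
Qed.

Definition mean_zero i u :=
  {ae m, forall x, ~ component i x -> u x = 0} /\ dens m u setT = 0.

Lemma lazy_support i u : integ m u -> {ae m, forall x, ~ component i x -> u x = 0} ->
  {ae m, forall x, ~ component i x -> lazy u x = 0}.
Proof.
move=> iu u0; apply: filterS2 (u0) (tr_support iu u0) => x h1 h2 nY.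
by rewrite /lazy h1// h2// addr0 mulr0.
Qed.

Lemma lazy_dens_T u : integ m u -> dens m (lazy u) setT = dens m u setT.
Proof. by move=> iu; rewrite (lazy_dens hT)// preimage_setT; lra. Qed.

Lemma lazy_mean_zero i u : integ m u -> mean_zero i u -> mean_zero i (lazy u).
Proof.
by move=> iu [u0 uz]; split; [exact: lazy_support|rewrite lazy_dens_T].
Qed.

Lemma iter_lazy_mean_zero i k u : integ m u -> mean_zero i u -> mean_zero i (iter k lazy u).
Proof.
move=> iu uz; elim: k => [//|k ih]; apply: lazy_mean_zero => //.
exact: (iter_lazy_integ hT).
Qed.

Lemma lazy_bound u s : integ m u -> {ae m, forall x, `|u x| <= s} ->
  {ae m, forall x, `|lazy u x| <= s}.
Proof.
move=> iu us; apply: filterS2 (us) (tr_bound hT iu us) => x h1 h2.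
rewrite /lazy normrM ger0_norm// (le_trans (ler_wpM2l _ (ler_normD _ _)))//; lra.
Qed.

Lemma lazy_hol u K s : integ m u -> 0 <= K -> {ae m, forall x, `|u x| <= s} -> hol u K ->
  hol (lazy u) ((1 + th) / 2 * K + C * D * s / 2).
Proof.
move=> iu K0 us hu; have [K1 K1gt0 K1up] := branch_upper mc.
have := holZ 2^-1 (holD hu (tr_hol mc eta01 K1gt0 K1up iu K0 us hu)).
by apply: hol_le; rewrite ger0_norm//; lra.
Qed.

Lemma iter_lazy_hol u K s k : integ m u -> 0 <= K -> {ae m, forall x, `|u x| <= s} ->
  hol u K -> {ae m, forall x, `|iter k lazy u x| <= s} /\
  hol (iter k lazy u) (((1 + th) / 2) ^+ k * K + C * D * s / (1 - th)).
Proof.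
move=> iu K0 us hu; have s0 := ae_bound_ge0 us.
have b0 : 0 <= C * D * s / (1 - th) by rewrite !mulr_ge0// invr_ge0 subr_ge0 ltW.
elim: k => [|k [ih1 ih2]].
  by split => //; apply: hol_le hu; rewrite expr0 mul1r lerDl.
have il := iter_lazy_integ hT k iu; split; first exact: lazy_bound.
have q0 : 0 <= (1 + th) / 2 by rewrite divr_ge0// addr_ge0// ltW.
have K'0 : 0 <= ((1 + th) / 2) ^+ k * K + C * D * s / (1 - th).
  by rewrite addr_ge0// mulr_ge0// exprn_ge0.
apply: hol_le (lazy_hol il K'0 ih1 ih2).
rewrite mulrDr mulrA -exprS -addrA lerD2l le_eqVlt; apply/orP; left; apply/eqP.
by field; rewrite subr_eq0 eq_sym lt_eqF.
Qed.

(* The weight of the Hoelder constant is large enough for the lazy operator not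
   to increase the norm, the distortion being absorbed by the contraction. *)
Definition Lam := 2 * C * D / (1 - th) + 1.

Definition nrm u Z := [/\ integ m u, {ae m, forall x, `|u x| <= Z} & hol u (Lam * Z)].

Lemma Lam_ge1 : 1 <= Lam.
Proof. by rewrite lerDr !mulr_ge0// invr_ge0 subr_ge0 ltW. Qed.

Let Lam0 : 0 <= Lam := le_trans ler01 Lam_ge1.

Lemma nrm_ge0 u Z : nrm u Z -> 0 <= Z.
Proof. by move=> [_ /ae_bound_ge0]. Qed.

Lemma nrm_integ u Z : nrm u Z -> integ m u. Proof. by case. Qed.

Lemma nrm_le u Z Z' : Z <= Z' -> nrm u Z -> nrm u Z'.
Proof.
move=> ZZ' [iu us hu]; split => //.
  by apply: filterS us => x /le_trans; exact.
by apply: hol_le hu; rewrite ler_wpM2l.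
Qed.

Lemma nrm_ae_eq u v Z : integ m v -> {ae m, forall x, u x = v x} -> nrm u Z -> nrm v Z.
Proof.
move=> iv uv [iu us hu]; split => //; last exact: hol_ae_eq uv hu.
by apply: filterS2 uv us => x ->.
Qed.

Lemma nrmD u v Z Z' : nrm u Z -> nrm v Z' -> nrm (fun x => u x + v x) (Z + Z').
Proof.
move=> [iu us hu] [iv vs hv]; split; first exact: integD.
  by apply: filterS2 us vs => x h1 h2; rewrite (le_trans (ler_normD _ _))// lerD.
by rewrite mulrDr; exact: holD.
Qed.

Lemma nrmZ c u Z : nrm u Z -> nrm (fun x => c * u x) (`|c| * Z).
Proof.
move=> [iu us hu]; split; first exact: integZ.
  by apply: filterS us => x h1; rewrite normrM ler_wpM2l.
by rewrite mulrCA; exact: holZ.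
Qed.

Lemma distortion_le Z : 0 <= Z -> C * D * Z / (1 - th) <= Lam * Z / 2.
Proof.
move=> Z0; rewrite -[leRHS]mulrA (mulrC Z) mulrA [leLHS](_ : _ = C * D / (1 - th) * Z).
  by rewrite ler_wpM2r// /Lam -!mulrA mulrDl; lra.
by rewrite mulrAC.
Qed.

Lemma iter_lazy_nrm u Z k : nrm u Z -> nrm (iter k lazy u) (3 / 2 * Z).
Proof.
move=> h; have Z0 := nrm_ge0 h; case: h => iu us hu.
have [h1 h2] := iter_lazy_hol k iu (mulr_ge0 Lam0 Z0) us hu.
split; first exact: (iter_lazy_integ hT).
  by apply: filterS h1 => x /le_trans; apply; lra.
apply: hol_le h2; have := distortion_le Z0.
have q1 : ((1 + th) / 2) ^+ k <= 1.
  by apply: exprn_ile1; have := th0; have := th1; lra.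
have := ler_wpM2r (mulr_ge0 Lam0 Z0) q1; lra.
Qed.

Lemma small_power (a e : R) : 0 <= a < 1 -> 0 < e -> exists n : nat, a ^+ n <= e.
Proof.
move=> /andP[a0 a1] e0; have : (a ^+ n @[n --> \oo] --> (0 : R)).
  by apply: cvg_expr; rewrite ger0_norm.
move=> /cvgrPdist_le /(_ _ e0) [n _ /(_ n (leqnn n))].
by rewrite /= sub0r normrN ger0_norm ?exprn_ge0// => h; exists n.
Qed.

Lemma component_hol i : hol (\1_(component i) : X -> R) 0.
Proof.
move=> j; apply: aeW => -[x y] /= Ax Ay; rewrite mul0r.
suff -> : \1_(component i) x = \1_(component i) y :> R by rewrite subrr normr0.
rewrite !indicE; have -> // : (x \in component i) = (y \in component i).
apply/idP/idP; rewrite !inE => -[l rl Al]; exists l => //.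
  by rewrite (branch_uniq mc Al Ax).
by rewrite (branch_uniq mc Al Ay).
Qed.

Lemma component_lazy_set i N E : measurable E ->
  lazy_set T N (fun B => mr m (B `&` component i)) E = mr m (E `&` component i).
Proof.
have mY := component_meas mc i.
elim: N E => [//|N ih] E mE /=; have mTE := preimage_meas hT mE.
rewrite !ih//.
have -> : mr m (T @^-1` E `&` component i) = mr m (E `&` component i).
  rewrite -[RHS](mr_preimage hT (measurableI _ _ mE mY)) preimage_setI.
  rewrite -[LHS]mul1r -[RHS]mul1r -!(dens_cst m 1); last 2 first.
  - by apply: measurableI => //; exact: (preimage_meas hT).
  - exact: measurableI.
  apply: dens_ae_set; [exact: measurableI| |exact: integ_cst|].
    by apply: measurableI => //; exact: (preimage_meas hT).
  by apply: filterS (component_ae mc i) => x h; split => -[/= e1 /h e2].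
by lra.
Qed.

Lemma lazy_sup_contraction i : 0 < mr m (A i) -> exists (N : nat) (rho : R), 0 <= rho < 1 /\
  forall u Z, mean_zero i u -> nrm u Z -> {ae m, forall x, `|iter N lazy u x| <= rho * Z}.
Proof.
move=> Ai0; have [M [c [c0 hlow]]] := lazy_lower i.
set Y := component i in hlow *; have mY : measurable Y by exact: (component_meas mc).
have Y0 : 0 < mr m Y.
  by apply: (lt_le_trans Ai0) (mr_le m _ mY _) => // x Ax; exists i => //; exact: (reach_refl T Ai0).
pose e := (2 * Lam)^-1 `^ eta^-1 / (D * gam).
have Dg : 0 < D * gam by rewrite mulr_gt0// (lt_le_trans ltr01 (mc_D mc)).
have L2 : 0 < (2 * Lam)^-1 by rewrite invr_gt0 mulr_gt0// (lt_le_trans ltr01 Lam_ge1).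
have e0 : 0 < e by rewrite divr_gt0// powR_gt0.
have g01 : 0 <= gam < 1 by rewrite (ltW gam0) gam1.
have [n hn] := small_power g01 e0.
have hdel : Lam * (D * gam ^+ n.+1) `^ eta <= 2^-1.
  have : (D * gam ^+ n.+1) `^ eta <= (2 * Lam)^-1.
    have -> : (2 * Lam)^-1 = ((2 * Lam)^-1 `^ eta^-1) `^ eta.
      by rewrite -powRrM mulVf ?gt_eqF// powRr1// ltW.
    rewrite ge0_ler_powR ?nnegrE ?(ltW eta0) ?powR_ge0//.
      by rewrite mulr_ge0// exprn_ge0// ltW.
    by rewrite exprS mulrA mulrC -ler_pdivlMr.
  have Lp : 0 < Lam by exact: lt_le_trans ltr01 Lam_ge1.
  move=> /(ler_wpM2l Lam0) h; apply: (le_trans h).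
  by rewrite invfM mulrCA divff ?gt_eqF// mulr1.
pose N := (n.+1 + M)%N.
pose rho := Num.max 0 (1 - c * 2^-1 ^+ N * mr m Y / 2).
have cN : 0 < c * 2^-1 ^+ N * mr m Y / 2 by rewrite !mulr_gt0// exprn_gt0.
exists N, rho; split; first by rewrite /rho le_max lexx/= gt_max ltr01/=; lra.
have main u Z E : mean_zero i u -> nrm u Z -> measurable E ->
    dens m (iter N lazy u) E <= rho * Z * mr m E.
  move=> [u0 um] nu mE; have Z0 := nrm_ge0 nu; case: nu => iu us hu.
  have i1 : integ m (\1_Y : X -> R) by exact: integrable_indic.
  pose v x := Z * \1_Y x + -1 * u x.
  have iv : integ m v by apply: integD; exact: integZ.
  have dv B : measurable B -> dens m v B = Z * mr m (B `&` Y) + -1 * dens m u B.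
    move=> mB; rewrite densD//; [|exact: integZ|exact: integZ].
    rewrite !densZ//; congr (_ * _ + _).
    have -> : dens m (\1_Y : X -> R) B = dens m (fun x => 1 * \1_Y x) B.
      by apply: dens_eq => x _; rewrite mul1r.
    by rewrite (dens_indic m (fun=> 1)) dens_cst ?mul1r//; exact: measurableI.
  have v0 : {ae m, forall x, 0 <= v x}.
    apply: filterS2 u0 us => x h1 h2; rewrite /v indicE mulN1r.
    have [Yx|nY] := pselect (Y x).
      by rewrite mem_set// mulr1 subr_ge0 (le_trans (ler_norm _)).
    by rewrite memNset// mulr0 h1// subr0.
  have hv : hol v (Lam * Z).
    have := holD (holZ Z (component_hol i)) (holZ (-1) hu).
    by rewrite normrN1 mul1r mulr0 add0r.
  have := hlow N n v _ E iv v0 (mulr_ge0 Lam0 Z0) hv mE (leqnn _).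
  rewrite (iter_lazy_dens hT)// (lazy_set_eq _ mE dv).
  rewrite lazy_set_comb component_lazy_set// -(iter_lazy_dens hT)// -/Y.
  rewrite dv// setIid.
  have -> : dens m u Y = 0.
    rewrite -um (densID measurableT mY iu) setTI.
    have mYc : measurable (setT `\` Y) by exact: measurableD.
    have -> : dens m u (setT `\` Y) = dens m (fun=> 0) (setT `\` Y).
      apply: dens_ae_eq => //; first exact: integ_cst.
      by apply: filterS u0 => x h [_ nY]; exact: h.
    by rewrite dens_cst// mul0r addr0.
  rewrite mulr0 addr0 => h.
  have mE0 := mr_ge0 m (E `&` Y); have YY := ltW Y0.
  have mEY : mr m (E `&` Y) <= mr m E by apply: mr_le => //; exact: measurableI.
  have r0 : 0 <= rho by rewrite /rho le_max lexx.
  apply: (@le_trans _ _ (rho * Z * mr m (E `&` Y))); last first.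
    by rewrite ler_wpM2l// mulr_ge0.
  have r1 : (1 - c * 2^-1 ^+ N * mr m Y / 2) * Z * mr m (E `&` Y) <= rho * Z * mr m (E `&` Y).
    by rewrite ler_wpM2r// ler_wpM2r// /rho le_max lexx orbT.
  apply: le_trans r1.
  have k0 : 0 <= c * 2^-1 ^+ N * mr m (E `&` Y) * Z * mr m Y.
    by rewrite !mulr_ge0 ?exprn_ge0// ltW.
  have := ler_wpM2l k0 hdel.
  move: h; move: (2^-1 ^+ N) (_ `^ eta) (mr m (E `&` Y)) (mr m Y) (mr m E) (dens _ _ _) (Lam).
  move=> a b e' y ee dd L; lra.
move=> u Z uz nu; have Z0 := nrm_ge0 nu; have iu := nrm_integ nu.
have := @ae_norm_le_of_dens _ _ _ m (iter N lazy u) 0 (rho * Z) setT measurableT (iter_lazy_integ hT N iu).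
have hE E : measurable E -> E `<=` setT -> `|dens m (iter N lazy u) E - 0 * mr m E| <= rho * Z * mr m E.
  move=> mE _; rewrite mul0r subr0 ler_norml main// andbT lerNl.
  have nN := nrmZ (-1) nu; rewrite normrN1 mul1r in nN.
  have zN : mean_zero i (fun x => -1 * u x).
    case: uz => u0 um; split; last by rewrite densZ// um mulr0.
    by apply: filterS u0 => x h /h ->; rewrite mulr0.
  have := main _ _ _ zN nN mE; congr (_ <= _).
  rewrite !(iter_lazy_dens hT)//; last exact: nrm_integ nN.
  rewrite (@lazy_set_eq _ _ (fun B => 0 * dens m u B + -1 * dens m u B))//.
    by rewrite lazy_set_comb mul0r add0r mulN1r.
  by move=> B mB; rewrite densZ// mul0r add0r.
by move=> /(_ hE); apply: filterS => x /(_ Logic.I); rewrite subr0.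
Qed.

Lemma lazy_contraction i : 0 < mr m (A i) -> exists (N : nat) (rho : R), 0 < rho < 1 /\
  (0 < N)%N /\ forall u Z, mean_zero i u -> nrm u Z -> nrm (iter N lazy u) (rho * Z).
Proof.
move=> Ai0; have [N [rho [/andP[r0 r1] h]]] := lazy_sup_contraction Ai0.
pose q := (1 + th) / 2.
have q01 : 0 <= q < 1 by apply/andP; rewrite /q; have := th0; have := th1; split; lra.
have s0 : 0 < 6^-1 :> R by rewrite invr_gt0.
have [k hk] := small_power q01 s0.
exists (k.+1 + N)%N, (Num.max rho 2^-1); split.
  by rewrite lt_max gt_max r1 invr_gt0 ltr0n orbT/= invf_lt1// ltr1n.
split; first by rewrite addSn.
move=> u Z uz nu; have Z0 := nrm_ge0 nu; have iu := nrm_integ nu.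
have h1 := h u Z uz nu; have [h2 _ h3] := iter_lazy_nrm N nu.
rewrite iterD.
have [|h4 h5] := iter_lazy_hol k.+1 h2 _ h1 h3; first by rewrite !mulr_ge0.
have rz0 : 0 <= rho * Z by rewrite mulr_ge0.
split; first exact: (iter_lazy_integ hT).
  by apply: filterS h4 => x /le_trans; apply; rewrite ler_wpM2r// le_max lexx.
apply: hol_le h5; have := distortion_le rz0.
have q6 : q ^+ k.+1 <= 6^-1.
  by case/andP: q01 => q0 q1; apply: le_trans hk; rewrite exprS ler_piMl ?exprn_ge0// ltW.
have h32 : 0 <= 3 / 2 * Z by rewrite mulr_ge0.
have := ler_wpM2r (mulr_ge0 Lam0 h32) q6; rewrite /q => e1.
have lz := mulr_ge0 Lam0 Z0.
have m1 : rho <= Num.max rho 2^-1 by rewrite le_max lexx.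
have m2 : 2^-1 <= Num.max rho 2^-1 by rewrite le_max lexx orbT.
have := ler_wpM2l lz m1; have := ler_wpM2l lz m2; lra.
Qed.

Lemma lazy_gap i : 0 < mr m (A i) -> exists (r B : R), 0 < r < 1 /\ 1 <= B /\
  forall u Z j, mean_zero i u -> nrm u Z -> nrm (iter j lazy u) (B * r ^+ j * Z).
Proof.
move=> Ai0; have [N [rho [/andP[r0 r1] [N0 h]]]] := lazy_contraction Ai0.
pose r := rho `^ N%:R^-1.
have rN : r ^+ N = rho.
  by rewrite -powR_mulrn ?powR_ge0// -powRrM mulVf ?powRr1 ?ltW// pnatr_eq0 -lt0n.
have rgt0 : 0 < r by exact: powR_gt0.
have rlt1 : r < 1.
  rewrite ltNge; apply/negP => r1'; have := exprn_ege1 N r1'; rewrite rN; lra.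
exists r, (3 / 2 / rho); rewrite rgt0 rlt1; split => //; split.
  by rewrite ler_pdivlMr//; lra.
move=> u Z j uz nu; have Z0 := nrm_ge0 nu; have iu := nrm_integ nu.
have hk k : nrm (iter (k * N) lazy u) (rho ^+ k * Z).
  elim: k => [|k ih]; first by rewrite mul0n expr0 mul1r.
  by rewrite mulSn iterD exprS -mulrA; apply: h => //; exact: iter_lazy_mean_zero.
have := iter_lazy_nrm (j %% N)%N (hk (j %/ N)%N); rewrite -iterD addnC -divn_eq.
apply: nrm_le; rewrite [leRHS]mulrAC -[leRHS]mulrA -[leRHS]mulrA ler_wpM2l//.
rewrite mulrA mulrAC ler_wpM2r// ler_pdivlMl// -exprS -rN -exprM.
rewrite ler_wiXn2l ?(ltW rgt0) ?(ltW rlt1)//.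
by rewrite {1}(divn_eq j N) mulnS addnC mulnC leq_add2r ltnW// ltn_mod.
Qed.

End spectral_gap.

(** * Perturbation by unimodular multipliers *)

Lemma mean_value_between {R : realType} (g g' : R -> R) (a b : R) :
  (forall x : R, is_derive x 1 g (g' x)) ->
  exists2 c : R, (a <= c <= b \/ b <= c <= a) & g b - g a = g' c * (b - a).
Proof.
move=> dg.
have ct (x y : R) : {within `[x, y], continuous g}.
  apply: derivable_within_continuous => z _; exact: (@ex_derive _ _ _ _ _ _ _ (dg z)).
have [ab|ba] := leP a b.
  have [c cab ->] := MVT_segment ab (fun x _ => dg x) (ct a b).
  by exists c => //; left; move: cab; rewrite in_itv.
have [c cab e] := MVT_segment (ltW ba) (fun x _ => dg x) (ct b a).
exists c; first by right; move: cab; rewrite in_itv.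
by rewrite -opprB e; ring.
Qed.

Lemma cos_sin_lip {R : realType} (a b : R) :
  `|cos a - cos b| <= `|a - b| /\ `|sin a - sin b| <= `|a - b|.
Proof.
have h (g g' : R -> R) : (forall x : R, is_derive x 1 g (g' x)) -> (forall x, `|g' x| <= 1) ->
    `|g a - g b| <= `|a - b|.
  move=> dg g1; have [c _ ->] := mean_value_between b a dg.
  by rewrite normrM ler_piMl.
split; [apply: (h cos (fun x => - sin x)) => x|apply: (h sin cos) => x].
  by rewrite normrN ler_norml sin_geN1 sin_le1.
by rewrite ler_norml cos_geN1 cos_le1.
Qed.

Section complex_modulus.
Context {R : realType}.
Implicit Types z w : R[i].
Local Notation Re := complex.Re.
Local Notation Im := complex.Im.

Lemma ReD z w : Re (z + w) = Re z + Re w. Proof. by case: z; case: w. Qed.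
Lemma ImD z w : Im (z + w) = Im z + Im w. Proof. by case: z; case: w. Qed.
Lemma ReN z : Re (- z) = - Re z. Proof. by case: z. Qed.
Lemma ImN z : Im (- z) = - Im z. Proof. by case: z. Qed.
Lemma ReM z w : Re (z * w) = Re z * Re w - Im z * Im w. Proof. by case: z; case: w. Qed.
Lemma ImM z w : Im (z * w) = Re z * Im w + Im z * Re w. Proof. by case: z; case: w. Qed.

Lemma complex_ext z w : Re z = Re w -> Im z = Im w -> z = w.
Proof. by case: z => a b; case: w => a' b' /= -> ->. Qed.

Lemma cmodM z w : cmod (z * w) = cmod z * cmod w. Proof. exact: Normc.normcM. Qed.
Lemma cmodD z w : cmod (z + w) <= cmod z + cmod w. Proof. exact: le_normcD. Qed.
Lemma cmodN z : cmod (- z) = cmod z. Proof. exact: normcN. Qed.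
Lemma cmodV z : cmod z^-1 = (cmod z)^-1. Proof. exact: Normc.normcV. Qed.
Lemma cmod0 : cmod (0 : R[i]) = 0. Proof. exact: Normc.normc0. Qed.
Lemma cmod1 : cmod (1 : R[i]) = 1. Proof. exact: Normc.normc1. Qed.
Lemma cmod_ge0 z : 0 <= cmod z. Proof. by case: z => a b; exact: sqrtr_ge0. Qed.
Lemma cmod_eq0 z : cmod z = 0 -> z = 0. Proof. exact: Normc.eq0_normc. Qed.

Lemma cmodB z w : cmod (z - w) <= cmod z + cmod w.
Proof. by rewrite (le_trans (cmodD _ _))// cmodN. Qed.

Lemma cmodBC z w : cmod (z - w) = cmod (w - z).
Proof. by rewrite -cmodN opprB. Qed.

Lemma cmod_triangle z u w : cmod (z - w) <= cmod (z - u) + cmod (u - w).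
Proof. by rewrite (le_trans _ (cmodD _ _))// addrA subrK. Qed.

Lemma cmodR (x : R) : cmod x%:C = `|x|.
Proof. by rewrite /cmod /= expr0n/= addr0 sqrtr_sqr. Qed.

Lemma cmodX z n : cmod (z ^+ n) = cmod z ^+ n.
Proof. by elim: n => [|n ih]; rewrite ?expr0 ?cmod1// !exprS cmodM ih. Qed.

Lemma cmod_sum (I : Type) (s : seq I) (F : I -> R[i]) :
  cmod (\sum_(i <- s) F i) <= \sum_(i <- s) cmod (F i).
Proof.
elim: s => [|i s ih]; first by rewrite !big_nil cmod0.
by rewrite !big_cons (le_trans (cmodD _ _))// lerD2l.
Qed.

Lemma Re_cmod z : `|Re z| <= cmod z.
Proof. by case: z => a b; rewrite /cmod/= -sqrtr_sqr ler_wsqrtr// lerDl sqr_ge0. Qed.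

Lemma Im_cmod z : `|Im z| <= cmod z.
Proof. by case: z => a b; rewrite /cmod/= -sqrtr_sqr ler_wsqrtr// lerDr sqr_ge0. Qed.

Lemma cmod_ReIm z : cmod z <= `|Re z| + `|Im z|.
Proof.
case: z => a b; rewrite /cmod/= -[leRHS]ger0_norm ?addr_ge0// -sqrtr_sqr ler_wsqrtr//.
by rewrite sqrrD !real_normK ?num_real// lerD2r lerDl mulrn_wge0// mulr_ge0.
Qed.

Lemma cmod_cexpi (x : R) : cmod (cexpi x) = 1.
Proof. by rewrite /cmod/= cos2Dsin2 sqrtr1. Qed.

Lemma cexpiD (x y : R) : cexpi (x + y) = cexpi x * cexpi y.
Proof. by apply: complex_ext; rewrite ?ReM ?ImM/= ?cosD ?sinD//; ring. Qed.

Lemma cexpi0 : cexpi (0 : R) = 1.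
Proof. by apply: complex_ext; rewrite /= ?cos0 ?sin0. Qed.

End complex_modulus.

Section complex_transfer.
Context {d : measure_display} {X : measurableType d} {R : realType}.
Variables (m : probability X R) (T : X -> X).
Hypothesis hT : measure_preserving m T.
Implicit Types u v w : X -> R[i].
Local Notation Re := complex.Re.
Local Notation Im := complex.Im.

Definition cinteg u := integ m (fun x => Re (u x)) /\ integ m (fun x => Im (u x)).

Definition ctr u x : R[i] := tr m T (fun y => Re (u y)) x +i* tr m T (fun y => Im (u y)) x.

Lemma cintegD u v : cinteg u -> cinteg v -> cinteg (fun x => u x + v x).
Proof.
move=> [u1 u2] [v1 v2]; split.
  by rewrite (_ : (fun x => _) = fun x => Re (u x) + Re (v x)) ?funeqE => [|x]; [exact: integD|rewrite ReD].
by rewrite (_ : (fun x => _) = fun x => Im (u x) + Im (v x)) ?funeqE => [|x]; [exact: integD|rewrite ImD].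
Qed.

Lemma cintegZ (c : R[i]) u : cinteg u -> cinteg (fun x => c * u x).
Proof.
move=> [u1 u2]; split.
  rewrite (_ : (fun x => _) = fun x => Re c * Re (u x) - Im c * Im (u x)).
    by apply: integB; exact: integZ.
  by apply/funext => x; rewrite ReM.
rewrite (_ : (fun x => _) = fun x => Re c * Im (u x) + Im c * Re (u x)).
  by apply: integD; exact: integZ.
by apply/funext => x; rewrite ImM.
Qed.

Lemma cintegB u v : cinteg u -> cinteg v -> cinteg (fun x => u x - v x).
Proof.
move=> iu iv; have := cintegD iu (cintegZ (-1) iv).
by congr cinteg; apply/funext => x; rewrite mulN1r.
Qed.

Lemma ctr_integ u : cinteg u -> cinteg (ctr u).
Proof. by move=> [u1 u2]; split; exact: (tr_integ hT). Qed.

Lemma ctrD u v : cinteg u -> cinteg v ->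
  {ae m, forall x, ctr (fun y => u y + v y) x = ctr u x + ctr v x}.
Proof.
move=> [u1 u2] [v1 v2]; apply: filterS2 (trD hT u1 v1) (trD hT u2 v2) => x e1 e2.
apply: complex_ext; rewrite ?ReD ?ImD/=.
  by rewrite -e1; congr (tr m T _ x); apply/funext => y; rewrite ReD.
by rewrite -e2; congr (tr m T _ x); apply/funext => y; rewrite ImD.
Qed.

Lemma ctrZ (c : R[i]) u : cinteg u ->
  {ae m, forall x, ctr (fun y => c * u y) x = c * ctr u x}.
Proof.
move=> [u1 u2].
have h1 := trD hT (integZ (Re c) u1) (integZ (- Im c) u2).
have h2 := trD hT (integZ (Re c) u2) (integZ (Im c) u1).
apply: filterS3 h1 h2 (filterI (filterI (trZ hT (Re c) u1) (trZ hT (- Im c) u2))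
  (filterI (trZ hT (Re c) u2) (trZ hT (Im c) u1))) => x e1 e2 [[e3 e4] [e5 e6]].
apply: complex_ext; rewrite ?ReM ?ImM/=.
  rewrite -mulNr -e3 -e4 -e1; congr (tr m T _ x); apply/funext => y.
  by rewrite ReM mulNr.
by rewrite -e5 -e6 -e2; congr (tr m T _ x); apply/funext => y; rewrite ImM.
Qed.

Lemma ctr_congr u v : cinteg u -> cinteg v -> {ae m, forall x, u x = v x} ->
  {ae m, forall x, ctr u x = ctr v x}.
Proof.
move=> [u1 u2] [v1 v2] uv.
have h1 : {ae m, forall x, Re (u x) = Re (v x)} by apply: filterS uv => x ->.
have h2 : {ae m, forall x, Im (u x) = Im (v x)} by apply: filterS uv => x ->.
apply: filterS2 (tr_congr hT u1 v1 h1) (tr_congr hT u2 v2 h2) => x e1 e2.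
by rewrite /ctr e1 e2.
Qed.

Definition cdens u : R[i] := dens m (fun x => Re (u x)) setT +i* dens m (fun x => Im (u x)) setT.

Lemma cdensD u v : cinteg u -> cinteg v -> cdens (fun x => u x + v x) = cdens u + cdens v.
Proof.
move=> [u1 u2] [v1 v2]; apply: complex_ext; rewrite ?ReD ?ImD/= -densD//;
  by apply: dens_eq => x _; rewrite ?ReD ?ImD.
Qed.

Lemma cdensZ (c : R[i]) u : cinteg u -> cdens (fun x => c * u x) = c * cdens u.
Proof.
move=> [u1 u2]; apply: complex_ext; rewrite ?ReM ?ImM/= -!densZ//.
  by rewrite -densB//; try exact: integZ; apply: dens_eq => x _; rewrite ReM.
by rewrite -densD//; try exact: integZ; apply: dens_eq => x _; rewrite ImM.
Qed.

Lemma cdensB u v : cinteg u -> cinteg v -> cdens (fun x => u x - v x) = cdens u - cdens v.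
Proof.
move=> iu iv; rewrite -[- cdens v]mulN1r -cdensZ// -cdensD//; last exact: cintegZ.
by congr cdens; apply/funext => x; rewrite mulN1r.
Qed.

Lemma cdens_congr u v : cinteg u -> cinteg v -> {ae m, forall x, u x = v x} -> cdens u = cdens v.
Proof.
move=> [u1 u2] [v1 v2] uv; apply: complex_ext => /=;
  by apply: dens_ae_eq => //; apply: filterS uv => x ->.
Qed.

Lemma cdens_bound u (s : R) : cinteg u -> {ae m, forall x, cmod (u x) <= s} ->
  cmod (cdens u) <= 2 * s.
Proof.
move=> [u1 u2] us; rewrite (le_trans (cmod_ReIm _))//= mulr_natl mulr2n lerD//.
  rewrite -[leRHS]mulr1 -(mrT m); apply: dens_ae_bound => //.
  by apply: filterS us => x h _; rewrite (le_trans (Re_cmod _)).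
rewrite -[leRHS]mulr1 -(mrT m); apply: dens_ae_bound => //.
by apply: filterS us => x h _; rewrite (le_trans (Im_cmod _)).
Qed.

Lemma cinteg_bounded u (s : R) : cmeasurable u -> {ae m, forall x, cmod (u x) <= s} -> cinteg u.
Proof.
move=> [m1 m2] us; split.
  apply: (@integ_ae_bounded _ _ _ _ _ s) => //.
  by apply: filterS us => x; apply: le_trans; exact: Re_cmod.
apply: (@integ_ae_bounded _ _ _ _ _ s) => //.
by apply: filterS us => x; apply: le_trans; exact: Im_cmod.
Qed.

Lemma cmeasurableM u v : cmeasurable u -> cmeasurable v -> cmeasurable (fun x => u x * v x).
Proof.
move=> [u1 u2] [v1 v2]; split.
  rewrite (_ : (fun x => _) = fun x => Re (u x) * Re (v x) - Im (u x) * Im (v x)).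
    by apply: measurable_funB; exact: measurable_funM.
  by apply/funext => x; rewrite ReM.
rewrite (_ : (fun x => _) = fun x => Re (u x) * Im (v x) + Im (u x) * Re (v x)).
  by apply: measurable_funD; exact: measurable_funM.
by apply/funext => x; rewrite ImM.
Qed.

Lemma cinteg_meas u : cinteg u -> cmeasurable u.
Proof. by move=> [u1 u2]; split; [exact: integ_meas u1|exact: integ_meas u2]. Qed.

Lemma cintegM u v (M : R) : cmeasurable v -> (forall x, cmod (v x) <= M) -> cinteg u ->
  cinteg (fun x => v x * u x).
Proof.
move=> [v1 v2] vM [u1 u2].
have vR x : `|Re (v x)| <= M by exact: le_trans (Re_cmod _) (vM x).
have vI x : `|Im (v x)| <= M by exact: le_trans (Im_cmod _) (vM x).
split.
  rewrite (_ : (fun x => _) = fun x => Re (v x) * Re (u x) - Im (v x) * Im (u x)).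
    by apply: integB; [exact: (integM_bounded v1 vR)|exact: (integM_bounded v2 vI)].
  by apply/funext => x; rewrite ReM.
rewrite (_ : (fun x => _) = fun x => Re (v x) * Im (u x) + Im (v x) * Re (u x)).
  by apply: integD; [exact: (integM_bounded v1 vR)|exact: (integM_bounded v2 vI)].
by apply/funext => x; rewrite ImM.
Qed.

Lemma cmeasurable_comp v : cmeasurable v -> cmeasurable (fun x => v (T x)).
Proof.
by move=> [v1 v2]; split; [apply: (measurableT_comp v1)|apply: (measurableT_comp v2)];
  exact: preserving_fun hT.
Qed.

Lemma ctr_test u v (M : R) : cinteg u -> cmeasurable v -> (forall x, cmod (v x) <= M) ->
  cdens (fun x => v x * ctr u x) = cdens (fun x => v (T x) * u x).
Proof.
move=> iu mv vM; have [u1 u2] := iu; have [v1 v2] := mv; have [t1 t2] := ctr_integ iu.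
have [w1 w2] := cmeasurable_comp mv.
have vR x : `|Re (v x)| <= M by exact: le_trans (Re_cmod _) (vM x).
have vI x : `|Im (v x)| <= M by exact: le_trans (Im_cmod _) (vM x).
have h (g : X -> R) (k : X -> R[i]) : measurable_fun setT g -> (forall x, `|g x| <= M) ->
    cinteg k -> (dens m (fun x => g x * Re (ctr k x)) setT = dens m (fun x => g (T x) * Re (k x)) setT) /\
    (dens m (fun x => g x * Im (ctr k x)) setT = dens m (fun x => g (T x) * Im (k x)) setT).
  move=> mg gM [k1 k2]; split; apply: (tr_test hT (M := M)) => //; exact: aeW.
have [a1 a2] := h _ _ v1 vR iu; have [b1 b2] := h _ _ v2 vI iu.
apply: complex_ext => /=.
  transitivity (dens m (fun x => Re (v x) * Re (ctr u x)) setT - dens m (fun x => Im (v x) * Im (ctr u x)) setT).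
    rewrite -densB//; [|exact: (integM_bounded v1 vR)|exact: (integM_bounded v2 vI)].
    by apply: dens_eq => x _; rewrite ReM.
  rewrite a1 b2 -densB//; [|exact: (integM_bounded w1 (fun x => vR (T x)))|exact: (integM_bounded w2 (fun x => vI (T x)))].
  by apply: dens_eq => x _; rewrite ReM.
transitivity (dens m (fun x => Re (v x) * Im (ctr u x)) setT + dens m (fun x => Im (v x) * Re (ctr u x)) setT).
  rewrite -densD//; [|exact: (integM_bounded v1 vR)|exact: (integM_bounded v2 vI)].
  by apply: dens_eq => x _; rewrite ImM.
rewrite a2 b1 -densD//; [|exact: (integM_bounded w1 (fun x => vR (T x)))|exact: (integM_bounded w2 (fun x => vI (T x)))].
by apply: dens_eq => x _; rewrite ImM.
Qed.

Definition clazy u x : R[i] :=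
  lazy m T (fun y => Re (u y)) x +i* lazy m T (fun y => Im (u y)) x.

Lemma clazyE u x : clazy u x = 2^-1 * (u x + ctr u x).
Proof.
have -> : (2^-1 : R[i]) = (2^-1 : R)%:C by rewrite fmorphV rmorph_nat.
by apply: complex_ext; rewrite /clazy /lazy ?ReM ?ImM ?ReD ?ImD/=; ring.
Qed.

Lemma clazy_integ u : cinteg u -> cinteg (clazy u).
Proof. by move=> [u1 u2]; split; exact: (lazy_integ hT). Qed.

Lemma clazyD u v : cinteg u -> cinteg v ->
  {ae m, forall x, clazy (fun y => u y + v y) x = clazy u x + clazy v x}.
Proof.
move=> iu iv; apply: filterS (ctrD iu iv) => x e; rewrite !clazyE e; ring.
Qed.

Lemma clazy_congr u v : cinteg u -> cinteg v -> {ae m, forall x, u x = v x} ->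
  {ae m, forall x, clazy u x = clazy v x}.
Proof.
by move=> iu iv uv; apply: filterS2 (uv) (ctr_congr iu iv uv) => x e1 e2; rewrite !clazyE e1 e2.
Qed.

Lemma clazy_dens u : cinteg u -> cdens (clazy u) = cdens u.
Proof.
by move=> [u1 u2]; apply: complex_ext; rewrite /= (lazy_dens hT)// preimage_setT; lra.
Qed.

Variable e : X -> R[i].
Hypotheses (me : cmeasurable e) (e1 : forall x, cmod (e x) = 1).

Definition twist u x := e x * u x.

Definition clazy_twist u x := 2^-1 * (u x + ctr (twist u) x).

Lemma twist_integ u : cinteg u -> cinteg (twist u).
Proof. by apply: (cintegM (M := 1)) => // x; rewrite e1. Qed.

Lemma clazy_twist_integ u : cinteg u -> cinteg (clazy_twist u).
Proof.
by move=> iu; apply/cintegZ/cintegD => //; exact/ctr_integ/twist_integ.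
Qed.

Lemma clazy_twistD u v : cinteg u -> cinteg v ->
  {ae m, forall x, clazy_twist (fun y => u y + v y) x = clazy_twist u x + clazy_twist v x}.
Proof.
move=> iu iv; apply: filterS (ctrD (twist_integ iu) (twist_integ iv)) => x h.
rewrite /clazy_twist (_ : twist _ = fun y => twist u y + twist v y); last first.
  by apply/funext => y; rewrite /twist mulrDr.
by rewrite h; ring.
Qed.

Lemma clazy_twistZ (c : R[i]) u : cinteg u ->
  {ae m, forall x, clazy_twist (fun y => c * u y) x = c * clazy_twist u x}.
Proof.
move=> iu; apply: filterS (ctrZ c (twist_integ iu)) => x h.
rewrite /clazy_twist (_ : twist _ = fun y => c * twist u y); last first.
  by apply/funext => y; rewrite /twist mulrCA.
by rewrite h; ring.
Qed.

Lemma clazy_twist_congr u v : cinteg u -> cinteg v -> {ae m, forall x, u x = v x} ->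
  {ae m, forall x, clazy_twist u x = clazy_twist v x}.
Proof.
move=> iu iv uv.
have tuv : {ae m, forall x, twist u x = twist v x} by apply: filterS uv => x h; rewrite /twist h.
apply: filterS2 (uv) (ctr_congr (twist_integ iu) (twist_integ iv) tuv) => x h1 h2.
by rewrite /clazy_twist h1 h2.
Qed.

Lemma iter_clazy_twist_integ n u : cinteg u -> cinteg (iter n clazy_twist u).
Proof. by move=> iu; elim: n => [//|n ih] /=; exact: clazy_twist_integ. Qed.

End complex_transfer.

Section unimodular_multiplier.
Context {d : measure_display} {X : measurableType d} {R : realType}.
Variable f : X -> R.

Definition expif (t : R) x := cexpi (t * f x).

Lemma expif_cmod t x : cmod (expif t x) = 1. Proof. exact: cmod_cexpi. Qed.

Lemma expif_meas t : measurable_fun setT f -> cmeasurable (expif t).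
Proof.
move=> mf; have mtf : measurable_fun setT (fun x => t * f x) by exact: measurable_funM.
split; apply: (measurableT_comp _ mtf); apply: continuous_measurable_fun.
  exact: continuous_cos.
exact: continuous_sin.
Qed.

End unimodular_multiplier.

Section complex_norm.
Context {R : realType} {d : measure_display} {X : metricMeasurableType R d}.
Variables (m : probability X R) (T : X -> X) (A I : nat -> set X)
  (G : nat -> X -> R) (gam D C : R).
Hypothesis mc : markov_coding m T A I G gam D C.
Variable eta : R.
Hypothesis eta01 : 0 < eta <= 1.
Implicit Types (E B : set X) (u v w : X -> R[i]).
Local Notation Re := complex.Re.
Local Notation Im := complex.Im.

Let hT := mc_preserving mc.
Let mA := mc_A mc.
Let D0 : 0 <= D. Proof. exact: le_trans ler01 (mc_D mc). Qed.
Let C0 := mc_C mc.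
Let eta0 : 0 < eta. Proof. by case/andP: eta01. Qed.
Local Notation component := (component m T A).
Local Notation nrm := (nrm m A gam D C eta).
Local Notation Lam := (Lam gam D C eta).
Local Notation clazy := (clazy m T).

Definition cnrm u (Z : R) := nrm (fun x => Re (u x)) Z /\ nrm (fun x => Im (u x)) Z.

Lemma cnrm_integ u Z : cnrm u Z -> cinteg m u.
Proof. by move=> [[? _ _] [? _ _]]. Qed.

Lemma cnrm_ge0 u Z : cnrm u Z -> 0 <= Z.
Proof. by move=> [/nrm_ge0]. Qed.

Lemma cnrm_le u Z Z' : Z <= Z' -> cnrm u Z -> cnrm u Z'.
Proof. by move=> ZZ' [h1 h2]; split; apply: (nrm_le mc eta01) ZZ' _. Qed.

Lemma cnrm_ae_eq u v Z : cinteg m v -> {ae m, forall x, u x = v x} -> cnrm u Z -> cnrm v Z.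
Proof.
move=> [v1 v2] uv [h1 h2]; split.
  by apply: nrm_ae_eq h1 => //; apply: filterS uv => x ->.
by apply: nrm_ae_eq h2 => //; apply: filterS uv => x ->.
Qed.

Lemma cnrmD u v Z Z' : cnrm u Z -> cnrm v Z' -> cnrm (fun x => u x + v x) (Z + Z').
Proof.
move=> [u1 u2] [v1 v2]; split.
  rewrite (_ : (fun x => _) = fun x => Re (u x) + Re (v x)); first exact: nrmD.
  by apply/funext => x; rewrite ReD.
rewrite (_ : (fun x => _) = fun x => Im (u x) + Im (v x)); first exact: nrmD.
by apply/funext => x; rewrite ImD.
Qed.

Lemma cnrmZ (c : R[i]) u Z : cnrm u Z -> cnrm (fun x => c * u x) (2 * cmod c * Z).
Proof.
move=> nu; have Z0 := cnrm_ge0 nu; case: nu => u1 u2.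
have r1 := ler_wpM2r Z0 (Re_cmod c); have r2 := ler_wpM2r Z0 (Im_cmod c).
split.
  rewrite (_ : (fun x => _) = fun x => Re c * Re (u x) + (- Im c) * Im (u x)).
    apply: (nrm_le mc eta01) (nrmD (nrmZ (Re c) u1) (nrmZ (- Im c) u2)).
    by rewrite normrN; lra.
  by apply/funext => x; rewrite ReM mulNr.
rewrite (_ : (fun x => _) = fun x => Re c * Im (u x) + Im c * Re (u x)).
  by apply: (nrm_le mc eta01) (nrmD (nrmZ (Re c) u2) (nrmZ (Im c) u1)); lra.
by apply/funext => x; rewrite ImM.
Qed.

Lemma cnrm_cdens u Z : cnrm u Z -> cmod (cdens m u) <= 2 * Z.
Proof.
move=> [[u1 b1 _] [u2 b2 _]]; rewrite (le_trans (cmod_ReIm _))//= mulr_natl mulr2n lerD//.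
  by rewrite -[leRHS]mulr1 -(mrT m); apply: dens_ae_bound => //; apply: filterS b1.
by rewrite -[leRHS]mulr1 -(mrT m); apply: dens_ae_bound => //; apply: filterS b2.
Qed.

Lemma iter_clazyE j u : iter j clazy u =
  fun x => iter j (lazy m T) (fun y => Re (u y)) x +i* iter j (lazy m T) (fun y => Im (u y)) x.
Proof.
elim: j => [|j ih].
  by apply/funext => x /=; case: (u x).
by rewrite iterS ih.
Qed.

Lemma iter_clazy_integ j u : cinteg m u -> cinteg m (iter j clazy u).
Proof. by move=> iu; elim: j => [//|j ih] /=; exact: clazy_integ. Qed.

Lemma iter_clazy_congr j u v : cinteg m u -> cinteg m v -> {ae m, forall x, u x = v x} ->
  {ae m, forall x, iter j clazy u x = iter j clazy v x}.
Proof.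
move=> iu iv uv; elim: j => [//|j ih] /=.
by apply: clazy_congr => //; exact: iter_clazy_integ.
Qed.

Lemma iter_clazyD j u v : cinteg m u -> cinteg m v ->
  {ae m, forall x, iter j clazy (fun y => u y + v y) x = iter j clazy u x + iter j clazy v x}.
Proof.
move=> iu iv; elim: j => [|j ih] /=; first exact: aeW.
have [a b] := (iter_clazy_integ j iu, iter_clazy_integ j iv).
have c := iter_clazy_integ j (cintegD iu iv).
by apply: filterS2 (clazy_congr hT c (cintegD a b) ih) (clazyD hT a b) => x ->.
Qed.

Definition csupport i u := {ae m, forall x, ~ component i x -> u x = 0}.

Lemma ctr_support i u : cinteg m u -> csupport i u -> csupport i (ctr m T u).
Proof.
move=> [u1 u2] su.
have s1 : {ae m, forall x, ~ component i x -> Re (u x) = 0} by apply: filterS su => x h /h ->.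
have s2 : {ae m, forall x, ~ component i x -> Im (u x) = 0} by apply: filterS su => x h /h ->.
apply: filterS2 (tr_support mc u1 s1) (tr_support mc u2 s2) => x h1 h2 nY.
by apply: complex_ext; rewrite /= ?h1 ?h2.
Qed.

Section perturbation.
Variables (f : X -> R) (B : nat -> R) (S : R).
Hypotheses (mf : measurable_fun setT f) (B0 : forall i, 0 <= B i)
  (fB : forall i x, A i x -> `|f x| `^ eta <= B i)
  (fH : forall i x y, A i x -> A i y -> `|f x - f y| `^ eta <= B i * mdist x y `^ eta)
  (BS : forall n, \sum_(i < n) B i * mr m (A i) <= S).

Let S0 : 0 <= S. Proof. by have := BS 0; rewrite big_ord0. Qed.

Lemma multiplier_nrm : exists2 kap : R, 0 < kap & forall (g : X -> R) (tau : R) (u : X -> R) Z,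
  measurable_fun setT g -> 0 <= tau -> (forall x, `|g x| <= 2) ->
  (forall i x, A i x -> `|g x| <= tau * B i) ->
  (forall i x y, A i x -> A i y -> `|g x - g y| <= tau * B i * mdist x y `^ eta) ->
  nrm u Z -> nrm (tr m T (fun y => g y * u y)) (kap * tau * Z).
Proof.
have [K1 K1gt0 K1up] := branch_upper mc; have L1 := Lam_ge1 mc eta01.
pose kap := K1 * S * (Lam + 1 + C * D).
have cd0 : 0 <= C * D by rewrite mulr_ge0.
have L0 : 0 <= Lam by exact: le_trans ler01 L1.
have kap0 : 0 <= kap.
  apply: mulr_ge0; first by apply: mulr_ge0 => //; exact: ltW.
  exact: addr_ge0 (addr_ge0 L0 ler01) cd0.
exists (kap + 1); first by rewrite ltr_wpDl.
move=> g tau u Z mg tau0 g2 gB gH nu; have Z0 := nrm_ge0 nu; case: nu => iu us hu.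
have [//|||] := @tr_mul_hol _ _ _ _ _ _ _ _ _ _ _ mc _ eta01 _ K1gt0 K1up u g
  (fun i => tau * B i) (tau * S) (Lam * Z) Z mg g2 _ gB gH _ iu _ us hu.
- by move=> i; rewrite mulr_ge0.
- move=> n; rewrite (eq_bigr (fun i : 'I_n => tau * (B i * mr m (A i)))); last by move=> i _; rewrite mulrA.
  by rewrite -mulr_sumr; apply: ler_wpM2l => //; exact: BS.
- by rewrite mulr_ge0//; lra.
move=> h1 h2.
have tZ : 0 <= tau * Z by rewrite mulr_ge0.
have e0 : K1 * (tau * S) * (Lam * Z + Z + C * D * Z) = kap * tau * Z by rewrite /kap; ring.
have k1 : kap * tau * Z <= (kap + 1) * tau * Z by rewrite -!(mulrA _ tau) ler_wpM2r// lerDl.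
split.
- by apply/(tr_integ hT)/(integM_bounded mg g2).
- apply: filterS h1 => x /le_trans; apply; apply: le_trans k1.
  rewrite -e0 -[leLHS]mulr1 !mulrA (_ : _ * Z * 1 = K1 * tau * S * Z); last by rewrite mulr1.
  rewrite -subr_ge0 (_ : _ - _ = K1 * S * (tau * Z) * (Lam + C * D)); last by ring.
  apply: mulr_ge0; last exact: addr_ge0 L0 cd0.
  by apply: mulr_ge0 => //; apply: mulr_ge0 => //; exact: ltW.
- apply: hol_le h2; rewrite e0; apply: (le_trans k1); rewrite ler_peMl//.
  by rewrite -mulrA mulr_ge0// addr_ge0.
Qed.

Lemma le_powR_min (x a : R) : 0 <= a -> x <= 2 -> x <= a -> x <= 2 * a `^ eta.
Proof.
have /andP[_ eta1] := eta01.
move=> a0 x2 xa; have [a1|a1] := leP a 1; last first.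
  by rewrite (le_trans x2)// ler_peMr// -(powRr0 a) ler_powR// ltW.
have [a00|an0] := eqVneq a 0; first by rewrite (le_trans xa)// a00 mulr_ge0 ?powR_ge0.
rewrite (le_trans xa)// (le_trans (ger1_powR _ eta1))//; first by rewrite lt0r an0 a0.
by rewrite ler_peMl ?powR_ge0// ler1n.
Qed.

Local Notation K t := (clazy_twist m T (expif f t)).

Definition pert t u x := K t u x - clazy u x.

Lemma pert_integ t u : cinteg m u -> cinteg m (pert t u).
Proof.
move=> iu; apply: cintegB; last exact: clazy_integ.
by apply: (clazy_twist_integ hT) => //; [exact: expif_meas|exact: expif_cmod].
Qed.

Lemma pert_nrm : exists2 kap : R, 0 < kap & forall t u Z, cnrm u Z ->
  cnrm (pert t u) (kap * `|t| `^ eta * Z).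
Proof.
have [kap k0 hk] := multiplier_nrm; exists (2 * kap); first by rewrite mulr_gt0.
move=> t u Z nu; have Z0 := cnrm_ge0 nu; have iu := cnrm_integ nu.
have [u1 u2] := nu; have [iu1 iu2] := iu.
pose tau := 2 * `|t| `^ eta; have tau0 : 0 <= tau by rewrite mulr_ge0 ?powR_ge0.
have e1 (a b : R) : `|t * a - t * b| `^ eta = `|t| `^ eta * `|a - b| `^ eta.
  by rewrite -mulrBr normrM powRM.
have lip i x y : A i x -> A i y -> 2 * `|t * f x - t * f y| `^ eta <= tau * B i * mdist x y `^ eta.
  by move=> Ax Ay; rewrite e1 /tau -!mulrA !ler_wpM2l ?powR_ge0//; exact: fH.
have bnd i x : A i x -> 2 * `|t * f x - t * 0| `^ eta <= tau * B i.
  by move=> Ax; rewrite e1 subr0 /tau -!mulrA !ler_wpM2l ?powR_ge0//; exact: fB.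
have mtf : measurable_fun setT (fun x => t * f x) by exact: measurable_funM.
pose h x := cos (t * f x) - 1; pose s x := sin (t * f x).
have [mc' ms] := expif_meas t mf.
have mh : measurable_fun setT h by apply: measurable_funB.
have h2 (a b : R) : `|cos a - cos b| <= 2.
  by rewrite (le_trans (ler_normB _ _))// (_ : 2 = 1 + 1 :> R)// lerD// ler_norml cos_geN1 cos_le1.
have s2 (a b : R) : `|sin a - sin b| <= 2.
  by rewrite (le_trans (ler_normB _ _))// (_ : 2 = 1 + 1 :> R)// lerD// ler_norml sin_geN1 sin_le1.
have cpow (a b : R) : `|cos a - cos b| <= 2 * `|a - b| `^ eta.
  by apply: le_powR_min => //; case: (cos_sin_lip a b).
have spow (a b : R) : `|sin a - sin b| <= 2 * `|a - b| `^ eta.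
  by apply: le_powR_min => //; case: (cos_sin_lip a b).
have hE x : h x = cos (t * f x) - cos (t * 0) by rewrite mulr0 cos0.
have sE x : s x = sin (t * f x) - sin (t * 0) by rewrite mulr0 sin0 subr0.
have hh (v : X -> R) : nrm v Z -> nrm (tr m T (fun y => h y * v y)) (kap * tau * Z).
  apply: hk => //.
  - by move=> x; rewrite hE.
  - move=> i x Ax; apply: le_trans (bnd i x Ax).
    by rewrite hE.
  - move=> i x y Ax Ay; apply: le_trans (lip i x y Ax Ay).
    by rewrite /h opprB addrA subrK.
have hs (v : X -> R) : nrm v Z -> nrm (tr m T (fun y => s y * v y)) (kap * tau * Z).
  apply: hk => //.
  - by move=> x; rewrite sE.
  - move=> i x Ax; apply: le_trans (bnd i x Ax).
    by rewrite sE.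
  - move=> i x y Ax Ay; apply: le_trans (lip i x y Ax Ay); exact: spow.
have hb x : `|h x| <= 2 by rewrite hE.
have sb x : `|s x| <= 2 by rewrite sE.
have trS (v w : X -> R) : nrm v Z -> nrm w Z ->
    {ae m, forall x, tr m T (fun y => v y + (h y * v y + s y * w y)) x =
      tr m T v x + (tr m T (fun y => h y * v y) x + tr m T (fun y => s y * w y) x)}.
  move=> nv nw; have iv := nrm_integ nv; have iw := nrm_integ nw.
  have i1 := integM_bounded mh hb iv; have i2 := integM_bounded ms sb iw.
  apply: filterS2 (trD hT iv (integD i1 i2)) (trD hT i1 i2) => x -> ->//.
have half (v w : X -> R) : nrm v Z -> nrm w Z ->
  nrm (fun x => 2^-1 * (tr m T (fun y => h y * v y) x + tr m T (fun y => s y * w y) x))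
    (2 * kap * `|t| `^ eta * Z).
  move=> nv nw; have := nrmZ 2^-1 (nrmD (hh v nv) (hs w nw)).
  by apply: (nrm_le mc eta01); rewrite ger0_norm// /tau; lra.
have [p1 p2] := pert_integ t iu.
have eh : (2^-1 : R[i]) = (2^-1 : R)%:C by rewrite fmorphV rmorph_nat.
have nu2 : nrm (fun x => -1 * Im (u x)) Z.
  by have := nrmZ (-1) u2; rewrite normrN1 mul1r.
split.
  apply: nrm_ae_eq p1 _ (half _ _ u1 nu2).
  apply: filterS (trS _ _ u1 nu2) => x e.
  rewrite /pert clazyE /clazy_twist eh !(ReD,ReN,ReM)/=.
  rewrite (_ : (fun y => Re (twist _ _ y)) = fun y => Re (u y) + (h y * Re (u y) + s y * (-1 * Im (u y)))).
    by rewrite e; ring.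
  by apply/funext => y; rewrite /twist ReM/= /h /s; ring.
apply: nrm_ae_eq p2 _ (half _ _ u2 u1).
apply: filterS (trS _ _ u2 u1) => x e.
rewrite /pert clazyE /clazy_twist eh !(ImD,ImN,ImM)/=.
rewrite (_ : (fun y => Im (twist _ _ y)) = fun y => Im (u y) + (h y * Im (u y) + s y * Re (u y))).
  by rewrite e; ring.
by apply/funext => y; rewrite /twist ImM/= /h /s; ring.
Qed.

End perturbation.
End complex_norm.

Lemma normalized_step_id (F : fieldType) (e en a p w : F) : e != 0 ->
  a + ((e^-1 - 1) * a + e^-1 * (p + - (e - en) * w)) = e^-1 * (a + p + en * w) - w.
Proof. by move=> e0; field. Qed.

Section normalized_iterates.
Context {R : realType} {d : measure_display} {X : metricMeasurableType R d}.
Variables (m : probability X R) (T : X -> X) (A I : nat -> set X)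
  (G : nat -> X -> R) (gam D C : R).
Hypothesis mc : markov_coding m T A I G gam D C.
Variable eta : R.
Hypothesis eta01 : 0 < eta <= 1.
Implicit Types (E : set X) (u v : X -> R[i]).
Local Notation Re := complex.Re.
Local Notation Im := complex.Im.
Let hT := mc_preserving mc.
Local Notation cnrm := (cnrm m A gam D C eta).
Local Notation clazy := (clazy m T).
Local Notation csupport := (csupport m T A).
Variables (f : X -> R) (mf : measurable_fun setT f).
Local Notation K t := (clazy_twist m T (expif f t)).
Local Notation pt t := (pert m T f t).
Variables (kap : R) (kap0 : 0 < kap).
Hypothesis hpert : forall t u Z, cnrm u Z -> cnrm (pt t u) (kap * `|t| `^ eta * Z).
Variable i : nat.
Hypothesis Ai0 : 0 < mr m (A i).
Local Notation Y := (component m T A i).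
Variables (r Bc : R).
Hypotheses (r01 : 0 < r < 1) (Bc1 : 1 <= Bc).
Hypothesis hgap : forall (u : X -> R) Z j, mean_zero m T A i u -> nrm m A gam D C eta u Z ->
  nrm m A gam D C eta (iter j (lazy m T) u) (Bc * r ^+ j * Z).

Let mY : measurable Y := component_meas mc i.
Let K_integ t u : cinteg m u -> cinteg m (K t u).
Proof. by apply: clazy_twist_integ => //; [exact: expif_meas|exact: expif_cmod]. Qed.

Lemma component_mr_gt0 : 0 < mr m Y.
Proof.
apply: (lt_le_trans Ai0); apply: mr_le => //; first exact: (mc_A mc).
by move=> x Ax; exists i => //; exact: reach_refl.
Qed.
Let b0 := component_mr_gt0.

Definition cmean u : R[i] := ((mr m Y)^-1)%:C * cdens m u.

Lemma cmeanD u v : cinteg m u -> cinteg m v -> cmean (fun x => u x + v x) = cmean u + cmean v.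
Proof. by move=> iu iv; rewrite /cmean cdensD// mulrDr. Qed.

Lemma cmeanZ (c : R[i]) u : cinteg m u -> cmean (fun x => c * u x) = c * cmean u.
Proof. by move=> iu; rewrite /cmean cdensZ// mulrCA. Qed.

Lemma cmean_congr u v : cinteg m u -> cinteg m v -> {ae m, forall x, u x = v x} -> cmean u = cmean v.
Proof. by move=> iu iv uv; rewrite /cmean (cdens_congr iu iv uv). Qed.

Lemma cmean_lazy u : cinteg m u -> cmean (clazy u) = cmean u.
Proof. by move=> iu; rewrite /cmean (clazy_dens hT). Qed.

Lemma cmean_le u Z : cnrm u Z -> cmod (cmean u) <= 2 * Z / mr m Y.
Proof.
move=> nu; rewrite /cmean cmodM cmodR ger0_norm ?invr_ge0 ?mr_ge0// mulrC.
by rewrite ler_wpM2r ?invr_ge0 ?mr_ge0//; exact: cnrm_cdens nu.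
Qed.

Definition cmz u := csupport i u /\ cmean u = 0.

Lemma cmz_cdens u : cmean u = 0 -> cdens m u = 0.
Proof.
move=> /eqP; rewrite mulf_eq0 => /orP[/eqP h|/eqP//].
have : (mr m Y)^-1 = 0 by have := congr1 (@complex.Re R) h.
by move/eqP; rewrite invr_eq0 gt_eqF.
Qed.

Lemma K_support t u : cinteg m u -> csupport i u -> csupport i (K t u).
Proof.
move=> iu su; have it : cinteg m (twist (expif f t) u).
  by apply: twist_integ => //; [exact: expif_meas|exact: expif_cmod].
have st : csupport i (twist (expif f t) u).
  by apply: filterS su => x h /h e; rewrite /twist e mulr0.
apply: filterS2 (su) (ctr_support mc it st) => x h1 h2 nY.
by rewrite /clazy_twist h1// h2// addr0 mulr0.
Qed.

Lemma clazy_support u : cinteg m u -> csupport i u -> csupport i (clazy u).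
Proof.
move=> iu su; apply: filterS2 (su) (ctr_support mc iu su) => x h1 h2 nY.
by rewrite clazyE h1// h2// addr0 mulr0.
Qed.

Definition anrm u (Z : R) := cinteg m u /\ forall j, cnrm (iter j clazy u) (r ^+ j * Z).

Lemma anrm_of_cnrm u Z : cmz u -> cnrm u Z -> anrm u (Bc * Z).
Proof.
move=> [su /cmz_cdens zu] nu; have Z0 := cnrm_ge0 nu; split; first exact: cnrm_integ nu.
move=> j; rewrite iter_clazyE; case: nu => u1 u2.
have z1 : mean_zero m T A i (fun x => Re (u x)).
  split; first by apply: filterS su => x h /h ->.
  by have := congr1 (@complex.Re R) zu.
have z2 : mean_zero m T A i (fun x => Im (u x)).
  split; first by apply: filterS su => x h /h ->.
  by have := congr1 (@complex.Im R) zu.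
rewrite mulrCA mulrA.
by split; [exact: hgap z1 u1|exact: hgap z2 u2].
Qed.

Lemma anrm_cnrm u Z : anrm u Z -> cnrm u Z.
Proof. by move=> [_ /(_ 0%N)]; rewrite expr0 mul1r. Qed.

Lemma anrm_lazy u Z : anrm u Z -> anrm (clazy u) (r * Z).
Proof.
move=> [iu h]; split; first exact: clazy_integ.
by move=> j; rewrite -iterSr mulrA -exprSr; exact: h.
Qed.

Lemma anrmD u v Z Z' : anrm u Z -> anrm v Z' -> anrm (fun x => u x + v x) (Z + Z').
Proof.
move=> [iu hu] [iv hv]; split; first exact: cintegD.
move=> j; have := iter_clazyD mc j iu iv; rewrite mulrDr => h.
have hj := cnrmD (hu j) (hv j).
apply: (cnrm_ae_eq _ _ hj); first by apply: (iter_clazy_integ mc); exact: cintegD.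
by apply: filterS h => x ->.
Qed.

Lemma anrm_ae_eq u v Z : cinteg m v -> {ae m, forall x, u x = v x} -> anrm u Z -> anrm v Z.
Proof.
move=> iv uv [iu h]; split => // j; apply: cnrm_ae_eq (h j).
  exact: (iter_clazy_integ mc).
exact: (iter_clazy_congr mc).
Qed.

Lemma anrm_le u Z Z' : Z <= Z' -> anrm u Z -> anrm u Z'.
Proof.
move=> ZZ' [iu h]; split => // j; apply: (cnrm_le mc eta01) (h j).
by case/andP: r01 => r0 _; rewrite ler_wpM2l// exprn_ge0// ltW.
Qed.

Definition cone x : R[i] := (\1_Y x)%:C.

Lemma cone_nrm : cnrm cone 1.
Proof.
have L0 := le_trans ler01 (Lam_ge1 mc eta01).
have i1 : integ m (\1_Y : X -> R) by exact: integrable_indic.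
split; split => //=.
- by apply: aeW => x; rewrite indicE ger0_norm// lern1 leq_b1.
- by apply: hol_le (component_hol mc eta i); rewrite mulr1.
- exact: integ_cst.
- by apply: aeW => x; rewrite normr0.
- by move=> j; apply: aeW => -[x y] /= _ _; rewrite subrr normr0 mulr_ge0 ?powR_ge0 ?mulr1.
Qed.

Lemma cone_support : csupport i cone.
Proof. by apply: aeW => x nY; rewrite /cone indicE memNset. Qed.

Lemma cone_mean : cmean cone = 1.
Proof.
rewrite /cmean; have -> : cdens m cone = (mr m Y)%:C.
  apply: complex_ext => /=; last by rewrite dens_cst// mul0r.
  have -> : dens m (fun x => \1_Y x : R) setT = dens m (fun x => 1 * \1_Y x) setT.
    by apply: dens_eq => x _; rewrite mul1r.
  by rewrite (dens_indic m (fun=> 1)) setTI dens_cst ?mul1r.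
by rewrite -rmorphM mulVf ?gt_eqF.
Qed.

Lemma cone_lazy : {ae m, forall x, clazy cone x = cone x}.
Proof.
have [i1 _] := cnrm_integ cone_nrm.
have h1 : {ae m, forall x, tr m T (\1_Y : X -> R) x = \1_Y x}.
  apply: (tr_ae_eq hT) => // E mE; have mTE := preimage_meas hT mE.
  have e (F : set X) : measurable F -> dens m (\1_Y : X -> R) F = mr m (F `&` Y).
    move=> mF; have -> : dens m (\1_Y : X -> R) F = dens m (fun x => 1 * \1_Y x) F.
      by apply: dens_eq => x _; rewrite mul1r.
    by rewrite (dens_indic m (fun=> 1)) dens_cst ?mul1r//; exact: measurableI.
  rewrite !e//; have := component_lazy_set mc i 1 mE => /=; lra.
have h2 : {ae m, forall x, tr m T (fun=> 0) x = (0 : R)}.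
  apply: (tr_ae_eq hT); [exact: integ_cst|exact: integ_cst|].
  by move=> E mE; rewrite !dens_cst ?mul0r//; exact: (preimage_meas hT mE).
apply: filterS2 h1 h2 => x e1 e2.
by apply: complex_ext; rewrite /clazy/= /lazy ?e1 ?e2; lra.
Qed.

Variable t : R.
Let Q := Bc * kap * (48 / mr m Y + 4).
Let tau := `|t| `^ eta.
Hypothesis small : Q * tau <= (1 - r) / 2.
Let rho := (1 + r) / 2.

Let tau0 : 0 <= tau. Proof. exact: powR_ge0. Qed.
Let ib0 : 0 < (mr m Y)^-1. Proof. by rewrite invr_gt0. Qed.
Let Q48 : kap * (48 / mr m Y + 4) * tau <= Q * tau.
Proof.
rewrite /Q ler_wpM2r// -mulrA ler_peMl// mulr_ge0// ?(ltW kap0)//.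
by rewrite addr_ge0// mulr_ge0// ltW.
Qed.
Let Q0 : 0 <= Q * tau.
Proof.
apply: le_trans Q48; rewrite !mulr_ge0 ?(ltW kap0)//.
by rewrite addr_ge0// mulr_ge0// ltW.
Qed.
Let ktb : kap * tau / mr m Y <= 1 / 96.
Proof.
have := le_trans Q48 small; have kt : 0 <= kap * tau by rewrite mulr_ge0// ltW.
case/andP: r01 => r0 _.
rewrite (_ : kap * _ * tau = 48 * (kap * tau / mr m Y) + 4 * (kap * tau)); last by ring.
lra.
Qed.

Definition nstep u x := (cmean (K t u))^-1 * K t u x.
Definition niter n := iter n nstep cone.
Definition nfactor n := cmean (K t (niter n)).

Lemma niter_integ n : cinteg m (niter n).
Proof.
elim: n => [|n ih]; first exact: cnrm_integ cone_nrm.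
by apply: cintegZ; exact: K_integ.
Qed.

Lemma niter_support n : csupport i (niter n).
Proof.
elim: n => [|n ih]; first exact: cone_support.
apply: filterS (K_support t (niter_integ n) ih) => x h /h e.
by rewrite /niter /= /nstep -/(niter n) e mulr0.
Qed.

Lemma K_split u : K t u = fun x => clazy u x + pt t u x.
Proof. by apply/funext => x; rewrite /pert addrC subrK. Qed.

Let delta n x := niter n.+1 x - niter n x.

Lemma nuE n : cmean (niter n) = 1 -> nfactor n - 1 = cmean (pt t (niter n)).
Proof.
move=> h; have iu := niter_integ n.
have il := clazy_integ hT iu; have ip := pert_integ mc mf t iu.
by rewrite /nfactor K_split (cmeanD il ip) (cmean_lazy iu) h addrAC subrr add0r.
Qed.

Lemma nfactor_near n : cmean (niter n) = 1 -> cnrm (niter n) 2 ->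
  cmod (nfactor n - 1) <= 4 * (kap * tau / mr m Y).
Proof.
move=> h1 h2; rewrite nuE// (le_trans (cmean_le (hpert t h2)))//.
by rewrite le_eqVlt; apply/orP; left; apply/eqP; rewrite -/tau; ring.
Qed.

Lemma nfactor_inv n : cmod (nfactor n - 1) <= 4 * (kap * tau / mr m Y) ->
  [/\ nfactor n != 0, cmod (nfactor n)^-1 <= 2 &
      cmod ((nfactor n)^-1 - 1) <= 8 * (kap * tau / mr m Y)].
Proof.
set e := nfactor n => h.
have h1 : 2^-1 <= cmod e.
  have := cmod_triangle 1 e 0; rewrite !subr0 cmod1 cmodBC; have := ktb; lra.
have e0 : e != 0 by apply/eqP => e0; move: h1; rewrite e0 cmod0; lra.
have eV : cmod e^-1 <= 2.
  rewrite cmodV -[leRHS]invrK lef_pV2//; rewrite posrE ?invr_gt0//; lra.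
split => //.
have -> : e^-1 - 1 = e^-1 * (1 - e) by rewrite mulrBr mulr1 mulVf.
rewrite cmodM cmodBC (le_trans (ler_pM _ _ eV h))// ?cmod_ge0//; lra.
Qed.

Lemma mean_step n : nfactor n != 0 -> cmean (niter n.+1) = 1.
Proof.
move=> e0; rewrite /niter /= /nstep -/(niter n) cmeanZ; last exact/K_integ/niter_integ.
by rewrite mulVf.
Qed.

Lemma delta_integ n : cinteg m (delta n).
Proof. by apply: cintegB; exact: niter_integ. Qed.

Lemma delta_mz n : cmean (niter n) = 1 -> cmean (niter n.+1) = 1 -> cmz (delta n).
Proof.
move=> h1 h2; split.
  apply: filterS2 (niter_support n) (niter_support n.+1) => x e1 e2 nY.
  by rewrite /delta e1// e2// subrr.
have iN : cinteg m (fun x => -1 * niter n x) by apply: cintegZ; exact: niter_integ.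
have -> : delta n = fun x => niter n.+1 x + -1 * niter n x.
  by apply/funext => x; rewrite mulN1r.
by rewrite (cmeanD (niter_integ _) iN) (cmeanZ _ (niter_integ _)) h1 h2 mulN1r subrr.
Qed.

Lemma nu_le n z : cmz (delta n) -> cnrm (delta n) z -> cmean (niter n) = 1 ->
  cmean (niter n.+1) = 1 -> cmod (nfactor n.+1 - nfactor n) <= 2 * (kap * tau / mr m Y) * z.
Proof.
move=> [_ zd] nd h1 h2.
have -> : nfactor n.+1 - nfactor n = cmean (pt t (delta n)).
  have ip := pert_integ mc mf t (delta_integ n).
  have il := clazy_integ hT (delta_integ n).
  have -> : cmean (pt t (delta n)) = cmean (K t (delta n)).
    by rewrite K_split (cmeanD il ip) (cmean_lazy (delta_integ n)) zd add0r.
  rewrite /nfactor.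
  have i1 := K_integ t (niter_integ n); have i2 := K_integ t (niter_integ n.+1).
  have i3 := K_integ t (delta_integ n).
  apply: (addIr (cmean (K t (niter n)))); rewrite subrK -cmeanD//.
  apply: cmean_congr => //; first exact: cintegD.
  have := clazy_twistD hT (expif_meas t mf) (expif_cmod f t) (delta_integ n) (niter_integ n).
  apply: filterS => x <-; congr (K t _ x); apply/funext => y.
  by rewrite /delta subrK.
rewrite (le_trans (cmean_le (hpert t nd)))// le_eqVlt; apply/orP; left; apply/eqP.
by rewrite -/tau; ring.
Qed.

Lemma niter_main n : [/\ cmean (niter n) = 1,
  cnrm (niter n) (1 + Q * tau * \sum_(k < n) rho ^+ k) & anrm (delta n) (Q * tau * rho ^+ n)].
Proof.
have [r0 r1] := andP r01.
have rho0 : 0 <= rho by rewrite /rho; lra.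
have rho1 : rho < 1 by rewrite /rho; lra.
have kt0 : 0 <= kap * tau by rewrite mulr_ge0// ltW.
have ktb0 : 0 <= kap * tau / mr m Y by rewrite mulr_ge0// ltW.
have bnd2 k : 1 + Q * tau * \sum_(j < k) rho ^+ j <= 2.
  have g : (1 - rho) * \sum_(j < k) rho ^+ j <= 1.
    rewrite -opprB mulNr -subrX1 opprB lerBlDr lerDl exprn_ge0//.
  have s0 : 0 <= \sum_(j < k) rho ^+ j by apply: sumr_ge0 => j _; rewrite exprn_ge0.
  have := ler_wpM2r s0 small; move: g; rewrite /rho; lra.
have dS n' : cmean (niter n') = 1 -> cnrm (niter n') 2 -> cmean (niter n'.+1) = 1.
  by move=> h1 h2; apply: mean_step; have [] := nfactor_inv (nfactor_near h1 h2).
elim: n => [|n [ih1 ih2 ih3]].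
  have h1 : cmean (niter 0) = 1 := cone_mean; have h2 : cnrm (niter 0) 2.
    by apply: (cnrm_le mc eta01) cone_nrm; rewrite ler1n.
  split => //; first by rewrite big_ord0 mulr0 addr0; exact: cone_nrm.
  have h3 := dS 0%N h1 h2; have [e0 eV e1] := nfactor_inv (nfactor_near h1 h2).
  set e := nfactor 0 in e0 eV e1.
  have -> : Q * tau * rho ^+ 0 = Bc * (kap * (48 / mr m Y + 4) * tau) by rewrite /Q expr0; ring.
  apply: anrm_of_cnrm; first exact: delta_mz.
  have il := clazy_integ hT (cnrm_integ cone_nrm).
  have n1 : cnrm (clazy cone) 1.
    by apply: cnrm_ae_eq il _ cone_nrm; apply: filterS cone_lazy => x ->.
  have := cnrmD (cnrmZ mc eta01 (e^-1 - 1) n1) (cnrmZ mc eta01 e^-1 (hpert t cone_nrm)).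
  move=> h; apply: (@cnrm_le _ _ _ _ _ _ _ _ _ _ _ mc _ eta01 _
    (2 * (8 * (kap * tau / mr m Y)) * 1 + 2 * 2 * (kap * tau * 1))).
    rewrite (_ : kap * _ * tau = 48 * (kap * tau / mr m Y) + 4 * (kap * tau)); last by ring.
    lra.
  apply: (@cnrm_ae_eq _ _ _ _ _ _ _ _ _ (fun x => (e^-1 - 1) * clazy cone x + e^-1 * pt t cone x)).
  - exact: delta_integ.
  - apply: filterS cone_lazy => x hx.
    rewrite /delta /niter /= /nstep -/(niter 0) -/(nfactor 0) -/e.
    by rewrite (K_split cone) hx; ring.
  - apply: (cnrm_le mc eta01) h; rewrite -/tau lerD//.
      by rewrite ler_wpM2r// ler_wpM2l.
    by rewrite ler_wpM2r ?mulr1// ler_wpM2l.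
have n2 : cnrm (niter n) 2 by apply: (cnrm_le mc eta01) ih2.
have h1 := dS n ih1 n2.
set z := Q * tau * rho ^+ n in ih3.
have z0 : 0 <= z by rewrite mulr_ge0// exprn_ge0.
have nS : cnrm (niter n.+1) (1 + Q * tau * \sum_(k < n.+1) rho ^+ k).
  rewrite big_ord_recr/= mulrDr addrA.
  have := cnrmD ih2 (anrm_cnrm ih3); congr cnrm.
  by apply/funext => x; rewrite /delta addrC subrK.
have nS2 : cnrm (niter n.+1) 2 by apply: (cnrm_le mc eta01) nS.
split => //.
have h3 := dS n.+1 h1 nS2; have [e0 eV e1] := nfactor_inv (nfactor_near h1 nS2).
set e := nfactor n.+1 in e0 eV e1.
have mz := delta_mz ih1 h1; have mz' := delta_mz h1 h3.
have nd := anrm_cnrm ih3; have nu := nu_le mz nd ih1 h1.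
set v := nfactor n.+1 - nfactor n in nu.
have id := delta_integ n; have ild := clazy_integ hT id.
have al := anrm_lazy ih3; have nl := anrm_cnrm al.
pose Rn x := (e^-1 - 1) * clazy (delta n) x + e^-1 * (pt t (delta n) x + (- v) * niter n.+1 x).
have iRn : cinteg m Rn.
  apply: cintegD; apply: cintegZ => //; apply: cintegD; first exact: (pert_integ mc mf t (delta_integ n)).
  by apply: cintegZ; exact: niter_integ.
have eR : {ae m, forall x, clazy (delta n) x + Rn x = delta n.+1 x}.
  have hK := clazy_twistD hT (expif_meas t mf) (expif_cmod f t) (delta_integ n) (niter_integ n).
  apply: filterS hK => x hK.
  have [en0 _ _] := nfactor_inv (nfactor_near ih1 n2).
  have eK : K t (niter n) x = nfactor n * niter n.+1 x.
    by rewrite [niter n.+1 x]/= /nstep -/(niter n) -/(nfactor n) mulrA divff// mul1r.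
  have eK' : K t (niter n.+1) x = K t (delta n) x + K t (niter n) x.
    rewrite -hK; congr (K t _ x); apply/funext => y; by rewrite /delta subrK.
  have eD : delta n.+1 x = e^-1 * K t (niter n.+1) x - niter n.+1 x by [].
  rewrite eD eK' eK /Rn (K_split (delta n)) /v -/e.
  clear -e0; move: (clazy _ x) (pert _ _ _ _ _ x) (niter _ x) (nfactor n) e0.
  move: e => e a p w en e0; exact: normalized_step_id.
have mzR : cmz Rn.
  have zl : cmz (clazy (delta n)).
    by split; [exact: clazy_support (proj1 mz)|rewrite cmean_lazy//; exact: (proj2 mz)].
  split.
    apply: filterS3 eR (proj1 mz') (proj1 zl) => x h h4 h5 nY.
    by have := h; rewrite h4// h5// add0r.
  have : cmean (fun x => clazy (delta n) x + Rn x) = cmean (delta n.+1).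
    by apply: cmean_congr eR; [exact: cintegD|exact: delta_integ].
  by rewrite cmeanD// (proj2 zl) (proj2 mz') add0r.
have nR : cnrm Rn (kap * (48 / mr m Y + 4) * tau * z).
  have h := cnrmD (cnrmZ mc eta01 (e^-1 - 1) nl) (cnrmZ mc eta01 e^-1 (cnrmD (hpert t nd) (cnrmZ mc eta01 (- v) nS2))).
  apply: (cnrm_le mc eta01) h; rewrite -/tau cmodN.
  set k := kap * tau / mr m Y in e1 nu ktb0.
  rewrite (_ : kap * _ * tau * z = 2 * (8 * k) * z + 2 * 2 * (kap * tau * z + 2 * (2 * k * z) * 2)); last by rewrite /k; ring.
  have rz : r * z <= z by rewrite ler_piMl// ltW.
  rewrite lerD//.
    apply: ler_pM => //; last by rewrite ler_wpM2l.
      by rewrite mulr_ge0 ?cmod_ge0.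
    by rewrite mulr_ge0// ltW.
  apply: ler_pM; last 2 first.
  - by rewrite ler_wpM2l.
  - by rewrite lerD2l ler_wpM2r// ler_wpM2l.
  - by rewrite mulr_ge0 ?cmod_ge0.
  - by apply: addr_ge0; [exact: mulr_ge0|rewrite !mulr_ge0 ?cmod_ge0].
have aR := anrm_of_cnrm mzR nR.
apply: anrm_ae_eq (delta_integ n.+1) eR _.
apply: anrm_le (anrmD al aR).
have -> : Bc * (kap * (48 / mr m Y + 4) * tau * z) = Q * tau * z by rewrite /Q; ring.
have -> : Q * tau * rho ^+ n.+1 = rho * z by rewrite exprS /z; ring.
have := ler_wpM2r z0 small; rewrite /rho; lra.
Qed.

Lemma normalized_iterates : forall n,
  [/\ cmean (niter n) = 1, cnrm (niter n) 2, nfactor n != 0,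
      cmod (nfactor n - 1) <= 4 * (kap * tau / mr m Y) &
      cnrm (fun x => niter n.+1 x - niter n x) (rho ^+ n)] /\
      cmod (nfactor n.+1 - nfactor n) <= rho ^+ n.
Proof.
have [r0 r1] := andP r01.
have rho0 : 0 <= rho by rewrite /rho; lra.
have rho1 : rho < 1 by rewrite /rho; lra.
move=> n.
have bnd2 k : 1 + Q * tau * \sum_(j < k) rho ^+ j <= 2.
  have g : (1 - rho) * \sum_(j < k) rho ^+ j <= 1.
    rewrite -opprB mulNr -subrX1 opprB lerBlDr lerDl exprn_ge0//.
  have s0 : 0 <= \sum_(j < k) rho ^+ j by apply: sumr_ge0 => j _; rewrite exprn_ge0.
  have := ler_wpM2r s0 small; move: g; rewrite /rho; lra.
have [h1 h2 h3] := niter_main n; have [h4 h5 _] := niter_main n.+1.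
have n2 := cnrm_le mc eta01 (bnd2 n) h2.
have e1 := nfactor_near h1 n2; have [e0 _ _] := nfactor_inv e1.
have rn : 0 <= rho ^+ n by rewrite exprn_ge0.
have le1 : Q * tau * rho ^+ n <= rho ^+ n by rewrite ler_piMl//; have := small; lra.
have nd := cnrm_le mc eta01 le1 (anrm_cnrm h3).
split; first by split.
apply: (le_trans (nu_le (delta_mz h1 h4) nd h1 h4)).
by rewrite ler_piMl//; have := ktb; lra.
Qed.

End normalized_iterates.

Section geometric_limits.
Context {R : realType}.

Lemma le_of_geometric (rho a b c : R) : 0 <= rho < 1 ->
  (forall n, a <= b + c * rho ^+ n) -> a <= b.
Proof.
move=> r01 h; apply/ler_addgt0Pr => e e0.
have c1 : 0 < `|c| + 1 by rewrite ltr_wpDl.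
have [n hn] := small_power r01 (divr_gt0 e0 c1).
apply: (le_trans (h n)); rewrite lerD2l.
move: hn; rewrite ler_pdivlMr//; apply: le_trans.
have := ler_norm c; have rn : 0 <= rho ^+ n by rewrite exprn_ge0//; case/andP: r01.
move=> /(ler_wpM2r rn); lra.
Qed.

Lemma geometric_sum_le (rho : R) n k : 0 <= rho < 1 ->
  \sum_(j < k) rho ^+ (n + j) <= rho ^+ n / (1 - rho).
Proof.
move=> /andP[r0 r1]; have d0 : 0 < 1 - rho by rewrite subr_gt0.
rewrite ler_pdivlMr// (eq_bigr (fun j : 'I_k => rho ^+ n * rho ^+ j)); last by move=> j _; rewrite exprD.
rewrite -mulr_sumr -mulrA ler_piMr ?exprn_ge0//.
by rewrite mulrC -opprB mulNr -subrX1 opprB lerBlDr lerDl exprn_ge0.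
Qed.

Lemma geometric_cauchy (rho : R) (s : nat -> R) : 0 <= rho < 1 ->
  (forall n, `|s n.+1 - s n| <= rho ^+ n) ->
  exists2 l : R, s n @[n --> \oo] --> l & forall n, `|l - s n| <= rho ^+ n / (1 - rho).
Proof.
move=> r01 hs; have /andP[r0 r1] := r01.
have cs : cvgn (series (telescope s)).
  apply: normed_cvg; apply: (@series_le_cvg _ _ (geometric 1 rho)).
  - by move=> n /=.
  - by move=> n; rewrite /geometric/= mul1r exprn_ge0.
  - by move=> n; rewrite /geometric/= mul1r; exact: hs.
  - by apply: is_cvg_geometric_series; rewrite ger0_norm.
have cl : cvgn s.
  rewrite telescopeK in cs; have /cvg_ex[/= l hl] := cs.
  apply/cvg_ex; exists (l + s 0%N).
  have hcs : (fun=> s 0%N) n @[n --> \oo] --> s 0%N by exact: cvg_cst.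
  have es : (fun n => s n - s 0%N) + (fun=> s 0%N) = s.
    by apply/funext => n; rewrite fctE subrK.
  have h : ((fun n => s n - s 0%N) + (fun=> s 0%N)) n @[n --> \oo] --> l + s 0%N.
    exact: cvgD hl hcs.
  by rewrite es in h.
exists (limn s); first exact: cl.
have step n k : `|s (n + k)%N - s n| <= rho ^+ n / (1 - rho).
  apply: le_trans (geometric_sum_le n k r01).
  elim: k => [|k ih]; first by rewrite addn0 subrr normr0 big_ord0.
  rewrite big_ord_recr/= addnS -(subrKA (s (n + k)%N)) addrC.
  by rewrite (le_trans (ler_normD _ _))// lerD.
move=> n; apply/ler_addgt0Pr => e e0.
have /cvgrPdist_lt /(_ _ e0) [N _ hN] := cl.
have := hN (maxn N n) (leq_maxl _ _) => /= h1.
have h2 := step n (maxn N n - n)%N; rewrite subnKC ?leq_maxr// in h2.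
rewrite -(subrKA (s (maxn N n))) addrC (le_trans (ler_normD _ _))// lerD// ltW//.
Qed.

Lemma ae_geometric_limit {d : measure_display} {X : measurableType d}
    (m : probability X R) (rho : R) (u : nat -> X -> R) : 0 <= rho < 1 ->
  (forall n, measurable_fun setT (u n)) ->
  (forall n, {ae m, forall x, `|u n.+1 x - u n x| <= rho ^+ n}) ->
  exists2 W : X -> R, measurable_fun setT W &
    forall n, {ae m, forall x, `|W x - u n x| <= rho ^+ n / (1 - rho)}.
Proof.
move=> r01 mu hu; have /andP[r0 r1] := r01.
pose s n x := u 0%N x + \sum_(k < n) truncate (rho ^+ k) (fun x => u k.+1 x - u k x) x.
have ms n : measurable_fun setT (s n).
  apply: measurable_funD => //; apply: measurable_sum => k.
  by apply: truncate_meas; exact: measurable_funB.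
have hs x n : `|s n.+1 x - s n x| <= rho ^+ n.
  rewrite /s big_ord_recr/= addrA (addrC _ (truncate _ _ _)) addrK.
  by apply: truncate_le; rewrite exprn_ge0.
have /choice[W hW] x : exists l : R, s n x @[n --> \oo] --> l /\
    forall n, `|l - s n x| <= rho ^+ n / (1 - rho).
  by have [l h1 h2] := geometric_cauchy r01 (hs x); exists l.
exists W.
  by apply: (measurable_fun_cvg ms) => x _; case: (hW x).
have eu : {ae m, forall x, forall n, `|u n.+1 x - u n x| <= rho ^+ n} by exact: ae_foralln.
move=> n; apply: filterS eu => x hx.
suff -> : u n x = s n x by case: (hW x).
rewrite /s; elim: n => [|n ih]; first by rewrite big_ord0 addr0.
by rewrite big_ord_recr/= truncate_id// addrA -ih addrC subrK.
Qed.

End geometric_limits.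

Section component_eigenfunction.
Context {R : realType} {d : measure_display} {X : metricMeasurableType R d}.
Variables (m : probability X R) (T : X -> X) (A I : nat -> set X)
  (G : nat -> X -> R) (gam D C : R).
Hypothesis mc : markov_coding m T A I G gam D C.
Variable eta : R.
Hypothesis eta01 : 0 < eta <= 1.
Variable alpha : set (set X).
Hypothesis alphaA : forall a, alpha a -> exists i, A i `<=` a /\ m.-negligible (a `\` A i).
Implicit Types (u v w : X -> R[i]).
Local Notation Re := complex.Re.
Local Notation Im := complex.Im.
Let hT := mc_preserving mc.
Local Notation cnrm := (cnrm m A gam D C eta).
Local Notation Lam := (Lam gam D C eta).
Variables (f : X -> R) (mf : measurable_fun setT f).
Variable t : R.
Local Notation e := (expif f t).
Let me := expif_meas t mf.
Let e1 := expif_cmod f t.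

Lemma ctr_of_eigen u (c : R[i]) u' x : 2^-1 * (u x + ctr m T (twist e u) x) = c * u' x ->
  ctr m T (twist e u) x = 2 * c * u' x - u x.
Proof.
move=> h; have : u x + ctr m T (twist e u) x = 2 * (c * u' x).
  by rewrite -h mulrA divff ?mul1r// pnatr_eq0.
by move=> hh; rewrite -mulrA -hh [u x + _]addrC addrK.
Qed.

Lemma eigenfunction_limit (w : nat -> X -> R[i]) (en : nat -> R[i]) (rho b : R) :
  0 <= rho < 1 -> 0 < b ->
  (forall n, cnrm (w n) 2) -> (forall n, 1 <= b * cmod (cdens m (w n))) ->
  (forall n, cnrm (fun x => w n.+1 x - w n x) (rho ^+ n)) ->
  (forall n, clazy_twist m T e (w n) = fun x => en n * w n.+1 x) ->
  (forall n, cmod (en n.+1 - en n) <= rho ^+ n) ->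
  exists2 z : R[i], perturbed_eigenvalue m T alpha eta f t (2 * z - 1) &
    forall n, cmod (en n - z) <= 2 * (rho ^+ n / (1 - rho)).
Proof.
move=> r01 b0 w2 wb dw Kw den; have /andP[r0 r1] := r01.
have dR n : `|Re (en n.+1) - Re (en n)| <= rho ^+ n.
  by rewrite -ReN -ReD (le_trans (Re_cmod _)).
have dI n : `|Im (en n.+1) - Im (en n)| <= rho ^+ n.
  by rewrite -ImN -ImD (le_trans (Im_cmod _)).
have [zr _ hzr] := geometric_cauchy r01 dR; have [zi _ hzi] := geometric_cauchy r01 dI.
pose z : R[i] := zr +i* zi.
have hz n : cmod (en n - z) <= 2 * (rho ^+ n / (1 - rho)).
  rewrite cmodBC (le_trans (cmod_ReIm _))// ReD ImD ReN ImN/= mulr_natl mulr2n.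
  by rewrite lerD.
have iw n := cnrm_integ (w2 n).
have dwR n : {ae m, forall x, `|Re (w n.+1 x) - Re (w n x)| <= rho ^+ n}.
  have [[_ h _] _] := dw n; apply: filterS h => x; by rewrite ReD ReN.
have dwI n : {ae m, forall x, `|Im (w n.+1 x) - Im (w n x)| <= rho ^+ n}.
  have [_ [_ h _]] := dw n; apply: filterS h => x; by rewrite ImD ImN.
have mR n : measurable_fun setT (fun x => Re (w n x)) by have [h _] := iw n; exact: integ_meas h.
have mI n : measurable_fun setT (fun x => Im (w n x)) by have [_ h] := iw n; exact: integ_meas h.
have [WR mWR hWR] := ae_geometric_limit r01 mR dwR.
have [WI mWI hWI] := ae_geometric_limit r01 mI dwI.
pose W x : R[i] := WR x +i* WI x.
have mW : cmeasurable W by split.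
pose c := 2 / (1 - rho).
have c0 : 0 <= c by rewrite divr_ge0// subr_ge0 ltW.
have hW n : {ae m, forall x, cmod (W x - w n x) <= c * rho ^+ n}.
  apply: filterS2 (hWR n) (hWI n) => x h1 h2.
  rewrite (le_trans (cmod_ReIm _))// ReD ImD ReN ImN/=.
  by rewrite (_ : c * _ = rho ^+ n / (1 - rho) + rho ^+ n / (1 - rho)) ?lerD// /c; ring.
have w4 n : {ae m, forall x, cmod (w n x) <= 4}.
  have [[_ h1 _] [_ h2 _]] := w2 n; apply: filterS2 h1 h2 => x h1 h2.
  rewrite (le_trans (cmod_ReIm _))//; lra.
have WM : {ae m, forall x, cmod (W x) <= c + 4}.
  apply: filterS2 (hW 0%N) (w4 0%N) => x h1 h2.
  rewrite expr0 mulr1 in h1; rewrite -(subrK (w 0%N x) (W x)).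
  by rewrite (le_trans (cmodD _ _))// lerD.
have iW : cinteg m W by exact: cinteg_bounded mW WM.
have ieW : cinteg m (fun x => e x * W x) by exact: (twist_integ me e1).
exists z => //; exists W; split.
- split => //; first by exists (c + 4).
  exists (4 * Lam) => a /alphaA[j [Aa nA]].
  have L0 := le_trans ler01 (Lam_ge1 mc eta01).
  have aA : {ae m, forall x, a x -> A j x}.
    by apply: negligibleS nA => x /= /not_implyP.
  have hWn : {ae m, forall x, forall n, cmod (W x - w n x) <= c * rho ^+ n} by exact: ae_foralln.
  have hol2 : {ae (m \x m)%E, forall xy : X * X, forall n, A j xy.1 -> A j xy.2 ->
      cmod (w n xy.1 - w n xy.2) <= 4 * Lam * mdist xy.1 xy.2 `^ eta}.
    apply: ae_foralln => n; have [[_ _ h1] [_ _ h2]] := w2 n.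
    apply: filterS2 (h1 j) (h2 j) => -[x y] /= k1 k2 Ax Ay.
    rewrite (le_trans (cmod_ReIm _))// ReD ImD ReN ImN.
    have := k1 Ax Ay; have := k2 Ax Ay; lra.
  apply: filterS3 (filterI (ae_prod_left aA) (ae_prod_right aA)) hol2
    (filterI (ae_prod_left hWn) (ae_prod_right hWn)) => -[x y] /= [ax ay] hh [hx hy] a1 a2.
  apply: (@le_of_geometric R rho (cmod (W x - W y)) _ (2 * c) r01) => n.
  have -> : W x - W y = (w n x - w n y) + ((W x - w n x) - (W y - w n y)).
    by move: (W x) (W y) (w n x) (w n y) => p q r s; ring.
  rewrite (le_trans (cmodD _ _))// lerD ?hh//; [exact: ax|exact: ay|].
  rewrite (le_trans (cmodB _ _))//; have := hx n; have := hy n; lra.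
- move=> W0; have : (1 : R) <= 0; last by rewrite ler10.
  apply: (le_of_geometric (c := b * (2 * c)) r01) => n; rewrite add0r.
  apply: (le_trans (wb n)).
  rewrite (_ : b * (2 * c) * rho ^+ n = b * (2 * (c * rho ^+ n))); last by ring.
  rewrite ler_wpM2l ?(ltW b0)//.
  apply: cdens_bound => //.
  apply: filterS2 W0 (hW n) => x h1 h2; rewrite h1 sub0r cmodN in h2; exact: h2.
- split; [exact: ieW|exact: cintegZ|].
  move=> v mv [M vM].
  have [x0 _] : exists x0 : X, True.
    have [x0 _ _] : exists2 x0 : X, setT x0 & True.
      by apply: (@ae_exists _ _ R m (fun=> True) setT measurableT); rewrite ?mrT//; exact: aeW.
    by exists x0.
  have M0 : 0 <= M by rewrite (le_trans (cmod_ge0 (v x0))).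
  have mvT := cmeasurable_comp hT mv.
  have vTM x : cmod (v (T x)) <= M by [].
  have ilW : cinteg m (fun x => (2 * z - 1) * W x) by exact: cintegZ.
  suff h : cdens m (fun x => v (T x) * (e x * W x)) = cdens m (fun x => v x * ((2 * z - 1) * W x)).
    transitivity (cdens m (fun x => v (T x) * (e x * W x))).
      by congr (cintegral m _); apply/funext => x; rewrite mulrC.
    by rewrite h; congr (cintegral m _); apply/funext => x; rewrite mulrC.
  apply/eqP; rewrite -subr_eq0; apply/eqP/cmod_eq0/le_anti; rewrite cmod_ge0 andbT.
  pose k1 := 16 / (1 - rho) + 2 * cmod z * c + c.
  apply: (@le_of_geometric R rho _ _ (2 * (M * c) + 2 * (M * k1)) r01) => n; rewrite add0r.
  have itw := twist_integ me e1 (iw n); have ict := ctr_integ hT itw.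
  have ht := ctr_test hT itw mv vM.
  apply: (le_trans (cmod_triangle _ (cdens m (fun x => v (T x) * twist e (w n) x)) _)).
  rewrite [leRHS]mulrDl lerD//.
    rewrite -cdensB; [|exact: (cintegM mvT vTM ieW)|exact: (cintegM mvT vTM itw)].
    rewrite -mulrA; apply: cdens_bound.
      by apply: cintegB; [exact: (cintegM mvT vTM ieW)|exact: (cintegM mvT vTM itw)].
    apply: filterS (hW n) => x hx; rewrite -mulrBr /twist -mulrBr !cmodM e1 mul1r.
    by rewrite -mulrA ler_pM ?cmod_ge0.
  rewrite -ht -cdensB; [|exact: (cintegM mv vM ict)|exact: (cintegM mv vM ilW)].
  rewrite -mulrA; apply: cdens_bound.
    by apply: cintegB; [exact: (cintegM mv vM ict)|exact: (cintegM mv vM ilW)].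
  apply: filterS3 (hW n) (hW n.+1) (w4 n.+1) => x h1 h2 h3.
  rewrite -mulrBr cmodM -mulrA; apply: ler_pM; rewrite ?cmod_ge0//.
  have hk : ctr m T (twist e (w n)) x = 2 * en n * w n.+1 x - w n x.
    by apply: (@ctr_of_eigen (w n) (en n) (w n.+1) x); exact: (congr1 (fun g => g x) (Kw n)).
  rewrite hk.
  have -> : 2 * en n * w n.+1 x - w n x - (2 * z - 1) * W x =
     2 * ((en n - z) * w n.+1 x) - 2 * (z * (W x - w n.+1 x)) + (W x - w n x).
    by move: (en n) (W x) (w n.+1 x) (w n x) (z) => p q r' s z'; ring.
  have c2 : cmod (2 : R[i]) = 2.
    by have := cmodR (2 : R); rewrite rmorph_nat ger0_norm.
  have rn : 0 <= rho ^+ n by rewrite exprn_ge0.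
  rewrite /k1 [leRHS]mulrDl (le_trans (cmodD _ _))// lerD//.
  rewrite [leRHS]mulrDl (le_trans (cmodB _ _))// lerD//.
    rewrite !cmodM c2.
    have := ler_pM (cmod_ge0 _) (cmod_ge0 _) (hz n) h3.
    rewrite (_ : 16 / _ * _ = 2 * (2 * (rho ^+ n / (1 - rho)) * 4)); last by ring.
    by move=> ?; rewrite ler_wpM2l.
  rewrite !cmodM c2 -!mulrA ler_wpM2l// ler_wpM2l ?cmod_ge0// (le_trans h2)//.
  apply: (@le_trans _ _ (c * rho ^+ n)); last by rewrite /c -mulrA.
  by rewrite exprS ler_wpM2l// ler_piMl// ltW.
Qed.

End component_eigenfunction.

(** * Recurrence for the characteristic functions of Birkhoff sums *)

Section birkhoff.
Context {d : measure_display} {X : measurableType d} {R : realType}.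
Variables (m : probability X R) (T : X -> X).
Hypothesis hT : measure_preserving m T.
Variables (f : X -> R) (mf : measurable_fun setT f).

Definition birkhoff k x := \sum_(j < k) f (iter j T x).

Lemma birkhoff_meas k : measurable_fun setT (birkhoff k).
Proof.
apply: measurable_sum => j; apply: measurableT_comp => //.
exact: preserving_fun (preserving_iter hT j).
Qed.

Lemma birkhoffS k x : birkhoff k.+1 x = f x + birkhoff k (T x).
Proof.
rewrite /birkhoff big_ord_recl/=; congr (_ + _); apply: eq_bigr => j _.
by rewrite -iterS iterSr.
Qed.

Fixpoint lazy_avg n (s : nat -> R[i]) : R[i] :=
  if n is n'.+1 then 2^-1 * (lazy_avg n' s + lazy_avg n' (fun j => s j.+1)) else s 0%N.

Lemma lazy_avg_sum (J : Type) (l : seq J) n (s : J -> nat -> R[i]) :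
  lazy_avg n (fun j => \sum_(i <- l) s i j) = \sum_(i <- l) lazy_avg n (s i).
Proof.
elim: n s => [//|n ih] s /=.
by rewrite !ih -big_split/= mulr_sumr.
Qed.

Lemma lazy_avg_ext n s s' : (forall j, s j = s' j) -> lazy_avg n s = lazy_avg n s'.
Proof. by move=> h; congr lazy_avg; exact/funext. Qed.

Lemma cmod_half : cmod (2^-1 : R[i]) = 2^-1.
Proof.
have -> : (2^-1 : R[i]) = (2^-1 : R)%:C by rewrite fmorphV rmorph_nat.
by rewrite cmodR ger0_norm.
Qed.

Lemma lazy_avg_bound n s (M : R) : (forall j, cmod (s j) <= M) -> cmod (lazy_avg n s) <= M.
Proof.
elim: n s => [|n ih] s h /=; first exact: h.
rewrite cmodM cmod_half; have := ih s h; have := ih (fun j => s j.+1) (fun j => h j.+1).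
have := cmodD (lazy_avg n s) (lazy_avg n (fun j => s j.+1)); lra.
Qed.

Lemma birkhoff_cmeas t k : cmeasurable (fun x => cexpi (t * birkhoff k x)).
Proof. exact: expif_meas (birkhoff_meas k). Qed.

Lemma lazy_avg_iter t n k (u : X -> R[i]) : cinteg m u ->
  cdens m (fun x => cexpi (t * birkhoff k x) * iter n (clazy_twist m T (expif f t)) u x) =
  lazy_avg n (fun j => cdens m (fun x => cexpi (t * birkhoff (k + j) x) * u x)).
Proof.
move=> iu; elim: n k => [|n ih] k; first by rewrite /= addn0.
have me := expif_meas t mf; have e1 := expif_cmod f t.
set v := iter n (clazy_twist m T (expif f t)) u.
have iv : cinteg m v by exact: (iter_clazy_twist_integ hT me e1).
have itw := twist_integ me e1 iv; have ict := ctr_integ hT itw.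
have mb := birkhoff_cmeas t k.
have b1 x : cmod (cexpi (t * birkhoff k x)) <= 1 by rewrite cmod_cexpi.
have i1 := cintegM mb b1 iv; have i2 := cintegM mb b1 ict.
have -> : cdens m (fun x => cexpi (t * birkhoff k x) * iter n.+1 (clazy_twist m T (expif f t)) u x) =
    2^-1 * (cdens m (fun x => cexpi (t * birkhoff k x) * v x) +
      cdens m (fun x => cexpi (t * birkhoff k x) * ctr m T (twist (expif f t) v) x)).
  rewrite -cdensD// -cdensZ; last exact: cintegD.
  congr cdens; apply/funext => x; rewrite iterS /clazy_twist -/v.
  by rewrite mulrCA mulrDr.
rewrite (ctr_test hT itw mb b1) [RHS]/=; congr (_ * (_ + _)); first exact: ih.
transitivity (cdens m (fun x => cexpi (t * birkhoff k.+1 x) * v x)).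
  congr cdens; apply/funext => x; rewrite /twist mulrA; congr (_ * _).
  by rewrite birkhoffS mulrDr addrC cexpiD.
by rewrite ih; apply: lazy_avg_ext => j; rewrite addSnnS.
Qed.

End birkhoff.

Lemma powR_near0 {R : realType} (eta c e : R) : 0 < eta -> 0 < e ->
  \forall t \near (0 : R), c * `|t| `^ eta <= e.
Proof.
move=> eta0 e0; have c1 : 0 < `|c| + 1 by rewrite ltr_wpDl.
have ec0 : 0 < e / (`|c| + 1) by rewrite divr_gt0.
near=> t.
have ht : `|t| <= (e / (`|c| + 1)) `^ eta^-1.
  near: t; apply/nbhs_normP; exists ((e / (`|c| + 1)) `^ eta^-1) => /=; first exact: powR_gt0.
  by move=> y /=; rewrite sub0r normrN => /ltW.
have : `|t| `^ eta <= e / (`|c| + 1).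
  have -> : e / (`|c| + 1) = ((e / (`|c| + 1)) `^ eta^-1) `^ eta.
    by rewrite -powRrM mulVf ?gt_eqF// powRr1// ltW.
  by rewrite ge0_ler_powR ?nnegrE ?powR_ge0// ltW.
rewrite ler_pdivlMr// => h.
have p0 : 0 <= `|t| `^ eta := powR_ge0 _ _.
by have := ler_wpM2r p0 (ler_norm c); lra.
Unshelve. all: by end_near. Qed.

Section recurrence.
Context {R : realType} {d : measure_display} {X : metricMeasurableType R d}.
Variables (m : probability X R) (T : X -> X) (A I : nat -> set X)
  (G : nat -> X -> R) (gam D C : R).
Hypothesis mc : markov_coding m T A I G gam D C.
Variable eta : R.
Hypothesis eta01 : 0 < eta <= 1.
Variable alpha : set (set X).
Hypothesis alphaA : forall a, alpha a -> exists i, A i `<=` a /\ m.-negligible (a `\` A i).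
Let hT := mc_preserving mc.
Let eta0 : 0 < eta. Proof. by case/andP: eta01. Qed.
Variables (f : X -> R) (B : nat -> R) (S : R).
Hypotheses (mf : measurable_fun setT f) (B0 : forall i, 0 <= B i)
  (fB : forall i x, A i x -> `|f x| `^ eta <= B i)
  (fH : forall i x y, A i x -> A i y -> `|f x - f y| `^ eta <= B i * mdist x y `^ eta)
  (BS : forall n, \sum_(i < n) B i * mr m (A i) <= S).
Variable lambda : R -> R[i].
Hypothesis hlam : leading_eigenvalue m T alpha eta f lambda.
Local Notation K t := (clazy_twist m T (expif f t)).
Local Notation cone := (cone m T A).

Lemma component_recurrence i : 0 < mr m (A i) -> exists (rho M : R), [/\ 0 <= rho < 1, 0 <= M &
  \forall t \near (0 : R), forall n,
    cmod (cdens m (iter n.+1 (K t) (cone i)) - (1 + lambda t) / 2 * cdens m (iter n (K t) (cone i)))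
      <= M * rho ^+ n].
Proof.
move=> Ai0.
have [kap kap0 hpert] := pert_nrm mc eta01 mf B0 fB fH BS.
have [r [Bc [r01 [Bc1 hgap]]]] := lazy_gap mc eta01 Ai0.
have [r0 r1] := andP r01.
have b0 := component_mr_gt0 mc Ai0; set b := mr m (component m T A i) in b0.
pose rho := (1 + r) / 2.
have rho01 : 0 <= rho < 1 by apply/andP; rewrite /rho; split; lra.
have [rho0 rho1] := andP rho01.
have [[r' r'0 hev] _] := hlam.
exists rho, (4 / (1 - rho)); split => //; first by rewrite divr_ge0// subr_ge0 ltW.
have i0 : cinteg m (cone i) := cnrm_integ (cone_nrm mc eta01 i).
near=> t => n.
have small : Bc * kap * (48 / b + 4) * `|t| `^ eta <= (1 - r) / 2.
  by near: t; apply: powR_near0 => //; rewrite divr_gt0// subr_gt0.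
have small2 : 9 * kap / b * `|t| `^ eta <= r' / 2.
  by near: t; apply: powR_near0 => //; rewrite divr_gt0.
have hevt : cmod (lambda t - 1) < r' /\ forall z, cmod (z - 1) < r' ->
    (perturbed_eigenvalue m T alpha eta f t z <-> z = lambda t) by near: t.
have hN := normalized_iterates mc eta01 mf kap0 hpert Ai0 r01 Bc1 hgap small.
have me := expif_meas t mf; have e1 := expif_cmod f t.
set w := niter m T A f i t in hN; set en := nfactor m T A f i t in hN.
have w2 k : cnrm m A gam D C eta (w k) 2 by have [[]] := hN k.
have iw k := cnrm_integ (w2 k).
have wS k : K t (w k) = fun x => en k * w k.+1 x.
  apply/funext => x; have [[_ _ ek0 _ _] _] := hN k.
  by rewrite /w [niter _ _ _ _ _ _ k.+1 x]/= /nstep -/(niter _ _ _ _ _ _ _) -/w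
    -[cmean _ _ _ _ _]/(en k) mulrA divff// mul1r.
have [z hz1 hz2] : exists2 z : R[i], perturbed_eigenvalue m T alpha eta f t (2 * z - 1) &
    forall k, cmod (en k - z) <= 2 * (rho ^+ k / (1 - rho)).
  apply: (@eigenfunction_limit _ _ _ m T A I G gam D C mc eta eta01 alpha alphaA f mf t
    w en rho b^-1) => //.
  - by rewrite invr_gt0.
  - move=> k; have [[h _ _ _ _] _] := hN k.
    have ib : 0 <= b^-1 by rewrite invr_ge0 ltW.
    by have := congr1 cmod h; rewrite /cmean cmodM cmodR cmod1 (ger0_norm ib) => ->.
  - by move=> k; have [[_ _ _ _ h] _] := hN k.
  - by move=> k; have [_] := hN k.
have z1 : cmod (z - 1) <= 4 * (kap * `|t| `^ eta / b).
  apply: (@le_of_geometric R rho _ _ (2 / (1 - rho)) rho01) => k.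
  rewrite (le_trans (cmod_triangle z (en k) 1))// addrC lerD//.
    by have [[_ _ _ h _] _] := hN k.
  by rewrite cmodBC (le_trans (hz2 k))//; lra.
have zl : 2 * z - 1 = lambda t.
  apply/(hevt.2 _ _).1 => //.
  have -> : 2 * z - 1 - 1 = 2 * (z - 1) by rewrite mulrBr mulr1 -addrA -opprD.
  have c2 : cmod (2 : R[i]) = 2 by have := cmodR (2 : R); rewrite rmorph_nat ger0_norm.
  rewrite cmodM c2; apply: (le_lt_trans (ler_wpM2l _ z1)) => //.
  have k0 : 0 <= kap * `|t| `^ eta / b.
    by rewrite !mulr_ge0 ?powR_ge0 ?invr_ge0// ltW.
  move: small2; rewrite (_ : 9 * _ / _ * _ = 9 * (kap * `|t| `^ eta / b)); last by ring.
  lra.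
have ez : (1 + lambda t) / 2 = z.
  by rewrite -zl addrC subrK mulrC mulrA mulVf ?mul1r// pnatr_eq0.
have it k : {ae m, forall x, iter k (K t) (cone i) x = (\prod_(j < k) en j) * w k x}.
  elim: k => [|k ih]; first by apply: aeW => x; rewrite big_ord0 mul1r.
  have iK := iter_clazy_twist_integ hT me e1 k i0.
  have h1 := clazy_twist_congr hT me e1 iK (cintegZ (\prod_(j < k) en j) (iw k)) ih.
  apply: filterS2 h1 (clazy_twistZ hT me e1 (\prod_(j < k) en j) (iw k)) => x h2 h3.
  by rewrite iterS h2 h3 wS big_ord_recr/= mulrA.
have ad k : cdens m (iter k (K t) (cone i)) = (\prod_(j < k) en j) * b%:C.
  rewrite (cdens_congr _ _ (it k)); last 2 first.
  - exact: (iter_clazy_twist_integ hT me e1 k i0).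
  - exact: cintegZ.
  rewrite cdensZ//; congr (_ * _).
  have [[h _ _ _ _] _] := hN k; move: h; rewrite /cmean -/b -[cdens m _]/(cdens m (w k)).
  move=> /(congr1 (fun y => b%:C * y)); rewrite mulrA -rmorphM mulfV ?gt_eqF// mul1r mulr1//.
have a2 k : cmod (cdens m (iter k (K t) (cone i))) <= 2.
  have := lazy_avg_iter hT mf t k 0 i0.
  have -> : cdens m (fun x => cexpi (t * birkhoff T f 0 x) * iter k (K t) (cone i) x) =
      cdens m (iter k (K t) (cone i)).
    by congr cdens; apply/funext => x; rewrite /birkhoff big_ord0 mulr0 cexpi0 mul1r.
  move=> ->; apply: lazy_avg_bound => j.
  have mb := birkhoff_cmeas hT mf t (0 + j).
  have b1 x : cmod (cexpi (t * birkhoff T f (0 + j) x)) <= 1 by rewrite cmod_cexpi.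
  rewrite -[leRHS]mulr1; apply: cdens_bound; first exact: (cintegM mb b1 i0).
  apply: aeW => x; rewrite cmodM cmod_cexpi mul1r -[cone i x]/((\1_(component m T A i) x)%:C) cmodR indicE.
  by rewrite ger0_norm// lern1 leq_b1.
rewrite ez.
have -> : cdens m (iter n.+1 (K t) (cone i)) = en n * cdens m (iter n (K t) (cone i)).
  by rewrite !ad big_ord_recr/= mulrAC mulrC mulrA.
rewrite -mulrBl cmodM (le_trans (ler_pM (cmod_ge0 _) (cmod_ge0 _) (hz2 n) (a2 n)))//.
by rewrite le_eqVlt; apply/orP; left; apply/eqP; ring.
Unshelve. all: by end_near. Qed.

Lemma components_partition : exists l : seq nat, (forall i, i \in l -> 0 < mr m (A i)) /\
  {ae m, forall x, \sum_(i <- l) cone i x = 1}.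
Proof.
have [F hF] := mc_bip mc.
pose F' := [seq i <- F | 0 < mr m (A i)].
have [l [l1 l2]] : exists l : seq nat, (forall i, i \in l -> i \in F') /\
    forall x, \sum_(i <- l) cone i x = (`[< exists2 b, b \in F' & component m T A b x >])%:R.
  elim: F' => [|b s [l [l1 l2]]].
    exists [::]; split => // x; rewrite big_nil; case: asboolP => // -[] b; by rewrite in_nil.
  have [[b' b's e]|nb] := pselect (exists2 b', b' \in s & component m T A b' = component m T A b).
    exists l; split; first by move=> i /l1; rewrite in_cons orbC => ->.
    move=> x; rewrite l2; congr (_%:R); congr nat_of_bool; apply/asboolP/asboolP.
      by move=> [c cs cx]; exists c => //; rewrite in_cons cs orbT.
    move=> [c]; rewrite in_cons => /orP[/eqP -> bx|cs cx]; last by exists c.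
    by exists b' => //; rewrite e.
  exists (b :: l); split.
    by move=> i; rewrite !in_cons => /orP[->//|/l1 ->]; rewrite orbT.
  move=> x; rewrite big_cons l2 -[cone b x]/((\1_(component m T A b) x)%:C) indicE.
  have [bx|nbx] := pselect (component m T A b x).
    rewrite mem_set//; case: asboolP => [[c cs cx]|_].
      by exfalso; apply: nb; exists c => //; exact: (component_disjoint mc cx bx).
    rewrite addr0; case: asboolP => // h; exfalso; apply: h; exists b => //.
    by rewrite in_cons eqxx.
  rewrite memNset// add0r; congr (_%:R); congr nat_of_bool; apply/asboolP/asboolP.
    by move=> [c cs cx]; exists c => //; rewrite in_cons cs orbT.
  move=> [c]; rewrite in_cons => /orP[/eqP -> //|cs cx]; by exists c.
exists l; split; first by move=> i /l1; rewrite mem_filter => /andP[].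
have cov : {ae m, forall x, exists2 i, A i x & 0 < mr m (A i)}.
  have mU : measurable (~` \bigcup_i A i) by apply/measurableC/bigcupT_measurable; exact: (mc_A mc).
  have h1 := ae_in_null (fun=> False) mU (mc_cover mc).
  have h2 : {ae m, forall x, forall i, A i x -> mr m (A i) <> 0}.
    apply: ae_foralln => i.
    have [Ai|Ai] := eqVneq (mr m (A i)) 0; last by apply: aeW => x _; exact/eqP.
    by apply: filterS (ae_in_null (fun=> False) (mc_A mc i) Ai) => x h /h.
  apply: filterS2 h1 h2 => x h1 h2.
  have [i _ Ax] : (\bigcup_i A i) x by apply: contrapT.
  by exists i => //; rewrite lt_neqAle mr_ge0 eq_sym andbT; apply/eqP/h2.
apply: filterS cov => x [i Ax Ai]; rewrite l2; case: asboolP => // h; exfalso; apply: h.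
have [b [c [bF _ b0 _ [hi _]]]] := hF i Ai.
exists b; first by rewrite mem_filter b0.
exists i => //; apply: (reach_step mc) => //.
by rewrite (mr_mod0 (mc_A mc i) (mc_I mc b) hi).
Qed.

Theorem lazy_recurrence : exists (rho M : R), [/\ 0 < rho < 1, 0 <= M &
  \forall t \near (0 : R), forall n,
    cmod (lazy_avg n.+1 (fun j => cdens m (fun x => cexpi (t * birkhoff T f j x)))
      - (1 + lambda t) / 2 * lazy_avg n (fun j => cdens m (fun x => cexpi (t * birkhoff T f j x))))
      <= M * rho ^+ n].
Proof.
have [l [l0 l1]] := components_partition.
have [rho [M [rho01 M0 hr]]] : exists (rho M : R), [/\ 0 < rho < 1, 0 <= M &
  \forall t \near (0 : R), forall n, \sum_(i <- l)
    cmod (cdens m (iter n.+1 (K t) (cone i)) - (1 + lambda t) / 2 * cdens m (iter n (K t) (cone i)))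
      <= M * rho ^+ n].
  elim: l l0 {l1} => [|i l ih] l0.
    exists 2^-1, 0; split => //; first by rewrite invr_gt0 ltr0n invf_lt1// ltr1n.
    by near=> t => n; rewrite big_nil mul0r.
  have [|rho [M [/andP[r0 r1] M0 hr]]] := ih.
    by move=> j jl; apply: l0; rewrite in_cons jl orbT.
  have [|rho' [M' [/andP[r0' r1'] M0' hr']]] := @component_recurrence i.
    by apply: l0; rewrite in_cons eqxx.
  exists (Num.max rho rho'), (M' + M); split.
  - by rewrite lt_max r0 gt_max r1 r1'.
  - exact: addr_ge0.
  near=> t => n; rewrite big_cons (mulrDl M') lerD//.
    apply: (@le_trans _ _ (M' * rho' ^+ n)); first by move: n; near: t.
    by rewrite ler_wpM2l// lerXn2r ?nnegrE// ?le_max ?r0' ?lexx ?orbT.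
  apply: (@le_trans _ _ (M * rho ^+ n)); first by move: n; near: t.
  by rewrite ler_wpM2l// lerXn2r ?nnegrE// ?le_max ?(ltW r0) ?lexx.
exists rho, M; split => //; near=> t => n.
have mb j := birkhoff_cmeas hT mf t j.
have b1 j x : cmod (cexpi (t * birkhoff T f j x)) <= 1 by rewrite cmod_cexpi.
have i0 i : cinteg m (cone i) := cnrm_integ (cone_nrm mc eta01 i).
have sumE k : lazy_avg k (fun j => cdens m (fun x => cexpi (t * birkhoff T f j x))) =
    \sum_(i <- l) cdens m (iter k (K t) (cone i)).
  transitivity (lazy_avg k (fun j => \sum_(i <- l) cdens m (fun x => cexpi (t * birkhoff T f j x) * cone i x))).
    apply: lazy_avg_ext => j.
    have [is1 <-] : cinteg m (fun x => \sum_(i <- l) cexpi (t * birkhoff T f j x) * cone i x) /\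
      cdens m (fun x => \sum_(i <- l) cexpi (t * birkhoff T f j x) * cone i x) =
      \sum_(i <- l) cdens m (fun x => cexpi (t * birkhoff T f j x) * cone i x).
      elim: (l) => [|i s [ih1 ih2]].
        have i00 : cinteg m (fun=> 0 : R[i]) by split; exact: integ_cst.
        rewrite (_ : (fun x => _) = fun=> 0); last by apply/funext => x; rewrite big_nil.
        split => //; rewrite big_nil; apply: complex_ext => /=; by rewrite dens_cst// mul0r.
      have ii := cintegM (mb j) (b1 j) (i0 i).
      rewrite (_ : (fun x => _) = fun x => cexpi (t * birkhoff T f j x) * cone i x +
        \sum_(i <- s) cexpi (t * birkhoff T f j x) * cone i x); last first.
        by apply/funext => x; rewrite big_cons.
      by split; [exact: cintegD|rewrite cdensD// ih2 big_cons].
    apply: cdens_congr => //.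
      by apply: cinteg_bounded (mb j) _; apply: aeW => x; exact: b1.
    by apply: filterS l1 => x hx; rewrite -mulr_sumr hx mulr1.
  rewrite lazy_avg_sum; apply: eq_bigr => i _.
  transitivity (cdens m (fun x => cexpi (t * birkhoff T f 0 x) * iter k (K t) (cone i) x)).
    by rewrite (lazy_avg_iter hT mf t k 0 (i0 i)).
  by congr cdens; apply/funext => x; rewrite /birkhoff big_ord0 mulr0 cexpi0 mul1r.
rewrite !sumE mulr_sumr -sumrB (le_trans (cmod_sum _ _))//.
by move: n; near: t.
Unshelve. all: by end_near. Qed.

End recurrence.

(** * Taylor expansions with polynomially growing coefficients *)

Section taylor.
Context {R : realType}.
Local Notation Re := complex.Re.
Local Notation Im := complex.Im.

Fixpoint expi_coef l : R[i] :=
  if l is l'.+1 then 'i%C * expi_coef l' / l'.+1%:R else 1.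

Fixpoint expi_rem k (y : R) : R[i] :=
  if k is k'.+1 then expi_rem k' y - expi_coef k' * (y ^+ k')%:C else cexpi y.

Lemma expi_remE k y :
  cexpi y = \sum_(l < k) expi_coef l * (y ^+ l)%:C + expi_rem k y.
Proof.
elim: k => [|k ih]; first by rewrite big_ord0 add0r.
by rewrite big_ord_recr/= {1}ih -addrA; congr (_ + _); rewrite addrC subrK.
Qed.

Lemma natr_complex k : (k%:R : R[i]) = (k%:R : R)%:C.
Proof. by rewrite rmorph_nat. Qed.

Lemma expi_coefS k : k.+1%:R * Re (expi_coef k.+1) = - Im (expi_coef k) /\
  k.+1%:R * Im (expi_coef k.+1) = Re (expi_coef k).
Proof.
have k0 : (k.+1%:R : R) != 0 by rewrite pnatr_eq0.
have h : (k.+1%:R : R)%:C * expi_coef k.+1 = 'i%C * expi_coef k.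
  rewrite -[expi_coef k.+1]/('i%C * expi_coef k / k.+1%:R) natr_complex mulrCA divff ?mulr1// -natr_complex pnatr_eq0//.
have hr := congr1 (@complex.Re R) h; have hi := congr1 (@complex.Im R) h.
by move: hr hi; rewrite !ReM !ImM/= !mul0r !mul1r subr0 addr0 sub0r add0r.
Qed.

Lemma expi_rem_derive k (y : R) :
  is_derive y 1 (fun y => Re (expi_rem k.+1 y)) (- Im (expi_rem k y)) /\
  is_derive y 1 (fun y => Im (expi_rem k.+1 y)) (Re (expi_rem k y)).
Proof.
elim: k => [|k [ih1 ih2]].
  split.
    rewrite (_ : (fun y => _) = fun y : R => cos y - 1); last first.
      by apply/funext => z; rewrite -[expi_rem 1 z]/(cexpi z - 1 * (z ^+ 0)%:C) ReD ReN ReM/= mul1r mul0r subr0 expr0.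
    by apply: is_derive_eq; rewrite /= subr0.
  rewrite (_ : (fun y => _) = fun y : R => sin y); last first.
    by apply/funext => z; rewrite -[expi_rem 1 z]/(cexpi z - 1 * (z ^+ 0)%:C) ImD ImN ImM/= mulr0 mul0r addr0 subr0.
  exact: is_derive_sin.
have [c1 c2] := expi_coefS k.
have dX (a : R) : is_derive y 1 (fun z : R => a * z ^+ k.+1) (a * (k.+1%:R * y ^+ k)).
  have dk : is_derive y 1 (fun z : R => z ^+ k.+1) (k.+1%:R * y ^+ k).
    apply: DeriveDef; first exact: exprn_derivable.
    by rewrite exp_derive /GRing.scale/= mulr1.
  exact: (is_deriveZ a dk).
split.
  rewrite (_ : (fun y => _) = fun z : R => Re (expi_rem k.+1 z) - Re (expi_coef k.+1) * z ^+ k.+1); last first.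
    by apply/funext => z; rewrite -[expi_rem k.+2 z]/(expi_rem k.+1 z - expi_coef k.+1 * (z ^+ k.+1)%:C) ReD ReN ReM/= mulr0 subr0.
  have := is_deriveB ih1 (dX (Re (expi_coef k.+1))).
  rewrite (_ : - Im (expi_rem k.+1 y) = - Im (expi_rem k y) - Re (expi_coef k.+1) * (k.+1%:R * y ^+ k))//.
  rewrite -[expi_rem k.+1 y]/(expi_rem k y - expi_coef k * (y ^+ k)%:C) ImD ImN ImM/= mulr0 add0r.
  rewrite mulrA (mulrC _ k.+1%:R) c1; ring.
rewrite (_ : (fun y => _) = fun z : R => Im (expi_rem k.+1 z) - Im (expi_coef k.+1) * z ^+ k.+1); last first.
  by apply/funext => z; rewrite -[expi_rem k.+2 z]/(expi_rem k.+1 z - expi_coef k.+1 * (z ^+ k.+1)%:C) ImD ImN ImM/= mulr0 add0r.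
have := is_deriveB ih2 (dX (Im (expi_coef k.+1))).
rewrite (_ : Re (expi_rem k.+1 y) = Re (expi_rem k y) - Im (expi_coef k.+1) * (k.+1%:R * y ^+ k))//.
rewrite -[expi_rem k.+1 y]/(expi_rem k y - expi_coef k * (y ^+ k)%:C) ReD ReN ReM/= mulr0 subr0.
by rewrite mulrA (mulrC _ k.+1%:R) c2; ring.
Qed.

Lemma expi_rem0 k : expi_rem k.+1 0 = 0.
Proof.
elim: k => [|k ih]; first by rewrite /= cexpi0 expr0 mul1r subrr.
by rewrite /= -/(expi_rem k.+1 0) ih expr0n/= mulr0 subrr.
Qed.

Lemma expi_rem_pow k (y : R) : `|Re (expi_rem k y)| <= `|y| ^+ k /\ `|Im (expi_rem k y)| <= `|y| ^+ k.
Proof.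
elim: k y => [|k ih] y; first by rewrite expr0 /= !ler_norml cos_geN1 cos_le1 sin_geN1 sin_le1.
have bd c : (0 <= c <= y \/ y <= c <= 0) -> `|c| ^+ k * `|y| <= `|y| ^+ k.+1.
  move=> hc; rewrite exprSr ler_wpM2r// lerXn2r ?nnegrE//.
  case: hc => /andP[h1 h2].
    by rewrite !ger0_norm// (le_trans h1).
  by rewrite !ler0_norm ?lerN2// (le_trans h1).
split.
  have [c hc] := mean_value_between 0 y (fun z => (expi_rem_derive k z).1).
  rewrite expi_rem0 !subr0 => ->; rewrite normrM normrN.
  by apply: le_trans (bd c hc); rewrite ler_wpM2r//; case: (ih c).
have [c hc] := mean_value_between 0 y (fun z => (expi_rem_derive k z).2).
rewrite expi_rem0 !subr0 => ->; rewrite normrM.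
by apply: le_trans (bd c hc); rewrite ler_wpM2r//; case: (ih c).
Qed.

Lemma expi_coef_cmod k : cmod (expi_coef k) <= 1.
Proof.
elim: k => [|k ih]; first by rewrite cmod1.
rewrite /= !cmodM cmodV natr_complex cmodR ger0_norm//.
have -> : cmod ('i%C : R[i]) = 1 by rewrite /cmod/= expr0n expr1n add0r sqrtr1.
rewrite mul1r (le_trans _ ih)// ler_piMr ?cmod_ge0// invf_le1// ler1n//.
Qed.

Lemma expi_rem_bound k (s : R) : k%:R <= s <= k.+1%:R -> forall y : R,
  cmod (expi_rem k.+1 y) <= 3 * `|y| `^ s.
Proof.
move=> /andP[ks sk] y; have k0 : (0 : R) <= k%:R by [].
have hk j : cmod (expi_rem j y) <= 2 * `|y| ^+ j.
  have [h1 h2] := expi_rem_pow j y; rewrite (le_trans (cmod_ReIm _))//; lra.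
have [y1|y1] := leP `|y| 1.
  have [->|y0] := eqVneq y 0; first by rewrite expi_rem0 cmod0 mulr_ge0// powR_ge0.
  apply: (le_trans (hk k.+1)).
  have : `|y| ^+ k.+1 <= `|y| `^ s.
    by rewrite -powR_mulrn// ger_powR// normr_gt0 y0.
  by have := powR_ge0 `|y| s; lra.
have : `|y| ^+ k <= `|y| `^ s by rewrite -powR_mulrn// ler_powR// ltW.
move=> h; rewrite -[expi_rem k.+1 y]/(expi_rem k y - expi_coef k * (y ^+ k)%:C).
rewrite (le_trans (cmodB _ _))//.
have := hk k; have := expi_coef_cmod k.
rewrite cmodM cmodR normrX => c1 h2.
have := ler_wpM2r (exprn_ge0 k (normr_ge0 y)) c1; lra.
Qed.

Lemma expi_sub1 k (y : R) : cexpi y - 1 =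
  \sum_(l < k) expi_coef l.+1 * (y ^+ l.+1)%:C + expi_rem k.+1 y.
Proof.
by rewrite (expi_remE k.+1 y) big_ord_recl/= expr0 mulr1 addrC addrA addKr.
Qed.

Lemma expi_sub1_bound (s y : R) : 0 <= s <= 1 -> cmod (cexpi y - 1) <= 3 * `|y| `^ s.
Proof.
move=> s01; rewrite (expi_sub1 0) big_ord0 add0r; apply: expi_rem_bound => //.
Qed.

Definition good_pair (eta p : R) (st : R * R) :=
  [/\ 0 < st.1, 0 < st.2, st.2 <= p, eta * st.2 / p <= st.1 & st.1 + st.2 <= p + eta * st.2 / p].

Lemma expi_sub1_product (eta p : R) : 0 < eta <= 1 -> 1 < p ->
  let q := p + eta / (2 * p) in
  exists (J : seq (nat * nat)) (Lp : seq (R * R)) (M : R),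
  [/\ forall il, il \in J -> good_pair eta p (il.1%:R, il.2%:R) /\ (0 < il.1)%N /\ (0 < il.2)%N,
      forall st, st \in Lp -> good_pair eta p st /\ st.1 + st.2 = q, 0 <= M &
      forall x y : R, cmod ((cexpi x - 1) * (cexpi y - 1)
          - \sum_(il <- J) expi_coef il.1 * expi_coef il.2 * (x ^+ il.1 * y ^+ il.2)%:C)
        <= M * \sum_(st <- Lp) `|x| `^ st.1 * `|y| `^ st.2].
Proof.
move=> /andP[eta0 eta1] p1 q.
have p0 : 0 < p by lra.
have ep0 : 0 < eta / p by rewrite divr_gt0.
have ep1 : eta / p < 1 by rewrite ltr_pdivrMr//; lra.
have qE : q = p + eta / p / 2 by rewrite /q invfM; ring.
have gp (s s' : R) : 0 < s -> 0 < s' -> s' <= p -> s' * (eta / p) <= s ->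
    s + s' <= p + s' * (eta / p) -> good_pair eta p (s, s').
  by move=> h1 h2 h3 h4 h5; rewrite /good_pair/= mulrAC (mulrC _ s'); split.
have [q2|q2] := leP q 2.
  exists [::], [:: (q / 2, q / 2)], 9; split => //.
  - move=> st; rewrite inE => /eqP ->; split; last by rewrite /=; lra.
    apply: gp; try nra.
  - move=> x y; rewrite big_nil subr0 big_seq1 cmodM.
    have s01 : 0 <= q / 2 <= 1 by apply/andP; split; lra.
    have := ler_pM (cmod_ge0 _) (cmod_ge0 _) (expi_sub1_bound x s01) (expi_sub1_bound y s01).
    by rewrite mulrACA -natrM.
have [k /andP[k1 k2]] : exists k : nat, k.+1%:R < q <= k.+2%:R.
  have := ceil_itv q; have c2 : 0 < Num.ceil q by rewrite ceil_gt0; lra.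
  case: (Num.ceil q) c2 => [[|[|k]]|]// _ hq.
    by move: hq; rewrite subrr => /andP[_]; rewrite (_ : 1%:~R = 1 :> R)//; lra.
  exists k; move: hq; rewrite (_ : (Posz k.+2 - 1)%:~R = k.+1%:R :> R)//.
have kq (i : 'I_k) : i.+1%:R + 1 < q.
  by apply: le_lt_trans k1; rewrite natr1 ler_nat ltnS.
exists [seq (x.+1, y.+1) | x <- iota 0 k, y <- iota 0 (k - x)].
exists ((q - 1, 1) :: [seq (i.+1%:R, q - i.+1%:R) | i <- iota 0 k]), 9.
split => //.
- move=> il /allpairsPdep[i [l [ik lk ->]]]; split => //=.
  move: ik lk; rewrite !mem_iota !add0n /= => ik lk.
  have h : (i.+1%:R + l.+1%:R : R) <= k.+1%:R.
    by rewrite -natrD ler_nat; lia.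
  have h1 : (1 : R) <= i.+1%:R by rewrite ler1n.
  have h2 : (1 : R) <= l.+1%:R by rewrite ler1n.
  have h3 : l.+1%:R * (eta / p) <= p * (eta / p) by rewrite ler_wpM2r ?(ltW ep0)//; lra.
  have h4 : 1 * (eta / p) <= l.+1%:R * (eta / p) by rewrite ler_wpM2r ?(ltW ep0).
  have h5 : p * (eta / p) = eta by rewrite mulrCA divff ?mulr1// gt_eqF.
  by apply: gp; lra.
- move=> st; rewrite in_cons => /orP[/eqP ->|h].
    by split; [apply: gp; lra|rewrite /=; lra].
  have /mapP[j jI ->] := h; move: j jI => i.
  rewrite mem_iota add0n => /andP[_ ik]; split; last by rewrite /=; lra.
  have := kq (Ordinal ik) => /= hk.
  have h1 : (1 : R) <= i.+1%:R by rewrite ler1n.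
  have h3 : (q - i.+1%:R) * (eta / p) <= p * (eta / p) by rewrite ler_wpM2r ?(ltW ep0)//; lra.
  have h4 : 1 * (eta / p) <= (q - i.+1%:R) * (eta / p) by rewrite ler_wpM2r ?(ltW ep0)//; lra.
  have h5 : p * (eta / p) = eta by rewrite mulrCA divff ?mulr1// gt_eqF.
  by apply: gp; lra.
move=> x y.
have iotaE n (F : nat -> R[i]) : \sum_(i <- iota 0 n) F i = \sum_(i < n) F i.
  by rewrite -(big_mkord xpredT F) /index_iota subn0.
have -> : (cexpi x - 1) * (cexpi y - 1) - \sum_(il <- [seq (x0.+1, y0.+1) | x0 <- iota 0 k, y0 <- iota 0 (k - x0)])
     expi_coef il.1 * expi_coef il.2 * (x ^+ il.1 * y ^+ il.2)%:C =
   expi_rem k.+1 x * (cexpi y - 1) +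
   \sum_(i < k) expi_coef i.+1 * (x ^+ i.+1)%:C * expi_rem (k - i).+1 y.
  rewrite big_allpairs_dep iotaE {1}(expi_sub1 k x) mulrDl mulr_suml addrAC addrC; congr (_ + _).
  rewrite -sumrB; apply: eq_bigr => i _; rewrite iotaE (expi_sub1 (k - i) y).
  rewrite mulrDr mulr_sumr addrAC -sumrB big1 ?add0r// => l _ /=.
  by rewrite rmorphM/=; apply/eqP; rewrite subr_eq0; apply/eqP; ring.
rewrite big_cons big_map [leRHS]mulrDr (le_trans (cmodD _ _))// lerD//.
  rewrite cmodM.
  have a1 : k%:R <= q - 1 <= k.+1%:R.
    by move: k1 k2; rewrite -!natr1 => *; apply/andP; split; lra.
  have a2 : 0 <= (1 : R) <= 1 by rewrite ler01 lexx.
  have := ler_pM (cmod_ge0 _) (cmod_ge0 _) (expi_rem_bound a1 x) (expi_sub1_bound y a2).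
  by rewrite mulrACA -natrM.
have iotaE' n (F : nat -> R) : \sum_(i <- iota 0 n) F i = \sum_(i < n) F i.
  by rewrite -(big_mkord xpredT F) /index_iota subn0.
rewrite mulr_sumr (le_trans (cmod_sum _ _))// iotaE'.
apply: ler_sum => i _; rewrite -[(i.+1%:R, _).1]/(i.+1%:R) -[(_, _).2]/(q - i.+1%:R).
have c1 := expi_coef_cmod i.+1; move: (expi_coef i.+1) c1 => c0 c1.
rewrite (cmodM _ (expi_rem _ _)) (cmodM c0) cmodR normrX.
have ik := ltn_ord i.
have a1 : (k - i)%:R <= q - i.+1%:R <= (k - i).+1%:R.
  rewrite -!natr1 natrB ?(ltnW ik)//; move: k1 k2; rewrite -!natr1 => *.
  by apply/andP; split; lra.
have := expi_rem_bound a1 y; move: (cmod (expi_rem _ _)) (cmod_ge0 (expi_rem (k - i).+1 y)) => r0 r00.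
have x0 : 0 <= `|x| ^+ i.+1 by rewrite exprn_ge0.
rewrite powR_mulrn// => h.
have := ler_pM (mulr_ge0 (cmod_ge0 _) x0) r00 (ler_wpM2r x0 c1) h.
have := mulr_ge0 x0 (powR_ge0 `|y| (q - i.+1%:R)); lra.
Qed.

End taylor.

Section poly_expansion.
Context {R : realType}.
Implicit Types (phi psi : nat -> R -> R[i]) (t : R).

Lemma powR_le1 (x a b : R) : 0 <= x <= 1 -> 0 <= a <= b -> x `^ b <= x `^ a.
Proof.
move=> /andP[x0 x1] /andP[a0 ab].
have [xz|xn0] := eqVneq x 0; last by rewrite ger_powR// lt0r xn0 x0.
rewrite xz; have [b0|bn0] := eqVneq b 0.
  by have -> : a = b by apply/le_anti; rewrite ab b0.
by rewrite powR0// powR_ge0.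
Qed.

Lemma powR_mul_le (x a b c : R) : 0 <= x <= 1 -> 0 <= a -> 0 <= b -> 0 < c -> c <= a + b ->
  x `^ a * x `^ b <= x `^ c.
Proof.
move=> x01 a0 b0 c0 cab; have /andP[x0 x1] := x01.
have [xz|xn0] := eqVneq x 0.
  rewrite xz; have [az|an0] := eqVneq a 0; last by rewrite (powR0 an0) mul0r powR_ge0.
  have bn0 : b != 0 by rewrite gt_eqF//; lra.
  by rewrite (powR0 bn0) mulr0 powR_ge0.
rewrite -powRD; last by rewrite xn0 implybT.
by apply: powR_le1 => //; rewrite (ltW c0).
Qed.

Definition poly_expansion (r : R) (s : nat) phi :=
  exists (K L : nat) (M : R) (P : nat -> {poly R[i]}), 0 <= M /\ forall n,
  [/\ (size (P n) <= L)%N, forall i, (i < s)%N -> (P n)`_i = 0,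
      forall i, cmod (P n)`_i <= M * n.+1%:R ^+ K &
      forall t, `|t| <= 1 -> cmod (phi n t - (P n).[t%:C]) <= M * n.+1%:R ^+ K * `|t| `^ r].

Lemma horner_bound (P : {poly R[i]}) (L s : nat) (B t : R) : (size P <= L)%N ->
  (forall i, (i < s)%N -> P`_i = 0) -> (forall i, cmod P`_i <= B) -> `|t| <= 1 ->
  cmod P.[t%:C] <= L%:R * B * `|t| ^+ s.
Proof.
move=> PL P0 PB t1; rewrite (horner_coef_wide _ PL) (le_trans (cmod_sum _ _))//.
have B0 : 0 <= B by exact: le_trans (cmod_ge0 _) (PB 0%N).
apply: (@le_trans _ _ (\sum_(i < L) B * `|t| ^+ s)); last first.
  by rewrite sumr_const card_ord -[leLHS]mulr_natl mulrA.
apply: ler_sum => i _; have [/P0 ->|si] := ltnP i s.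
  by rewrite mul0r cmod0 mulr_ge0// exprn_ge0.
by rewrite cmodM cmodX cmodR ler_pM ?cmod_ge0 ?exprn_ge0// ler_wiXn2l.
Qed.

Lemma natS_exp_le (n k K K' : nat) : (k <= n)%N -> (K <= K')%N ->
  (k.+1%:R ^+ K : R) <= n.+1%:R ^+ K'.
Proof.
move=> kn KK'; apply: (@le_trans _ _ (n.+1%:R ^+ K)).
  by rewrite lerXn2r ?nnegrE// ler_nat.
by rewrite ler_weXn2l// ler1n.
Qed.

Let nS_ge0 n K : (0 : R) <= n.+1%:R ^+ K. Proof. by rewrite exprn_ge0. Qed.

Lemma poly_expansion_weaken r r' s s' phi : 0 <= r' <= r -> (s' <= s)%N ->
  poly_expansion r s phi -> poly_expansion r' s' phi.
Proof.
move=> rr ss [K [L [M [P [M0 h]]]]]; exists K, L, M, P; split => // n.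
have [h1 h2 h3 h4] := h n; split => //.
  by move=> i si; apply: h2; exact: leq_trans ss.
move=> t t1; apply: (le_trans (h4 t t1)); rewrite ler_wpM2l ?mulr_ge0//.
by apply: powR_le1 => //; rewrite normr_ge0.
Qed.

Lemma poly_expansion_ext r s phi psi : (forall n t, phi n t = psi n t) ->
  poly_expansion r s phi -> poly_expansion r s psi.
Proof.
by move=> e; congr poly_expansion; apply/funext => n; apply/funext => t.
Qed.

Lemma poly_expansionDZ r s (c : R[i]) phi psi : poly_expansion r s phi ->
  poly_expansion r s psi -> poly_expansion r s (fun n t => phi n t + c * psi n t).
Proof.
move=> [K [L [M [P [M0 h]]]]] [K' [L' [M' [P' [M'0 h']]]]].
exists (maxn K K'), (maxn L L'), (M + cmod c * M'), (fun n => P n + c *: P' n).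
have c0 := cmod_ge0 c; split; first by rewrite addr_ge0// mulr_ge0.
move=> n; have [h1 h2 h3 h4] := h n; have [k1 k2 k3 k4] := h' n.
have e1 : n.+1%:R ^+ K <= n.+1%:R ^+ maxn K K' :> R by rewrite natS_exp_le// leq_maxl.
have e2 : n.+1%:R ^+ K' <= n.+1%:R ^+ maxn K K' :> R by rewrite natS_exp_le// leq_maxr.
have m1 := ler_wpM2l M0 e1; have m2 := ler_wpM2l (mulr_ge0 c0 M'0) e2.
split.
- rewrite (leq_trans (size_polyD _ _))// geq_max (leq_trans h1) ?leq_maxl//.
  by rewrite (leq_trans (size_scale_leq _ _))// (leq_trans k1) ?leq_maxr.
- by move=> i si; rewrite coefD coefZ h2// k2// mulr0 addr0.
- move=> i; rewrite coefD coefZ (le_trans (cmodD _ _))// cmodM mulrDl lerD//.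
    exact: le_trans (h3 i) m1.
  by apply: le_trans m2; rewrite -mulrA ler_wpM2l.
- move=> t t1; rewrite hornerD hornerZ.
  have -> : phi n t + c * psi n t - ((P n).[t%:C] + c * (P' n).[t%:C]) =
    (phi n t - (P n).[t%:C]) + c * (psi n t - (P' n).[t%:C]) by ring.
  rewrite (le_trans (cmodD _ _))// cmodM !mulrDl lerD//.
    by apply: (le_trans (h4 t t1)); rewrite ler_wpM2r ?powR_ge0.
  apply: (le_trans (ler_wpM2l c0 (k4 t t1))).
  by rewrite mulrA ler_wpM2r ?powR_ge0// mulrA.
Qed.

Lemma poly_expansionM r r' r0 (s s' : nat) phi psi : 0 <= r -> 0 <= r' -> 0 < r0 ->
  r0 <= r + r' -> r0 <= r + s'%:R -> r0 <= r' + s%:R ->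
  poly_expansion r s phi -> poly_expansion r' s' psi ->
  poly_expansion r0 (s + s') (fun n t => phi n t * psi n t).
Proof.
move=> rge0 r'ge0 r0gt0 c1 c2 c3 [K [L [M [P [M0 h]]]]] [K' [L' [M' [P' [M'0 h']]]]].
have L0 : (0 : R) <= L%:R by []. have L'0 : (0 : R) <= L'%:R by [].
exists (K + K')%N, (L + L')%N, ((L + L').+2%:R * (M * M')), (fun n => P n * P' n).
split; first by rewrite !mulr_ge0.
move=> n; have [h1 h2 h3 h4] := h n; have [k1 k2 k3 k4] := h' n.
set N := n.+1%:R in h3 h4 k3 k4 *.
have N0 : 0 <= N by []. have NK := exprn_ge0 K N0. have NK' := exprn_ge0 K' N0.
have szPQ : (size (P n * P' n)%R <= L + L')%N.
  rewrite (leq_trans (size_polyMleq _ _))// (leq_trans (leq_pred _))//.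
  by rewrite leq_add.
split => //.
- move=> i si; rewrite coefM big1// => j _.
  have [js|sj] := ltnP j s; first by rewrite h2// mul0r.
  have ji : (j <= i)%N by rewrite -ltnS ltn_ord.
  by rewrite k2 ?mulr0// ltn_subLR// (leq_trans si)// leq_add2r.
- move=> i; have [iL|Li] := ltnP i (L + L')%N; last first.
    by rewrite nth_default ?cmod0 ?(leq_trans szPQ)// !mulr_ge0// exprn_ge0.
  rewrite coefM (le_trans (cmod_sum _ _))//.
  apply: (@le_trans _ _ (\sum_(j < i.+1) (M * N ^+ K) * (M' * N ^+ K'))).
    by apply: ler_sum => j _; rewrite cmodM ler_pM ?cmod_ge0.
  have -> : M * N ^+ K * (M' * N ^+ K') = M * M' * N ^+ (K + K') by rewrite exprD; ring.
  rewrite sumr_const card_ord -[leLHS]mulr_natl -(mulrA _ (M * M')).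
  by rewrite ler_wpM2r ?mulr_ge0 ?exprn_ge0// ler_nat leqW// leqW.
- move=> t t1; rewrite hornerM.
  have -> : phi n t * psi n t - (P n).[t%:C] * (P' n).[t%:C] =
    (phi n t - (P n).[t%:C]) * (psi n t - (P' n).[t%:C]) +
    ((phi n t - (P n).[t%:C]) * (P' n).[t%:C] + (P n).[t%:C] * (psi n t - (P' n).[t%:C])) by ring.
  have t01 : 0 <= `|t| <= 1 by rewrite normr_ge0.
  have hP := horner_bound h1 h2 h3 t1; have hP' := horner_bound k1 k2 k3 t1.
  have a4 := h4 t t1; have b4 := k4 t t1.
  have q1 := powR_mul_le t01 rge0 r'ge0 r0gt0 c1.
  have q2 : `|t| `^ r * `|t| ^+ s' <= `|t| `^ r0 by rewrite -powR_mulrn// powR_mul_le.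
  have q3 : `|t| ^+ s * `|t| `^ r' <= `|t| `^ r0.
    by rewrite mulrC -powR_mulrn// powR_mul_le.
  have -> : (L + L').+2%:R * (M * M') * N ^+ (K + K') * `|t| `^ r0 =
    (2 + (L%:R + L'%:R)) * ((M * N ^+ K) * (M' * N ^+ K') * `|t| `^ r0).
    by rewrite exprD -natrD -(addn2 (L + L')) natrD; ring.
  have MM0 : 0 <= (M * N ^+ K) * (M' * N ^+ K') by rewrite !mulr_ge0.
  have MMt : 0 <= (M * N ^+ K) * (M' * N ^+ K') * `|t| `^ r0 by rewrite mulr_ge0// powR_ge0.
  have z1 := ler_pM (cmod_ge0 _) (cmod_ge0 _) a4 b4.
  have z2 := ler_pM (cmod_ge0 _) (cmod_ge0 _) a4 hP'.
  have z3 := ler_pM (cmod_ge0 _) (cmod_ge0 _) hP b4.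
  have y1 := ler_wpM2l MM0 q1.
  have y2 := ler_wpM2l (mulr_ge0 L'0 MM0) q2.
  have y3 := ler_wpM2l (mulr_ge0 L0 MM0) q3.
  rewrite (le_trans (cmodD _ _))// (le_trans (lerD (lexx _) (cmodD _ _)))// !cmodM.
  move: z1 z2 z3 y1 y2 y3 MMt.
  move: (cmod (phi n t - _)) (cmod (psi n t - _)) (cmod (P n).[_]) (cmod (P' n).[_]).
  move: (L%:R) (L'%:R) (`|t| `^ r0) (`|t| `^ r) (`|t| `^ r') (`|t| ^+ s) (`|t| ^+ s').
  move: (N ^+ K) (N ^+ K') => x1 x2 x3 x4 x5 x6 x7 x8 x9 w1 w2 w3 w4 z1 z2 z3 y1 y2 y3 y4.
  lra.
Qed.

Lemma poly_expansion_psum r s phi : poly_expansion r s phi ->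
  poly_expansion r s (fun n t => \sum_(k < n) phi k t).
Proof.
move=> [K [L [M [P [M0 h]]]]]; exists K.+1, L, M, (fun n => \sum_(k < n) P k); split => // n.
have sum_le (F : nat -> R) (B : R) : 0 <= B -> (forall k, F k <= M * k.+1%:R ^+ K * B) ->
    \sum_(k < n) F k <= M * n.+1%:R ^+ K.+1 * B.
  move=> B0 hF; apply: (@le_trans _ _ (\sum_(k < n) M * n.+1%:R ^+ K * B)).
    apply: ler_sum => k _; apply: (le_trans (hF k)); rewrite ler_wpM2r// ler_wpM2l//.
    by rewrite natS_exp_le// ltnW.
  rewrite sumr_const card_ord -[leLHS]mulr_natl mulrA ler_wpM2r//.
  rewrite exprS [leRHS]mulrCA ler_wpM2r ?mulr_ge0// ler_nat//.
split.
- apply: (leq_trans (size_sum _ _ _)); apply/bigmax_leqP => k _; by case: (h k).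
- by move=> i si; rewrite coef_sum big1// => k _; case: (h k) => _ ->.
- move=> i; rewrite coef_sum (le_trans (cmod_sum _ _))// -[leRHS]mulr1.
  by apply: (sum_le (fun k => cmod (P k)`_i)) => // k; rewrite mulr1; case: (h k).
- move=> t t1; rewrite horner_sum -sumrB (le_trans (cmod_sum _ _))//.
  apply: (sum_le (fun k => cmod (phi k t - (P k).[t%:C]))); first exact: powR_ge0.
  by move=> k; case: (h k) => _ _ _; exact.
Qed.

Lemma lazy_avg_le n (s : nat -> R[i]) (M : R) : (forall j, (j <= n)%N -> cmod (s j) <= M) ->
  cmod (lazy_avg n s) <= M.
Proof.
move=> h; pose s' j := if (j <= n)%N then s j else 0.
have M0 : 0 <= M by exact: le_trans (cmod_ge0 _) (h 0%N isT).
suff -> : lazy_avg n s = lazy_avg n s'.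
  by apply: lazy_avg_bound => j; rewrite /s'; case: ifP => [/h//|_]; rewrite cmod0.
have : forall j, (j <= n)%N -> s j = s' j by move=> j; rewrite /s' => ->.
move: s' => s' {h M M0}; elim: n s s' => [|n ih] s s' e /=; first exact: e.
congr (_ * (_ + _)); apply: ih => j jn; apply: e => //.
exact: leq_trans jn _.
Qed.

Lemma lazy_avgZ n (s : nat -> R[i]) (c : R[i]) :
  lazy_avg n (fun j => s j * c) = lazy_avg n s * c.
Proof. by elim: n s => [//|n ih] s /=; rewrite !ih -mulrDl mulrA. Qed.

Lemma lazy_avgB n (s s' : nat -> R[i]) :
  lazy_avg n (fun j => s j - s' j) = lazy_avg n s - lazy_avg n s'.
Proof. by elim: n s s' => [//|n ih] s s' /=; rewrite !ih -mulrBr opprD addrACA. Qed.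

Lemma lazy_avg_cst n (c : R[i]) : lazy_avg n (fun=> c) = c.
Proof.
elim: n => [//|n ih] /=; rewrite !ih; have -> : c + c = 2 * c by ring.
by rewrite mulrA mulVf ?mul1r// pnatr_eq0.
Qed.

Lemma poly_expansion_lavg r s phi : poly_expansion r s phi ->
  poly_expansion r s (fun n t => lazy_avg n (fun j => phi j t)).
Proof.
move=> [K [L [M [P [M0 h]]]]].
exists K, L, M, (fun n => \poly_(i < L) lazy_avg n (fun j => (P j)`_i)); split => // n.
split.
- exact: size_poly.
- move=> i si; rewrite coef_poly; case: ifP => // _.
  rewrite -[RHS](lazy_avg_cst n).
  by apply: lazy_avg_ext => j; have [_ h2 _ _] := h j; exact: h2.
- move=> i; rewrite coef_poly; case: ifP => _; last by rewrite cmod0 mulr_ge0.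
  apply: lazy_avg_le => j jn; have [_ _ h3 _] := h j; apply: (le_trans (h3 i)).
  by rewrite ler_wpM2l// natS_exp_le.
- move=> t t1.
  have -> : (\poly_(i < L) lazy_avg n (fun j => (P j)`_i)).[t%:C] = lazy_avg n (fun j => (P j).[t%:C]).
    rewrite horner_poly.
    transitivity (lazy_avg n (fun j => \sum_(i < L) (P j)`_i * t%:C ^+ i)).
      by rewrite lazy_avg_sum; apply: eq_bigr => i _; rewrite lazy_avgZ.
    by apply: lazy_avg_ext => j; case: (h j) => sz _ _ _; rewrite (horner_coef_wide _ sz).
  rewrite -lazy_avgB; apply: lazy_avg_le => j jn; have [_ _ _ h4] := h j.
  apply: (le_trans (h4 t t1)); rewrite ler_wpM2r ?powR_ge0// ler_wpM2l//.
  by rewrite natS_exp_le.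
Qed.

End poly_expansion.

Lemma good_pair_le {R : realType} (eta p : R) (st : R * R) (x y : R) : 0 < eta -> 0 < p ->
  good_pair eta p st -> 0 <= x -> 0 <= y ->
  x `^ st.1 * y `^ st.2 <= 1 + x `^ p + x `^ eta * y `^ p.
Proof.
case: st => s s' eta0 p0 [/= s0 s'0 s'p ss se] x0 y0.
pose th := s' / p; have th0 : 0 < th by rewrite divr_gt0.
have th1 : th <= 1 by rewrite ler_pdivrMr// mul1r.
have etE : eta * s' / p = eta * th by rewrite mulrA.
rewrite etE in ss se.
have s'E : s' = p * th by rewrite mulrCA divff ?mulr1// gt_eqF.
have eth : 0 <= eta * th by rewrite mulr_ge0// ltW.
set b := x `^ eta * y `^ p; have b0 : 0 <= b by rewrite mulr_ge0 ?powR_ge0.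
have [xz|xn0] := eqVneq x 0.
  by rewrite {1}xz powR0 ?gt_eqF// mul0r !addr_ge0// powR_ge0.
have eq1 : x `^ s * y `^ s' = x `^ (s - eta * th) * b `^ th.
  rewrite /b powRM ?powR_ge0// -!powRrM -s'E mulrA -powRD ?subrK// xn0.
  by rewrite implybT.
pose mx := Num.max 1 x; have mx1 : 1 <= mx by rewrite le_max lexx.
have mxx : x <= mx by rewrite le_max lexx orbT.
have mx0 : 0 <= mx by exact: le_trans ler01 mx1.
pose Z := Num.max b (mx `^ p).
have Z1 : mx `^ p <= Z by rewrite le_max lexx orbT.
have Zb : b <= Z by rewrite le_max lexx.
have Z0 : 0 <= Z by exact: le_trans b0 Zb.
have h1 : x `^ (s - eta * th) <= Z `^ (1 - th).
  apply: (@le_trans _ _ (mx `^ (s - eta * th))).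
    by rewrite ge0_ler_powR ?nnegrE// subr_ge0.
  apply: (@le_trans _ _ ((mx `^ p) `^ (1 - th))).
    rewrite -powRrM ler_powR//; move: se; rewrite {1}s'E; lra.
  by rewrite ge0_ler_powR ?nnegrE ?powR_ge0// subr_ge0.
have h2 : b `^ th <= Z `^ th by rewrite ge0_ler_powR ?nnegrE// ltW.
have Zpos : 0 < Z by apply: lt_le_trans Z1; rewrite powR_gt0// (lt_le_trans ltr01).
rewrite eq1 (le_trans (ler_pM (powR_ge0 _ _) (powR_ge0 _ _) h1 h2))//.
rewrite -powRD; last by rewrite (gt_eqF Zpos) implybT.
rewrite subrK powRr1// /Z /mx; have xp := powR_ge0 x p.
case: (leP b _) => _; last by rewrite lerDr addr_ge0.
case: (leP 1 x) => _; first by rewrite addrAC lerDr addr_ge0.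
by rewrite powR1 -addrA lerDl addr_ge0.
Qed.

Lemma power_sum_le {R : realType} n (a : nat -> R) (s : R) : 0 < s ->
  `|\sum_(j < n) a j| `^ s <= n.+1%:R `^ s * \sum_(j < n) `|a j| `^ s.
Proof.
move=> s0; case: n => [|n].
  by rewrite !big_ord0 normr0 powR0 ?gt_eqF// mulr0.
have [j hj] : exists j : 'I_n.+1, `|\sum_(j < n.+1) a j| <= n.+1%:R * `|a j|.
  apply: contrapT => /forallNP h.
  have : \sum_(j < n.+1) `|\sum_(j < n.+1) a j| > \sum_(j < n.+1) n.+1%:R * `|a j|.
    apply: ltr_sum; first by apply/hasP; exists ord0 => //; rewrite mem_index_enum.
    by move=> j _; rewrite ltNge; apply/negP/h.
  rewrite sumr_const card_ord -mulr_sumr -[ltRHS]mulr_natl ltr_pM2l//.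
  by rewrite ltNge ler_norm_sum.
apply: (@le_trans _ _ ((n.+1%:R * `|a j|) `^ s)).
  by rewrite ge0_ler_powR ?nnegrE ?mulr_ge0// ltW.
rewrite powRM//; apply: ler_pM; rewrite ?powR_ge0//.
  by rewrite ge0_ler_powR ?nnegrE ?(ltW s0)// ler_nat.
by rewrite (bigD1 j)//= lerDl sumr_ge0// => k _; exact: powR_ge0.
Qed.

Section integrable_cover.
Context {d : measure_display} {X : measurableType d} {R : realType}.
Variable m : probability X R.

Lemma integ_cover (g : X -> R) (h : nat -> X -> R) (F : nat -> set X) (c : R) :
  measurable_fun setT g -> (forall x, 0 <= g x) ->
  (forall i, integ m (h i)) -> (forall i x, F i x -> g x <= h i x) ->
  (forall i, measurable (F i)) -> trivIset setT F -> mr m (~` \bigcup_i F i) = 0 ->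
  (forall n, \sum_(i < n) dens m (h i) (F i) <= c) ->
  integ m g /\ dens m g setT <= c.
Proof.
move=> mg g0 ih gh mF tF F0 hc.
have mU : measurable (\bigcup_i F i) by exact: bigcupT_measurable.
have mEg : measurable_fun setT (EFin \o g) by exact/measurable_EFinP.
have hle : (\int[m]_x (g x)%:E <= c%:E)%E.
  have -> : (\int[m]_x (g x)%:E = \int[m]_(x in \bigcup_i F i) (g x)%:E)%E.
    rewrite (ge0_negligible_integral (measurableC mU) measurableT)//.
    - by rewrite setTD setCK.
    - by move=> x _; rewrite lee_fin.
    - by apply/mr0P => //; exact: measurableC.
  rewrite ge0_integral_bigcup//; last 2 first.
  - exact: measurable_funTS.
  - by move=> x _; rewrite lee_fin.
  apply: lime_le.
    by apply: is_cvg_nneseries => i _ _; apply: integral_ge0 => x _; rewrite lee_fin.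
  apply: nearW => n; rewrite big_mkord.
  apply: (@le_trans _ _ (\sum_(i < n) (dens m (h i) (F i))%:E)%E); last first.
    by rewrite sumEFin lee_fin; exact: hc.
  apply: lee_sum => i _; rewrite /dens /Rintegral fineK; last first.
    by apply: integrable_fin_num => //; exact: integS.
  apply: ge0_le_integral => //.
  - by move=> x _; rewrite lee_fin.
  - exact: measurable_funTS.
  - by apply: measurable_int; exact: integS.
  - by move=> x Fx; rewrite lee_fin; exact: gh.
have ig : integ m g.
  apply/integrableP; split => //.
  rewrite (_ : (fun x => _) = fun x => (g x)%:E); last first.
    by apply/funext => x /=; rewrite ger0_norm.
  exact: le_lt_trans hle (ltry _).
split => //; rewrite -lee_fin /dens /Rintegral fineK//.
by apply: integrable_fin_num.
Qed.

Lemma dens_dominated (g h : X -> R) : measurable_fun setT g -> integ m h ->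
  (forall x, `|g x| <= h x) -> integ m g /\ `|dens m g setT| <= dens m h setT.
Proof.
move=> mg ih gh; have ig := integ_le mg gh ih.
split => //; apply: (le_trans (dens_norm measurableT ig)).
by apply: dens_le => //; exact: integ_norm.
Qed.

Lemma cdens_dominated (g : X -> R[i]) (h : X -> R) : cmeasurable g -> integ m h ->
  (forall x, cmod (g x) <= h x) -> cinteg m g /\ cmod (cdens m g) <= 2 * dens m h setT.
Proof.
move=> [m1 m2] ih gh.
have [i1 b1] := dens_dominated m1 ih (fun x => le_trans (Re_cmod _) (gh x)).
have [i2 b2] := dens_dominated m2 ih (fun x => le_trans (Im_cmod _) (gh x)).
split => //; rewrite (le_trans (cmod_ReIm _))//= ; lra.
Qed.

Lemma powR_meas (g : X -> R) (s : R) : measurable_fun setT g ->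
  measurable_fun setT (fun x => `|g x| `^ s).
Proof.
move=> mg; apply: (measurableT_comp (measurable_powR s)).
exact: measurableT_comp.
Qed.

End integrable_cover.

Section expectation_expansion.
Context {d : measure_display} {X : measurableType d} {R : realType}.
Variable m : probability X R.

Lemma cmeasurableB (u v : X -> R[i]) : cmeasurable u -> cmeasurable v ->
  cmeasurable (fun x => u x - v x).
Proof.
move=> [u1 u2] [v1 v2]; split.
  rewrite (_ : (fun x => _) = fun x => complex.Re (u x) - complex.Re (v x)).
    exact: measurable_funB.
  by apply/funext => x; rewrite ReD ReN.
rewrite (_ : (fun x => _) = fun x => complex.Im (u x) - complex.Im (v x)).
  exact: measurable_funB.
by apply/funext => x; rewrite ImD ImN.
Qed.

Lemma cmeasurable_cst (c : R[i]) : cmeasurable (fun _ : X => c).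
Proof. by split; exact: measurable_cst. Qed.

Lemma cinteg_real (g : X -> R) : integ m g -> cinteg m (fun x => (g x)%:C).
Proof. by move=> ig; split => //; exact: integ_cst. Qed.

Lemma cdens_real (g : X -> R) : cdens m (fun x => (g x)%:C) = (dens m g setT)%:C.
Proof. by apply: complex_ext => //=; rewrite dens_cst// mul0r. Qed.

Lemma cdens_cst (c : R[i]) : cdens m (fun=> c) = c.
Proof. by apply: complex_ext; rewrite /= dens_cst// mrT mulr1. Qed.

Lemma cdens_sum (I : eqType) (s : seq I) (F : I -> X -> R[i]) :
  {in s, forall j, cinteg m (F j)} ->
  cinteg m (fun x => \sum_(j <- s) F j x) /\
  cdens m (fun x => \sum_(j <- s) F j x) = \sum_(j <- s) cdens m (F j).
Proof.
elim: s => [|j s ih] h.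
  rewrite big_nil -[RHS](cdens_cst 0).
  rewrite (_ : (fun x => _) = fun=> 0); first by split => //; split; exact: integ_cst.
  by apply/funext => x; rewrite big_nil.
have [|ih1 ih2] := ih; first by move=> k ks; apply: h; rewrite inE ks orbT.
have hj := h j (mem_head _ _).
rewrite (_ : (fun x => _) = fun x => F j x + \sum_(j <- s) F j x).
  by rewrite cdensD// big_cons ih2; split => //; exact: cintegD.
by apply/funext => x; rewrite big_cons.
Qed.

Lemma poly_expansion_cdens (Phi : R -> R -> R[i]) (cf : nat * nat -> R[i])
    (J : seq (nat * nat)) (Lp : seq (R * R)) (M q : R) (s : nat) (a b : nat -> X -> R)
    (Q : R * R -> Prop) (K : nat) (M' : R) :
  {in J, forall il, (s <= il.1 + il.2)%N /\ Q (il.1%:R, il.2%:R)} ->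
  {in Lp, forall st, st.1 + st.2 = q /\ Q st} -> 0 < q -> 0 <= M ->
  (forall x y : R, cmod (Phi x y - \sum_(il <- J) cf il * (x ^+ il.1 * y ^+ il.2)%:C)
     <= M * \sum_(st <- Lp) `|x| `^ st.1 * `|y| `^ st.2) ->
  (forall n, measurable_fun setT (a n)) -> (forall n, measurable_fun setT (b n)) ->
  (forall n t, cmeasurable (fun x => Phi (t * a n x) (t * b n x))) -> 0 <= M' ->
  (forall st n, Q st -> integ m (fun x => `|a n x| `^ st.1 * `|b n x| `^ st.2) /\
     dens m (fun x => `|a n x| `^ st.1 * `|b n x| `^ st.2) setT <= M' * n.+1%:R ^+ K) ->
  poly_expansion q s (fun n t => cdens m (fun x => Phi (t * a n x) (t * b n x))).
Proof.
move=> JQ LQ q0 M0 Phi_le ma mb mPhi M'0 hQ.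
pose g il n x := a n x ^+ il.1 * b n x ^+ il.2 : R.
pose D n : R := M' * n.+1%:R ^+ K.
have D0 n : 0 <= D n by rewrite mulr_ge0.
have hg il n : il \in J -> integ m (g il n) /\ `|dens m (g il n) setT| <= D n.
  move=> /JQ[_ /(hQ _ n)/=[i1 d1]].
  have mg : measurable_fun setT (g il n).
    by apply: measurable_funM; apply: measurable_funX.
  have [i2 d2] : integ m (g il n) /\ `|dens m (g il n) setT| <=
      dens m (fun x => `|a n x| `^ il.1%:R * `|b n x| `^ il.2%:R) setT.
    by apply: dens_dominated => // x; rewrite normrM !normrX !powR_mulrn.
  by split => //; exact: le_trans d2 d1.
pose CJ := \sum_(il <- J) cmod (cf il).
have CJ0 : 0 <= CJ by apply: sumr_ge0 => il _; exact: cmod_ge0.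
pose P n : {poly R[i]} :=
  \sum_(il <- J) (cf il * (dens m (g il n) setT)%:C) *: 'X^(il.1 + il.2).
have Pcoef n k : (P n)`_k =
    \sum_(il <- J) cf il * (dens m (g il n) setT)%:C * (k == il.1 + il.2)%N%:R.
  by rewrite coef_sum; apply: eq_bigr => il _; rewrite coefZ coefXn.
exists K, (\max_(il <- J) (il.1 + il.2)).+1, (M' * (CJ + 2 * M * (size Lp)%:R)), P.
have S0 : 0 <= 2 * M * (size Lp)%:R :> R by rewrite !mulr_ge0.
split; first by rewrite mulr_ge0// addr_ge0.
move=> n; split.
- rewrite /P big_seq; elim/big_ind : _ => [|u v hu hv|il ilJ].
  + by rewrite size_poly0.
  + by rewrite (leq_trans (size_polyD _ _))// geq_max hu.
  + rewrite (leq_trans (size_scale_leq _ _))// size_polyXn ltnS.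
    exact: (@leq_bigmax_seq _ J (fun=> true) (fun il : nat * nat => il.1 + il.2)%N).
- move=> k ks; rewrite Pcoef big_seq big1// => il /JQ[sil _].
  by rewrite ltn_eqF ?mulr0// (leq_trans ks).
- move=> k; rewrite Pcoef (le_trans (cmod_sum _ _))//.
  apply: (@le_trans _ _ (CJ * D n)).
    rewrite /CJ mulr_suml big_seq [leRHS]big_seq; apply: ler_sum => il ilJ.
    rewrite cmodM cmodM cmodR natr_complex cmodR -mulrA ler_wpM2l ?cmod_ge0//.
    have [_ d1] := hg _ n ilJ; rewrite (le_trans _ d1)// ler_piMr// ger0_norm// lern1.
    exact: leq_b1.
  rewrite /D mulrCA mulrA ler_wpM2r ?exprn_ge0// ler_wpM2l// lerDl//.
move=> t _.
pose h x := M * `|t| `^ q * \sum_(st <- Lp) `|a n x| `^ st.1 * `|b n x| `^ st.2.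
have [is1 ds1] : cinteg m (fun x => \sum_(il <- J) cf il * ((t * a n x) ^+ il.1 * (t * b n x) ^+ il.2)%:C) /\
   cdens m (fun x => \sum_(il <- J) cf il * ((t * a n x) ^+ il.1 * (t * b n x) ^+ il.2)%:C) = (P n).[t%:C].
  have e il x : cf il * ((t * a n x) ^+ il.1 * (t * b n x) ^+ il.2)%:C =
      cf il * t%:C ^+ (il.1 + il.2) * (g il n x)%:C.
    by rewrite /g !exprMn mulrACA -exprD rmorphM/= mulrA rmorphXn.
  have ci il : il \in J -> cinteg m (fun x => cf il * ((t * a n x) ^+ il.1 * (t * b n x) ^+ il.2)%:C).
    move=> ilJ; rewrite (_ : (fun x => _) = fun x => cf il * t%:C ^+ (il.1 + il.2) * (g il n x)%:C).
      by apply/cintegZ/cinteg_real; case: (hg il n ilJ).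
    by apply/funext.
  have [c1 c2] := cdens_sum ci; split => //; rewrite c2 /P horner_sum.
  rewrite big_seq [RHS]big_seq; apply: eq_bigr => il ilJ.
  rewrite hornerZ hornerXn mulrAC -cdens_real -cdensZ; last first.
    by apply: cinteg_real; case: (hg il n ilJ).
  by congr cdens; apply/funext.
have hst st : st \in Lp -> integ m (fun x => `|a n x| `^ st.1 * `|b n x| `^ st.2) /\
    dens m (fun x => `|a n x| `^ st.1 * `|b n x| `^ st.2) setT <= D n.
  by move=> /LQ[_ /(hQ _ n)].
have [ih dh] : integ m h /\ dens m h setT <= M * `|t| `^ q * ((size Lp)%:R * D n).
  have [[i1 _] e1] := cdens_sum (fun st stL => cinteg_real (hst st stL).1).
  have hE : (fun x => \sum_(st <- Lp) `|a n x| `^ st.1 * `|b n x| `^ st.2) =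
      (fun x => complex.Re (\sum_(st <- Lp) (`|a n x| `^ st.1 * `|b n x| `^ st.2)%:C)).
    by apply/funext => x; rewrite -rmorph_sum.
  have i2 : integ m (fun x => \sum_(st <- Lp) `|a n x| `^ st.1 * `|b n x| `^ st.2).
    by rewrite hE.
  split; first exact: integZ.
  rewrite densZ// ler_wpM2l ?mulr_ge0 ?powR_ge0//.
  have -> : dens m (fun x => \sum_(st <- Lp) `|a n x| `^ st.1 * `|b n x| `^ st.2) setT =
      \sum_(st <- Lp) dens m (fun x => `|a n x| `^ st.1 * `|b n x| `^ st.2) setT.
    move/(congr1 (@complex.Re R)) : e1; rewrite [LHS]/= hE => ->.
    under eq_bigr do rewrite cdens_real.
    by rewrite -rmorph_sum.
  apply: (@le_trans _ _ (\sum_(st <- Lp) D n)).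
    by rewrite big_seq [leRHS]big_seq; apply: ler_sum => st /hst[].
  by rewrite big_const_seq count_predT iter_addr_0 mulr_natl.
have hle x : cmod (Phi (t * a n x) (t * b n x) - \sum_(il <- J) cf il * ((t * a n x) ^+ il.1 * (t * b n x) ^+ il.2)%:C) <= h x.
  apply: (le_trans (Phi_le _ _)); rewrite /h -mulrA ler_wpM2l// mulr_sumr big_seq [leRHS]big_seq.
  apply: ler_sum => st /LQ[stq _]; rewrite !normrM !powRM// mulrACA -powRD ?stq//.
  by rewrite gt_eqF.
have [i3 d3] := cdens_dominated (cmeasurableB (mPhi n t) (cinteg_meas is1)) ih hle.
have iPhi : cinteg m (fun x => Phi (t * a n x) (t * b n x)).
  have := cintegD i3 is1; congr cinteg; apply/funext => x; exact: subrK.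
rewrite -ds1 -cdensB//; apply: (le_trans d3).
apply: (le_trans (ler_wpM2l _ dh)) => //.
have e (u v : R) : 2 * (M * v * ((size Lp)%:R * (M' * u))) = 2 * M * (size Lp)%:R * M' * (u * v).
  by ring.
rewrite /D e -[leRHS]mulrA ler_wpM2r ?mulr_ge0 ?powR_ge0// mulrC ler_wpM2l// lerDr//.
Qed.

End expectation_expansion.

(** * Correlation moments *)

Section moments.
Context {R : realType} {d : measure_display} {X : metricMeasurableType R d}.
Variables (m : probability X R) (T : X -> X) (A I : nat -> set X)
  (G : nat -> X -> R) (gam D C : R).
Hypothesis mc : markov_coding m T A I G gam D C.
Variable eta : R.
Hypothesis eta01 : 0 < eta <= 1.
Let hT := mc_preserving mc.
Let mA := mc_A mc.
Let eta0 : 0 < eta. Proof. by case/andP: eta01. Qed.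
Variables (f : X -> R) (B : nat -> R) (S : R).
Hypotheses (mf : measurable_fun setT f) (B0 : forall i, 0 <= B i)
  (fB : forall i x, A i x -> `|f x| `^ eta <= B i)
  (BS : forall n, \sum_(i < n) B i * mr m (A i) <= S).
Variable p : R.
Hypothesis p1 : 1 < p.
Hypothesis fp : integ m (fun x => `|f x| `^ p).
Let p0 : 0 < p := lt_trans ltr01 p1.

Let m_iter k : measurable_fun setT (iter k T).
Proof. exact: preserving_fun (preserving_iter hT k). Qed.

Lemma branch_comp_le (K1 : R) i v : 0 < K1 -> (forall i E, measurable E ->
    mr m (A i `&` T @^-1` E) <= K1 * mr m (A i) * mr m E) ->
  integ m v -> (forall x, 0 <= v x) ->
  dens m (fun x => v (T x)) (A i) <= K1 * mr m (A i) * dens m v setT.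
Proof.
move=> K10 K1up iv v0; have mv := integ_meas iv.
have ivT : integ m (fun x => v (T x)) := integ_comp hT iv.
have mvT : measurable_fun setT (fun x => v (T x)) := integ_meas ivT.
pose F k := [set x | k%:R <= v (T x) < k.+1%:R].
have mF k : measurable (F k).
  have := mvT measurableT `[k%:R, k.+1%:R[%classic (measurable_itv _).
  by rewrite setTI; congr measurable; apply/seteqP; split => x /=; rewrite in_itv.
have Ftr x k : F k x -> k = Num.trunc (v (T x)).
  by move=> Fk; apply/esym/truncn_def.
have tF : trivIset setT F.
  by apply/trivIsetP => j k _ _ jk; apply/seteqP; split => // x [/Ftr e1 /Ftr e2]; rewrite e1 e2 eqxx in jk.
have cF : mr m (~` \bigcup_k F k) = 0.
  rewrite (_ : ~` _ = set0) ?mr_set0//; apply/seteqP; split => // x; apply.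
  by exists (Num.trunc (v (T x))) => //; exact: truncn_itv.
apply: (dens_cover_le ivT (fun x => v0 (T x)) (mA i) mF tF cF) => n.
pose vn := truncate n%:R v.
have mvn : measurable_fun setT vn by exact: truncate_meas.
have vnb x : `|vn x| <= n%:R by exact: truncate_le.
have vn_le x : vn x <= v x.
  by rewrite /vn /truncate ge_max ge_min lexx andbT (le_trans _ (v0 x))// oppr_le0.
have vn0 x : 0 <= vn x by rewrite /vn /truncate le_max le_min v0 ler0n orbT.
have ivn : integ m vn by exact: integ_bounded mvn vnb.
have ivnT : integ m (fun x => vn (T x)) := integ_comp hT ivn.
have i1 : integ m (\1_(A i) : X -> R) by exact: integrable_indic.
have htr : {ae m, forall x, tr m T (\1_(A i) : X -> R) x <= K1 * mr m (A i)}.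
  have := @ae_le_of_dens _ _ _ m (tr m T (\1_(A i) : X -> R)) (K1 * mr m (A i)) setT measurableT
    (tr_integ hT i1).
  have h E : measurable E -> E `<=` setT -> dens m (tr m T (\1_(A i) : X -> R)) E <= K1 * mr m (A i) * mr m E.
    move=> mE _; have mTE := preimage_meas hT mE.
    rewrite (tr_dens hT)//.
    have -> : dens m (\1_(A i) : X -> R) (T @^-1` E) = dens m (fun x => 1 * \1_(A i) x) (T @^-1` E).
      by apply: dens_eq => x _; rewrite mul1r.
    rewrite (dens_indic m (fun=> 1)) dens_cst ?mul1r; last exact: measurableI.
    by rewrite setIC K1up.
  by move=> /(_ h); apply: filterS => x; exact.
have e1 : dens m (fun x => vn (T x)) (A i) <= K1 * mr m (A i) * dens m v setT.
  rewrite -[A i]setTI -dens_indic -(tr_test hT (v := vn) (M := n%:R) i1 mvn); last exact: aeW.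
  rewrite -densZ//; apply: dens_ae_le => //.
  - by apply: (integM_bounded mvn vnb); exact: (tr_integ hT).
  - exact: integZ.
  - apply: filterS htr => x hx _; rewrite setTI mulrC.
    have h1 := ler_wpM2l (vn0 x) hx.
    have h2 : K1 * mr m (A i) * vn x <= K1 * mr m (A i) * v x.
      by rewrite ler_wpM2l// mulr_ge0 ?mr_ge0 ?(ltW K10).
    by rewrite mulrC (le_trans h1)// mulrC.
apply: le_trans e1.
apply: (@le_trans _ _ (dens m (fun x => \sum_(k < n) vn (T x) * \1_(F k) x) (A i))).
  rewrite dens_sum//; last by move=> k; exact: integ_indic.
  apply: ler_sum => k _; rewrite -dens_indic.
  rewrite le_eqVlt; apply/orP; left; apply/eqP; apply: dens_eq => x _.
  rewrite indicE; case: (boolP (x \in F k)) => [|_]; last by rewrite !mulr0.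
  rewrite inE => /andP[_ h]; congr (_ * _); rewrite /vn truncate_id// ger0_norm//.
  by rewrite (le_trans (ltW h))// ler_nat.
apply: dens_le => //.
  by apply: integ_sum => k; exact: integ_indic.
move=> x _; rewrite -mulr_sumr ler_piMr//.
have [h|h] := ltnP (Num.trunc (v (T x))) n.
  rewrite (bigD1 (Ordinal h))//= big1 ?addr0.
    by rewrite indicE lern1 leq_b1.
  move=> k /eqP kn; rewrite indicE memNset// => /Ftr e; apply: kn; exact: val_inj.
rewrite big1 ?ler01// => k _; rewrite indicE memNset// => /Ftr e.
by move: h; rewrite -e leqNgt ltn_ord.
Qed.

Lemma weighted_comp : exists2 K : R, 0 <= K & forall v, integ m v -> (forall x, 0 <= v x) ->
  integ m (fun x => `|f x| `^ eta * v (T x)) /\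
  dens m (fun x => `|f x| `^ eta * v (T x)) setT <= K * dens m v setT.
Proof.
have [K1 K10 K1up] := branch_upper mc.
have S0 : 0 <= S by have := BS 0; rewrite big_ord0.
exists (K1 * S) => [|v iv v0]; first by rewrite mulr_ge0// ltW.
have ivT : integ m (fun x => v (T x)) := integ_comp hT iv.
have mvT : measurable_fun setT (fun x => v (T x)) := integ_meas ivT.
have dv0 : 0 <= dens m v setT by exact: dens_ge0.
apply: (@integ_cover _ _ _ m _ (fun i x => B i * v (T x)) A).
- by apply: measurable_funM => //; exact: powR_meas.
- by move=> x; rewrite mulr_ge0 ?powR_ge0.
- by move=> i; exact: integZ.
- by move=> i x Ax; rewrite ler_wpM2r// fB.
- exact: mA.
- exact: mc_triv mc.
- exact: mc_cover mc.
move=> n; apply: (@le_trans _ _ (\sum_(i < n) K1 * dens m v setT * (B i * mr m (A i)))).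
  apply: ler_sum => i _; rewrite densZ//.
  have := ler_wpM2l (B0 i) (branch_comp_le i K10 K1up iv v0).
  by congr (_ <= _); ring.
rewrite -mulr_sumr (_ : K1 * S * _ = K1 * dens m v setT * S); last by ring.
apply: ler_wpM2l; last exact: BS.
by rewrite mulr_ge0// ltW.
Qed.

Let fiter (k : nat) (x : X) : R := `|f (iter k T x)|.

Let m_fiter k : measurable_fun setT (fun x => f (iter k T x)).
Proof. exact: measurableT_comp. Qed.

Lemma pair_moment : exists2 H : R, 0 <= H & forall st k, good_pair eta p st ->
  integ m (fun x => `|f x| `^ st.1 * fiter k.+1 x `^ st.2) /\
  dens m (fun x => `|f x| `^ st.1 * fiter k.+1 x `^ st.2) setT <= H.
Proof.
have [K K0 hK] := weighted_comp.
set P := dens m (fun x => `|f x| `^ p) setT.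
have P0 : 0 <= P by apply: dens_ge0 => x _; exact: powR_ge0.
exists (1 + P + K * P); first by rewrite !addr_ge0// mulr_ge0.
move=> st k gst.
have ivk : integ m (fun x => `|f (iter k T x)| `^ p) := integ_comp (preserving_iter hT k) fp.
have Pk : dens m (fun x => `|f (iter k T x)| `^ p) setT = P.
  exact: (dens_comp (preserving_iter hT k) measurableT fp).
have [i2 d2] := hK _ ivk (fun x => powR_ge0 _ _).
have i1 : integ m (fun x => 1 + `|f x| `^ p) by apply: integD => //; exact: integ_cst.
have ih := integD i1 i2.
have le1 x : `| (`|f x|) `^ st.1 * fiter k.+1 x `^ st.2| <=
    1 + `|f x| `^ p + `|f x| `^ eta * `|f (iter k T (T x))| `^ p.
  rewrite ger0_norm ?mulr_ge0 ?powR_ge0//.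
  have := good_pair_le eta0 p0 gst (normr_ge0 (f x)) (normr_ge0 (f (iter k.+1 T x))).
  by rewrite {2}iterSr.
have mg : measurable_fun setT (fun x => `|f x| `^ st.1 * fiter k.+1 x `^ st.2).
  by apply: measurable_funM; exact: powR_meas.
have [i3 d3] := dens_dominated mg ih le1; split => //.
apply: (le_trans (ler_norm _)); apply: (le_trans d3).
rewrite Pk in d2; rewrite (densD measurableT i1 i2).
rewrite (densD measurableT (integ_cst m 1) fp) (dens_cst m 1 measurableT) mrT mulr1.
exact: lerD (lexx _) d2.
Qed.

Lemma birkhoff_moment : exists (K : nat) (M : R), 0 <= M /\ forall st n, good_pair eta p st ->
  integ m (fun x => `|birkhoff T f n x| `^ st.1 * fiter n x `^ st.2) /\
  dens m (fun x => `|birkhoff T f n x| `^ st.1 * fiter n x `^ st.2) setT <= M * n.+1%:R ^+ K.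
Proof.
have [H H0 hH] := pair_moment.
pose K0 := (Num.trunc (p + eta)).+1.
exists K0.+1, H; split => // st n gst.
have [s0 s'0 s'p ss se] := gst.
have hj (j : 'I_n) : integ m (fun x => fiter j x `^ st.1 * fiter n x `^ st.2) /\
    dens m (fun x => fiter j x `^ st.1 * fiter n x `^ st.2) setT <= H.
  have [i1 d1] := hH st (n - j).-1 gst.
  have nj : ((n - j).-1.+1 + j)%N = n by rewrite prednK ?subn_gt0 ?ltn_ord// subnK// ltnW.
  have e : (fun x => fiter j x `^ st.1 * fiter n x `^ st.2) =
      (fun x => `|f x| `^ st.1 * fiter (n - j).-1.+1 x `^ st.2) \o iter j T.
    by apply/funext => x /=; rewrite /fiter -iterD nj.
  rewrite e; split; first exact: (integ_comp (preserving_iter hT j) i1).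
  rewrite -[setT in dens _ _ setT](preimage_setT (iter j T)).
  by rewrite (dens_comp (preserving_iter hT j) measurableT i1).
pose h x := n.+1%:R `^ st.1 * \sum_(j < n) fiter j x `^ st.1 * fiter n x `^ st.2.
have ih : integ m h by apply: integZ; apply: integ_sum => j; case: (hj j).
have mg : measurable_fun setT (fun x => `|birkhoff T f n x| `^ st.1 * fiter n x `^ st.2).
  apply: measurable_funM; last exact: powR_meas.
  by apply: powR_meas; exact: (birkhoff_meas hT mf).
have le1 x : `| (`|birkhoff T f n x|) `^ st.1 * fiter n x `^ st.2| <= h x.
  rewrite ger0_norm ?mulr_ge0 ?powR_ge0// /h -mulr_suml mulrA ler_wpM2r ?powR_ge0//.
  by rewrite (le_trans (power_sum_le n (fun j => f (iter j T x)) s0)).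
have [i2 d2] := dens_dominated mg ih le1; split => //.
apply: (le_trans (ler_norm _)); apply: (le_trans d2).
rewrite /h densZ//; last by apply: integ_sum => j; case: (hj j).
rewrite dens_sum//; last by move=> j; case: (hj j).
have sK : n.+1%:R `^ st.1 <= n.+1%:R ^+ K0 :> R.
  rewrite -powR_mulrn// ler_powR ?ler1n//.
  have pe : 0 <= p + eta by rewrite addr_ge0// ltW.
  have [_ h2] := andP (truncn_itv pe).
  have th : eta * st.2 / p <= eta by rewrite ler_pdivrMr// ler_wpM2l// ltW.
  by rewrite /K0; lra.
apply: (@le_trans _ _ (n.+1%:R ^+ K0 * \sum_(j < n) H)).
  apply: ler_pM; rewrite ?powR_ge0//; last by apply: ler_sum => j _; case: (hj j).
  by apply: sumr_ge0 => j _; apply: dens_ge0 => x _; rewrite mulr_ge0 ?powR_ge0.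
rewrite sumr_const card_ord -(mulr_natl H) exprS mulrCA mulrA mulrC ler_wpM2l//.
by rewrite ler_wpM2r ?exprn_ge0// ler_nat.
Qed.

Let q := p + eta / (2 * p).
Let q_gt1 : 1 < q.
Proof. by rewrite /q ltr_wpDr// divr_ge0 ?mulr_ge0// ltW. Qed.

Definition correlation (n : nat) (t : R) :=
  cdens m (fun x => (cexpi (t * birkhoff T f n x) - 1) * (cexpi (t * f (iter n T x)) - 1)).

Lemma correlation_expansion : poly_expansion q 2 correlation.
Proof.
have [J [Lp [M [hJ hL M0 hle]]]] := expi_sub1_product eta01 p1.
have [K [M' [M'0 hm]]] := birkhoff_moment.
apply: (poly_expansion_cdens (Phi := fun x y => (cexpi x - 1) * (cexpi y - 1))
  (cf := fun il => expi_coef il.1 * expi_coef il.2) (J := J) (Lp := Lp) (M := M)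
  (Q := good_pair eta p) (K := K) (M' := M')) => //.
- by move=> il /hJ[h1 [h2 h3]]; split => //; rewrite -(addn1 1) leq_add.
- by move=> st /hL[].
- exact: lt_trans ltr01 q_gt1.
- exact: (birkhoff_meas hT mf).
- move=> n t; apply: cmeasurableM; apply: cmeasurableB => //; try exact: cmeasurable_cst.
    exact: (expif_meas t (birkhoff_meas hT mf n)).
  exact: (expif_meas t (m_fiter n)).
Qed.

Definition first_moment (t : R) := cdens m (fun x => cexpi (t * f x) - 1).

Lemma first_moment_expansion : poly_expansion p 1 (fun _ => first_moment).
Proof.
pose k := Num.trunc p.
have /andP[k1 k2] := truncn_itv (ltW p0).
set P := dens m (fun x => `|f x| `^ p) setT.
have P0 : 0 <= P by apply: dens_ge0 => x _; exact: powR_ge0.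
have i1 : integ m (fun x => 1 + `|f x| `^ p) by apply: integD => //; exact: integ_cst.
apply: (poly_expansion_cdens (Phi := fun x y => cexpi y - 1)
  (cf := fun il => expi_coef il.2) (J := [seq (0%N, l.+1) | l <- iota 0 k])
  (Lp := [:: (0, p)]) (M := 3) (K := 0%N) (M' := 1 + P) (a := fun _ => f) (b := fun _ => f)
  (Q := fun st => st.1 = 0 /\ 0 < st.2 <= p)) => //.
- move=> il /mapP[l]; rewrite mem_iota add0n => /andP[_ lk] ->; split => //; split => //=.
  by rewrite ltr0n/= (le_trans _ k1)// ler_nat.
- by move=> st; rewrite inE => /eqP -> /=; rewrite add0r p0 lexx.
- move=> x y; rewrite big_seq1/= powRr0 mul1r big_map (expi_sub1 k y).
  have -> : \sum_(j <- iota 0 k) expi_coef j.+1 * (x ^+ 0 * y ^+ j.+1)%:C =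
      \sum_(l < k) expi_coef l.+1 * (y ^+ l.+1)%:C :> R[i].
    rewrite -(big_mkord xpredT (fun l => expi_coef l.+1 * (y ^+ l.+1)%:C)) /index_iota subn0.
    by apply: eq_bigr => l _; rewrite expr0 mul1r.
  by rewrite addrAC subrr add0r expi_rem_bound// k1 ltW.
- move=> n t; apply: cmeasurableB; last exact: cmeasurable_cst.
  exact: (expif_meas t mf).
- by rewrite addr_ge0.
move=> [s0 s] n /= [-> /andP[sp0 sp]].
have mg : measurable_fun setT (fun x => `|f x| `^ 0 * `|f x| `^ s).
  by apply: measurable_funM; exact: powR_meas.
have [x|i2 d2] := dens_dominated mg i1.
  rewrite powRr0 mul1r ger0_norm ?powR_ge0//.
  have [f1|f1] := leP 1 `|f x|.
    by rewrite (le_trans (ler_powR f1 sp))// lerDr.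
  rewrite (@le_trans _ _ 1)// ?lerDl ?powR_ge0//.
  rewrite -[leRHS](powRr0 `|f x|); apply: powR_le1; first by rewrite normr_ge0 ltW.
  by rewrite lexx ltW.
split => //; apply: (le_trans (ler_norm _)); apply: (le_trans d2).
rewrite expr0 mulr1 (densD measurableT (integ_cst m 1) fp) (dens_cst m 1 measurableT) mrT mulr1.
exact: lexx.
Qed.

Lemma birkhoff_recurrence n t :
  cdens m (fun x => cexpi (t * birkhoff T f n.+1 x)) =
  cdens m (fun x => cexpi (t * birkhoff T f n x)) + (first_moment t + correlation n t).
Proof.
have m1 := expif_meas t (birkhoff_meas hT mf n).
have m2 := expif_meas t (m_fiter n).
have b1 (g : X -> R) : {ae m, forall x, cmod (cexpi (t * g x)) <= 1}.
  by apply: aeW => x; rewrite cmod_cexpi.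
have b2 (g : X -> R) : forall x, cmod (cexpi (t * g x) - 1) <= 2.
  by move=> x; rewrite (le_trans (cmodB _ _))// cmod_cexpi cmod1.
have i1 := cinteg_bounded m1 (b1 _).
have i2 := cinteg_bounded m2 (b1 _).
have i0 := cinteg_bounded (expif_meas t mf) (b1 _).
have ic : cinteg m (fun _ : X => 1 : R[i]) by split; exact: integ_cst.
have i3 : cinteg m (fun x => (cexpi (t * birkhoff T f n x) - 1) * (cexpi (t * f (iter n T x)) - 1)).
  apply: (cintegM (M := 2)); last exact: cintegB.
    by apply: cmeasurableB m1 _; exact: cmeasurable_cst.
  exact: b2.
have -> : first_moment t = cdens m (fun x => cexpi (t * f (iter n T x)) - 1).
  have [j1 j2] := cintegB i0 ic.
  rewrite /first_moment; apply: complex_ext; rewrite /= -[setT in RHS](preimage_setT (iter n T)).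
    by rewrite -(dens_comp (preserving_iter hT n) measurableT j1).
  by rewrite -(dens_comp (preserving_iter hT n) measurableT j2).
rewrite /correlation -cdensD//; last exact: cintegB.
rewrite -cdensD//; last by apply: cintegD => //; exact: cintegB.
congr cdens; apply/funext => x; rewrite /birkhoff big_ord_recr/= mulrDr cexpiD.
by move: (cexpi _) (cexpi _) => u v; ring.
Qed.

Lemma birkhoff_expansion t n :
  cdens m (fun x => cexpi (t * birkhoff T f n x)) =
  1 + \sum_(k < n) (first_moment t + correlation k t).
Proof.
elim: n => [|n ih]; last by rewrite birkhoff_recurrence ih big_ord_recr/= -addrA.
rewrite big_ord0 addr0 -[RHS](cdens_cst m); congr cdens; apply/funext => x.
by rewrite /birkhoff big_ord0 mulr0 cexpi0.
Qed.

End moments.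

(** * Limit of the approximating polynomials *)

Section geometric_scales.
Context {R : realType}.
Implicit Types (a s : nat -> R[i]).

Lemma expn_geometric (K : nat) (r : R) : 0 < r < 1 ->
  exists2 C : R, 0 <= C & forall n, n.+1%:R ^+ K * r ^+ n <= C.
Proof.
elim: K r => [|K ih] r /andP[r0 r1].
  by exists 1 => // n; rewrite expr0 mul1r exprn_ile1 ?(ltW r0) ?(ltW r1).
pose u := Num.sqrt r; have u0 : 0 < u by rewrite sqrtr_gt0.
have u1 : u < 1 by rewrite -[ltRHS]sqrtr1 ltr_sqrt.
have uu : r = u * u by rewrite -expr2 sqr_sqrtr// ltW.
have [|C C0 hC] := ih u; first by rewrite u0 u1.
exists (C * (1 - u)^-1) => [|n]; first by rewrite mulr_ge0// invr_ge0 subr_ge0 ltW.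
have bern : n.+1%:R * u ^+ n <= (1 - u)^-1.
  rewrite -[leRHS]mul1r ler_pdivlMr ?subr_gt0//.
  have : n.+1%:R * u ^+ n <= \sum_(i < n.+1) u ^+ i.
    rewrite mulr_natl -{1}(card_ord n.+1) -sumr_const ler_sum// => i _.
    by rewrite ler_wiXn2l ?(ltW u0) ?(ltW u1)// -ltnS.
  move=> h; have := ler_wpM2r (_ : 0 <= 1 - u) h; rewrite subr_ge0 (ltW u1) => /(_ isT).
  have := subrX1 u n.+1; have : 0 <= u ^+ n.+1 by rewrite exprn_ge0 ?ltW.
  by move: (\sum_(i < _) _) (u ^+ n.+1) => S U; nra.
rewrite exprS {1}uu exprMn mulrACA mulrC.
by apply: ler_pM => //; rewrite !mulr_ge0 ?exprn_ge0 ?(ltW u0).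
Qed.

Lemma complex_geometric_cauchy (r C : R) s : 0 < r < 1 -> 0 <= C ->
  (forall n, cmod (s n.+1 - s n) <= C * r ^+ n) ->
  exists l : R[i], forall n, cmod (l - s n) <= 2 * C / (1 - r) * r ^+ n.
Proof.
move=> /andP[r0 r1] C0 hs; have r01 : 0 <= r < 1 by rewrite (ltW r0).
have C1 : 0 < C + 1 by rewrite ltr_wpDl.
have part (g : R[i] -> R) : (forall z, `|g z| <= cmod z) ->
    (forall z w, g (z - w) = g z - g w) ->
    exists l, forall n, `|l - g (s n)| <= C / (1 - r) * r ^+ n.
  move=> hg gB; have [Cz|Cn0] := eqVneq C 0.
    exists (g (s 0%N)) => n; suff -> : s n = s 0%N by rewrite subrr normr0 Cz !mul0r.
    elim: n => [//|n <-]; apply/eqP; rewrite -subr_eq0; apply/eqP/cmod_eq0/le_anti.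
    by rewrite cmod_ge0 (le_trans (hs n))// Cz mul0r.
  have [n|l _ hl] := @geometric_cauchy R r (fun n => C^-1 * g (s n)) r01.
    rewrite -mulrBr -gB normrM ger0_norm ?invr_ge0// mulrC ler_pdivrMr ?lt0r ?Cn0//.
    by rewrite mulrC (le_trans (hg _)).
  exists (C * l) => n.
  have -> : C * l - g (s n) = C * (l - C^-1 * g (s n)) by rewrite mulrBr mulVKf.
  by rewrite normrM (ger0_norm C0) -[leRHS]mulrA ler_wpM2l// [leRHS]mulrC hl.
have [l1 h1] := part (@complex.Re R) (@Re_cmod R) (fun z w => etrans (ReD z (- w)) (congr1 _ (ReN w))).
have [l2 h2] := part (@complex.Im R) (@Im_cmod R) (fun z w => etrans (ImD z (- w)) (congr1 _ (ImN w))).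
exists (l1 +i* l2) => n; apply: (le_trans (cmod_ReIm _)); rewrite ReD ReN ImD ImN.
have := lerD (h1 n) (h2 n); rewrite -[complex.Re (l1 +i* l2)]/l1 -[complex.Im (l1 +i* l2)]/l2.
by rewrite -!mulrA (mulr_natl _ 2) mulr2n.
Qed.

(* The operation [Q(x) - 2^L Q(x/2)] kills the coefficient of degree [L]. *)
Lemma coef_bound (L : nat) : exists2 C : R, 0 <= C & forall a (B : R),
  (forall x : R, 0 <= x <= 1 -> cmod (\sum_(i < L) a i * x%:C ^+ i) <= B) ->
  forall i, (i < L)%N -> cmod (a i) <= C * B.
Proof.
elim: L => [|L [C C0 ih]]; first by exists 0.
have X0 : (0 : R) <= 2 ^+ L by exact: exprn_ge0.
exists (C * (1 + 2 ^+ L) + (1 + L%:R * (C * (1 + 2 ^+ L)))) => [|a B hB i].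
  by rewrite !addr_ge0// !mulr_ge0// ?addr_ge0// mulr_ge0// addr_ge0.
have B0 : 0 <= B by apply: le_trans (cmod_ge0 _) (hB 0 _); rewrite lexx ler01.
pose CL := C * (1 + 2 ^+ L); have CL0 : 0 <= CL by rewrite mulr_ge0// addr_ge0.
pose a' i := a i * (1 - 2 ^+ L * (2^-1 : R)%:C ^+ i).
have low k : (k < L)%N -> cmod (a k) <= CL * B.
  move=> kL; have := ih a' ((1 + 2 ^+ L) * B).
  have h x : 0 <= x <= 1 -> cmod (\sum_(i < L) a' i * x%:C ^+ i) <= (1 + 2 ^+ L) * B.
    move=> /andP[x0 x1].
    have -> : \sum_(i < L) a' i * x%:C ^+ i = \sum_(i < L.+1) a i * x%:C ^+ i -
        2 ^+ L * \sum_(i < L.+1) a i * (2^-1 * x : R)%:C ^+ i.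
      rewrite mulr_sumr -sumrB big_ord_recr/=.
      rewrite [X in _ + X](_ : _ = 0) ?addr0.
        by apply: eq_bigr => j _; rewrite rmorphM/= exprMn /a'; ring.
      rewrite rmorphM/= exprMn fmorphV rmorph_nat exprVn.
      by rewrite mulrCA (mulrA (2 ^+ L)) divff ?mul1r ?subrr// expf_neq0// pnatr_eq0.
    rewrite (le_trans (cmodB _ _))// mulrDl mul1r lerD ?hB ?x0//.
    rewrite cmodM cmodX natr_complex cmodR ger0_norm// ler_wpM2l// hB//.
    by apply/andP; split; lra.
  move=> /(_ h k kL); rewrite /a' cmodM mulrA; apply: le_trans.
  rewrite ler_peMr ?cmod_ge0//.
  have -> : (2 : R[i]) ^+ L * (2^-1 : R)%:C ^+ k = (2 ^+ (L - k) : R)%:C.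
    rewrite fmorphV rmorph_nat exprVn rmorphXn/= rmorph_nat -{1}(subnK (ltnW kL)) exprD.
    by rewrite mulfK// expf_neq0// pnatr_eq0.
  have -> : 1 - (2 ^+ (L - k) : R)%:C = (1 - 2 ^+ (L - k) : R)%:C by rewrite rmorphB/= rmorph1.
  rewrite cmodR.
  have : (2 : R) <= 2 ^+ (L - k).
    by rewrite -{1}[2]expr1 ler_weXn2l ?subn_gt0// ler1n.
  by move=> h2; rewrite ler0_norm; lra.
have last : cmod (a L) <= (1 + L%:R * CL) * B.
  have h1 := hB 1; rewrite ler01 lexx in h1; have {h1} := h1 isT.
  rewrite big_ord_recr/= expr1n mulr1 => h1.
  have h2 : cmod (\sum_(i < L) a i * 1%:C ^+ i) <= L%:R * CL * B.
    apply: (le_trans (cmod_sum _ _)).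
    apply: (@le_trans _ _ (\sum_(i < L) CL * B)).
      by apply: ler_sum => k _; rewrite expr1n mulr1 low.
    by rewrite sumr_const card_ord -[leLHS]mulr_natl mulrA.
  have := cmod_triangle (a L) (- \sum_(i < L) a i * 1%:C ^+ i) 0.
  rewrite !subr0 opprK cmodN => h3; apply: (le_trans h3).
  by rewrite mulrDl mul1r lerD// addrC.
rewrite ltnS leq_eqVlt => /orP[/eqP ->|iL]; rewrite mulrDl.
  by rewrite (le_trans last)// lerDr mulr_ge0.
by rewrite (le_trans (low _ iL))// lerDl mulr_ge0// addr_ge0// mulr_ge0.
Qed.

Lemma geometric_scale (t0 tau t : R) : 0 < tau < 1 -> 0 < t <= t0 ->
  exists n : nat, t0 * tau ^+ n.+1 <= t <= t0 * tau ^+ n.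
Proof.
move=> /andP[tau0 tau1] /andP[tp tt0].
have ex : exists n, t0 * tau ^+ n.+1 <= t.
  apply: contrapT => /forallNP h.
  have : t <= 0.
    apply: (@le_of_geometric _ tau t 0 t0); first by rewrite ltW.
    move=> n; rewrite add0r; have /negP := h n; rewrite -ltNge => /ltW h1.
    apply: (le_trans h1); rewrite ler_wpM2l ?(le_trans (ltW tp))// exprS.
    by rewrite ler_piMl ?(ltW tau1)// exprn_ge0// ltW.
  by rewrite leNgt tp.
case: (ex_minnP ex) => n hn hmin; exists n; rewrite hn/=.
case: n hn hmin => [|n] hn hmin; first by rewrite expr0 mulr1.
by rewrite leNgt; apply/negP => /ltW/hmin; rewrite ltnn.
Qed.

End geometric_scales.

Lemma powR_exprn {R : realType} (x s : R) n : 0 <= x -> (x ^+ n) `^ s = (x `^ s) ^+ n.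
Proof.
move=> x0; elim: n => [|n ih]; first by rewrite !expr0 powR1.
by rewrite !exprS powRM ?exprn_ge0// ih.
Qed.

Lemma powR_in01 {R : realType} (x e : R) : 0 < x < 1 -> 0 < e -> 0 < x `^ e < 1.
Proof.
move=> /andP[x0 x1] e0; rewrite powR_gt0//=.
have e1 : (1 : R) `^ e = 1 by rewrite powR1.
by rewrite -[ltRHS]e1 gt0_ltr_powR// nnegrE ltW.
Qed.

Section limit_expansion.
Context {R : realType}.
Variables (mu : R -> R[i]) (Q : nat -> {poly R[i]}) (K L : nat) (M rho q q' t0 : R).
Hypotheses (q0 : 0 < q') (qq : q' < q) (rho01 : 0 < rho < 1) (M0 : 0 <= M)
  (t00 : 0 < t0) (t01 : t0 <= 1)
  (Qsize : forall n, (size (Q n) <= L)%N)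
  (Qlow : forall n i, (i < 2)%N -> (Q n)`_i = 0)
  (Qcoef : forall n i, cmod (Q n)`_i <= M * n.+1%:R ^+ K)
  (approx : forall n t, `|t| <= t0 ->
    cmod (mu t - (Q n).[t%:C]) <= M * n.+1%:R ^+ K * (rho ^+ n + `|t| `^ q)).

Let r0 : 0 < rho. Proof. by case/andP: rho01. Qed.
Let tau := rho `^ q^-1.
Let q'' := (q' + q) / 2.
Let s := tau `^ q''.

Let qpos : 0 < q. Proof. exact: lt_trans qq. Qed.
Let q1 : q' < q''. Proof. by have := qq; rewrite /q''; lra. Qed.
Let q2 : q'' < q. Proof. by have := qq; rewrite /q''; lra. Qed.

Let tau01 : 0 < tau < 1.
Proof. by apply: powR_in01 => //; rewrite invr_gt0. Qed.
Let tau0 : 0 < tau. Proof. by case/andP: tau01. Qed.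

Let rho_tau : rho = tau `^ q.
Proof. by rewrite /tau -powRrM mulVf ?powRr1 ?(ltW r0)// gt_eqF. Qed.

Lemma scale_bound : exists2 C : R, 0 <= C & forall n, n.+1%:R ^+ K * rho ^+ n <= C * s ^+ n.
Proof.
have dl : 0 < q - q'' by rewrite subr_gt0.
have [C C0 hC] := expn_geometric K (powR_in01 tau01 dl).
exists C => // n; have -> : rho = tau `^ (q - q'') * s.
  by rewrite /s -powRD ?subrK// gt_eqF ?implybT.
by rewrite exprMn mulrA ler_wpM2r ?exprn_ge0 ?powR_ge0.
Qed.

Lemma on_scale n (t : R) : `|t| <= t0 * tau ^+ n -> `|t| <= t0 /\ `|t| `^ q <= rho ^+ n.
Proof.
have tn0 : 0 <= tau ^+ n by rewrite exprn_ge0// ltW.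
move=> h; split.
  rewrite (le_trans h)// ler_piMr ?(ltW t00)// exprn_ile1 ?(ltW tau0)//.
  by case/andP: tau01 => _ /ltW.
rewrite rho_tau -powR_exprn ?(ltW tau0)// ge0_ler_powR ?nnegrE ?(ltW qpos)//.
by rewrite (le_trans h)// ler_piMl.
Qed.

Lemma approx_scale : exists2 C : R, 0 <= C & forall n t, `|t| <= t0 * tau ^+ n ->
  cmod (mu t - (Q n).[t%:C]) <= C * s ^+ n.
Proof.
have [C C0 hC] := scale_bound.
exists (M * 2 * C) => [|n t /on_scale[h1 h2]]; first by rewrite !mulr_ge0.
apply: (le_trans (approx n h1)).
have M2 : 0 <= M * 2 by rewrite mulr_ge0.
have := ler_wpM2l M2 (hC n); rewrite [leRHS]mulrA; apply: le_trans.
rewrite -[leRHS]mulrA -[leLHS]mulrA ler_wpM2l//.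
rewrite [leRHS]mulrCA ler_wpM2l ?exprn_ge0//; lra.
Qed.

Let s01 : 0 < s < 1.
Proof. by apply: powR_in01 => //; exact: lt_trans q1. Qed.
Let s0 : 0 < s. Proof. by case/andP: s01. Qed.

Lemma coef_step (i : nat) : exists2 C : R, 0 <= C & forall n,
  cmod ((Q n.+1)`_i - (Q n)`_i) <= C * (s / tau ^+ i) ^+ n.
Proof.
have [C C0 hC] := approx_scale; have [CL CL0 hCL] := coef_bound (R := R) L.
have tt0 : 0 < t0 * tau by rewrite mulr_gt0.
have ti0 : 0 < (t0 * tau) ^+ i by exact: exprn_gt0.
exists (CL * (2 * C) / (t0 * tau) ^+ i) => [|n]; first by rewrite !mulr_ge0// invr_ge0 ltW.
have [iL|iL] := ltnP i L; last first.
  rewrite !nth_default ?(leq_trans (Qsize _))// subrr cmod0.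
  by rewrite !mulr_ge0 ?exprn_ge0 ?invr_ge0 ?divr_ge0 ?exprn_ge0 ?(ltW s0) ?(ltW tt0) ?(ltW tau0).
pose tn := t0 * tau ^+ n.+1; have tn0 : 0 < tn by rewrite mulr_gt0// exprn_gt0.
have tnn : tn <= t0 * tau ^+ n.
  rewrite ler_wpM2l ?(ltW t00)// exprS ler_piMl ?exprn_ge0 ?(ltW tau0)//.
  by case/andP: tau01 => _ /ltW.
pose a i := ((Q n.+1)`_i - (Q n)`_i) * tn%:C ^+ i.
have := hCL a (2 * C * s ^+ n).
have h x : 0 <= x <= 1 -> cmod (\sum_(i < L) a i * x%:C ^+ i) <= 2 * C * s ^+ n.
  move=> /andP[x0 x1].
  have -> : \sum_(i < L) a i * x%:C ^+ i = (Q n.+1).[(tn * x)%:C] - (Q n).[(tn * x)%:C].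
    rewrite !(@horner_coef_wide _ L) ?Qsize// -sumrB; apply: eq_bigr => j _.
    have -> : (tn * x)%:C = tn%:C * x%:C by exact: rmorphM.
    rewrite /a exprMn.
    by move: (Q n.+1)`_j (Q n)`_j (tn%:C ^+ j) (x%:C ^+ j) => u v w z; ring.
  have le1 : `|tn * x| <= tn.
    by rewrite (ger0_norm (mulr_ge0 (ltW tn0) x0)) ler_piMr// ltW.
  have h1 := hC n.+1 _ le1; have h2 := hC n _ (le_trans le1 tnn).
  have := cmod_triangle (Q n.+1).[(tn * x)%:C] (mu (tn * x)) (Q n).[(tn * x)%:C].
  rewrite (cmodBC _ (mu _)) => h3.
  have h4 : C * s ^+ n.+1 <= C * s ^+ n.
    by rewrite ler_wpM2l// exprS ler_piMl ?exprn_ge0 ?(ltW s0)//; case/andP: s01 => _ /ltW.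
  move: (cmod _) (cmod _) (cmod _) h1 h2 h3 h4 => u v w *; lra.
move=> /(_ h i iL); rewrite /a cmodM cmodX cmodR ger0_norm ?(ltW tn0)//.
rewrite -ler_pdivlMr ?exprn_gt0// => h1; apply: (le_trans h1).
rewrite le_eqVlt; apply/orP; left; apply/eqP.
have -> : tn ^+ i = (t0 * tau) ^+ i * (tau ^+ i) ^+ n.
  by rewrite /tn exprS mulrA exprMn -!exprM mulnC.
rewrite expr_div_n.
move: (gt_eqF ti0) (gt_eqF (exprn_gt0 n (exprn_gt0 i tau0))).
move: ((t0 * tau) ^+ i) ((tau ^+ i) ^+ n) (s ^+ n) => u v w /negbT u0 /negbT v0.
by field; rewrite u0 v0.
Qed.

(* On the annulus [t0 tau^(n+1) <= |t| <= t0 tau^n] the coefficients of degree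
   below [q''] have converged; those of higher degree are harmless. *)
Lemma coef_limit (i : nat) : exists (c : R[i]) (C : R), 0 <= C /\ forall n (t : R),
  t0 * tau ^+ n.+1 <= `|t| <= t0 * tau ^+ n ->
  cmod ((Q n)`_i - c) * `|t| ^+ i <= C * `|t| `^ q'.
Proof.
have tle1 n (t : R) : `|t| <= t0 * tau ^+ n -> `|t| <= 1 by move=> /on_scale[h _]; exact: le_trans t01.
have tlen n (t : R) : `|t| <= t0 * tau ^+ n -> `|t| <= tau ^+ n.
  by move=> h; rewrite (le_trans h)// ler_piMl// exprn_ge0// ltW.
have q''0 : 0 < q'' by exact: lt_trans q1.
have [iq|iq] := ltP i%:R q''; last first.
  have dl : 0 < q'' - q' by rewrite subr_gt0.
  have [C C0 hC] := expn_geometric K (powR_in01 tau01 dl).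
  exists 0, (M * C); split => [|n t /andP[_ tn]]; first by rewrite mulr_ge0.
  rewrite subr0; have h1 : `|t| ^+ i <= `|t| `^ q''.
    by rewrite -powR_mulrn// powR_le1 ?normr_ge0 ?(tle1 n)// (ltW q''0).
  have h2 : `|t| `^ q'' <= (tau `^ (q'' - q')) ^+ n * `|t| `^ q'.
    have [->|tn0] := eqVneq `|t| 0.
      by rewrite !powR0 ?mulr0// gt_eqF.
    rewrite -[X in _ `^ X <= _](subrK q') powRD ?tn0 ?implybT// ler_wpM2r ?powR_ge0//.
    rewrite -powR_exprn ?(ltW tau0)// ge0_ler_powR ?nnegrE ?(ltW dl) ?exprn_ge0 ?(ltW tau0)//.
    exact: tlen.
  apply: (le_trans (ler_pM (cmod_ge0 _) _ (Qcoef n i) (le_trans h1 h2))) => //.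
  rewrite mulrA ler_wpM2r ?powR_ge0// -mulrA ler_wpM2l//.
have [C C0 hC] := coef_step i.
have th01 : 0 < s / tau ^+ i < 1.
  have -> : s / tau ^+ i = tau `^ (q'' - i%:R).
    by rewrite powRB ?gt_eqF ?implybT// powR_mulrn// ltW.
  by apply: powR_in01 => //; rewrite subr_gt0.
have [c hc] := complex_geometric_cauchy th01 C0 hC.
have /andP[th0 th1] := th01.
pose C1 := 2 * C / (1 - s / tau ^+ i).
have C10 : 0 <= C1 by rewrite !mulr_ge0// invr_ge0 subr_ge0 ltW.
have tt0 : 0 < t0 * tau by rewrite mulr_gt0.
exists c, (C1 * (t0 * tau)^-1 `^ q''); split => [|n t /andP[tn1 tn2]].
  by rewrite mulr_ge0// powR_ge0.
rewrite cmodBC; have h1 := hc n.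
have h2 : `|t| ^+ i <= (tau ^+ i) ^+ n.
  by rewrite -exprM mulnC exprM lerXn2r ?nnegrE ?exprn_ge0 ?(ltW tau0)// tlen.
apply: (le_trans (ler_pM (cmod_ge0 _) _ h1 h2)); first by rewrite exprn_ge0.
rewrite -[leLHS]mulrA -exprMn divfK ?gt_eqF ?exprn_gt0// -/C1 -[leRHS]mulrA ler_wpM2l//.
have h3 : tau ^+ n <= (t0 * tau)^-1 * `|t|.
  by rewrite mulrC ler_pdivlMr// mulrCA -exprSr.
rewrite /s -powR_exprn ?(ltW tau0)//.
apply: (@le_trans _ _ (((t0 * tau)^-1 * `|t|) `^ q'')).
  by rewrite ge0_ler_powR ?nnegrE ?(ltW q''0) ?mulr_ge0 ?invr_ge0 ?(ltW tt0) ?exprn_ge0 ?(ltW tau0).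
rewrite powRM ?invr_ge0 ?(ltW tt0)// ler_wpM2l ?powR_ge0// powR_le1 ?normr_ge0 ?(tle1 n)//.
by rewrite (ltW q0) ltW.
Qed.

Lemma limit_expansion : exists (c : nat -> R[i]) (C : R), forall t, `|t| <= t0 ->
  cmod (mu t - \sum_(2 <= i < Num.bound q' | i%:R < q') c i * t%:C ^+ i) <= C * `|t| `^ q'.
Proof.
have [cC hcC] := choice coef_limit.
have [C1 hC1] := choice hcC.
pose c i := if (i < L)%N && (1 < i)%N && (i%:R < q') then cC i else 0.
have [Ca Ca0 hCa] := approx_scale.
have tt0 : 0 < t0 * tau by rewrite mulr_gt0.
have q''0 : 0 < q'' by exact: lt_trans q1.
pose B := Ca * (t0 * tau)^-1 `^ q'' + \sum_(i < L) (C1 i + cmod (cC i)).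
exists c, B => t tt.
have B0 : 0 <= B.
  rewrite addr_ge0 ?mulr_ge0 ?powR_ge0// sumr_ge0// => i _.
  by rewrite addr_ge0 ?cmod_ge0//; case: (hC1 i).
have sumE : \sum_(2 <= i < Num.bound q' | i%:R < q') c i * t%:C ^+ i =
    \sum_(i < L) c i * t%:C ^+ i.
  pose N := maxn L (maxn 2 (Num.bound q')).
  have LN : (L <= N)%N by exact: leq_maxl.
  have bN : (Num.bound q' <= N)%N by rewrite !leq_max leqnn !orbT.
  rewrite (big_ord_widen N (fun i => c i * t%:C ^+ i) LN).
  rewrite (big_nat_widen _ _ _ _ _ bN) (big_nat_widenl _ 0)// big_mkord.
  rewrite big_mkcond [RHS]big_mkcond; apply: eq_bigr => i _ /=.
  rewrite /c; have [iL|iL] := ltnP i L; last by rewrite /= mul0r; case: ifP.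
  case: (ltnP 1 i) => i1 /=; last by rewrite !mul0r andbF.
  case: ltP => iq /=; last by rewrite mul0r.
  suff -> : (i < Num.bound q')%N by [].
  have := archi_boundP (ltW q0); rewrite -(ltr_nat R); exact: lt_trans.
rewrite sumE; have [t00'|tn0] := eqVneq t 0.
  have -> : \sum_(i < L) c i * t%:C ^+ i = 0.
    apply: big1 => i _; rewrite /c t00'; case: (nat_of_ord i) => [|j]; last by rewrite expr0n mulr0.
    by rewrite !(andbF, andFb) mul0r.
  rewrite subr0 t00' normr0 powR0 ?gt_eqF// mulr0.
  apply: (@le_of_geometric _ s _ _ Ca); first by rewrite (ltW s0); case/andP: s01.
  move=> n; rewrite add0r; have := hCa n 0; rewrite normr0 => /(_ _).
  rewrite horner_coef0 Qlow// subr0; apply.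
  by rewrite mulr_ge0 ?(ltW t00)// exprn_ge0// ltW.
have tp : 0 < `|t| <= t0 by rewrite normr_gt0 tn0.
have [n /andP[n1 n2]] := geometric_scale tau01 tp.
have tle1 : `|t| <= 1 by exact: le_trans t01.
have h1 := hCa n t n2.
have h2 : s ^+ n <= (t0 * tau)^-1 `^ q'' * `|t| `^ q'.
  have h3 : tau ^+ n <= (t0 * tau)^-1 * `|t|.
    by rewrite mulrC ler_pdivlMr// mulrCA -exprSr.
  rewrite /s -powR_exprn ?(ltW tau0)//.
  apply: (@le_trans _ _ (((t0 * tau)^-1 * `|t|) `^ q'')).
    by rewrite ge0_ler_powR ?nnegrE ?(ltW q''0) ?mulr_ge0 ?invr_ge0 ?(ltW tt0) ?exprn_ge0 ?(ltW tau0).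
  rewrite powRM ?invr_ge0 ?(ltW tt0)// ler_wpM2l ?powR_ge0// powR_le1 ?normr_ge0 ?tle1//.
  by rewrite (ltW q0) ltW.
have h4 (i : 'I_L) : cmod (((Q n)`_i - c i) * t%:C ^+ i) <= (C1 i + cmod (cC i)) * `|t| `^ q'.
  have [C10 /(_ n t) h5] := hC1 i; have {}h5 := h5 _; rewrite n1 n2 in h5; have {}h5 := h5 isT.
  rewrite cmodM cmodX cmodR mulrDl /c ltn_ord.
  have p1 : 0 <= C1 i * `|t| `^ q' by rewrite mulr_ge0 ?powR_ge0.
  have p2 : 0 <= cmod (cC i) * `|t| `^ q' by rewrite mulr_ge0 ?powR_ge0 ?cmod_ge0.
  case: (ltnP 1 i) => i1 /=; last by rewrite Qlow// subrr cmod0 mul0r addr_ge0.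
  case: ltP => iq /=; first by rewrite (le_trans h5)// lerDl.
  have h6 : `|t| ^+ i <= `|t| `^ q' by rewrite -powR_mulrn// powR_le1 ?normr_ge0// (ltW q0).
  apply: (@le_trans _ _ ((cmod ((Q n)`_i - cC i) + cmod (cC i)) * `|t| ^+ i)).
    by rewrite ler_wpM2r ?exprn_ge0// subr0 (le_trans _ (cmodD _ _))// subrK.
  by rewrite [leLHS]mulrDl lerD// ler_wpM2l ?cmod_ge0.
have h5 : cmod ((Q n).[t%:C] - \sum_(i < L) c i * t%:C ^+ i) <=
    (\sum_(i < L) (C1 i + cmod (cC i))) * `|t| `^ q'.
  rewrite (@horner_coef_wide _ L) ?Qsize// -sumrB mulr_suml.
  apply: (le_trans (cmod_sum _ _)); apply: ler_sum => i _.
  by rewrite -mulrBl h4.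
apply: (le_trans (cmod_triangle _ (Q n).[t%:C] _)); rewrite /B [leRHS]mulrDl lerD//.
by rewrite (le_trans h1)// -mulrA ler_wpM2l.
Qed.

End limit_expansion.

Section leading_expansion.
Context {R : realType}.
Variables (lambda e : R -> R[i]) (xi : nat -> R -> R[i]) (p q q' : R) (rho M : R).
Hypotheses (p1 : 1 < p) (pq : p <= q) (qp : q <= p + 1) (q'0 : 0 < q') (q'q : q' < q)
  (rho01 : 0 < rho < 1) (M0 : 0 <= M)
  (xi_exp : poly_expansion q 2 xi) (e_exp : poly_expansion p 1 (fun _ => e))
  (lambda1 : forall r : R, 0 < r -> \forall t \near (0 : R), cmod (lambda t - 1) < r).

Definition partial_mean t (n : nat) : R[i] := 1 + \sum_(k < n) (e t + xi k t).

Hypothesis recurrence : \forall t \near (0 : R), forall n,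
  cmod (lazy_avg n.+1 (partial_mean t) - (1 + lambda t) / 2 * lazy_avg n (partial_mean t))
    <= M * rho ^+ n.

Let mu t := lambda t - 1 - e t.
Let z n t := lazy_avg n (fun j => \sum_(k < j) (e t + xi k t)).
Let x n t := lazy_avg n (fun j => xi j t) - e t * z n t.

Lemma poly_expansion_le r s (phi : nat -> R -> R[i]) : s%:R <= r -> poly_expansion r s phi ->
  exists (K : nat) (C : R), 0 <= C /\ forall n t, `|t| <= 1 ->
    cmod (phi n t) <= C * n.+1%:R ^+ K * `|t| ^+ s.
Proof.
move=> sr [K [L [N [P [N0 h]]]]]; exists K, (N + L%:R * N); split; first by rewrite addr_ge0// mulr_ge0.
move=> n t t1; have [h1 h2 h3 /(_ t t1) h4] := h n.
have h5 := horner_bound h1 h2 h3 t1.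
have h6 : `|t| `^ r <= `|t| ^+ s by rewrite -powR_mulrn// powR_le1 ?normr_ge0 ?ler0n ?t1.
have := cmod_triangle (phi n t) (P n).[t%:C] 0; rewrite !subr0 => /le_trans; apply.
rewrite -mulrA [leRHS]mulrDl lerD//.
  by rewrite (le_trans h4)// -mulrA ler_wpM2l// ler_wpM2l.
by rewrite (le_trans h5)// !mulrA.
Qed.

Lemma mean_expansion : poly_expansion p 1 z.
Proof.
have xi1 : poly_expansion p 1 xi.
  by apply: poly_expansion_weaken xi_exp => //; rewrite pq ltW// (lt_trans ltr01).
have h : poly_expansion p 1 (fun n t => e t + xi n t).
  by apply: poly_expansion_ext (poly_expansionDZ 1 e_exp xi1) => n t; rewrite mul1r.
exact: (poly_expansion_lavg (poly_expansion_psum h)).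
Qed.

Lemma forcing_expansion : poly_expansion q 2 x.
Proof.
have p0 : 0 < p by exact: lt_trans p1.
have ez : poly_expansion q (1 + 1) (fun n t => e t * z n t).
  apply: (poly_expansionM _ _ _ _ _ _ e_exp mean_expansion) => //; try exact: ltW.
    exact: lt_le_trans pq.
  by rewrite (le_trans qp)// lerD2l ltW.
apply: poly_expansion_ext (poly_expansionDZ (-1) (poly_expansion_lavg xi_exp) ez) => n t.
by rewrite mulN1r.
Qed.

Lemma leading_identity t n :
  lazy_avg n.+1 (partial_mean t) - (1 + lambda t) / 2 * lazy_avg n (partial_mean t) =
  2^-1 * (x n t - mu t * (1 + z n t)).
Proof.
have zE : lazy_avg n (partial_mean t) = 1 + z n t.
  rewrite -[1 in RHS](lazy_avg_cst n) -[z n t]opprK -(sub0r (z n t)) -{1}(lazy_avg_cst n 0).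
  rewrite -lazy_avgB -lazy_avgB; apply: lazy_avg_ext => j.
  by rewrite sub0r opprK.
have dE : lazy_avg n (fun j => partial_mean t j.+1) =
    lazy_avg n (partial_mean t) + (e t + lazy_avg n (fun j => xi j t)).
  apply/eqP; rewrite addrC -subr_eq -lazy_avgB; apply/eqP.
  rewrite -[e t in RHS](lazy_avg_cst n) -[lazy_avg n (fun j => xi j t)]opprK.
  rewrite -(sub0r (lazy_avg n (fun j => xi j t))) -{1}(lazy_avg_cst n 0) -lazy_avgB -lazy_avgB.
  apply: lazy_avg_ext => j; rewrite /partial_mean big_ord_recr/=.
  by rewrite sub0r opprK addrA [X in X - _]addrC addrK.
rewrite /= dE zE /x /mu; move: (lazy_avg n _) (z n t) (e t) (lambda t) => u v w l.
have h2 : (2 : R[i]) != 0 by rewrite pnatr_eq0.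
by field.
Qed.

(* Iterating the fixed-point equation [mu = x n - z n * mu + O(rho^n)]. *)
Fixpoint neumann l n t : R[i] := if l is l'.+1 then x n t - z n t * neumann l' n t else 0.

Lemma neumann_expansion l : poly_expansion q 2 (neumann l).
Proof.
elim: l => [|l ih].
  exists 0%N, 0%N, 0, (fun=> 0); split => // n; split => //; first by rewrite size_poly0.
  - by move=> i _; rewrite coef0.
  - by move=> i; rewrite coef0 cmod0 mul0r.
  - by move=> t _; rewrite horner0 subrr cmod0 !mul0r.
have p0 : 0 < p by exact: lt_trans p1.
have q0 : 0 < q by exact: lt_le_trans pq.
have zn : poly_expansion q 2 (fun n t => z n t * neumann l n t).
  have h : poly_expansion q (1 + 2) (fun n t => z n t * neumann l n t).
    apply: (poly_expansionM _ _ _ _ _ _ mean_expansion ih) => //; try exact: ltW.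
    - by rewrite lerDr ltW.
    - by rewrite (le_trans qp)// lerD2l ler1n.
    - by rewrite lerDl.
  by apply: poly_expansion_weaken h => //; rewrite (ltW q0) lexx.
apply: poly_expansion_ext (poly_expansionDZ (-1) forcing_expansion zn) => n t.
by rewrite mulN1r.
Qed.

Lemma neumann_error t n l (B Z : R) : cmod (mu t) <= B -> cmod (z n t) <= Z -> 1 <= Z ->
  cmod (x n t - mu t * (1 + z n t)) <= 2 * M * rho ^+ n ->
  cmod (mu t - neumann l n t) <= l%:R * Z ^+ l * (2 * M * rho ^+ n) + cmod (z n t) ^+ l * B.
Proof.
move=> muB zZ Z1; move: (2 * M * rho ^+ n) => E hx.
have E0 : 0 <= E by exact: le_trans (cmod_ge0 _) hx.
have Z0 : 0 <= Z by exact: le_trans ler01 Z1.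
elim: l => [|l ih]; first by rewrite /= subr0 !mul0r add0r expr0 mul1r.
have -> : mu t - neumann l.+1 n t =
    - (x n t - mu t * (1 + z n t)) - z n t * (mu t - neumann l n t).
  by rewrite /=; move: (mu t) (x n t) (z n t) (neumann l n t) => *; ring.
apply: (le_trans (cmodB _ _)); rewrite cmodN cmodM.
have h1 := ler_wpM2l (cmod_ge0 (z n t)) ih.
apply: (le_trans (lerD hx h1)); rewrite mulrDr addrA !exprS -!mulrA lerD2r.
have -> : l.+1%:R = 1 + l%:R :> R by rewrite nat1r.
rewrite [leRHS](mulrDl 1) mul1r lerD//.
  by rewrite mulrA -exprS ler_peMl// exprn_ege1.
rewrite mulrCA ler_wpM2l// ler_wpM2r// mulr_ge0//; exact: exprn_ge0.
Qed.

Lemma leading_expansion : exists (c : nat -> R[i]) (C : R), \forall t \near (0 : R),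
  cmod (lambda t - (1 + e t + \sum_(2 <= i < Num.bound q' | i%:R < q') c i * t%:C ^+ i))
    <= C * `|t| `^ q'.
Proof.
have p0 : 0 < p by exact: lt_trans p1.
have q0 : 0 < q by exact: lt_le_trans pq.
have p1' : 1%:R <= p by exact: ltW.
have [Kz [Cz [Cz0 hz]]] := poly_expansion_le p1' mean_expansion.
have [Ke [Ce [Ce0 he]]] := poly_expansion_le p1' e_exp.
pose l := (Num.bound q); have lq : q <= l%:R by exact/ltW/archi_boundP/ltW.
have [Kv [L [Mv [P [Mv0 hP]]]]] := neumann_expansion l.
pose B := 1 + Ce.
have B0 : 0 <= B by rewrite addr_ge0.
have muB : \forall t \near (0 : R), `|t| <= 1 -> cmod (mu t) <= B.
  apply: filterS (lambda1 ltr01) => t lt1 t1.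
  rewrite /mu (le_trans (cmodB _ _))// /B lerD ?(ltW lt1)//.
  have := he 0%N t t1; rewrite expr1n mulr1 => h; rewrite (le_trans h)// ler_piMr//.
have [t0 /= t00 hall] : \forall t \near (0 : R), (`|t| <= 1 -> cmod (mu t) <= B) /\
    forall n, cmod (x n t - mu t * (1 + z n t)) <= 2 * M * rho ^+ n.
  apply: filterS2 muB recurrence => t h1 h2; split => // n.
  have := h2 n; rewrite leading_identity cmodM cmodV natr_complex cmodR ger0_norm//.
  move: (cmod _) => u; have r0 : 0 <= M * rho ^+ n.
    by rewrite mulr_ge0// exprn_ge0//; case/andP: rho01 => /ltW.
  lra.
pose t1 := Num.min (t0 / 2) 1.
have t10 : 0 < t1 by rewrite lt_min ltr01 divr_gt0.
have t11 : t1 <= 1 by rewrite ge_min lexx orbT.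
have ht t : `|t| <= t1 -> `|t| <= 1 /\ forall n, cmod (mu t) <= B /\
    cmod (x n t - mu t * (1 + z n t)) <= 2 * M * rho ^+ n.
  rewrite le_min => /andP[a1 a2]; split => // n.
  have [|h1 h2] := hall t; last by split; [exact: h1|].
  rewrite /ball_/= sub0r normrN; lra.
pose K := (Kz * l + Kv)%N; pose Z := (1 + Cz) ^+ l.
have Z0 : 0 <= Z by rewrite exprn_ge0// addr_ge0.
have r0 : 0 <= rho by case/andP: rho01 => /ltW.
pose N := Mv + l%:R * Z * (2 * M) + Z * B.
have N1 : 0 <= l%:R * Z * (2 * M) by rewrite !mulr_ge0.
have N2 : 0 <= Z * B by rewrite mulr_ge0.
have Mvle : Mv <= N by rewrite /N -addrA lerDl addr_ge0.
have approx n t : `|t| <= t1 -> cmod (mu t - (P n).[t%:C]) <= N * n.+1%:R ^+ K * (rho ^+ n + `|t| `^ q).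
  move=> /ht[tle1 /(_ n)[h1 h2]]; have [_ _ _ /(_ t tle1) h3] := hP n.
  have n1 : (1 : R) <= n.+1%:R by rewrite ler1n.
  have nK (j : nat) : (1 : R) <= n.+1%:R ^+ j by exact: exprn_ege1.
  have tq0 := powR_ge0 `|t| q; have rn0 : 0 <= rho ^+ n by exact: exprn_ge0.
  have hz1 := hz n t tle1; rewrite expr1 in hz1.
  pose Zn := (1 + Cz) * n.+1%:R ^+ Kz.
  have Zn1 : 1 <= Zn by rewrite /Zn mulr_ege1// lerDl.
  have zt : cmod (z n t) <= Zn * `|t|.
    by rewrite (le_trans hz1)// ler_wpM2r// ler_wpM2r ?exprn_ge0// lerDr.
  have zZn : cmod (z n t) <= Zn.
    by rewrite (le_trans zt)// ler_piMr// (le_trans ler01).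
  have h4 := neumann_error l h1 zZn Zn1 h2.
  have ZnE : Zn ^+ l <= Z * n.+1%:R ^+ K.
    by rewrite /Zn exprMn -exprM ler_wpM2l// /K exprD ler_peMr// exprn_ge0.
  have h5 : cmod (z n t) ^+ l <= Zn ^+ l * `|t| `^ q.
    rewrite (@le_trans _ _ ((Zn * `|t|) ^+ l))//.
      by rewrite lerXn2r ?nnegrE ?cmod_ge0// mulr_ge0// (le_trans ler01).
    rewrite exprMn ler_wpM2l ?exprn_ge0 ?(le_trans ler01)//.
    by rewrite -powR_mulrn// powR_le1 ?normr_ge0// (ltW q0).
  have h6 : cmod (neumann l n t - (P n).[t%:C]) <= Mv * n.+1%:R ^+ K * `|t| `^ q.
    rewrite (le_trans h3)// ler_wpM2r// ler_wpM2l// /K exprD ler_peMl// exprn_ge0//.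
  have h7 : l%:R * Zn ^+ l * (2 * M * rho ^+ n) <= l%:R * Z * (2 * M) * n.+1%:R ^+ K * rho ^+ n.
    have := ler_wpM2l (mulr_ge0 (ler0n R l) (mulr_ge0 (mulr_ge0 (ler0n R 2) M0) rn0)) ZnE.
    by move: (Zn ^+ l) (n.+1%:R ^+ K) (rho ^+ n) (l%:R) => a b c dd; congr (_ <= _); ring.
  have h8 : cmod (z n t) ^+ l * B <= Z * B * n.+1%:R ^+ K * `|t| `^ q.
    have := ler_wpM2r B0 (le_trans h5 (ler_wpM2r tq0 ZnE)).
    by move: (n.+1%:R ^+ K) (`|t| `^ q) => b c; congr (_ <= _); ring.
  have h9 := cmod_triangle (mu t) (neumann l n t) (P n).[t%:C].
  apply: (le_trans h9); apply: (le_trans (lerD h4 h6)).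
  apply: (le_trans (lerD (lerD h7 h8) (lexx _))).
  have nK0 : 0 <= n.+1%:R ^+ K :> R by rewrite exprn_ge0.
  have e1 := mulr_ge0 nK0 rn0; have e2 := mulr_ge0 nK0 tq0.
  rewrite /N; move: (l%:R * Z * (2 * M)) (Z * B) N1 N2 (n.+1%:R ^+ K) (rho ^+ n) (`|t| `^ q) e1 e2.
  move=> a b a0 b0 u v w uv uw.
  have := mulr_ge0 a0 uw; have := mulr_ge0 b0 uv; have := mulr_ge0 Mv0 uv.
  have -> : (Mv + a + b) * u * (v + w) = (Mv * (u * v) + Mv * (u * w)) + (a * (u * v) + a * (u * w)) + (b * (u * v) + b * (u * w)) by ring.
  have -> : a * u * v = a * (u * v) by ring.
  have -> : b * u * w = b * (u * w) by ring.
  have -> : Mv * u * w = Mv * (u * w) by ring.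
  lra.
have sizeP n : (size (P n) <= L)%N by case: (hP n).
have lowP n i : (i < 2)%N -> (P n)`_i = 0 by case: (hP n) => _ h _ _; exact: h.
have coefP n i : cmod (P n)`_i <= N * n.+1%:R ^+ K.
  have [_ _ /(_ i) h _] := hP n; apply: (le_trans h).
  by apply: ler_pM; rewrite ?exprn_ge0// natS_exp_le// leq_addl.
have [c [C hc]] := limit_expansion q'0 q'q rho01 (le_trans Mv0 Mvle) t10 t11 sizeP lowP coefP approx.
exists c, C; near=> t; have tt : `|t| <= t1.
  near: t; exists t1 => //= y; rewrite /= sub0r normrN; exact: ltW.
have := hc t tt; congr (cmod _ <= _); rewrite /mu; move: (\sum_(_ <= _ < _ | _) _) => s.
by move: (lambda t) (e t) => u v; ring.
Unshelve. all: by end_near.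
Qed.

End leading_expansion.

(** * Hoelder bounds on the pieces *)

Section holder_data.
Context {R : realType} {d : measure_display} {X : metricMeasurableType R d}.
Variable m : probability X R.

Lemma sum_dens_le (w : X -> R) (F : nat -> set X) n : integ m w -> (forall x, 0 <= w x) ->
  (forall i, measurable (F i)) -> trivIset setT F ->
  \sum_(i < n) dens m w (F i) <= dens m w setT.
Proof.
move=> iw w0 mF tF; have mU k : measurable (\big[setU/set0]_(i < k) F i).
  by apply: bigsetU_measurable => i _.
suff -> : \sum_(i < n) dens m w (F i) = dens m w (\big[setU/set0]_(i < n) F i).
  by apply: dens_nneg_subset.
elim: n => [|n ih].
  by rewrite !big_ord0 (dens_null _ iw)// mr_set0.
rewrite !big_ord_recr/= ih -densU//.
rewrite -bigcup_mkord; apply/seteqP; split => // x [[i /= iln Fix] Fnx].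
by have e := tF i n Logic.I Logic.I (ex_intro _ x (conj Fix Fnx)); rewrite e ltnn in iln.
Qed.

Lemma powRD_le (a b s : R) : 0 <= a -> 0 <= b -> 0 < s <= 1 ->
  (a + b) `^ s <= 2 * (a `^ s + b `^ s).
Proof.
move=> a0 b0 /andP[s0 s1].
have aux u v : 0 <= u -> u <= v -> (u + v) `^ s <= 2 * (u `^ s + v `^ s).
  move=> u0 uv; have v0 : 0 <= v by exact: le_trans uv.
  have h1 : (u + v) `^ s <= (2 * v) `^ s.
    by rewrite ge0_ler_powR ?nnegrE ?(ltW s0)//; lra.
  have h2 : (2 : R) `^ s <= 2.
    by rewrite -[leRHS]powRr1// ler_powR// ler1n.
  rewrite powRM// in h1; have := ler_wpM2r (powR_ge0 v s) h2.
  have := powR_ge0 u s; lra.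
case: (leP a b) => [|/ltW] ab; first exact: aux.
by rewrite addrC [X in _ <= 2 * X]addrC aux.
Qed.

Lemma piece_value (w : X -> R) (E : set X) : measurable E -> 0 < mr m E -> integ m w ->
  exists2 y, E y & w y * mr m E <= dens m w E + mr m E.
Proof.
move=> mE E0 iw; apply: contrapT => h.
pose c := dens m w E / mr m E + 1.
have hc y : E y -> c <= w y.
  move=> Ey; rewrite leNgt; apply/negP => hy; apply: h; exists y => //.
  have := ler_wpM2r (ltW E0) (ltW hy).
  by rewrite /c mulrDl mul1r divfK// gt_eqF.
have := dens_le mE (integ_cst m c) iw hc.
rewrite dens_cst// /c mulrDl mul1r divfK ?gt_eqF//; lra.
Qed.

Lemma holder_data (f : X -> R) (p eta D : R) (e A : nat -> set X) (alpha : set (set X)) :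
  measurable_fun setT f -> 1 < p -> integ m (fun x => `|f x| `^ p) -> 0 < eta <= 1 ->
  (forall x y : X, mdist x y <= D) -> 0 <= D ->
  (forall a, alpha a -> measurable a /\ (0 < m a)%E) ->
  (forall i, e i = set0 \/ alpha (e i)) -> (forall i, A i `<=` e i) ->
  (forall i, mr m (e i `\` A i) = 0) -> (forall a, alpha a -> exists i, e i = a) ->
  (forall i, measurable (A i)) -> trivIset setT A ->
  (\esum_(a in alpha) (m a * best_lipschitz f a `^ eta) < +oo)%E ->
  exists (B : nat -> R) (S : R), [/\ forall i, 0 <= B i,
    forall i x, A i x -> `|f x| `^ eta <= B i,
    forall i x y, A i x -> A i y -> `|f x - f y| `^ eta <= B i * mdist x y `^ eta &
    forall n, \sum_(i < n) B i * mr m (A i) <= S].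
Proof.
move=> mf p1 fp eta01 diam D0 malpha ealpha Ae eA enum_e mA tA Sfin.
have /andP[eta0 eta1] := eta01; have p0 : 0 < p by exact: lt_trans p1.
have ieta : integ m (fun x => `|f x| `^ eta).
  have i1 : integ m (fun x => 1 + `|f x| `^ p) by apply: integD => //; exact: integ_cst.
  have [x|//] := dens_dominated (powR_meas eta mf) i1.
  rewrite ger0_norm ?powR_ge0//; have [f1|f1] := leP 1 `|f x|.
    have ep : eta <= p by rewrite (le_trans eta1)// ltW.
    by rewrite (le_trans (ler_powR f1 ep))// lerDr.
  rewrite (@le_trans _ _ 1)// ?lerDl ?powR_ge0//.
  rewrite -[leRHS](powRr0 `|f x|); apply: powR_le1; first by rewrite normr_ge0 ltW.
  by rewrite lexx ltW.
pose W i := (m (e i) * best_lipschitz f (e i) `^ eta)%E.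
pose J := [pred i | `[< alpha (e i) >]].
have mre i : alpha (e i) -> mr m (A i) = mr m (e i) /\ 0 < mr m (A i).
  move=> /malpha[me e0]; have AE := mr_mod0 me (mA i) (eA i).
  by rewrite (setIidr (Ae i)) in AE; rewrite AE mr_gt0.
have e_inj : set_inj [set i | J i] e.
  move=> i j /set_mem/asboolP ei /set_mem/asboolP ej eij; apply: contrapT => /eqP ij.
  have [AiE Ai0] := mre i ei; have [AjE _] := mre j ej.
  have Aij : A i `&` A j = set0 by move/trivIsetP : tA; exact.
  have : mr m (A i `\` A j) = 0.
    apply: (mr0_le (m := m) (B := e j `\` A j)) => //.
    - exact: measurableD.
    - by apply: measurableD => //; case: (malpha _ ej).
    - by move=> x [Aix nAj]; split => //; rewrite -eij; exact: Ae.
  have -> : A i `\` A j = A i.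
    apply/seteqP; split => [x []//|x Aix]; split => // Ajx.
    by have : (A i `&` A j) x by []; rewrite Aij.
  by move=> h; rewrite h ltxx in Ai0.
have W0 i : (0 <= W i)%E by rewrite mule_ge0// poweR_ge0.
have WS n : (\sum_(0 <= i < n | J i) W i <= \esum_(a in alpha) (m a * best_lipschitz f a `^ eta))%E.
  rewrite (@reindex_esum _ _ _ [set i | J i] alpha e); last first.
    split => //; first by move=> i /asboolP.
    by move=> a aa; have [i ei] := enum_e a aa; exists i => //; apply/asboolP; rewrite ei.
  apply: (le_trans (nneseries_lim_ge (P := J) n (fun i _ _ => W0 i))).
  by rewrite nneseries_esum.
set S0 := (\esum_(a in alpha) _)%E in Sfin WS.
pose L i := fine (best_lipschitz f (e i)).
have LE i : alpha (e i) -> best_lipschitz f (e i) = (L i)%:E /\ 0 <= L i /\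
    W i = (mr m (A i) * L i `^ eta)%:E.
  move=> ei; have [me e0] := malpha _ ei; have [AE A0] := mre i ei.
  have [x Ax] := mr_gt0_nonempty A0.
  have b0 : (0 <= best_lipschitz f (e i))%E.
    apply: ereal_sup_ubound; exists (x, x); first by split; exact: Ae.
    by rewrite /= subrr normr0 mul0r.
  have Wfin : (W i < +oo)%E.
    apply: le_lt_trans Sfin; apply: le_trans (WS i.+1).
    rewrite big_mkcond big_nat_recr//= asboolT// leeDr// sume_ge0// => k _.
    by case: ifP.
  have bfin : (best_lipschitz f (e i) < +oo)%E.
    apply: (lty_poweRy (r := eta)); first by rewrite gt_eqF.
    rewrite ltey; apply/eqP => h; move: Wfin; rewrite /W h gt0_muley//.
  have bE : best_lipschitz f (e i) = (L i)%:E.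
    by rewrite /L fineK// ge0_fin_numE.
  split => //; split; first by rewrite -lee_fin -bE.
  by rewrite /W bE poweR_EFin -mr_fin// -EFinM AE.
have hB i : exists b, [/\ 0 <= b, forall x, A i x -> `|f x| `^ eta <= b,
    forall x y, A i x -> A i y -> `|f x - f y| `^ eta <= b * mdist x y `^ eta &
    b * mr m (A i) <= 2 * (dens m (fun x => `|f x| `^ eta) (A i) + mr m (A i)) +
      (2 * D `^ eta + 1) * fine (if J i then W i else 0%E)].
  have [ei|ei] := ealpha i.
    exists 0; have Ai x : ~ A i x by move=> /Ae; rewrite ei.
    split => //; try by move=> x /Ai.
      by move=> x y /Ai.
    rewrite mul0r addr_ge0// mulr_ge0//.
    - by rewrite addr_ge0 ?mr_ge0// dens_ge0// => x _; exact: powR_ge0.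
    - by rewrite addr_ge0// mulr_ge0// powR_ge0.
    - by rewrite fine_ge0//; case: ifP.
  have [bE [L0 WE]] := LE i ei; have [AE A0] := mre i ei.
  have [y Ay hy] := piece_value (mA i) A0 ieta.
  have lip u v : A i u -> A i v -> `|f u - f v| <= L i * mdist u v.
    move=> Au Av; have [->|uv] := eqVneq u v; first by rewrite subrr normr0 mdistxx mulr0.
    have duv : 0 < mdist u v by rewrite mdist_gt0.
    rewrite -ler_pdivrMr// -lee_fin -bE; apply: ereal_sup_ubound.
    by exists (u, v) => //; split; exact: Ae.
  pose b := 2 * (`|f y| `^ eta + (L i * D) `^ eta) + L i `^ eta.
  have b1 : L i `^ eta <= b.
    by rewrite /b lerDr mulr_ge0// addr_ge0// powR_ge0.
  exists b; split.
  - exact: le_trans (powR_ge0 _ _) b1.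
  - move=> x Ax; have h1 : `|f x| <= `|f y| + L i * D.
      have := lip x y Ax Ay; have := ler_wpM2l L0 (diam x y).
      have := ler_normD (f x - f y) (f y); rewrite subrK; lra.
    apply: (@le_trans _ _ ((`|f y| + L i * D) `^ eta)).
      by rewrite ge0_ler_powR ?nnegrE ?(ltW eta0) ?addr_ge0 ?mulr_ge0.
    by rewrite (le_trans (powRD_le _ _ eta01)) ?mulr_ge0// /b lerDl powR_ge0.
  - move=> x x' Ax Ax'; apply: (@le_trans _ _ ((L i * mdist x x') `^ eta)).
      by rewrite ge0_ler_powR ?nnegrE ?(ltW eta0) ?mulr_ge0 ?mdist_ge0//; exact: lip.
    by rewrite powRM ?mdist_ge0// ler_wpM2r ?powR_ge0.
  have Ji : J i by apply/asboolP.
  rewrite Ji WE /b powRM//=; move: (`|f y| `^ eta) (L i `^ eta) (D `^ eta) (mr m (A i)) (dens m _ _) hy.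
  move=> u v w a c h; have := ler_wpM2l (ler0n R 2) h; nra.
have [B hBB] := choice hB.
exists B, (2 * (dens m (fun x => `|f x| `^ eta) setT + mr m setT) + (2 * D `^ eta + 1) * fine S0).
split; try by move=> i; case: (hBB i).
move=> n; apply: (@le_trans _ _ (\sum_(i < n) (2 * (dens m (fun x => `|f x| `^ eta) (A i) + mr m (A i)) +
      (2 * D `^ eta + 1) * fine (if J i then W i else 0%E)))).
  by apply: ler_sum => i _; case: (hBB i).
rewrite big_split/= -!mulr_sumr; apply: lerD; apply: ler_wpM2l => //.
- rewrite big_split/= lerD//.
    by apply: sum_dens_le => // x; exact: powR_ge0.
  rewrite -mr_bigcup_ord//; apply: mr_le => //; exact: bigcup_measurable.
- by rewrite addr_ge0// mulr_ge0// powR_ge0.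
rewrite -lee_fin fineK; last first.
  by rewrite ge0_fin_numE// (le_trans _ (WS 0%N))// big_geq.
apply: le_trans (WS n); rewrite -sumEFin [leRHS]big_mkcond big_mkord.
apply: lee_sum => i _; rewrite fineK//; case: ifPn => // /asboolP ei.
by have [_ [_ ->]] := LE i ei.
Qed.

End holder_data.

Theorem theorem3p13 (R : realType) (d : measure_display)
    (X : metricMeasurableType R d) (m : probability X R)
    (T : X -> X) (alpha : set (set X)) (eta : R)
    (X_borel : borel_space X) (X_bounded : bounded_metric X)
    (T_gibbs_markov : gibbs_markov m T alpha)
    (T_mixing : mixing m T alpha)
    (eta_range : 0 < eta <= 1) :
  exists eps : R -> R,
    [/\ forall p : R, 1 < p -> 0 < eps p,
        forall K : set R, compact K -> K `<=` [set p | 1 < p] ->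
          exists2 delta : R, 0 < delta & forall p, K p -> delta <= eps p &
        forall (f : X -> R) (p : R) (lambda : R -> R[i]),
          measurable_fun setT f ->
          (\esum_(a in alpha) (m a * best_lipschitz f a `^ eta) < +oo)%E ->
          1 < p -> f \in Lfun m p%:E ->
          leading_eigenvalue m T alpha eta f lambda ->
          exists (c : nat -> R[i]) (M : R),
            \forall t \near (0 : R),
              cmod (lambda t
                    - (cintegral m (fun x => cexpi (t * f x))
                       + \sum_(2 <= i < Num.bound (p + eps p)
                               | i%:R < p + eps p) c i * t%:C ^+ i))
              <= M * `|t| `^ (p + eps p)].
Proof.
have /andP[eta0 eta1] := eta_range.
exists (fun p => eta / (4 * p)); split.
- by move=> p p1; rewrite divr_gt0// mulr_gt0// (lt_trans ltr01).
- move=> K /compact_bounded[N [Nreal hN]] K1.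
  have NN : N < `|N| + 1 by rewrite ltr_pwDr// ler_norm.
  exists (eta / (4 * (`|N| + 1))); first by rewrite divr_gt0// mulr_gt0// ltr_wpDl.
  move=> p Kp; have p0 : 0 < p by apply: lt_trans ltr01 _; exact: K1.
  rewrite ler_wpM2l ?(ltW eta0)// lef_pV2 ?posrE ?mulr_gt0// ?ltr_wpDl// ler_wpM2l//.
  exact: le_trans (ler_norm p) (hN _ NN p Kp).
move=> f p lambda mf Sfin p1 fLp hlam.
have p0 : 0 < p by exact: lt_trans p1.
have [e [A [I [G [gam [D [C [mc [ealpha Ae eA enum_e]]]]]]]]] :=
  gibbs_markov_coding X_bounded T_gibbs_markov.
have [malpha _ _] := gm_partition T_gibbs_markov.
have fp : integ m (fun x => `|f x| `^ p) by exact: Lfun_integrable (ltW p1) fLp.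
have D0 : 0 <= D by exact: le_trans ler01 (mc_D mc).
have [B [S [B0 fB fH BS]]] := holder_data mf p1 fp eta_range (mc_diam mc) D0 malpha ealpha Ae eA
  enum_e (mc_A mc) (mc_triv mc) Sfin.
have alphaA a : alpha a -> exists i, A i `<=` a /\ m.-negligible (a `\` A i).
  move=> aa; have [i ei] := enum_e a aa; exists i; rewrite -ei; split; first exact: Ae.
  apply: (negligible_mr _ (eA i)) => //; apply: measurableD; last exact: mc_A mc i.
  by rewrite ei; case: (malpha a aa).
have [rho [M [rho01 M0 hrec]]] := lazy_recurrence mc eta_range alphaA mf B0 fB fH BS hlam.
pose q := p + eta / (2 * p); pose q' := p + eta / (4 * p).
have ep0 : 0 < eta / p by rewrite divr_gt0.
have ep1 : eta / p < 1 by rewrite ltr_pdivrMr//; lra.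
have qE : q = p + eta / p / 2 by rewrite /q invfM; ring.
have q'E : q' = p + eta / p / 4 by rewrite /q' invfM; ring.
have pq : p <= q by lra.
have qp : q <= p + 1 by lra.
have q'0 : 0 < q' by lra.
have q'q : q' < q by lra.
have xi_exp := correlation_expansion mc eta_range mf B0 fB BS p1 fp.
have e_exp := first_moment_expansion mf p1 fp.
have rec : \forall t \near (0 : R), forall n,
  cmod (lazy_avg n.+1 (partial_mean (first_moment m f) (correlation m T f) t) -
    (1 + lambda t) / 2 * lazy_avg n (partial_mean (first_moment m f) (correlation m T f) t)) <= M * rho ^+ n.
  apply: filterS hrec => t h n; have := h n; congr (cmod (_ - _ * _) <= _);
    by apply: lazy_avg_ext => j; rewrite (birkhoff_expansion mc mf).
have [c [N hN]] := leading_expansion p1 pq qp q'0 q'q rho01 M0 xi_exp e_exp (proj2 hlam) rec.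
exists c, N; apply: filterS hN => t; rewrite -/q'.
suff -> : 1 + first_moment m f t = cintegral m (fun x => cexpi (t * f x)) by [].
have i1 : cinteg m (fun x => cexpi (t * f x)).
  apply: (cinteg_bounded (s := 1)); first exact: (expif_meas t mf).
  by apply: aeW => x; rewrite cmod_cexpi.
rewrite /first_moment cdensB//; last by split; exact: integ_cst.
by rewrite cdens_cst addrC subrK.
Qed.
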